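(* Let $\gamma\in\mathbb{R}$, $\gamma\neq0$, and let $\mathbb{T}=\mathbb{R}/2\pi\mathbb{Z}$. Let $B$ be any topological space continuously embedded in the space of distributions $(C^\infty(\mathbb{T}))^*$ and such that $L^2(\mathbb{T})$ is compactly embedded in $B$ (for example $B=H^s(\mathbb{T})$ with $s<0$). Then for any fixed $t\neq0$, the flow-map $u_0\mapsto u(t)$ of the periodic cubic Schrödinger equation $$ i u_t+u_{xx}+\gamma|u|^2u=0\quad\text{on }\mathbb{R}\times\mathbb{T}, $$ defined on $L^2(\mathbb{T})\subset B$, is discontinuous for the topology of $B$ (on both the source and the target) at any $u_0\in L^2(\mathbb{T})$ different from the origin. In particular, for every $s<0$ and every $t\neq0$ the map $u_0\mapsto u(t)$ is discontinuous from $H^s(\mathbb{T})$ into $H^s(\mathbb{T})$ at every $u_0\in L^2(\mathbb{T})\setminus\{0\}$.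
   Context: Functions are complex-valued. For $u_0\in L^2(\mathbb{T})$, the solution emanating from $u_0$ is defined as follows (known theorem of Bourgain): for every $T>0$ there is a unique solution $u\in L^4(]-T,T[\times\mathbb{T})$ of the equation with $u(0)=u_0$, in the sense of the integral (Duhamel) formulation, and it belongs to $C([-T,T];L^2(\mathbb{T}))$; this gives a unique global solution $u\in C(\mathbb{R};L^2(\mathbb{T}))$. The flow-map at time $t$ is $L^2(\mathbb{T})\ni u_0\mapsto u(t)\in L^2(\mathbb{T})$. The space $(C^\infty(\mathbb{T}))^*$ of periodic distributions carries its usual (weak-* ) topology. ''$B$ is continuously embedded in $(C^\infty(\mathbb{T}))^*$'' means $B\subset (C^\infty(\mathbb{T}))^*$ with continuous inclusion; ''$L^2(\mathbb{T})$ is compactly embedded in $B$'' means $L^2(\mathbb{T})\subset B$ with continuous inclusion (for the norm topology of $L^2(\mathbb{T})$) mapping norm-bounded subsets of $L^2(\mathbb{T})$ to relatively compact subsets of $B$. $H^s(\mathbb{T})$ is the Sobolev space with norm $\|\varphi\|_{H^s}=\|(1+k^2)^{s/2}\hat\varphi(k)\|_{\ell^2(\mathbb{Z})}$, $\hat\varphi(k)=\frac1{2\pi}\int_{\mathbb{T}}e^{-ikx}\varphi(x)\,dx$. *)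

(* Defs.v *)
From HB Require Import structures.
From mathcomp Require Import all_boot all_order all_algebra.
From mathcomp Require Export complex.
From mathcomp Require Import all_classical all_reals all_analysis.

Set Implicit Arguments.
Unset Strict Implicit.
Unset Printing Implicit Defensive.

Import Order.TTheory GRing.Theory Num.Theory numFieldNormedType.Exports.
Import Normc.

Local Open Scope classical_set_scope.
Local Open Scope ring_scope.
Local Open Scope complex_scope.

Section ComplexValued.
Context {R : realType}.
Implicit Types f u v : R -> R[i].

Definition cmeasurable {d} {T : measurableType d} (D : set T) (F : T -> R[i]) :=
  measurable_fun D (fun x => complex.Re (F x)) /\
  measurable_fun D (fun x => complex.Im (F x)).

Definition cintegral (D : set R) f : R[i] :=
  (\int[lebesgue_measure]_(x in D) complex.Re (f x)) +i*
  (\int[lebesgue_measure]_(x in D) complex.Im (f x)).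

(* The oriented integral from 0 to t, for t of either sign. *)
Definition cintegral0 (t : R) f : R[i] :=
  if 0 <= t then cintegral `[0, t] f else - cintegral `[t, 0] f.

Definition cis (x : R) : R[i] := cos x +i* sin x.

Definition cderiv (n : nat) f : R -> R[i] :=
  fun x => derive1n n (fun y => complex.Re (f y)) x +i*
           derive1n n (fun y => complex.Im (f y)) x.

End ComplexValued.

Section Torus.
Context {R : realType}.
Implicit Types f u v : R -> R[i].

(* Functions on R/2piZ are represented by functions on R, of which only the   *)
(* values on this fundamental domain matter; both endpoints are kept, which   *)
(* is harmless as functions are considered up to almost-everywhere equality.  *)
Definition torus : set R := `[0, 2 * pi]%classic.

(* Representatives of the elements of L^2; they are identified when they are  *)
(* almost everywhere equal on the torus.                                      *)
Definition L2 f :=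
  cmeasurable torus f /\
  (\int[lebesgue_measure]_(x in torus) (normc (f x) ^+ 2)%:E < +oo)%E.

Definition L2norm f : R :=
  Num.sqrt (\int[lebesgue_measure]_(x in torus) (normc (f x) ^+ 2)).

Definition fourier f (k : int) : R[i] :=
  ((2 * pi)^-1)%:C * cintegral torus (fun x => cis (- (k%:~R * x)) * f x).

Definition Hsnorm (s : R) f : \bar R :=
  (\esum_(k in [set: int])
     (((1 + (k%:~R : R) ^+ 2) `^ (s / 2) * normc (fourier f k)) ^+ 2)%:E)
  `^ (2^-1 : R).

End Torus.

(* C^oo(T), as smooth 2pi-periodic functions on the line. *)
Record testfun (R : realType) := TestFun {
  testfun_val :> R -> R[i];
  testfun_periodic : forall x, testfun_val (x + 2 * pi) = testfun_val x;
  testfun_smooth : forall (n : nat) (x : R),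
    derivable (derive1n n (fun y => complex.Re (testfun_val y))) x 1 /\
    derivable (derive1n n (fun y => complex.Im (testfun_val y))) x 1
}.

HB.instance Definition _ (R : realType) := gen_eqMixin (testfun R).
HB.instance Definition _ (R : realType) := gen_choiceMixin (testfun R).

(* The Frechet topology of C^oo(T): uniform convergence of all derivatives. *)
Definition testfun_top (R : realType) : topologicalType :=
  initial_topology (fun phi : testfun R =>
    (fun n : nat => cderiv n phi) :
      prod_topology (fun _ : nat => {uniform R -> R[i]^o})).

Record distribution (R : realType) := Distribution {
  distribution_val :> testfun R -> R[i];
  distribution_linear : forall (a : R[i]) (phi psi chi : testfun R),
    (forall x, chi x = a * phi x + psi x) ->
    distribution_val chi = a * distribution_val phi + distribution_val psi;
  distribution_continuous :
    continuous (distribution_val : testfun_top R -> R[i]^o)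
}.

HB.instance Definition _ (R : realType) := gen_eqMixin (distribution R).
HB.instance Definition _ (R : realType) := gen_choiceMixin (distribution R).

Definition weakstar (R : realType) : topologicalType :=
  initial_topology (fun l : distribution R =>
    (l : testfun R -> R[i]) : {ptws testfun R -> R[i]^o}).

Section Embeddings.
Context {R : realType} {B : topologicalType}.
Implicit Types (j : B -> weakstar R) (e : (R -> R[i]) -> B).

Definition continuously_embedded j := injective j /\ continuous j.

(* [e f] is the element of [B] which is the distribution associated with the  *)
(* function [f] of L^2; as [j] is injective, it only depends on the class of  *)
(* [f].                                                                       *)
Definition L2_embedded j e :=
  forall f, L2 f -> forall phi : testfun R,
    (j (e f) : distribution R) phi = cintegral torus (fun x => f x * phi x).

Definition L2_continuous e :=
  forall f, L2 f -> forall V, nbhs (e f) V ->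
    exists2 d : R, 0 < d &
      forall g, L2 g -> L2norm (g \- f) < d -> V (e g).

Definition L2_compact e :=
  forall (A : set (R -> R[i])) (M : R),
    A `<=` L2 -> (forall f, A f -> L2norm f <= M) -> precompact (e @` A).

Definition L2_compactly_embedded j e :=
  [/\ L2_embedded j e, L2_continuous e & L2_compact e].

(* Continuity at [u0] of a self-map of L^2, for the topology which L^2        *)
(* inherits from [B].                                                         *)
Definition B_continuous_at e (Phi : (R -> R[i]) -> R -> R[i]) u0 :=
  forall V, nbhs (e (Phi u0)) V ->
    exists2 U, nbhs (e u0) U & forall v, L2 v -> U (e v) -> V (e (Phi v)).

End Embeddings.

Definition Hs_continuous_at {R : realType} (s : R)
    (Phi : (R -> R[i]) -> R -> R[i]) (u0 : R -> R[i]) :=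
  forall eps : R, 0 < eps -> exists2 d : R, 0 < d &
    forall v, L2 v -> (Hsnorm s (v \- u0)%R < d%:E)%E ->
      (Hsnorm s (Phi v \- Phi u0)%R < eps%:E)%E.

Section Schrodinger.
Context {R : realType}.

Definition L4_on (T : R) (u : R -> R -> R[i]) :=
  let D := `]-T, T[%classic `*` torus in
  cmeasurable D (fun p : R * R => u p.1 p.2) /\
  (\int[lebesgue_measure \x lebesgue_measure]_(p in D)
     (normc (u p.1 p.2) ^+ 4)%:E < +oo)%E.

Definition cubic (f : R -> R[i]) : R -> R[i] :=
  fun x => (normc (f x) ^+ 2)%:C * f x.

(* u(t) = S(t) u0 + i gamma \int_0^t S(t - s) (|u|^2 u)(s) ds, read on the    *)
(* Fourier coefficients, where the group S(t) is the multiplier by            *)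
(* exp(- i k^2 t). At t = 0 this says that u(0) = u0.                         *)
Definition duhamel (gamma : R) (u0 : R -> R[i]) (u : R -> R -> R[i]) :=
  forall (t : R) (k : int),
  fourier (u t) k =
    cis (- (k%:~R ^+ 2 * t)) * fourier u0 k +
    'i%C * gamma%:C *
      cintegral0 t (fun s =>
        cis (- (k%:~R ^+ 2 * (t - s))) * fourier (cubic (u s)) k).

(* The global solution emanating from u0, [u t] being a representative of     *)
(* u(t) for every t.                                                          *)
Definition nls_solution (gamma : R) (u0 : R -> R[i]) (u : R -> R -> R[i]) :=
  [/\ forall t, L2 (u t),
      forall t, L2norm (u s \- u t) @[s --> t] --> (0 : R),
      forall T, 0 < T -> L4_on T u
    & duhamel gamma u0 u].

(* By Bourgain's theorem [nls_solution gamma u0] has one solution up to       *)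
(* almost-everywhere equality, so that this determines [Phi] on L^2; the      *)
(* uniqueness is not part of the definition.                                  *)
Definition flow_map (gamma t : R) (Phi : (R -> R[i]) -> R -> R[i]) :=
  forall u0 : R -> R[i], L2 u0 ->
    exists2 u, nls_solution gamma u0 u & Phi u0 = u t.

End Schrodinger.

(* Main.v *)
(* Let v be the solution from u0 and m(t) the mean of |v(t)|^2 over the torus. For the data
   u0 + c e^{iNx} with N large, the function
     e^{i theta t} v + c e^{i (Nx - N^2 t + psi(t))},  theta = 2 gamma c^2, psi' = gamma (2 m + c^2),
   solves the equation up to cubic terms carried by the waves of frequencies N, -N and 2N;
   these are not resonant, so that their time integrals vanish as N -> oo. Zygmund's L^4
   inequality, its dual and its retarded version (Christ-Kiselev) give well-posedness estimates
   on time intervals on which the L^4 mass of v and of the wave is small, where the error is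
   absorbed by a bootstrap; finitely many of them cover [0, t]. Thus the Fourier coefficients of the
   perturbed solution converge to those of e^{2 i gamma c^2 t} v(t), which is - v(t) when
   2 |gamma| c^2 |t| = pi. As u0 + c e^{iNx} tends to u0 weakly in L^2, hence in B by
   compactness, continuity at u0 would force v(t) = 0; time reversal, which also reduces negative times
   to positive ones, then gives u0 = 0. *)
Require Import Defs.
From mathcomp Require Import all_boot all_order all_algebra.
From mathcomp Require Import all_classical all_reals all_analysis.
From mathcomp Require Import measurable_realfun simple_functions ring lra zify.
Set Implicit Arguments.
Unset Strict Implicit.
Unset Printing Implicit Defensive.
Import Order.TTheory GRing.Theory Num.Theory numFieldNormedType.Exports.
Import Normc.
Local Open Scope classical_set_scope.
Local Open Scope ring_scope.
Local Open Scope complex_scope.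

(** * Complex-valued measurable functions and their integrals *)

(** The phase comes from the term [2 |b|^2 a] in the expansion of the cubic term at [a + b]: when
    [|b| = c] it rotates [a] at the speed [2 gamma c^2] however large N is, so that the weak limit
    keeps it. Among the interactions with the wave only the mean of [2 |a|^2 b] oscillates in step
    with the wave; it equals [2 m b] and is put into psi. The other sources do not become small in
    absolute value, since [|b|] does not depend on N: only their time integrals do, mode by mode. A
    source therefore enters the estimates through two quantities, the energy of its time integrals
    and the pairing of its Duhamel integral with a test function. Finitely many modes, at fixed
    distances from the frequency of the wave, are treated by the Riemann-Lebesgue lemma; the others
    carry little energy by Bessel's inequality. The amplitude c is imposed by t and is not small, so
    the absorption has to rest on short intervals, where the slow part and the wave have little L^4
    mass. Their length is at most 1, less than a period, so that Zygmund's estimate over one period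
    is enough. *)

Section complex_algebra.
Context {R : realType}.
Implicit Types (z w : R[i]) (x y : R).

Lemma ReD z w : complex.Re (z + w) = complex.Re z + complex.Re w.
Proof. by case: z w => [a b] [c d]. Qed.
Lemma ImD z w : complex.Im (z + w) = complex.Im z + complex.Im w.
Proof. by case: z w => [a b] [c d]. Qed.
Lemma ReN z : complex.Re (- z) = - complex.Re z.
Proof. by case: z => [a b]. Qed.
Lemma ImN z : complex.Im (- z) = - complex.Im z.
Proof. by case: z => [a b]. Qed.
Lemma ReM z w : complex.Re (z * w) =
  complex.Re z * complex.Re w - complex.Im z * complex.Im w.
Proof. by case: z w => [a b] [c d]. Qed.
Lemma ImM z w : complex.Im (z * w) =
  complex.Re z * complex.Im w + complex.Im z * complex.Re w.
Proof. by case: z w => [a b] [c d]. Qed.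
Lemma ReJ z : complex.Re z^*%C = complex.Re z.
Proof. by case: z. Qed.
Lemma ImJ z : complex.Im z^*%C = - complex.Im z.
Proof. by case: z. Qed.

Definition ReImE := (ReD, ImD, ReN, ImN, ReM, ImM, ReJ, ImJ).

Lemma eq_complexP z w : complex.Re z = complex.Re w ->
  complex.Im z = complex.Im w -> z = w.
Proof. by case: z w => [a b] [c d] /= -> ->. Qed.

Lemma normc_ge0 z : 0 <= normc z.
Proof. by case: z => a b; exact: sqrtr_ge0. Qed.

Lemma normc_sqr z : normc z ^+ 2 = complex.Re z ^+ 2 + complex.Im z ^+ 2.
Proof. by case: z => a b /=; rewrite sqr_sqrtr ?addr_ge0 ?sqr_ge0. Qed.

Lemma Re_le_normc z : `|complex.Re z| <= normc z.
Proof.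
by case: z => a b /=; rewrite -sqrtr_sqr ler_wsqrtr// lerDl sqr_ge0.
Qed.
Lemma Im_le_normc z : `|complex.Im z| <= normc z.
Proof.
by case: z => a b /=; rewrite -sqrtr_sqr ler_wsqrtr// lerDr sqr_ge0.
Qed.
Lemma normc_le_ReIm z : normc z <= `|complex.Re z| + `|complex.Im z|.
Proof.
rewrite -(@ler_pXn2r _ 2)// ?nnegrE ?normc_ge0 ?addr_ge0// normc_sqr.
by rewrite sqrrD !real_normK ?num_real// addrAC lerDl mulrn_wge0// mulr_ge0.
Qed.
Lemma normc_eq0 z : (normc z == 0) = (z == 0).
Proof. by apply/eqP/eqP => [/eq0_normc|->]//; rewrite normc0. Qed.
Lemma normcDle z w : normc (z + w) <= normc z + normc w.
Proof. exact: (le_normcD z w). Qed.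
Lemma normcNE z : normc (- z) = normc z.
Proof. exact: (normcN z). Qed.
Lemma normcME z w : normc (z * w) = normc z * normc w.
Proof. exact: (normcM z w). Qed.
Lemma normcBle z w : normc (z - w) <= normc z + normc w.
Proof. by rewrite (le_trans (normcDle _ _))// normcNE. Qed.
Lemma normc_dist z w : `|normc z - normc w| <= normc (z - w).
Proof.
have h1 : normc z <= normc (z - w) + normc w by rewrite -{1}(subrK w z) normcDle.
have h2 : normc w <= normc (z - w) + normc z.
  by rewrite -{1}(subKr z w) [leRHS]addrC normcBle.
by rewrite ler_norml; move: (normc z) (normc w) (normc _) h1 h2 => p q r; lra.
Qed.
Lemma normcJE z : normc z^*%C = normc z.
Proof. by case: z => a b /=; rewrite sqrrN. Qed.
Lemma normcR x : normc x%:C = `|x|.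
Proof. by rewrite /= expr0n/= addr0 sqrtr_sqr. Qed.
Lemma normc_i : normc ('i%C : R[i]) = 1.
Proof. by rewrite /= expr0n expr1n/= add0r sqrtr1. Qed.
Lemma mulcJ z : z * z^*%C = (normc z ^+ 2)%:C.
Proof. rewrite normc_sqr; apply: eq_complexP; rewrite !ReImE/=; ring. Qed.
Lemma conjcM z w : (z * w)^*%C = z^*%C * w^*%C.
Proof. by apply: eq_complexP; rewrite !ReImE; ring. Qed.
Lemma normc_sum (I : Type) (s : seq I) (F : I -> R[i]) :
  normc (\sum_(i <- s) F i) <= \sum_(i <- s) normc (F i).
Proof.
elim: s => [|i s ih]; first by rewrite !big_nil normc0.
by rewrite !big_cons (le_trans (normcDle _ _))// lerD2l.
Qed.
Lemma Re_sum (I : Type) (s : seq I) (F : I -> R[i]) :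
  complex.Re (\sum_(i <- s) F i) = \sum_(i <- s) complex.Re (F i).
Proof. by elim: s => [|i s ih]; rewrite ?big_nil// !big_cons ReD ih. Qed.
Lemma Im_sum (I : Type) (s : seq I) (F : I -> R[i]) :
  complex.Im (\sum_(i <- s) F i) = \sum_(i <- s) complex.Im (F i).
Proof. by elim: s => [|i s ih]; rewrite ?big_nil// !big_cons ImD ih. Qed.

Lemma cisD x y : cis (x + y) = cis x * cis y :> R[i].
Proof. by apply: eq_complexP; rewrite ReImE/= ?cosD ?sinD//; ring. Qed.
Lemma cis0 : cis 0 = 1 :> R[i].
Proof. by apply: eq_complexP; rewrite /= ?cos0 ?sin0. Qed.
Lemma cisN x : cis (- x) = (cis x)^*%C :> R[i].
Proof. by apply: eq_complexP; rewrite /= ?cosN ?sinN. Qed.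
Lemma normc_cis x : normc (cis x : R[i]) = 1.
Proof. by rewrite /= cos2Dsin2 sqrtr1. Qed.
Lemma cisK x : cis x * cis (- x) = 1 :> R[i].
Proof. by rewrite -cisD subrr cis0. Qed.
End complex_algebra.
Arguments normc : simpl never.

(** * Measurability of complex-valued functions *)

Section complex_measurability.
Context {d : measure_display} {T : measurableType d} {R : realType}.
Implicit Types (D : set T) (F G : T -> R[i]).

Lemma cmeasurableS D E F : measurable E -> D `<=` E ->
  cmeasurable E F -> cmeasurable D F.
Proof. by move=> mE DE [? ?]; split; exact: measurable_funS mE DE _. Qed.

Lemma eq_cmeasurable D F G : (forall x, D x -> F x = G x) ->
  cmeasurable D F -> cmeasurable D G.
Proof.
move=> FG [mr mi]; split.
  by apply: eq_measurable_fun mr => x; rewrite inE => /FG ->.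
by apply: eq_measurable_fun mi => x; rewrite inE => /FG ->.
Qed.

Lemma cmeasurable_cst D (z : R[i]) : cmeasurable D (fun=> z).
Proof. by split; exact: measurable_cst. Qed.

Lemma cmeasurableR D (f : T -> R) : measurable_fun D f ->
  cmeasurable D (fun x => (f x)%:C).
Proof. by move=> mf; split => //=; exact: measurable_cst. Qed.

Lemma cmeasurableD D F G : cmeasurable D F -> cmeasurable D G ->
  cmeasurable D (fun x => F x + G x).
Proof.
move=> [mr mi] [nr ni]; split.
  by under eq_fun do rewrite ReD; exact: measurable_funD.
by under eq_fun do rewrite ImD; exact: measurable_funD.
Qed.

Lemma cmeasurableN D F : cmeasurable D F -> cmeasurable D (fun x => - F x).
Proof.
move=> [mr mi]; split.
  by under eq_fun do rewrite ReN; exact: measurable_funN.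
by under eq_fun do rewrite ImN; exact: measurable_funN.
Qed.

Lemma cmeasurableB D F G : cmeasurable D F -> cmeasurable D G ->
  cmeasurable D (fun x => F x - G x).
Proof. by move=> mF mG; apply: cmeasurableD => //; exact: cmeasurableN. Qed.

Lemma cmeasurableM D F G : cmeasurable D F -> cmeasurable D G ->
  cmeasurable D (fun x => F x * G x).
Proof.
move=> [mr mi] [nr ni]; split.
  under eq_fun do rewrite ReM.
  by apply: measurable_funB; exact: measurable_funM.
under eq_fun do rewrite ImM.
by apply: measurable_funD; exact: measurable_funM.
Qed.

Lemma cmeasurableJ D F : cmeasurable D F ->
  cmeasurable D (fun x => (F x)^*%C).
Proof.
move=> [mr mi]; split.
  by under eq_fun do rewrite ReJ.
by under eq_fun do rewrite ImJ; exact: measurable_funN.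
Qed.

Lemma cmeasurable_sum D (I : Type) (s : seq I) (F : I -> T -> R[i]) :
  (forall i, cmeasurable D (F i)) ->
  cmeasurable D (fun x => \sum_(i <- s) F i x).
Proof.
move=> mF; elim: s => [|i s ih].
  by under eq_fun do rewrite big_nil; exact: cmeasurable_cst.
by under eq_fun do rewrite big_cons; exact: cmeasurableD.
Qed.

Lemma measurable_normc D F : cmeasurable D F ->
  measurable_fun D (fun x => normc (F x)).
Proof.
move=> [mr mi].
rewrite (_ : (fun x => normc (F x)) = Num.sqrt \o
   (fun x => complex.Re (F x) ^+ 2 + complex.Im (F x) ^+ 2)); last first.
  by apply/funext => x /=; case: (F x).
have ms : measurable_fun [set: R] (Num.sqrt : R -> R).
  by apply: continuous_measurable_fun; exact: sqrt_continuous.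
apply: measurableT_comp ms _.
by apply: measurable_funD; exact: measurable_funX.
Qed.

Lemma cmeasurable_cis D (f : T -> R) : measurable_fun D f ->
  cmeasurable D (fun x => cis (f x)).
Proof.
move=> mf; split.
  apply: (@measurableT_comp _ _ _ _ _ _ (@cos R)) => //.
  by apply: continuous_measurable_fun; exact: continuous_cos.
apply: (@measurableT_comp _ _ _ _ _ _ (@sin R)) => //.
by apply: continuous_measurable_fun; exact: continuous_sin.
Qed.
End complex_measurability.

Notation rint mu D f := (integrable mu D (fun x => (f x)%:E)).

(** * Integrals of real-valued functions *)

Section real_integral.
Context {d : measure_display} {T : measurableType d} {R : realType}.
Variable mu : {measure set T -> \bar R}.
Variable D : set T.
Hypothesis mD : measurable D.
Implicit Types f g : T -> R.

Lemma rint_measurable f : rint mu D f -> measurable_fun D f.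
Proof. by move/measurable_int/measurable_EFinP. Qed.

Lemma eq_rint f g : (forall x, D x -> f x = g x) -> rint mu D f -> rint mu D g.
Proof. by move=> fg; apply: eq_integrable => // x; rewrite inE => /fg ->. Qed.

Lemma eq_Rint f g : (forall x, D x -> f x = g x) ->
  \int[mu]_(x in D) f x = \int[mu]_(x in D) g x.
Proof. by move=> fg; apply: eq_Rintegral => x; rewrite inE => /fg ->. Qed.

Lemma rint_le f g : measurable_fun D f -> (forall x, D x -> `|f x| <= g x) ->
  rint mu D g -> rint mu D f.
Proof.
move=> mf fg; apply: le_integrable => //; first exact/measurable_EFinP.
by move=> x Dx /=; rewrite lee_fin (le_trans (fg _ Dx))// ler_norm.
Qed.

Lemma rintD f g : rint mu D f -> rint mu D g -> rint mu D (fun x => f x + g x).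
Proof. by move=> If Ig; have := integrableD mD If Ig; apply: eq_integrable. Qed.

Lemma rintZ (r : R) f : rint mu D f -> rint mu D (fun x => r * f x).
Proof. by move=> If; have := integrableZl mD r If; apply: eq_integrable. Qed.

Lemma rintN f : rint mu D f -> rint mu D (fun x => - f x).
Proof. by move=> If; have := integrableN If; apply: eq_integrable. Qed.

Lemma rintB f g : rint mu D f -> rint mu D g -> rint mu D (fun x => f x - g x).
Proof. by move=> If Ig; apply: rintD => //; exact: rintN. Qed.

Lemma rint_sum (I : Type) (s : seq I) (f : I -> T -> R) :
  (forall i, rint mu D (f i)) -> rint mu D (fun x => \sum_(i <- s) f i x).
Proof.
move=> If; elim: s => [|i s ih].
  by under eq_fun do rewrite big_nil; exact: integrable0.
by under eq_fun do rewrite big_cons; exact: rintD.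
Qed.

Lemma Rint_sum (I : Type) (s : seq I) (f : I -> T -> R) :
  (forall i, rint mu D (f i)) ->
  \int[mu]_(x in D) (\sum_(i <- s) f i x) =
  \sum_(i <- s) \int[mu]_(x in D) f i x.
Proof.
move=> If; elim: s => [|i s ih].
  by under eq_Rint do rewrite big_nil; rewrite big_nil /Rintegral integral0.
under eq_Rint do rewrite big_cons.
rewrite RintegralD//; [by rewrite big_cons ih|exact: If|exact: rint_sum].
Qed.

Lemma Rint_ge0 f : (forall x, D x -> 0 <= f x) -> 0 <= \int[mu]_(x in D) f x.
Proof. exact: Rintegral_ge0. Qed.

Lemma rint_EFin f : rint mu D f ->
  (\int[mu]_(x in D) (f x)%:E)%E = (\int[mu]_(x in D) f x)%:E.
Proof. by move=> If; rewrite /Rintegral fineK//; exact: integrable_fin_num. Qed.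

Lemma rint_lty f : measurable_fun D f -> (forall x, D x -> 0 <= f x) ->
  (\int[mu]_(x in D) (f x)%:E < +oo)%E -> rint mu D f.
Proof.
move=> mf f0 foo; apply/integrableP; split; first exact/measurable_EFinP.
rewrite (eq_integral (fun x => (f x)%:E))// => x; rewrite inE => Dx.
by rewrite /= ger0_norm// f0.
Qed.

Lemma rint_cst (r : R) : (mu D < +oo)%E -> rint mu D (fun=> r).
Proof.
move=> Doo; apply/integrableP; split; first exact: measurable_cst.
rewrite integral_cst// lte_mul_pinfty// ?ge0_fin_numE//.
Qed.

Lemma rint_bounded f (M : R) : (mu D < +oo)%E -> measurable_fun D f ->
  (forall x, D x -> `|f x| <= M) -> rint mu D f.
Proof. by move=> Doo mf fM; apply: rint_le fM _ => //; exact: rint_cst. Qed.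

End real_integral.

(* Sealed, as otherwise the conversion test unfolds integrals into suprema over
   simple functions. *)
Fact cint_sealed : {I : forall d (T : measurableType d) (R : realType)
    (mu : {measure set T -> \bar R}) (D : set T) (F : T -> R[i]), R[i] |
  forall d T R mu D F, I d T R mu D F =
    (\int[mu]_(x in D) complex.Re (F x)) +i* (\int[mu]_(x in D) complex.Im (F x))}.
Proof.
by exists (fun d T R mu D F =>
  (\int[mu]_(x in D) complex.Re (F x)) +i* (\int[mu]_(x in D) complex.Im (F x))).
Qed.

(** * Integrals of complex-valued functions *)

Section complex_integral.
Context {d : measure_display} {T : measurableType d} {R : realType}.
Variable mu : {measure set T -> \bar R}.
Implicit Types (D : set T) (F G : T -> R[i]).

Definition cint D F : R[i] := sval cint_sealed d T R mu D F.

Lemma cintE D F : cint D F = (\int[mu]_(x in D) complex.Re (F x)) +i*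
  (\int[mu]_(x in D) complex.Im (F x)).
Proof. by rewrite /cint; case: cint_sealed => I IE /=. Qed.

Definition cintegrable D F := rint mu D (fun x => complex.Re (F x)) /\
  rint mu D (fun x => complex.Im (F x)).

Section domain.
Variable D : set T.
Hypothesis mD : measurable D.

Lemma cintegrable_meas F : cintegrable D F -> cmeasurable D F.
Proof. by move=> [/rint_measurable ? /rint_measurable ?]. Qed.

Lemma cintegrable_normc F : cintegrable D F -> rint mu D (fun x => normc (F x)).
Proof.
move=> FI; have [FR FJ] := FI.
apply: (@rint_le _ _ _ _ _ mD _
  (fun x => `|complex.Re (F x)| + `|complex.Im (F x)|)).
- exact/measurable_normc/cintegrable_meas.
- by move=> x _; rewrite ger0_norm ?normc_ge0// normc_le_ReIm.
- by apply: rintD => //; exact: integrable_norm.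
Qed.

Lemma cintegrable_le F g : cmeasurable D F ->
  (forall x, D x -> normc (F x) <= g x) -> rint mu D g -> cintegrable D F.
Proof.
move=> [mr mi] Fg gI; split.
  apply: rint_le gI => // x Dx; exact: le_trans (Re_le_normc _) (Fg _ Dx).
apply: rint_le gI => // x Dx; exact: le_trans (Im_le_normc _) (Fg _ Dx).
Qed.

Lemma cintegrable_bounded F (M : R) : (mu D < +oo)%E -> cmeasurable D F ->
  (forall x, D x -> normc (F x) <= M) -> cintegrable D F.
Proof. by move=> Doo mF FM; apply: cintegrable_le FM _ => //; exact: rint_cst. Qed.

Lemma eq_cintegrable F G : (forall x, D x -> F x = G x) ->
  cintegrable D F -> cintegrable D G.
Proof.
by move=> FG [r i]; split; [apply: eq_rint r|apply: eq_rint i] => // x /FG ->.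
Qed.

Lemma eq_cint F G : (forall x, D x -> F x = G x) -> cint D F = cint D G.
Proof.
by move=> FG; rewrite !cintE; congr (_ +i* _); apply: eq_Rint => x /FG ->.
Qed.

Lemma cintegrableD F G : cintegrable D F -> cintegrable D G ->
  cintegrable D (fun x => F x + G x).
Proof.
move=> [? ?] [? ?]; split.
  by under eq_fun do rewrite ReD; exact: rintD.
by under eq_fun do rewrite ImD; exact: rintD.
Qed.

Lemma cintD F G : cintegrable D F -> cintegrable D G ->
  cint D (fun x => F x + G x) = cint D F + cint D G.
Proof.
move=> [? ?] [? ?]; apply: eq_complexP; rewrite ReImE !cintE/= -RintegralD//;
  by apply: eq_Rint => x _; rewrite ReImE.
Qed.

Lemma cintegrableZ (z : R[i]) F : cintegrable D F ->
  cintegrable D (fun x => z * F x).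
Proof.
move=> [? ?]; split.
  by under eq_fun do rewrite ReM; apply: rintB => //; exact: rintZ.
by under eq_fun do rewrite ImM; apply: rintD => //; exact: rintZ.
Qed.

Lemma cintZ (z : R[i]) F : cintegrable D F ->
  cint D (fun x => z * F x) = z * cint D F.
Proof.
move=> [? ?]; apply: eq_complexP; rewrite ReImE !cintE/= -!RintegralZl//.
  rewrite -RintegralB//; [|exact: rintZ..].
  by apply: eq_Rint => x _; rewrite ReImE.
rewrite -RintegralD//; [|exact: rintZ..].
by apply: eq_Rint => x _; rewrite ReImE.
Qed.

Lemma cintegrableZr (z : R[i]) F : cintegrable D F ->
  cintegrable D (fun x => F x * z).
Proof. by move=> /(cintegrableZ z); apply: eq_cintegrable => x _; exact: mulrC. Qed.

Lemma cintZr (z : R[i]) F : cintegrable D F ->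
  cint D (fun x => F x * z) = cint D F * z.
Proof.
by move=> FI; rewrite mulrC -cintZ//; apply: eq_cint => x _; exact: mulrC.
Qed.

Lemma cintegrableN F : cintegrable D F -> cintegrable D (fun x => - F x).
Proof.
by move=> /(cintegrableZ (-1)); apply: eq_cintegrable => x _; rewrite mulN1r.
Qed.

Lemma cintN F : cintegrable D F -> cint D (fun x => - F x) = - cint D F.
Proof.
move=> FI; rewrite -mulN1r -cintZ//; apply: eq_cint => x _.
by rewrite mulN1r.
Qed.

Lemma cintegrableB F G : cintegrable D F -> cintegrable D G ->
  cintegrable D (fun x => F x - G x).
Proof. by move=> FI GI; apply: cintegrableD => //; exact: cintegrableN. Qed.

Lemma cintB F G : cintegrable D F -> cintegrable D G ->
  cint D (fun x => F x - G x) = cint D F - cint D G.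
Proof. by move=> FI GI; rewrite cintD// ?cintN//; exact: cintegrableN. Qed.

Lemma cintegrableJ F : cintegrable D F -> cintegrable D (fun x => (F x)^*%C).
Proof.
move=> [? ?]; split; first by under eq_fun do rewrite ReJ.
by under eq_fun do rewrite ImJ; exact: rintN.
Qed.

Lemma cintJ F : cintegrable D F -> cint D (fun x => (F x)^*%C) = (cint D F)^*%C.
Proof.
move=> [? ?]; apply: eq_complexP; rewrite ReImE !cintE/=.
  by apply: eq_Rint => x _; rewrite ReImE.
rewrite -mulN1r -RintegralZl//.
by apply: eq_Rint => x _; rewrite ReImE mulN1r.
Qed.

Lemma cintegrable_sum (I : Type) (s : seq I) (F : I -> T -> R[i]) :
  (forall i, cintegrable D (F i)) ->
  cintegrable D (fun x => \sum_(i <- s) F i x).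
Proof.
move=> FI; split; [under eq_fun do rewrite Re_sum|under eq_fun do rewrite Im_sum].
  by apply: rint_sum => // i; case: (FI i).
by apply: rint_sum => // i; case: (FI i).
Qed.

Lemma cint_sum (I : Type) (s : seq I) (F : I -> T -> R[i]) :
  (forall i, cintegrable D (F i)) ->
  cint D (fun x => \sum_(i <- s) F i x) = \sum_(i <- s) cint D (F i).
Proof.
move=> FI; apply: eq_complexP; rewrite cintE ?Re_sum ?Im_sum/=;
  under [RHS]eq_bigr do rewrite cintE; rewrite -Rint_sum//.
- by apply: eq_Rint => x _; rewrite Re_sum.
- by move=> i; case: (FI i).
- by apply: eq_Rint => x _; rewrite Im_sum.
- by move=> i; case: (FI i).
Qed.

Lemma cintR (f : T -> R) :
  cint D (fun x => (f x)%:C) = (\int[mu]_(x in D) f x)%:C.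
Proof.
by rewrite cintE; apply: eq_complexP => //=; rewrite /Rintegral integral0.
Qed.

Lemma cintegrableR (f : T -> R) : rint mu D f ->
  cintegrable D (fun x => (f x)%:C).
Proof. by move=> fI; split => //=; exact: integrable0. Qed.

(* Rotate the value of the integral onto the positive real axis. *)
Lemma normc_cint F : cintegrable D F ->
  normc (cint D F) <= \int[mu]_(x in D) normc (F x).
Proof.
move=> FI; set z := cint D F.
have [z0|z0] := eqVneq z 0.
  by rewrite z0 normc0; apply: Rint_ge0 => x _; exact: normc_ge0.
have nz0 : normc z != 0 by rewrite normc_eq0.
have nzgt0 : 0 < normc z by rewrite lt_neqAle eq_sym nz0 normc_ge0.
rewrite -(ler_pM2l nzgt0) -expr2 -RintegralZl//; last exact: cintegrable_normc.
have -> : normc z ^+ 2 = complex.Re (z^*%C * z) by rewrite mulrC mulcJ.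
rewrite {2}/z -cintZ// cintE; apply: le_Rintegral => //.
- by have [] := cintegrableZ z^*%C FI.
- by apply: rintZ => //; exact: cintegrable_normc.
- move=> x _; rewrite (le_trans (ler_norm _))// (le_trans (Re_le_normc _))//.
  by rewrite normcME normcJE.
Qed.

Lemma normc_cint_le F g : cmeasurable D F ->
  (forall x, D x -> normc (F x) <= g x) -> rint mu D g ->
  normc (cint D F) <= \int[mu]_(x in D) g x.
Proof.
move=> mF Fg gI; have FI := cintegrable_le mF Fg gI.
rewrite (le_trans (normc_cint FI))//; apply: le_Rintegral => //.
exact: cintegrable_normc.
Qed.

End domain.

Lemma ae_eq_cint D F G : measurable D -> cmeasurable D F -> cmeasurable D G ->
  {ae mu, forall x, D x -> F x = G x} -> cint D F = cint D G.
Proof.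
move=> mD [mFr mFi] [mGr mGi] FG; rewrite !cintE /Rintegral; congr (fine _ +i* fine _);
  (apply: ae_eq_integral => //; [exact/measurable_EFinP..|]);
  by apply: filterS FG => x FGx Dx; rewrite FGx.
Qed.

Lemma cintegrable_boundedM D F G (M : R) : measurable D -> cmeasurable D G ->
  (forall x, D x -> normc (G x) <= M) -> cintegrable D F ->
  cintegrable D (fun x => G x * F x).
Proof.
move=> mD mG GM FI; apply: (cintegrable_le mD (g := fun x => M * normc (F x))).
- by apply: cmeasurableM => //; exact: cintegrable_meas FI.
- by move=> x Dx; rewrite normcME ler_wpM2r ?normc_ge0// GM.
- by apply: rintZ => //; exact: cintegrable_normc FI.
Qed.

Lemma cintegrableS D E F : measurable E -> measurable D -> D `<=` E ->
  cintegrable E F -> cintegrable D F.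
Proof. by move=> mE mD DE [? ?]; split; exact: integrableS mE mD DE _. Qed.

End complex_integral.

Notation leb := lebesgue_measure.

Lemma cintegralE (R : realType) (D : set R) (f : R -> R[i]) :
  cintegral D f = cint leb D f.
Proof. by rewrite cintE. Qed.

(** * The fundamental theorem of calculus and integrals of exponentials *)

Section calculus.
Context {R : realType}.
Implicit Types (a b x y : R) (f F : R -> R).

Lemma leb_itv_lty (a b : R) (b0 b1 : bool) :
  (leb [set` Interval (BSide b0 a) (BSide b1 b)] < +oo :> \bar R)%E.
Proof. by rewrite lebesgue_measure_itv/=; case: ifP => //; rewrite ltry. Qed.

Lemma rint_continuous f a b : {within `[a, b], continuous f} ->
  rint leb `[a, b] f.
Proof.
by move=> cf; apply: continuous_compact_integrable => //; exact: segment_compact.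
Qed.

Lemma Rint_FTC F f a b : a <= b -> {within `[a, b], continuous f} ->
  (forall x, x \in `[a, b] -> is_derive x 1 F (f x)) ->
  \int[leb]_(x in `[a, b]) f x = F b - F a.
Proof.
rewrite le_eqVlt => /predU1P[<- _ _|ab cf dF].
  by rewrite subrr set_itv1 Rintegral_set1.
have cF x : x \in `[a, b] -> {for x, continuous F}.
  move=> xab; apply: differentiable_continuous; apply/derivable1_diffP.
  by have [] := dF _ xab.
rewrite /Rintegral (@continuous_FTC2 _ f F) ?fine_EFin//.
- split.
  + by move=> x xab; have [] := dF x (subset_itv_oo_cc xab).
  + by apply: cvg_at_right_filter; apply: cF; rewrite in_itv/= lexx ltW.
  + by apply: cvg_at_left_filter; apply: cF; rewrite in_itv/= lexx ltW.
- by move=> x xab; rewrite derive1E; have [] := dF x (subset_itv_oo_cc xab).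
Qed.

Lemma cisDpi2 x (m : int) : cis (x + m%:~R * (2 * pi)) = cis x :> R[i].
Proof.
have cis2 y : cis (y + 2 * pi) = cis y :> R[i].
  by rewrite /cis mulr_natl cosD2pi sinD2pi.
have cisn y (n : nat) : cis (y + n%:R * (2 * pi)) = cis y :> R[i].
  by elim: n y => [|n ih] y; rewrite ?mul0r ?addr0// -natr1 mulrDl mul1r addrA cis2.
case: m => n; first exact: cisn.
by rewrite -[LHS](cisn _ n.+1) -addrA NegzE mulrNz -pmulrn mulNr addNr addr0.
Qed.

Lemma cint_cis_itv (w a b : R) : w != 0 -> a <= b ->
  cint leb `[a, b] (fun x => cis (w * x)) = (cis (w * b) - cis (w * a)) / ('i%C * w%:C).
Proof.
move=> w0 ab.
have E : (cis (w * b) - cis (w * a)) / ('i%C * w%:C) =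
  ((sin (w * b) - sin (w * a)) / w) +i* ((cos (w * a) - cos (w * b)) / w) :> R[i].
  have iw0 : 'i%C * w%:C != 0 :> R[i].
    by rewrite -normc_eq0 normcME normc_i normcR mul1r normr_eq0.
  apply: (mulIf iw0); rewrite mulfVK//.
  by apply: eq_complexP; rewrite !ReImE/=; field.
have cw : continuous ( *%R w : R -> R).
  by move=> x; apply: continuousM => //; exact: cst_continuous.
have dw (x : R) : is_derive x 1 (fun y => w * y) w.
  by apply: is_derive_eq; rewrite /GRing.scale/= mulr1.
rewrite E cintE; congr (_ +i* _).
  rewrite mulrBl.
  apply: (@Rint_FTC (fun x => sin (w * x) / w) (fun x => cos (w * x))) => //.
    by apply: continuous_subspaceT => x; apply: (continuous_comp (cw x)); exact: continuous_cos.
  move=> x _; have dsw : is_derive x 1 (fun y => sin (w * y)) (cos (w * x) * w).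
    exact: (is_derive1_comp (is_derive_sin _) (dw x)).
  by apply: is_derive_eq; rewrite /GRing.scale/=; field.
have -> : (cos (w * a) - cos (w * b)) / w = - (cos (w * b) / w) - - (cos (w * a) / w).
  by ring.
apply: (@Rint_FTC (fun x => - (cos (w * x) / w)) (fun x => sin (w * x))) => //.
  by apply: continuous_subspaceT => x; apply: (continuous_comp (cw x)); exact: continuous_sin.
move=> x _; have dsw : is_derive x 1 (fun y => cos (w * y)) (- sin (w * x) * w).
  exact: (is_derive1_comp (is_derive_cos _) (dw x)).
by apply: is_derive_eq; rewrite /GRing.scale/=; field.
Qed.

Lemma cis_shift_period a (m : int) : cis (m%:~R * (a + 2 * pi)) = cis (m%:~R * a) :> R[i].
Proof. by rewrite mulrDr cisDpi2. Qed.

Lemma pi2_gt0 : 0 < 2 * pi :> R.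
Proof. by rewrite mulr_gt0// pi_gt0. Qed.

Lemma leb_period a : leb `[a, a + 2 * pi] = (2 * pi)%:E :> \bar R.
Proof.
rewrite lebesgue_measure_itv/= lte_fin ltrDl pi2_gt0.
by rewrite -EFinD addrAC subrr add0r.
Qed.

Lemma cint_cis_period a (m : int) :
  cint leb `[a, a + 2 * pi] (fun x => cis (m%:~R * x)) =
  (if m == 0 then 2 * pi else 0)%:C.
Proof.
have [->|m0] := eqVneq m 0.
  under eq_cint do rewrite mul0r cis0.
  rewrite (_ : (fun=> 1) = (fun=> (1 : R)%:C))// cintR /Rintegral.
  by rewrite integral_cst//= leb_period mul1e.
rewrite cint_cis_itv ?intr_eq0// ?lerDl ?(ltW pi2_gt0)//.
by rewrite cis_shift_period subrr mul0r.
Qed.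

Lemma torusE : @torus R = `[0, 0 + 2 * pi]%classic.
Proof. by rewrite /torus add0r. Qed.

Lemma measurable_torus : measurable (@torus R : set (measurableTypeR R)).
Proof. exact: measurable_itv. Qed.

End calculus.
#[global] Hint Resolve measurable_torus : core.

(** * Square-integrable functions *)

Section square_integrable.
Context {d : measure_display} {T : measurableType d} {R : realType}.
Variable mu : {measure set T -> \bar R}.
Variable D : set T.
Hypothesis mD : measurable D.
Implicit Types (F G : T -> R[i]).

Definition CL2 F := cmeasurable D F /\ rint mu D (fun x => normc (F x) ^+ 2).

(** The square of the L^2 norm, written through the sealed [cint] so that conversion does not unfold
    the integral. *)
Definition norm2 F : R := complex.Re (cint mu D (fun x => ((normc (F x) ^+ 2)%:C))).

Lemma norm2E F : norm2 F = \int[mu]_(x in D) (normc (F x) ^+ 2).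
Proof. by rewrite /norm2 cintE. Qed.

Lemma norm2_ge0 F : 0 <= norm2 F.
Proof. by rewrite norm2E; apply: Rint_ge0 => x _; exact: sqr_ge0. Qed.

Lemma normcD_sqr (z w : R[i]) :
  normc (z + w) ^+ 2 <= 2 * normc z ^+ 2 + 2 * normc w ^+ 2.
Proof.
apply: (@le_trans _ _ ((normc z + normc w) ^+ 2)).
  by rewrite ler_sqr ?nnegrE ?addr_ge0 ?normc_ge0// normcDle.
have := sqr_ge0 (normc z - normc w); nra.
Qed.

Lemma CL2_meas F : CL2 F -> cmeasurable D F. Proof. by case. Qed.

Lemma eq_CL2 F G : (forall x, D x -> F x = G x) -> CL2 F -> CL2 G.
Proof.
move=> FG [mF F2]; split; first exact: eq_cmeasurable mF.
by apply: eq_rint F2 => // x /FG ->.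
Qed.

Lemma eq_norm2 F G : (forall x, D x -> F x = G x) -> norm2 F = norm2 G.
Proof. by move=> FG; rewrite !norm2E; apply: eq_Rint => x /FG ->. Qed.

Lemma CL2_le F g : cmeasurable D F -> (forall x, D x -> normc (F x) ^+ 2 <= g x) ->
  rint mu D g -> CL2 F.
Proof.
move=> mF Fg gI; split => //; apply: rint_le gI => //.
  exact/measurable_funX/measurable_normc.
by move=> x Dx; rewrite ger0_norm ?sqr_ge0//; exact: Fg.
Qed.

Lemma CL2D F G : CL2 F -> CL2 G -> CL2 (fun x => F x + G x).
Proof.
move=> [mF F2] [mG G2]; apply: (@CL2_le _
  (fun x => 2 * normc (F x) ^+ 2 + 2 * normc (G x) ^+ 2)).
- exact: cmeasurableD.
- by move=> x _; exact: normcD_sqr.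
- by apply: rintD => //; exact: rintZ.
Qed.

Lemma CL2Z (z : R[i]) F : CL2 F -> CL2 (fun x => z * F x).
Proof.
move=> [mF F2]; apply: (@CL2_le _ (fun x => normc z ^+ 2 * normc (F x) ^+ 2)).
- by apply: cmeasurableM => //; exact: cmeasurable_cst.
- by move=> x _; rewrite normcME exprMn.
- exact: rintZ.
Qed.

Lemma CL2N F : CL2 F -> CL2 (fun x => - F x).
Proof. by move=> /(CL2Z (-1)); apply: eq_CL2 => x _; rewrite mulN1r. Qed.

Lemma CL2B F G : CL2 F -> CL2 G -> CL2 (fun x => F x - G x).
Proof. by move=> F2 G2; apply: CL2D => //; exact: CL2N. Qed.

Lemma CL2J F : CL2 F -> CL2 (fun x => (F x)^*%C).
Proof.
move=> [mF F2]; split; first exact: cmeasurableJ.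
by apply: eq_rint F2 => // x _; rewrite normcJE.
Qed.

Lemma CL20 : CL2 (fun=> 0).
Proof.
split; first exact: cmeasurable_cst.
by under eq_fun do rewrite normc0 expr0n/=; exact: integrable0.
Qed.

Lemma CL2_sum (I : Type) (s : seq I) (F : I -> T -> R[i]) :
  (forall i, CL2 (F i)) -> CL2 (fun x => \sum_(i <- s) F i x).
Proof.
move=> F2; elim: s => [|i s ih].
  by apply: eq_CL2 CL20 => x _; rewrite big_nil.
by apply: eq_CL2 (CL2D (F2 i) ih) => x _; rewrite big_cons.
Qed.

Lemma CL2_boundedM F G (M : R) : cmeasurable D G -> (forall x, D x -> normc (G x) <= M) ->
  CL2 F -> CL2 (fun x => G x * F x).
Proof.
move=> mG GM [mF F2]; apply: (@CL2_le _ (fun x => M ^+ 2 * normc (F x) ^+ 2)).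
- exact: cmeasurableM.
- move=> x Dx; rewrite normcME exprMn ler_wpM2r ?sqr_ge0//.
  by rewrite ler_sqr ?nnegrE ?normc_ge0 ?(le_trans (normc_ge0 _) (GM _ Dx))// GM.
- exact: rintZ.
Qed.

Lemma CL2_prod F G : CL2 F -> CL2 G -> cintegrable mu D (fun x => F x * G x).
Proof.
move=> [mF F2] [mG G2]; apply: (@cintegrable_le _ _ _ _ _ mD _
  (fun x => normc (F x) ^+ 2 + normc (G x) ^+ 2)).
- exact: cmeasurableM.
- move=> x _; rewrite normcME.
  have := sqr_ge0 (normc (F x) - normc (G x)).
  have := sqr_ge0 (normc (F x)); have := sqr_ge0 (normc (G x)); nra.
- exact: rintD.
Qed.

Lemma CL2_bounded F (M : R) : (mu D < +oo)%E -> cmeasurable D F ->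
  (forall x, D x -> normc (F x) <= M) -> CL2 F.
Proof.
move=> Doo mF FM; apply: (@CL2_le _ (fun=> M ^+ 2)) => //; last exact: rint_cst.
move=> x Dx; rewrite ler_sqr ?nnegrE ?normc_ge0 ?(le_trans (normc_ge0 _) (FM _ Dx))//.
exact: FM.
Qed.

Lemma CL2_cintegrable F : (mu D < +oo)%E -> CL2 F -> cintegrable mu D F.
Proof.
move=> Doo F2; have C1 : CL2 (fun=> 1).
  apply: (@CL2_bounded (fun=> 1) 1 Doo); first exact: cmeasurable_cst.
  by move=> x _; rewrite normc1.
by apply: eq_cintegrable (CL2_prod F2 C1) => // x _; rewrite mulr1.
Qed.

Lemma norm2D_le F G : CL2 F -> CL2 G ->
  norm2 (fun x => F x + G x) <= 2 * norm2 F + 2 * norm2 G.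
Proof.
move=> F2 G2; have [mF IF] := F2; have [mG IG] := G2.
rewrite !norm2E -!RintegralZl// -RintegralD//; [|exact: rintZ..].
apply: le_Rintegral => //; first by have [] := CL2D F2 G2.
  by apply: rintD => //; exact: rintZ.
by move=> x _; exact: normcD_sqr.
Qed.

Lemma norm2Z (z : R[i]) F : CL2 F ->
  norm2 (fun x => z * F x) = normc z ^+ 2 * norm2 F.
Proof.
move=> [mF F2]; rewrite !norm2E -RintegralZl//.
by apply: eq_Rint => x _; rewrite normcME exprMn.
Qed.

Lemma cint_sqr F : CL2 F -> cint mu D (fun x => F x * (F x)^*%C) = (norm2 F)%:C.
Proof. by move=> _; rewrite norm2E -cintR; apply: eq_cint => x _; rewrite mulcJ. Qed.

End square_integrable.

(** * Orthogonal systems *)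

Lemma quarter_sum (R : realType) (a b e : R) : a < e / 4 -> b < e / 4 -> 2 * a + 2 * b < e.
Proof. by lra. Qed.

Section finite_sums.
Context {K : eqType} {R : realType}.

Lemma sum_uniq_split (V : nmodType) (s0 s : seq K) (F : K -> V) :
  uniq s0 -> uniq s -> {subset s0 <= s} ->
  \sum_(k <- s) F k = \sum_(k <- s0) F k + \sum_(k <- s | k \notin s0) F k.
Proof.
move=> u0 us s0s; rewrite (bigID [in s0])/=; congr (_ + _).
rewrite -big_filter; apply: perm_big; apply: uniq_perm => //.
  exact: filter_uniq.
by move=> k; rewrite mem_filter; apply/andP/idP => [[]|ks0]//; split=> //; exact: s0s.
Qed.

Lemma ler_sum_subset (s0 s : seq K) (F : K -> R) : (forall k, 0 <= F k) ->
  uniq s0 -> uniq s -> {subset s0 <= s} ->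
  \sum_(k <- s0) F k <= \sum_(k <- s) F k.
Proof.
move=> F0 u0 us s0s; rewrite (sum_uniq_split _ u0 us s0s) lerDl.
by apply: sumr_ge0.
Qed.

Lemma sum_kronecker (V : nmodType) (s : seq K) (k : K) (F : K -> V) :
  uniq s -> k \in s -> \sum_(l <- s) (if k == l then F l else 0) = F k.
Proof.
move=> us ks; rewrite (bigD1_seq k)//= eqxx big1 ?addr0// => l lk.
by rewrite eq_sym (negbTE lk).
Qed.

(** The finite sums have a supremum; a finite family whose sum is within [eps] of it leaves less
    than [eps] to any family disjoint from it. *)
Lemma summable_tail (a : K -> R) (B : R) : (forall k, 0 <= a k) ->
  (forall s, uniq s -> \sum_(k <- s) a k <= B) ->
  forall eps, 0 < eps -> exists2 s0, uniq s0 &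
    forall s, uniq s -> (forall k, k \in s -> k \notin s0) ->
      \sum_(k <- s) a k < eps.
Proof.
move=> a0 aB eps eps0.
pose S := [set \sum_(k <- s) a k | s in [set s | uniq s]].
have supS : has_sup S.
  split; first by exists (\sum_(k <- [::]) a k); exists [::].
  by exists B => _ [s us <-]; exact: aB.
have [_ [s0 us0 <-] s0S] := sup_adherent eps0 supS.
exists s0 => // s us ss0.
have : \sum_(k <- s0 ++ s) a k <= sup S.
  apply: ub_le_sup; first by case: supS.
  exists (s0 ++ s) => //=; rewrite cat_uniq us0 us andbT/=.
  by apply/hasPn => k /ss0.
by rewrite big_cat/=; lra.
Qed.

End finite_sums.

Section orthogonal_system.
Context {d : measure_display} {T : measurableType d} {R : realType} {K : eqType}.
Variable mu : {measure set T -> \bar R}.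
Variable D : set T.
Hypothesis mD : measurable D.
Hypothesis Doo : (mu D < +oo)%E.
Variables (phi : K -> T -> R[i]) (kappa : R).
Hypothesis mphi : forall k, cmeasurable D (phi k).
Hypothesis normc_phi : forall k x, normc (phi k x) = 1.
Hypothesis kappa_gt0 : 0 < kappa.
Hypothesis ortho : forall k l,
  cint mu D (fun x => phi k x * (phi l x)^*%C) = (if k == l then kappa else 0)%:C.
Implicit Types (F G : T -> R[i]) (s : seq K).

(** Not normalised: the coefficient of the expansion is [kappa^-1 * coef F k]. The system stands for
    the exponentials on an interval of length 2 pi and for the plane waves on a rectangle. *)
Definition coef F k := cint mu D (fun x => F x * (phi k x)^*%C).

Arguments coef : simpl never.

Definition trig s (a : K -> R[i]) x := \sum_(k <- s) a k * phi k x.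

(** By [norm2_proj] the difference is the squared distance from [F] to its projection, so that this
    is the convergence of the expansion in L^2 along finite families. *)
Definition parseval F := forall eps, 0 < eps -> exists2 s0, uniq s0 &
  forall s, uniq s -> {subset s0 <= s} ->
    norm2 mu D F - kappa^-1 * \sum_(k <- s) normc (coef F k) ^+ 2 < eps.

Lemma CL2_phi k : CL2 mu D (phi k).
Proof. by apply: (CL2_bounded mD Doo (M := 1)) => // x _; rewrite normc_phi. Qed.

Lemma CL2_trig s a : CL2 mu D (trig s a).
Proof. by apply: CL2_sum => // k; apply: CL2Z => //; exact: CL2_phi. Qed.

Lemma coef_integrable F k : CL2 mu D F ->
  cintegrable mu D (fun x => F x * (phi k x)^*%C).
Proof. by move=> F2; apply: CL2_prod => //; apply: CL2J => //; exact: CL2_phi. Qed.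

Lemma coefD F G k : CL2 mu D F -> CL2 mu D G ->
  coef (fun x => F x + G x) k = coef F k + coef G k.
Proof.
move=> F2 G2; rewrite /coef -cintD//; [|exact: coef_integrable..].
by apply: eq_cint => x _; rewrite mulrDl.
Qed.

Lemma coefZ (z : R[i]) F k : CL2 mu D F ->
  coef (fun x => z * F x) k = z * coef F k.
Proof.
move=> F2; rewrite /coef -cintZ//; [|exact: coef_integrable..].
by apply: eq_cint => x _; rewrite mulrA.
Qed.

Lemma cint_trigJ F s a : CL2 mu D F ->
  cint mu D (fun x => F x * (trig s a x)^*%C) =
  \sum_(k <- s) (a k)^*%C * coef F k.
Proof.
move=> F2; under eq_cint => x _.
  rewrite /trig rmorph_sum/= mulr_sumr; over.
rewrite cint_sum//; last first.
  move=> k; apply: CL2_prod => //; apply: CL2J => //; apply: CL2Z => //; exact: CL2_phi.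
apply: eq_bigr => k _; rewrite -cintZ//; last exact: coef_integrable.
by apply: eq_cint => x _; rewrite rmorphM/= mulrCA.
Qed.

Lemma coef_trig s a k : uniq s -> coef (trig s a) k =
  if k \in s then kappa%:C * a k else 0.
Proof.
move=> us; rewrite /coef /trig.
under eq_cint do rewrite mulr_suml.
rewrite cint_sum//; last first.
  by move=> l; apply: coef_integrable; apply: CL2Z => //; exact: CL2_phi.
under eq_bigr => l _.
  rewrite (_ : cint _ _ _ = if k == l then kappa%:C * a l else 0); last first.
    rewrite -/(coef _ _) coefZ; last exact: CL2_phi.
    by rewrite /coef ortho eq_sym; case: ifP => _; rewrite ?mulr0 // mulrC.
  over.
case: ifPn => ks; first by rewrite sum_kronecker.
rewrite big_seq big1// => l ls.
by case: eqP => // kl; rewrite kl ls in ks.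
Qed.

(** Expand the square and complete it in each coefficient. The projection is the choice of [a] that
    cancels the last sum, and [F = 0] gives the norm of a trigonometric sum. *)
Lemma best_approx s a F : uniq s -> CL2 mu D F ->
  norm2 mu D (fun x => F x - trig s a x) =
  norm2 mu D F - kappa^-1 * (\sum_(k <- s) normc (coef F k) ^+ 2) +
  kappa * \sum_(k <- s) normc (a k - kappa^-1%:C * coef F k) ^+ 2.
Proof.
move=> us F2; have P2 := CL2_trig s a.
have FP2 := CL2B mD F2 P2.
have iFF := CL2_prod mD F2 (CL2J mD F2).
have iFP := CL2_prod mD F2 (CL2J mD P2).
have iPF := CL2_prod mD P2 (CL2J mD F2).
have iPP := CL2_prod mD P2 (CL2J mD P2).
have -> : norm2 mu D (fun x => F x - trig s a x) =
    complex.Re (cint mu D (fun x => F x * (F x)^*%C) -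
      cint mu D (fun x => F x * (trig s a x)^*%C) -
      cint mu D (fun x => trig s a x * (F x)^*%C) +
      cint mu D (fun x => trig s a x * (trig s a x)^*%C)).
  have i1 := cintegrableB mD iFF iFP; have i2 := cintegrableB mD i1 iPF.
  rewrite -(cintB mD iFF iFP) -(cintB mD i1 iPF) -(cintD mD i2 iPP).
  rewrite (_ : norm2 _ _ _ = complex.Re (norm2 mu D (fun x => F x - trig s a x))%:C)//.
  rewrite -cint_sqr//; congr complex.Re; apply: eq_cint => x _.
  by rewrite rmorphB/=; ring.
rewrite cint_sqr// (cint_trigJ _ _ P2) (cint_trigJ _ _ F2).
rewrite (_ : cint mu D (fun x => trig s a x * (F x)^*%C) =
             (\sum_(k <- s) (a k)^*%C * coef F k)^*%C); last first.
  rewrite -cint_trigJ// -cintJ//; apply: eq_cint => x _.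
  by rewrite rmorphM/= conjcK mulrC.
rewrite (_ : \sum_(k <- s) (a k)^*%C * coef (trig s a) k =
  \sum_(k <- s) (kappa * normc (a k) ^+ 2)%:C); last first.
  rewrite big_seq [RHS]big_seq; apply: eq_bigr => k ks.
  rewrite coef_trig// ks mulrCA [_ * a k]mulrC mulcJ.
  by rewrite -rmorphM.
rewrite !ReImE !Re_sum/= -!addrA; congr (_ + _).
rewrite !mulr_sumr -!sumrN -!big_split/=; apply: eq_bigr => k _.
move: (coef F k) (a k) => c b; rewrite !normc_sqr !ReImE/=; field.
by rewrite gt_eqF.
Qed.

Lemma norm2_trig s a : uniq s ->
  norm2 mu D (trig s a) = kappa * \sum_(k <- s) normc (a k) ^+ 2.
Proof.
move=> us; have := best_approx a us (CL20 mu D).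
have cf0 k : coef (fun=> 0) k = 0.
  rewrite /coef (@eq_cint _ _ _ _ _ _ (fun=> (0 : R)%:C)); last by move=> x _; rewrite mul0r.
  by rewrite cintR /Rintegral integral0.
under [X in _ - _ * X + _]eq_bigr do rewrite cf0 normc0 expr0n.
under [X in _ + _ * X]eq_bigr do rewrite cf0 mulr0 subr0.
rewrite big1// mulr0 subr0 (_ : norm2 mu D (fun=> 0) = 0) ?add0r; last first.
  by rewrite !norm2E; under eq_Rint do rewrite normc0 expr0n; rewrite /Rintegral integral0.
by move=> <-; rewrite !norm2E; apply: eq_Rint => x _; rewrite sub0r normcNE.
Qed.

Definition proj s F := trig s (fun k => kappa^-1%:C * coef F k).

Lemma norm2_proj s F : uniq s -> CL2 mu D F ->
  norm2 mu D (fun x => F x - proj s F x) =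
  norm2 mu D F - kappa^-1 * (\sum_(k <- s) normc (coef F k) ^+ 2).
Proof.
move=> us F2; rewrite /proj best_approx//.
by rewrite [X in kappa * X]big1 ?mulr0 ?addr0// => k _; rewrite subrr normc0 expr0n.
Qed.

Lemma bessel s F : uniq s -> CL2 mu D F ->
  \sum_(k <- s) normc (coef F k) ^+ 2 <= kappa * norm2 mu D F.
Proof.
move=> us F2; rewrite -ler_pdivrMl// -subr_ge0 -norm2_proj//.
exact: norm2_ge0.
Qed.

Lemma coef_cvg0 F : CL2 mu D F -> forall eps, 0 < eps -> exists2 s0 : seq K,
  uniq s0 & forall k, k \notin s0 -> normc (coef F k) < eps.
Proof.
move=> F2 eps eps0.
have e2 : 0 < eps ^+ 2 by rewrite exprn_gt0.
have [s0 us0 H] := summable_tail (fun k => sqr_ge0 (normc (coef F k)))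
  (fun s us => bessel us F2) e2.
exists s0 => // k ks0.
have := H [:: k] isT; rewrite big_seq1 ltr_sqr ?nnegrE ?normc_ge0 ?ltW//.
by apply => l; rewrite inE => /eqP ->.
Qed.

Lemma CL2_proj s F : CL2 mu D (proj s F).
Proof. exact: CL2_trig. Qed.

Lemma parseval_approx F : CL2 mu D F ->
  (forall eps, 0 < eps -> exists s a, uniq s /\
     norm2 mu D (fun x => F x - trig s a x) < eps) -> parseval F.
Proof.
move=> F2 H eps eps0; have [s0 [a [us0 Fa]]] := H _ eps0.
exists s0 => // s us s0s; apply: le_lt_trans Fa.
rewrite best_approx// -addrA lerD2l.
rewrite (@le_trans _ _ (- (kappa^-1 * \sum_(k <- s0) normc (coef F k) ^+ 2)))//.
  rewrite lerN2 ler_wpM2l ?invr_ge0 ?(ltW kappa_gt0)//.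
  by apply: ler_sum_subset => // k; exact: sqr_ge0.
rewrite lerDl mulr_ge0 ?(ltW kappa_gt0)// sumr_ge0// => k _; exact: sqr_ge0.
Qed.

(** The functions satisfying Parseval's identity are closed in L^2, which allows completeness to be
    proved on simpler and simpler functions. *)
Lemma parseval_lim F : CL2 mu D F ->
  (forall eps, 0 < eps -> exists G, [/\ CL2 mu D G, parseval G &
     norm2 mu D (fun x => F x - G x) < eps]) -> parseval F.
Proof.
move=> F2 H; apply: parseval_approx => // eps eps0.
have e4 : 0 < eps / 4 by lra.
have [G [G2 PG FG]] := H _ e4.
have [s0 us0 /(_ _ us0)] := PG _ e4.
rewrite -norm2_proj// => Gs; exists s0, (fun k => kappa^-1%:C * coef G k); split=> //.
rewrite (@eq_norm2 _ _ _ _ _ _ (fun x => (F x - G x) + (G x - proj s0 G x))); last first.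
  by move=> x _; rewrite subrKA.
apply: (le_lt_trans (norm2D_le mD _ _)).
- exact: CL2B.
- by apply: CL2B => //; exact: CL2_proj.
- exact: (quarter_sum FG (Gs (fun _ h => h))).
Qed.

Lemma parsevalD F G : CL2 mu D F -> CL2 mu D G -> parseval F -> parseval G ->
  parseval (fun x => F x + G x).
Proof.
move=> F2 G2 PF PG eps eps0; have e4 : 0 < eps / 4 by lra.
have [s1 us1 H1] := PF _ e4; have [s2 us2 H2] := PG _ e4.
exists (undup (s1 ++ s2)); first exact: undup_uniq.
move=> s us ss.
have {}H1 : norm2 mu D (fun x => F x - proj s F x) < eps / 4.
  rewrite norm2_proj//; apply: H1 => // k ks; apply: ss.
  by rewrite mem_undup mem_cat ks.
have {}H2 : norm2 mu D (fun x => G x - proj s G x) < eps / 4.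
  rewrite norm2_proj//; apply: H2 => // k ks; apply: ss.
  by rewrite mem_undup mem_cat ks orbT.
rewrite -norm2_proj//; last exact: CL2D.
rewrite (@eq_norm2 _ _ _ _ _ _ (fun x => (F x - proj s F x) + (G x - proj s G x))); last first.
  move=> x _; rewrite addrACA -opprD; congr (_ - _).
  rewrite /proj /trig -big_split/=; apply: eq_bigr => k _.
  by rewrite coefD// mulrDr mulrDl.
apply: (le_lt_trans (norm2D_le mD _ _)).
- by apply: CL2B => //; exact: CL2_proj.
- by apply: CL2B => //; exact: CL2_proj.
- exact: (quarter_sum H1 H2).
Qed.

Lemma parsevalZ (z : R[i]) F : CL2 mu D F -> parseval F -> parseval (fun x => z * F x).
Proof.
move=> F2 PF eps eps0.
have z1 : 0 < normc z ^+ 2 + 1 by rewrite ltr_wpDl ?sqr_ge0.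
have e1 : 0 < eps / (normc z ^+ 2 + 1) by rewrite divr_gt0.
have [s0 us0 H] := PF _ e1; exists s0 => // s us ss.
rewrite norm2Z//; under eq_bigr do rewrite coefZ// normcME exprMn.
rewrite -mulr_sumr mulrCA -mulrBr.
have := H s us ss; rewrite -norm2_proj// ltr_pdivlMr// => H1.
have := norm2_ge0 mu D (fun x => F x - proj s F x).
move: H1; nra.
Qed.

Lemma parseval_phi k : parseval (phi k).
Proof.
apply: parseval_approx; first exact: CL2_phi.
move=> eps eps0; exists [:: k], (fun=> 1); split => //.
rewrite (@eq_norm2 _ _ _ _ _ _ (fun=> 0)).
  by rewrite !norm2E normc0 expr0n /Rintegral integral0.
by move=> x _; rewrite /trig big_seq1 mul1r subrr.
Qed.

Lemma eq_parseval F G : (forall x, D x -> F x = G x) -> parseval F -> parseval G.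
Proof.
move=> FG PF eps eps0; have [s0 us0 H] := PF _ eps0.
exists s0 => // s us ss; have := H s us ss.
rewrite (@eq_norm2 _ _ _ _ _ F G)//.
rewrite (eq_bigr (fun k => normc (coef G k) ^+ 2))// => k _.
by rewrite /coef (@eq_cint _ _ _ mu _ _ (fun x => G x * (phi k x)^*%C))// => x /FG ->.
Qed.

End orthogonal_system.

(** * Completeness of the trigonometric system *)

Section trigonometric_system.
Context {R : realType}.
Implicit Types (f g : R -> R[i]) (a x y : R) (k l m : int).

Definition expi k x : R[i] := cis (k%:~R * x).

Lemma measurable_expi k (D : set R) : cmeasurable D (expi k).
Proof. by apply: cmeasurable_cis; exact: measurable_funM. Qed.

Lemma normc_expi k x : normc (expi k x) = 1.
Proof. exact: normc_cis. Qed.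

Lemma expiD k l x : expi (k + l) x = expi k x * expi l x.
Proof. by rewrite /expi intrD mulrDl cisD. Qed.

Lemma expiN k x : expi (- k) x = (expi k x)^*%C.
Proof. by rewrite /expi mulrNz mulNr cisN. Qed.

Lemma expi0 x : expi 0 x = 1.
Proof. by rewrite /expi mul0r cis0. Qed.

Lemma expi_ortho a k l :
  cint leb `[a, a + 2 * pi] (fun x => expi k x * (expi l x)^*%C) =
  (if k == l then 2 * pi else 0)%:C.
Proof.
rewrite -subr_eq0 -(cint_cis_period a); apply: eq_cint => x _.
by rewrite -expiN -expiD.
Qed.

Lemma expi_ortho_torus k l :
  cint leb torus (fun x => expi k x * (expi l x)^*%C) =
  (if k == l then 2 * pi else 0)%:C.
Proof. by rewrite torusE expi_ortho. Qed.

Lemma leb_torus_lty : (leb (@torus R) < +oo)%E.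
Proof. exact: leb_itv_lty. Qed.

Lemma fourierE f k :
  fourier f k = ((2 * pi)^-1)%:C * coef leb torus expi f k.
Proof.
rewrite /fourier cintegralE; congr (_ * _); apply: eq_cint => x _.
by rewrite mulrC cisN.
Qed.

Local Notation CT := (CL2 leb (@torus R)).
Local Notation cf := (coef leb (@torus R) expi).
Local Notation mT := (@measurable_torus R).
Local Notation mE := (fun k => @measurable_expi k (@torus R)).
Local Notation PT := (parseval leb (@torus R) expi (2 * pi)).

(** Since [|e^{iz} - 1|^2 = 2 - 2 cos z], division by [e^{iz} - 1] is harmless at distance [m] from
    the multiples of 2 pi. *)
Lemma cosB1_lb (m z : R) : 0 < m -> m <= `|z| -> `|z| <= 2 * pi - m ->
  0 < 2 - 2 * cos m /\ 2 - 2 * cos m <= normc (cis z - 1 : R[i]) ^+ 2.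
Proof.
move=> m0 mz zm.
have E : normc (cis z - 1 : R[i]) ^+ 2 = 2 - 2 * cos z.
  rewrite normc_sqr !ReImE/= oppr0 addr0; have := cos2Dsin2 z; nra.
have mpi : m <= pi by lra.
have cosI (u v : R) : 0 <= v -> v <= u -> u <= pi -> cos u <= cos v.
  move=> v0 vu upi; rewrite leNgt ltr_cos ?in_itv/= -?leNgt//.
  - by rewrite (le_trans v0 vu).
  - by rewrite v0 (le_trans vu).
have cosS (u v : R) : 0 <= v -> v < u -> u <= pi -> cos u < cos v.
  move=> v0 vu upi; rewrite ltr_cos ?in_itv/=//.
  - by rewrite v0 (le_trans (ltW vu)).
  - by rewrite (le_trans v0 (ltW vu)).
have cm : cos m < 1 by rewrite -cos0; exact: cosS.
split; first by lra.
rewrite E lerD2l lerN2 ler_pM2l// -(cos_norm z).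
have [zpi|piz] := leP `|z| pi; first by apply: cosI => //; exact: ltW.
rewrite -(cosN `|z|) -(cosD2pi (- `|z|)) addrC mulr2n.
by apply: cosI; lra.
Qed.

Lemma coef_expiM f l k : cf (fun x => expi l x * f x) k = cf f (k - l).
Proof.
apply: eq_cint => x _.
by rewrite -!expiN opprB [l - k]addrC expiD; ring.
Qed.

Lemma CL2_expiM g l : CT g -> CT (fun x => expi l x * g x).
Proof.
move=> g2; apply: (@CL2_boundedM _ _ _ leb torus mT g (expi l) 1) => //.
  exact: measurable_expi.
by move=> x _; rewrite normc_expi.
Qed.

Lemma CL2_expi l : CT (expi l).
Proof. exact: (CL2_phi (mu := leb) mT leb_torus_lty mE normc_expi l). Qed.

Definition symseq (n : nat) : seq int := [seq i%:Z - n%:Z | i <- index_iota 0 n.*2.+1].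

Lemma symseq_uniq n : uniq (symseq n).
Proof.
rewrite map_inj_uniq ?iota_uniq// => i j /addIr [->] //.
Qed.

Lemma mem_symseq n k : (k \in symseq n) = (`|k|%N <= n)%N.
Proof.
apply/mapP/idP => [[j]|kn].
  by rewrite mem_index_iota => /andP[_ i2] ->; lia.
exists (absz (k + n%:Z)); first by rewrite mem_index_iota; lia.
by lia.
Qed.

Lemma seq_bounded (s : seq int) : exists n : nat, forall k, k \in s -> (`|k| <= n)%N.
Proof.
elim: s => [|k s [n ih]]; first by exists 0%N.
exists (maxn n `|k|%N) => l; rewrite inE => /predU1P[->|/ih]; first exact: leq_maxr.
by move=> ln; rewrite (leq_trans ln)// leq_maxl.
Qed.

(* Chernoff's proof of pointwise convergence: the partial sums telescope. *)
Lemma chernoff f g (A : R[i]) (x0 : R) : CT f -> CT g ->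
  (forall x, torus x -> f x = A + (cis (x - x0) - 1) * g x) ->
  forall eps, 0 < eps -> exists N : nat, forall n, (N <= n)%N ->
    normc (proj leb torus expi (2 * pi) (symseq n) f x0 - A) < eps.
Proof.
move=> f2 g2 fg eps eps0.
have pi2 := @pi2_gt0 R.
pose h k := ((2 * pi)^-1)%:C * cf g k * expi k x0.
have e2 : 0 < eps / 2 by rewrite divr_gt0.
have [s0 us0 s0P] := coef_cvg0 (mu := leb) mT leb_torus_lty mE normc_expi pi2
  expi_ortho_torus g2 e2.
have [N NP] := seq_bounded s0.
exists N.+1 => n Nn.
(* The factor [e^{i(x - x0)}] shifts the coefficients of [g] by one, so that each term of the
   partial sum at [x0] is a difference of consecutive values of [h]. *)
have fE k : ((2 * pi)^-1)%:C * cf f k * expi k x0 =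
    (if k == 0 then A else 0) + (h (k - 1) - h k).
  have C1 : CT (fun=> A).
    by apply: (CL2_bounded (mu := leb) mT leb_torus_lty (M := normc A)) => //;
      exact: cmeasurable_cst.
  have C2 : CT (fun x => cis (- x0) * (expi 1 x * g x)).
    exact: (CL2Z mT (cis (- x0)) (CL2_expiM 1 g2)).
  have -> : cf f k = cf (fun x => A * expi 0 x + (cis (- x0) * (expi 1 x * g x) + (-1) * g x)) k.
    apply: eq_cint => x Tx; rewrite fg// cisD expi0 mulr1 /expi mul1r; congr (_ * _).
    by ring.
  have CE := CL2_expi.
  rewrite !(coefD (mu := leb) mT leb_torus_lty mE normc_expi) ?(coefZ (mu := leb) mT leb_torus_lty
    mE normc_expi)//.
  - rewrite coef_expiM {1}/coef expi_ortho_torus /h expiD expiN eq_sym.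
    have -> : (expi 1 x0)^*%C = cis (- x0) by rewrite /expi mul1r cisN.
    case: eqP => [->|_]; last by ring.
    have pV : ((2 * pi)^-1)%:C * (2 * pi)%:C = 1 :> R[i].
      by rewrite -rmorphM mulVf ?gt_eqF.
    rewrite expi0; apply/eqP; rewrite -subr_eq0; apply/eqP.
    transitivity (A * (((2 * pi)^-1)%:C * (2 * pi)%:C - 1)); first by ring.
    by rewrite pV subrr mulr0.
  - exact: CL2_expiM.
  - exact: CL2Z.
  - exact: CL2Z.
  - by apply: CL2D => //; exact: CL2Z.
have -> : proj leb torus expi (2 * pi) (symseq n) f x0 - A = h (- n%:Z - 1) - h n%:Z.
  rewrite /proj /trig; under eq_bigr do rewrite fE.
  rewrite big_split/= [X in X + _ - _](_ : _ = A); last first.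
    have := @sum_kronecker int R[i] (symseq n) 0 (fun=> A) (symseq_uniq n).
    rewrite mem_symseq => /(_ isT) AE; rewrite -[RHS]AE; apply: eq_bigr => k _.
    by rewrite eq_sym.
  rewrite addrC addKr /symseq big_map.
  have := @telescope_sumr R[i] 0 n.*2.+1 (fun i => - h (i%:Z - n%:Z - 1)) (leq0n _).
  rewrite sub0r opprK => T; rewrite (_ : h n%:Z = h (n.*2.+1%:Z - n%:Z - 1)); last first.
    by congr h; lia.
  rewrite addrC -T; apply: eq_bigr => i _; rewrite opprK [RHS]addrC.
  by rewrite (_ : i.+1%:Z - n%:Z - 1 = i%:Z - n%:Z)//; lia.
have hN k : (N < `|k|)%N -> normc (h k) < eps / 2.
  move=> Nk; rewrite /h !normcME normc_expi mulr1 normcR.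
  have kn : k \notin s0 by apply/negP => /NP; rewrite leqNgt Nk.
  have := s0P k kn; apply: le_lt_trans.
  rewrite ler_piMl ?normc_ge0// gtr0_norm ?invr_gt0//.
  by rewrite invf_le1//; have := @pi_ge2 R; lra.
rewrite (le_lt_trans (normcBle _ _))//.
have h1 := hN (- n%:Z - 1); have h2 := hN n%:Z.
have {}h1 := h1 ltac:(lia); have {}h2 := h2 ltac:(lia).
by move: h1 h2; move: (normc _) (normc _) => p q; lra.
Qed.

(** Fatou's lemma turns the pointwise convergence of partial sums, known off a null set, into an L^2
    bound; [g] will be one fixed partial sum. *)
Lemma fatou_norm2 (D N : set R) (F : nat -> R -> R[i]) (f g : R -> R[i]) (B : R) :
  measurable (D : set (measurableTypeR R)) ->
  measurable (N : set (measurableTypeR R)) -> leb N = 0 ->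
  (forall n, CL2 leb D (F n)) -> CL2 leb D f -> CL2 leb D g ->
  (forall x, D x -> ~ N x -> forall eps, 0 < eps -> exists n0 : nat,
     forall n, (n0 <= n)%N -> normc (F n x - f x) < eps) ->
  (exists n0 : nat, forall n, (n0 <= n)%N -> norm2 leb D (fun x => F n x - g x) <= B) ->
  norm2 leb D (fun x => f x - g x) <= B.
Proof.
move=> mD mN N0 F2 f2 g2 Ff [n1 FB].
have fg2 := CL2B mD f2 g2.
have Fg2 n := CL2B mD (F2 n) g2.
have mDN := measurableD mD mN.
rewrite -lee_fin !norm2E -rint_EFin; last by have [] := fg2.
rewrite (ge0_negligible_integral mN mD _ _ N0); last 2 first.
- by apply/measurable_EFinP/measurable_funX/measurable_normc; have [] := fg2.
- by move=> x _; rewrite lee_fin sqr_ge0.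
pose u n (x : measurableTypeR R) := ((normc (F (n + n1)%N x - g x)) ^+ 2)%:E.
have mu_ n : measurable_fun D (u n).
  by apply/measurable_EFinP/measurable_funX/measurable_normc; have [] := Fg2 (n + n1)%N.
have cvu x : D x -> ~ N x -> u n x @[n --> \oo] --> ((normc (f x - g x)) ^+ 2)%:E.
  move=> Dx Nx; apply: cvg_EFin; first by near=> n.
  have H : normc (F (n + n1)%N x - g x) @[n --> \oo] --> normc (f x - g x).
    apply/cvgrPdist_lt => e e0; have [n0 H] := Ff x Dx Nx e e0.
    near=> n; have nn0 : (n0 <= n + n1)%N.
      by apply: leq_trans (leq_addr _ _); near: n; exact: nbhs_infty_ge.
    have := H _ nn0; rewrite distrC; apply: le_lt_trans.
    rewrite (le_trans (normc_dist _ _))//.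
    by rewrite opprB addrA subrK.
  rewrite expr2 (_ : fine \o _ = (fun n => normc (F (n + n1)%N x - g x) *
    normc (F (n + n1)%N x - g x))); first exact: cvgM.
  by apply/funext => n; rewrite /u/= expr2.
have -> : (\int[leb]_(x in D `\` N) ((normc (f x - g x)) ^+ 2)%:E =
           \int[leb]_(x in D `\` N) limn_einf (u ^~ x))%E.
  apply: eq_integral => x; rewrite inE => -[Dx Nx].
  by rewrite (cvg_limn_einf_sup (cvu x Dx Nx)).
have mu' n : measurable_fun (D `\` N) (u n) by apply: measurable_funS (mu_ n) => //; exact: subDsetl.
apply: (le_trans (fatou leb mDN mu' _)); first by move=> n x _; rewrite lee_fin sqr_ge0.
have -> : (fun n => \int[leb]_(x in D `\` N) u n x)%E =
          (fun n => (norm2 leb D (fun x => F (n + n1)%N x - g x))%:E).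
  apply/funext => n; rewrite -(ge0_negligible_integral mN mD (mu_ n) _ N0).
    by rewrite !norm2E -rint_EFin//; have [] := Fg2 (n + n1)%N.
  by move=> x _; rewrite lee_fin sqr_ge0.
rewrite limn_einf_lim; apply: lime_le; first exact: is_cvg_einfs.
apply: nearW => n; apply: (@le_trans _ _
    (norm2 leb D (fun x => F (n + n1)%N x - g x))%:E); last first.
  by rewrite lee_fin FB// leq_addl.
by apply: ereal_inf_lbound; exists n => /=.
Unshelve. all: by end_near. Qed.

End trigonometric_system.


(** * Dominated convergence *)

Section dominated.
Context {d : measure_display} {T : measurableType d} {R : realType}.
Variable mu : {measure set T -> \bar R}.
Variable D : set T.
Hypothesis mD : measurable D.

Lemma Rint_dct (f : nat -> T -> R) (h G : T -> R) :
  (forall n, measurable_fun D (f n)) -> measurable_fun D h ->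
  (forall x, D x -> f n x @[n --> \oo] --> h x) ->
  rint mu D G -> (forall n x, D x -> `|f n x| <= G x) ->
  \int[mu]_(x in D) f n x @[n --> \oo] --> \int[mu]_(x in D) h x.
Proof.
move=> mf mh fh GI fG.
have [] := @dominated_convergence _ _ _ mu D mD (fun n x => (f n x)%:E)
  (fun x => (h x)%:E) (fun x => (G x)%:E).
- by move=> n; apply/measurable_EFinP.
- exact/measurable_EFinP.
- apply: aeW => x Dx; apply: cvg_EFin; first by near=> n.
  exact: fh.
- exact: GI.
- by apply: aeW => x n Dx; rewrite /= lee_fin fG.
move=> hI _ H; have fI n : rint mu D (f n) by apply: rint_le GI => //; exact: fG.
rewrite (_ : (fun n => _) = fine \o (fun n => \int[mu]_(x in D) (f n x)%:E)%E).
  by apply: fine_cvg; rewrite -rint_EFin.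
by apply/funext => n /=; rewrite rint_EFin.
Unshelve. all: by end_near. Qed.

Lemma norm2_dct (F : nat -> T -> R[i]) (f : T -> R[i]) (G : T -> R) :
  (forall n, cmeasurable D (F n)) -> cmeasurable D f ->
  (forall x, D x -> normc (F n x - f x) @[n --> \oo] --> (0 : R)) ->
  rint mu D (fun x => G x ^+ 2) -> (forall n x, D x -> normc (F n x) <= G x) ->
  (forall x, D x -> normc (f x) <= G x) ->
  forall eps, 0 < eps -> exists n, norm2 mu D (fun x => f x - F n x) < eps.
Proof.
move=> mF mf Ff GI FG fG eps eps0.
have := @Rint_dct (fun n x => normc (f x - F n x) ^+ 2) (fun=> 0)
  (fun x => 4 * G x ^+ 2).
have -> : \int[mu]_(x in D) (0 : R) = 0 by rewrite /Rintegral integral0.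
move=> H; have /cvgrPdist_lt/(_ _ eps0) : norm2 mu D (fun x => f x - F n x) @[n --> \oo] --> (0 : R).
  under eq_fun do rewrite norm2E.
  apply: H => [n|//|x Dx||n x Dx].
  - by apply/measurable_funX/measurable_normc; apply: cmeasurableB.
  - have H2 : normc (F n x - f x) * normc (F n x - f x) @[n --> \oo] --> (0 : R).
      by rewrite -[X in _ --> X](mulr0 (0 : R)); apply: cvgM; exact: Ff.
    rewrite (_ : (fun n => _) =
      (fun n => normc (F n x - f x) * normc (F n x - f x)))//.
    by apply/funext => n; rewrite expr2 -opprB normcNE.
  - exact: rintZ.
  - rewrite ger0_norm ?sqr_ge0//.
    have h1 := FG n x Dx; have h2 := fG x Dx.
    have h3 := normcBle (f x) (F n x); have h4 := normc_ge0 (f x - F n x).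
    have h5 := normc_ge0 (f x).
    by move: (normc _) (normc _) (normc _) (G x) h1 h2 h3 h4 h5 => a b c e; nra.
move=> [n _ Hn]; exists n; have := Hn n (leqnn n).
by rewrite sub0r normrN ger0_norm//; exact: norm2_ge0.
Qed.
End dominated.

(** * Parseval's identity on the torus *)

Section parseval_torus.
Context {R : realType}.
Local Notation TR := (measurableTypeR R).
Local Notation CT := (CL2 leb (@torus R)).
Local Notation cf := (coef leb (@torus R) expi).
Local Notation mT := (@measurable_torus R).
Local Notation mE := (fun k => @measurable_expi R k (@torus R)).
Local Notation PT := (parseval leb (@torus R) expi (2 * pi)).
Local Notation Too := (@leb_torus_lty R).
Local Notation pi2 := (@pi2_gt0 R).

Lemma measurable_torusP (f : TR -> R) : measurable_fun setT f -> measurable_fun torus f.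
Proof. by move=> mf; apply: measurable_funS mf. Qed.

Let ind (E : set TR) x : R[i] := (\1_E x)%:C.

Lemma CL2_ind E : measurable E -> CT (ind E).
Proof.
move=> mE'; apply: (CL2_bounded (mu := leb) mT Too (M := 1)).
  by apply: cmeasurableR; apply: measurable_torusP; exact: measurable_indic.
by move=> x _; rewrite /ind normcR indicE; case: (_ \in _); rewrite /= ?normr1 ?normr0.
Qed.

Lemma torus_parsevalD (F G : R -> R[i]) : CT F -> CT G -> PT F -> PT G ->
  PT (fun x => F x + G x).
Proof.
exact: (parsevalD (mu := leb) mT Too mE (@normc_expi R) pi2 (@expi_ortho_torus R)).
Qed.

Lemma torus_parsevalZ (z : R[i]) (F : R -> R[i]) : CT F -> PT F ->
  PT (fun x => z * F x).
Proof.
exact: (parsevalZ (mu := leb) mT Too mE (@normc_expi R) pi2 (@expi_ortho_torus R)).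
Qed.

Lemma torus_parseval_lim (F : R -> R[i]) : CT F ->
  (forall eps, 0 < eps -> exists G, [/\ CT G, PT G &
     norm2 leb torus (fun x => F x - G x) < eps]) -> PT F.
Proof.
exact: (parseval_lim (mu := leb) mT Too mE (@normc_expi R) pi2 (@expi_ortho_torus R)).
Qed.

Lemma torus_parseval_approx (F : R -> R[i]) : CT F ->
  (forall eps, 0 < eps -> exists s a, uniq s /\
     norm2 leb torus (fun x => F x - trig expi s a x) < eps) -> PT F.
Proof.
exact: (parseval_approx (mu := leb) mT Too mE (@normc_expi R) pi2 (@expi_ortho_torus R)).
Qed.

Lemma torus_norm2_proj (s : seq int) (F : R -> R[i]) : uniq s -> CT F ->
  norm2 leb torus (fun x => F x - proj leb torus expi (2 * pi) s F x) =
  norm2 leb torus F - (2 * pi)^-1 * (\sum_(k <- s) normc (cf F k) ^+ 2).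
Proof.
exact: (norm2_proj (mu := leb) mT Too mE (@normc_expi R) pi2 (@expi_ortho_torus R)).
Qed.

Lemma torus_bessel (s : seq int) (F : R -> R[i]) : uniq s -> CT F ->
  \sum_(k <- s) normc (cf F k) ^+ 2 <= 2 * pi * norm2 leb torus F.
Proof.
exact: (bessel (mu := leb) mT Too mE (@normc_expi R) pi2 (@expi_ortho_torus R)).
Qed.

Lemma parseval_cst (z : R[i]) : PT (fun=> z).
Proof.
apply: (@eq_parseval _ _ R int leb torus expi (2 * pi) (fun x => z * expi 0 x)).
  by move=> x _; rewrite expi0 mulr1.
apply: torus_parsevalZ; first exact: CL2_expi.
exact: (parseval_phi (mu := leb) mT Too mE (@normc_expi R) pi2 (@expi_ortho_torus R)).
Qed.

Lemma ind_ray (y x : R) : ind `]-oo, y[ x = (if x < y then 1 else 0 : R)%:C.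
Proof. by rewrite /ind indicE mem_setE in_itv/=; case: (x < y). Qed.

Lemma measurable_ray (y : R) : measurable (`]-oo, y[%classic : set TR).
Proof. exact: measurable_itv. Qed.

(** Off the jumps of the periodic step function, [chernoff] gives pointwise convergence of the
    partial sums. The differences of partial sums are small in L^2 by Bessel's inequality, and
    Fatou's lemma identifies the limit. *)
Lemma parseval_ray (y : R) : PT (ind `]-oo, y[).
Proof.
have [y0|y0] := leP y 0.
  apply: eq_parseval (parseval_cst 0) => x; rewrite /torus/= in_itv/= => /andP[x0 _].
  by rewrite ind_ray ltNge (le_trans y0 x0).
have [y2|y2] := ltP (2 * pi) y.
  apply: eq_parseval (parseval_cst 1) => x; rewrite /torus/= in_itv/= => /andP[_ x2].
  by rewrite ind_ray (le_lt_trans x2 y2).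
set f := ind _; have f2 : CT f by apply: CL2_ind; exact: measurable_ray.
have f01 x x' : f x != f x' -> normc (f x - f x') = 1.
  rewrite /f !ind_ray; case: (x < y); case: (x' < y); rewrite ?eqxx// => _.
    by rewrite subr0 normc1.
  by rewrite sub0r normcNE normc1.
pose N : set TR := [set 0] `|` [set y] `|` [set 2 * pi].
have mN : measurable N by apply: measurableU; first apply: measurableU.
have N0 : leb N = 0.
  apply: null_set_setU => //; [by apply: measurableU| |exact: lebesgue_measure_set1].
  by apply: null_set_setU => //; exact: lebesgue_measure_set1.
have cvf x0 : torus x0 -> ~ N x0 -> forall eps, 0 < eps -> exists N : nat,
    forall n, (N <= n)%N ->
    normc (proj leb torus expi (2 * pi) (symseq n) f x0 - f x0) < eps.
  rewrite /torus/= in_itv/= => /andP[x00 x02] Nx0.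
  have {}x00 : 0 < x0.
    by rewrite lt_neqAle x00 andbT eq_sym; apply/eqP => H; apply: Nx0; left; left.
  have {}x02 : x0 < 2 * pi.
    by rewrite lt_neqAle x02 andbT; apply/eqP => H; apply: Nx0; right.
  have x0y : 0 < `|x0 - y|.
    by rewrite normr_gt0 subr_eq0; apply/eqP => H; apply: Nx0; left; right.
  (* The distance from [x0] to the jumps: where [f] differs from [f x0], the point [x] is at least
     [m] away from [x0] modulo 2 pi. *)
  pose m := Num.min `|x0 - y| (Num.min x0 (2 * pi - x0)).
  have m0 : 0 < m by rewrite !lt_min x0y x00 subr_gt0.
  have my : m <= `|x0 - y| by rewrite ge_min lexx.
  have mx0 : m <= x0 by rewrite !ge_min lexx orbT.
  have mx2 : m <= 2 * pi - x0 by rewrite !ge_min lexx !orbT.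
  have fx x : torus x -> f x != f x0 -> m <= `|x - x0| /\ `|x - x0| <= 2 * pi - m.
    rewrite /torus/= in_itv/= => /andP[x1 x2]; rewrite /f !ind_ray.
    clearbody m; case: (ltP x y) => xy; case: (ltP x0 y) => x0y'; rewrite ?eqxx// => _.
      rewrite ger0_norm ?subr_ge0// in my.
      by rewrite ler0_norm ?subr_le0 ?(le_trans (ltW xy))//; split; lra.
    rewrite ltr0_norm ?subr_lt0// in my.
    by rewrite ger0_norm ?subr_ge0 ?(le_trans (ltW x0y'))//; split; lra.
  pose w x : R[i] := cis (x - x0) - 1.
  pose c : R := 2 - 2 * cos m.
  have c0 : 0 < c.
    have m2 : `|m| <= 2 * pi - m by rewrite gtr0_norm//; lra.
    have mm : m <= `|m| by exact: ler_norm.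
    by have [] := cosB1_lb m0 mm m2.
  (* The maximum with [c] makes the quotient [g] bounded everywhere; where [f x] differs from [f x0]
     it is [normc (w x) ^+ 2], so that [g] is the true quotient there. *)
  pose q x := Num.max (normc (w x) ^+ 2) c.
  have q0 x : 0 < q x by rewrite lt_max c0 orbT.
  pose g x := (f x - f x0) * ((w x)^*%C * ((q x)^-1)%:C).
  have fg x : torus x -> f x = f x0 + (cis (x - x0) - 1) * g x.
    move=> Tx; rewrite /g; have [->|ne] := eqVneq (f x) (f x0).
      by rewrite subrr mul0r mulr0 addr0.
    have [mx xm] := fx x Tx ne.
    have [_ wc] := cosB1_lb m0 mx xm.
    have qE : q x = normc (w x) ^+ 2 by apply/max_idPl.
    have W1 : w x * ((w x)^*%C * ((q x)^-1)%:C) = 1.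
      by rewrite mulrA mulcJ -qE -rmorphM mulfV ?gt_eqF.
    by rewrite -/(w x) mulrCA W1 mulr1 addrC subrK.
  have mw : cmeasurable torus (w : TR -> R[i]).
    apply: cmeasurableB; last exact: cmeasurable_cst.
    by apply: cmeasurable_cis; apply: measurable_funB.
  have g2 : CT g.
    have mg : cmeasurable torus (g : TR -> R[i]).
      apply: cmeasurableM.
        by apply: cmeasurableB; [by have [] := f2|exact: cmeasurable_cst].
      apply: cmeasurableM; first exact: cmeasurableJ.
      apply: cmeasurableR.
      have mq : measurable_fun torus (q : TR -> R).
        by apply: measurable_maxr => //; apply/measurable_funX/measurable_normc.
      pose iv (z : R) := (Num.max z c)^-1.
      have miv : measurable_fun [set: R] iv.
        apply: continuous_measurable_fun => z.
        apply: cvgV; first by rewrite gt_eqF// lt_max c0 orbT.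
        by apply: (@continuous_max _ _ id (cst c)); [exact: cvg_id|exact: cvg_cst].
      rewrite (_ : (fun x => _) = iv \o q); last first.
        apply/funext => x; rewrite /iv/=; congr (_^-1).
        by apply/esym/max_idPl; rewrite le_max lexx orbT.
      by apply: measurableT_comp.
    apply: (CL2_bounded (mu := leb) mT Too (M := 2 / c) mg).
    move=> x Tx; rewrite /g; have [->|ne] := eqVneq (f x) (f x0).
      by rewrite subrr mul0r normc0 divr_ge0// ltW.
    rewrite !normcME f01// mul1r normcJE normcR gtr0_norm ?invr_gt0//.
    rewrite ler_pM ?normc_ge0 ?invr_ge0 ?(ltW (q0 x))//.
      by rewrite (le_trans (normcBle _ _))// normc_cis normc1.
    by rewrite lef_pV2 ?posrE// le_max lexx orbT.
  exact: (chernoff f2 g2 fg).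
apply: torus_parseval_approx => // eps eps0.
have e2 : 0 < eps / 2 by lra.
have [s0 us0 s0P] := summable_tail (fun k => sqr_ge0 (normc (cf f k)))
  (fun s us => torus_bessel us f2) e2.
have [n0 n0P] := seq_bounded s0.
pose a k := ((2 * pi)^-1)%:C * cf f k.
exists (symseq n0), a; split; first exact: symseq_uniq.
apply: (@le_lt_trans _ _ (eps / 2)); last by lra.
(* All partial sums of order at least [n0] are compared with that of order [n0]; the difference is a
   trigonometric sum over modes outside [s0]. *)
apply: (fatou_norm2 (F := fun n => proj leb torus expi (2 * pi) (symseq n) f) mT mN N0).
- by move=> n; rewrite /proj; exact: (CL2_trig (mu := leb) mT Too mE (@normc_expi R)).
- exact: f2.
- exact: (CL2_trig (mu := leb) mT Too mE (@normc_expi R)).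
- exact: cvf.
exists n0 => n n0n.
have sub : {subset symseq n0 <= symseq n}.
  by move=> k; rewrite !mem_symseq => /leq_trans; exact.
have usn := symseq_uniq n; have usn0 := symseq_uniq n0.
rewrite (@eq_norm2 _ TR R leb torus _ (trig expi [seq k <- symseq n | k \notin symseq n0] a)); last
  first.
  move=> x _; rewrite /proj /trig (sum_uniq_split _ usn0 usn sub) addrC addKr.
  by rewrite big_filter.
have uf : uniq [seq k <- symseq n | k \notin symseq n0] by exact: filter_uniq.
rewrite (norm2_trig (mu := leb) mT Too mE (@normc_expi R) pi2 (@expi_ortho_torus R))//.
rewrite (eq_bigr (fun k => (2 * pi)^-1 ^+ 2 * normc (cf f k) ^+ 2)); last first.
  by move=> k _; rewrite /a normcME exprMn normcR gtr0_norm ?invr_gt0// pi2.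
rewrite -mulr_sumr mulrA expr2 mulVKf ?gt_eqF// ?pi2//.
rewrite (@le_trans _ _ (\sum_(k <- [seq k <- symseq n | k \notin symseq n0]) normc (cf f k) ^+ 2))//.
  rewrite ler_piMl ?sumr_ge0// => [k _|]; first exact: sqr_ge0.
  by rewrite invf_le1 ?pi2//; have := @pi_ge2 R; lra.
apply: ltW; apply: s0P => // k; rewrite mem_filter mem_symseq => /andP[H _].
by apply: contra H => /n0P.
Qed.

Lemma torus_parseval_sum (I : Type) (s : seq I) (F : I -> R -> R[i]) :
  (forall i, CT (F i)) -> (forall i, PT (F i)) ->
  PT (fun x => \sum_(i <- s) F i x).
Proof.
move=> F2 PF; elim: s => [|i s ih].
  by apply: eq_parseval (parseval_cst 0) => x _; rewrite big_nil.
have := torus_parsevalD (F2 i) (CL2_sum mT s F2) (PF i) ih.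
by apply: eq_parseval => x _; rewrite big_cons.
Qed.

(** The Dynkin class theorem: rays are stable under intersection and generate the Borel sets, and
    Parseval's identity passes to complements and to countable disjoint unions. *)
Lemma parseval_ind (E : set TR) : measurable E -> PT (ind E).
Proof.
move=> mE'; apply: (@dynkin_induction _ TR (@RGenInftyO.G R) (fun E => PT (ind E))).
- exact: (RGenInftyO.measurableE R).
- move=> _ _ [x ->] [y ->]; exists (Num.min x y).
  apply/seteqP; split => z /=; rewrite !in_itv/= lt_min; first by move=> [-> ->].
  by move=> /andP[].
- by apply: eq_parseval (parseval_cst 1) => x _; rewrite /ind indicE in_setT.
- by move=> _ [x ->]; exact: parseval_ray.
- move=> S mS PS.
  have C1 : CT (fun=> 1).
    apply: (CL2_bounded (mu := leb) mT Too (M := 1)); first exact: cmeasurable_cst.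
    by move=> x _; rewrite normc1.
  have C2 := CL2Z mT (-1) (CL2_ind mS).
  have := torus_parsevalD C1 C2 (parseval_cst 1) (torus_parsevalZ (-1) (CL2_ind mS) PS).
  apply: eq_parseval => x _; rewrite /ind !indicE in_setC.
  by case: (x \in S) => /=; rewrite mulN1r ?subrr ?oppr0 ?addr0.
- move=> F mF tF PF; apply: torus_parseval_lim.
    by apply: CL2_ind; exact: bigcupT_measurable.
  pose S n x := \sum_(i <- index_iota 0 n) ind (F i) x.
  have S2 n : CT (S n) by apply: CL2_sum => // i; exact: CL2_ind.
  have SP n : PT (S n) by apply: torus_parseval_sum => // i; exact: CL2_ind.
  have SE n x : (exists2 k, F k x & S n x = (k < n)%N%:R) \/ (ind (\bigcup_k F k) x = 0 /\ S n x = 0).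
    have [[k _ Fkx]|nF] := pselect ((\bigcup_k F k) x).
      left; exists k => //; rewrite /S (eq_bigr (fun i => if k == i then 1 else 0)); last first.
        move=> i _; rewrite /ind indicE; case: eqP => [<-|ki]; first by rewrite mem_set.
        rewrite memNset// => Fix; apply: ki; apply: (tF k i) => //.
        by exists x.
      case: ltnP => kn; first by rewrite sum_kronecker ?iota_uniq// mem_index_iota.
      rewrite big_nat big1// => i /andP[_ i_n]; case: eqP => // ki.
      by move: i_n; rewrite -ki ltnNge kn.
    right; split; first by rewrite /ind indicE memNset.
    rewrite /S big1// => i _; rewrite /ind indicE memNset// => Fix.
    by apply: nF; exists i.
  have S1 n x : normc (S n x) <= 1.
    have [[k _ ->]|[_ ->]] := SE n x; last by rewrite normc0.
    by case: (_ < _)%N; rewrite ?normc1 ?normc0.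
  move=> eps eps0.
  have [n H] : exists n, norm2 leb torus (fun x => ind (\bigcup_k F k) x - S n x) < eps.
    apply: (norm2_dct (mu := leb) mT (G := fun=> 1)) => //.
    - by move=> n; have [] := S2 n.
    - by apply: CL2_meas; apply: CL2_ind; exact: bigcupT_measurable.
    - move=> x Tx; apply/cvgrPdist_lt => e e0.
      have [Fx|nFx] := pselect ((\bigcup_k F k) x); last first.
        near=> n; have [[k Fk _]|[-> ->]] := SE n x.
          by exfalso; apply: nFx; exists k.
        by rewrite subrr normc0 subrr normr0.
      have [k _ Fk] := Fx.
      exists k.+1 => // n /= kn; have [[k' Fk' ->]|[]] := SE n x; last first.
        by rewrite /ind indicE mem_set// => /eqP; rewrite eq_complex/= oner_eq0.
      have -> : k' = k by apply: (tF k' k) => //; exists x.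
      by rewrite kn /ind indicE mem_set// subrr normc0 subrr normr0.
    - by apply: rint_cst => //; exact: Too.
    - move=> x Tx; rewrite /ind normcR indicE; case: (_ \in _); by rewrite ?normr1 ?normr0.
  by exists (S n).
- have HE : @measurable _ TR = <<s @RGenInftyO.G R>> := RGenInftyO.measurableE R.
  by rewrite -HE.
Unshelve. all: by end_near. Qed.

Import HBNNSimple.

Lemma parseval_sfun (phi : {nnsfun TR >-> R}) : PT (fun x => (phi x)%:C).
Proof.
have -> : (fun x => (phi x)%:C) =
    (fun x => \sum_(y <- finmap.enum_fset (fset_set (range phi)))
       y%:C * ind (phi @^-1` [set y]) x).
  apply/funext => x; rewrite {1}(fimfunE phi x) (fsbig_finite _ _ (fimfunP phi))/=.
  by rewrite (raddf_sum (real_complex R)); apply: eq_bigr => y _; rewrite -rmorphM.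
have mphi y : measurable (phi @^-1` [set y]) by exact: measurable_funPTI.
apply: torus_parseval_sum => y; first by apply: CL2Z => //; exact: CL2_ind.
by apply: torus_parsevalZ; [exact: CL2_ind|exact: parseval_ind].
Qed.

Lemma parseval_ge0 (h : R -> R) : measurable_fun torus (h : TR -> R) ->
  (forall x, 0 <= h x) -> rint leb torus (fun x => h x ^+ 2) ->
  PT (fun x => (h x)%:C).
Proof.
move=> mh h0 h2.
have mh' : measurable_fun torus (fun x : TR => (h x)%:E) by exact/measurable_EFinP.
pose phi := nnsfun_approx mT mh'.
have h0' x : torus x -> (0 <= (h x)%:E)%E by rewrite lee_fin.
have cphi x : torus x -> phi n x @[n --> \oo] --> h x.
  move=> Tx; have := @cvg_approx _ _ _ _ _ x h0' Tx (ltry _).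
  apply: cvg_trans; apply: near_eq_cvg; near=> n.
  by rewrite /phi nnsfun_approxE.
have phih n x : torus x -> phi n x <= h x.
  by move=> Tx; rewrite -lee_fin /phi nnsfun_approxE; exact: le_approx.
have phi0 n x : 0 <= phi n x by exact: fun_ge0.
have mphi n : cmeasurable torus (fun x : TR => (phi n x)%:C).
  by apply: cmeasurableR; apply: measurable_torusP.
have H2 : CT (fun x => (h x)%:C).
  split; first exact: cmeasurableR.
  by apply: eq_rint h2 => // x _; rewrite normcR ger0_norm.
apply: torus_parseval_lim => // eps eps0.
have [n H] : exists n, norm2 leb torus (fun x => (h x)%:C - (phi n x)%:C) < eps.
  apply: (norm2_dct (mu := leb) mT (G := h)) => //.
  - move=> x Tx; have := cphi x Tx => /cvgrPdist_lt H; apply/cvgrPdist_lt => e e0.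
    apply: filterS (H e e0) => n.
    by rewrite -rmorphB normcR sub0r normrN normr_id distrC.
  - by move=> n x Tx; rewrite normcR ger0_norm// phih.
  - by move=> x Tx; rewrite normcR ger0_norm.
exists (fun x => (phi n x)%:C); split => //; last exact: parseval_sfun.
apply: (CL2_le mT (mphi n) _ h2) => x Tx.
by rewrite normcR ger0_norm// ler_sqr ?nnegrE// phih.
Unshelve. all: by end_near. Qed.

Theorem parseval_L2 (f : R -> R[i]) : CT f -> PT f.
Proof.
move=> f2; have [[mr mi] f2i] := f2.
pose h1 x := Num.max (complex.Re (f x)) 0; pose h2 x := Num.max (- complex.Re (f x)) 0.
pose h3 x := Num.max (complex.Im (f x)) 0; pose h4 x := Num.max (- complex.Im (f x)) 0.
have aux (h g : R -> R) : measurable_fun torus (g : TR -> R) -> (forall x, h x = Num.max (g x) 0) ->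
    (forall x, `|g x| <= normc (f x)) ->
    PT (fun x => (h x)%:C) /\ CT (fun x => (h x)%:C).
  move=> mg hE gf; have mh : measurable_fun torus (h : TR -> R).
    rewrite (_ : h = (fun x => Num.max (g x) 0)); last exact/funext.
    exact: measurable_maxr.
  have h0 x : 0 <= h x by rewrite hE le_max lexx orbT.
  have hf x : h x <= normc (f x).
    by rewrite hE ge_max (le_trans (ler_norm _) (gf x)) normc_ge0.
  have hh2 : rint leb torus (fun x => h x ^+ 2).
    apply: rint_le f2i => //; first exact: measurable_funX.
    by move=> x _; rewrite ger0_norm ?sqr_ge0// ler_sqr ?nnegrE ?normc_ge0.
  split; first exact: parseval_ge0.
  split; first exact: cmeasurableR.
  by apply: eq_rint hh2 => // x _; rewrite normcR ger0_norm.
have [P1 C1] := aux h1 _ mr (fun=> erefl) (fun x => Re_le_normc (f x)).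
have [P2 C2] := aux h2 (fun x => - complex.Re (f x)) (measurable_funN mr) (fun=> erefl) ltac:(by
  move=> x; rewrite normrN Re_le_normc).
have [P3 C3] := aux h3 _ mi (fun=> erefl) (fun x => Im_le_normc (f x)).
have [P4 C4] := aux h4 (fun x => - complex.Im (f x)) (measurable_funN mi) (fun=> erefl) ltac:(by
  move=> x; rewrite normrN Im_le_normc).
have D2 := CL2Z mT (-1) C2; have D3 := CL2Z mT 'i%C C3; have D4 := CL2Z mT (- 'i%C) C4.
have Q2 := torus_parsevalZ (-1) C2 P2; have Q3 := torus_parsevalZ 'i%C C3 P3.
have Q4 := torus_parsevalZ (- 'i%C) C4 P4.
have := torus_parsevalD (CL2D mT C1 D2) (CL2D mT D3 D4) (torus_parsevalD C1 D2 P1 Q2)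
  (torus_parsevalD D3 D4 Q3 Q4).
have maxE (r : R) : Num.max r 0 - Num.max (- r) 0 = r.
  by have [r0|r0] := leP 0 r; [rewrite max_r ?oppr_le0// subr0|rewrite max_l ?oppr_ge0 ?ltW// sub0r
    opprK].
apply: eq_parseval => x _; apply: eq_complexP; rewrite !ReImE/=.
  rewrite -[RHS]maxE -/(h1 x) -/(h2 x); ring.
rewrite -[RHS]maxE -/(h3 x) -/(h4 x); ring.
Qed.

Corollary fourier_eq0 (f : R -> R[i]) : CT f -> (forall k, fourier f k = 0) ->
  norm2 leb torus f = 0.
Proof.
move=> f2 f0; apply/eqP; rewrite eq_le norm2_ge0 andbT.
apply/ler_addgt0Pl => eps eps0; rewrite addr0.
have [s0 us0 /(_ s0 us0 (fun _ h => h))] := parseval_L2 f2 eps0.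
rewrite big1 ?mulr0 ?subr0; first exact: ltW.
move=> k _; have := f0 k; rewrite fourierE => /eqP; rewrite mulf_eq0 => /orP[|/eqP ->].
  by rewrite -normc_eq0 normcR normr_eq0 invr_eq0 gt_eqF ?pi2.
by rewrite normc0 expr0n.
Qed.

End parseval_torus.

(** * Fubini and integration by parts *)

Section fubini_rectangle.
Context {d1 d2 : measure_display} {T1 : measurableType d1} {T2 : measurableType d2}.
Context {R : realType}.
Variables (m1 : {sigma_finite_measure set T1 -> \bar R}).
Variables (m2 : {sigma_finite_measure set T2 -> \bar R}).
Variables (A : set T1) (B : set T2).
Hypotheses (mA : measurable A) (mB : measurable B).
Local Notation mm := (m1 \x m2)%E.
Let mAB : measurable (A `*` B) := measurableX mA mB.

Lemma measurable_slice (f : T1 * T2 -> R) a : measurable_fun (A `*` B) f -> A a ->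
  measurable_fun B (fun b => f (a, b)).
Proof.
move=> mf Aa; apply/measurable_restrictT => //.
move/measurable_restrictT : mf => /(_ mAB) mf.
rewrite (_ : _ \_ B = (f \_ (A `*` B)) \o pair a); first exact: measurableT_comp.
by apply/funext => b; rewrite /= !patchE in_setX (mem_set Aa).
Qed.

Lemma cmeasurable_slice (f : T1 * T2 -> R[i]) a : cmeasurable (A `*` B) f -> A a ->
  cmeasurable B (fun b => f (a, b)).
Proof.
by move=> [mr mi] Aa; split; [exact: (measurable_slice mr)|exact: (measurable_slice mi)].
Qed.

(** The inner integral in Fubini's theorem is an extended real, finite only almost everywhere;
    [fine] puts 0 for the infinite values and leaves the outer integral unchanged. *)
Lemma integrable_fine d (T : measurableType d) (mu : {measure set T -> \bar R})
  (D : set T) (g : T -> \bar R) : measurable D -> mu.-integrable D g ->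
  rint mu D (fine \o g) /\ \int[mu]_(x in D) (fine (g x)) = fine (\int[mu]_(x in D) g x)%E.
Proof.
move=> mD gI; have mg := measurable_int mu gI.
have mfg : measurable_fun D (fun x => (fine (g x))%:E).
  apply/measurable_EFinP.
  exact: (measurableT_comp (fine_measurable measurableT) mg).
split.
  apply: le_integrable gI => //= x Dx.
  by case: (g x) => [r||] //=; rewrite ?normr0 ?leey.
rewrite /Rintegral; congr fine; apply: ae_eq_integral => //.
have := integrable_ae mD gI; apply: filterS => x /= H Dx.
by rewrite fineK// H.
Qed.

Lemma fubini_rect (f : T1 * T2 -> R) : rint mm (A `*` B) f ->
  [/\ rint m1 A (fun a => \int[m2]_(b in B) f (a, b)),
      {ae m1, forall a, A a -> rint m2 B (fun b => f (a, b))} &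
      \int[mm]_(z in A `*` B) f z = \int[m1]_(a in A) \int[m2]_(b in B) f (a, b)].
Proof.
move=> fI; pose g := (EFin \o f) \_ (A `*` B).
have gI : mm.-integrable setT g by have := (integrable_mkcond (EFin \o f) mAB).1 fI.
have gE a b : g (a, b) = if (a \in A) && (b \in B) then (f (a, b))%:E else 0%E.
  by rewrite /g patchE in_setX.
have FE a : fubini_F m2 g a = if a \in A then (\int[m2]_(b in B) (f (a, b))%:E)%E else 0%E.
  rewrite /fubini_F; case: ifPn => aA.
    rewrite [in RHS]integral_mkcond; apply: eq_integral => b _.
    by rewrite gE aA patchE.
  by rewrite (eq_integral (cst 0%E)) ?integral0// => b _; rewrite gE (negbTE aA).
have FI := integrable_fubini_F gI.
have F0 : fubini_F m2 g = (fun a => \int[m2]_(b in B) (f (a, b))%:E)%E \_ A.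
  by apply/funext => a; rewrite FE patchE.
have HI : m1.-integrable A (fun a => \int[m2]_(b in B) (f (a, b))%:E)%E.
  by apply/integrable_mkcond => //; rewrite -F0.
have [H1 H2] := integrable_fine mA HI.
split => //.
- have := ae_integrable1 gI; apply: filterS => a /= Ha Aa.
  apply/integrable_mkcond => //.
  rewrite (_ : _ \_ _ = fun b => g (a, b))//; apply/funext => b.
  by rewrite gE (mem_set Aa) patchE.
rewrite /Rintegral in H2 *; rewrite H2; congr fine.
by rewrite integral_mkcond -/g -(integral12_prod_meas1 gI) F0 [RHS]integral_mkcond.
Qed.

Lemma fubini_rect2 (f : T1 * T2 -> R) : rint mm (A `*` B) f ->
  rint m2 B (fun b => \int[m1]_(a in A) f (a, b)) /\
  \int[mm]_(z in A `*` B) f z = \int[m2]_(b in B) \int[m1]_(a in A) f (a, b).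
Proof.
move=> fI; pose g := (EFin \o f) \_ (A `*` B).
have gI : mm.-integrable setT g by have := (integrable_mkcond (EFin \o f) mAB).1 fI.
have gE a b : g (a, b) = if (a \in A) && (b \in B) then (f (a, b))%:E else 0%E.
  by rewrite /g patchE in_setX.
have FE b : fubini_G m1 g b = if b \in B then (\int[m1]_(a in A) (f (a, b))%:E)%E else 0%E.
  rewrite /fubini_G; case: ifPn => bB.
    rewrite [in RHS]integral_mkcond; apply: eq_integral => a _.
    by rewrite gE bB andbT patchE.
  by rewrite (eq_integral (cst 0%E)) ?integral0// => a _; rewrite gE (negbTE bB) andbF.
have mg := measurable_int _ gI.
have FI : m2.-integrable setT (fubini_G m1 g).
  apply/integrableP; split; first exact: (measurable_fubini_G gI).
  apply: (@le_lt_trans _ _ (\int[m2]_y \int[m1]_x `|g (x, y)|)%E); last first.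
    exact/(integrable21ltyP m1 m2 mg).
  apply: ge0_le_integral => //.
  - by apply: measurableT_comp => //; exact: (measurable_fubini_G gI).
  - apply: (measurable_fun_fubini_tonelli_G (abse \o g)) => //=.
    exact: measurableT_comp.
  - move=> b _; apply: le_abse_integral => //.
    exact: measurableT_comp.
have F0 : fubini_G m1 g = (fun b => \int[m1]_(a in A) (f (a, b))%:E)%E \_ B.
  by apply/funext => b; rewrite FE patchE.
have HI : m2.-integrable B (fun b => \int[m1]_(a in A) (f (a, b))%:E)%E.
  by apply/integrable_mkcond => //; rewrite -F0.
have [H1 H2] := integrable_fine mB HI.
split => //.
rewrite /Rintegral in H2 *; rewrite H2; congr fine.
by rewrite integral_mkcond -/g -(integral21_prod_meas1 gI) F0 [RHS]integral_mkcond.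
Qed.

Lemma cfubini_rect (f : T1 * T2 -> R[i]) : cintegrable mm (A `*` B) f ->
  [/\ cintegrable m1 A (fun a => cint m2 B (fun b => f (a, b))),
      {ae m1, forall a, A a -> cintegrable m2 B (fun b => f (a, b))} &
      cint mm (A `*` B) f = cint m1 A (fun a => cint m2 B (fun b => f (a, b)))].
Proof.
move=> [/fubini_rect[r1 r2 r3] /fubini_rect[i1 i2 i3]]; split => //.
- by split; [apply: (eq_rint mA _ r1)|apply: (eq_rint mA _ i1)] => a _; rewrite cintE.
- by apply: filterS2 r2 i2 => a Hr Hi Aa; split; [exact: Hr|exact: Hi].
- rewrite !cintE r3 i3; apply: eq_complexP => /=;
    by apply: eq_Rint => a _; rewrite cintE.
Qed.

Lemma cfubini_swap (f : T1 * T2 -> R[i]) : cintegrable mm (A `*` B) f ->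
  cint m1 A (fun a => cint m2 B (fun b => f (a, b))) =
  cint m2 B (fun b => cint m1 A (fun a => f (a, b))).
Proof.
move=> fI; have [_ _ <-] := cfubini_rect fI.
have [/fubini_rect2[_ r3] /fubini_rect2[_ i3]] := fI.
rewrite !cintE r3 i3; apply: eq_complexP => /=;
  by apply: eq_Rint => a _; rewrite cintE.
Qed.

Lemma rint_rect_prod (f : T1 -> R) (g : T2 -> R) : rint m1 A f -> rint m2 B g ->
  rint mm (A `*` B) (fun z => f z.1 * g z.2).
Proof.
move=> fI gI; have mf := rint_measurable fI; have mg := rint_measurable gI.
have mfA := (measurable_restrictT f mA).1 mf; have mgB := (measurable_restrictT g mB).1 mg.
have mh : measurable_fun setT (fun z : T1 * T2 => ((f \_ A) z.1 * (g \_ B) z.2)%:E).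
  apply/measurable_EFinP; apply: measurable_funM.
    by apply: measurableT_comp => //; exact: measurable_fst.
  by apply: measurableT_comp => //; exact: measurable_snd.
apply/integrable_mkcond => //.
rewrite (_ : _ \_ _ = (fun z : T1 * T2 => ((f \_ A) z.1 * (g \_ B) z.2)%:E)); last first.
  apply/funext => -[a b]; rewrite !patchE in_setX/=.
  by case: (a \in A); case: (b \in B); rewrite ?mulr0 ?mul0r.
apply/integrable12ltyP => //=.
have HA : m1.-integrable setT (EFin \o (f \_ A)).
  by rewrite -restrict_EFin; exact: (integrable_mkcond (EFin \o f) mA).1 fI.
have HB : m2.-integrable setT (EFin \o (g \_ B)).
  by rewrite -restrict_EFin; exact: (integrable_mkcond (EFin \o g) mB).1 gI.
have HBn : measurable_fun setT (fun b => `|(g \_ B) b|%:E).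
  by apply/measurable_EFinP; exact: measurableT_comp.
have HAn : measurable_fun setT (fun a => `|(f \_ A) a|%:E).
  by apply/measurable_EFinP; exact: measurableT_comp.
have E a : (\int[m2]_b `|(f \_ A) a * (g \_ B) b|%:E =
            `|(f \_ A) a|%:E * \int[m2]_b `|(g \_ B) b|%:E)%E.
  rewrite -ge0_integralZl//.
  by apply: eq_integral => b _; rewrite normrM EFinM.
under eq_integral do rewrite E.
have [_ gy] := integrableP _ _ _ HB; have [_ fy] := integrableP _ _ _ HA.
have gf : (\int[m2]_b `|(g \_ B) b|%:E)%E \is a fin_num.
  by rewrite ge0_fin_numE//; apply: integral_ge0 => b _; rewrite lee_fin.
rewrite -(fineK gf) ge0_integralZr//; last first.
  by rewrite lee_fin fine_ge0//; apply: integral_ge0 => b _; rewrite lee_fin.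
have ff : (\int[m1]_b `|(f \_ A) b|%:E)%E \is a fin_num.
  by rewrite ge0_fin_numE//; apply: integral_ge0 => b _; rewrite lee_fin.
by rewrite -(fineK ff) -EFinM ltry.
Qed.

Lemma cintegrable_rect_prod (f : T1 -> R[i]) (g : T2 -> R[i]) :
  cintegrable m1 A f -> cintegrable m2 B g ->
  cintegrable mm (A `*` B) (fun z => f z.1 * g z.2).
Proof.
move=> fI gI; have [fr fi] := fI; have [gr gi] := gI; split.
  under eq_fun do rewrite ReM.
  exact: (rintB mAB (rint_rect_prod fr gr) (rint_rect_prod fi gi)).
under eq_fun do rewrite ImM.
exact: (rintD mAB (rint_rect_prod fr gi) (rint_rect_prod fi gr)).
Qed.

End fubini_rectangle.

Lemma cint_setI_ind d (T : measurableType d) (R : realType)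
  (mu : {measure set T -> \bar R}) (D P : set T) (f : T -> R[i]) :
  cint mu D (fun x => (\1_P x)%:C * f x) = cint mu (D `&` P) f.
Proof.
rewrite !cintE !Rintegral_mkcondr; congr (_ +i* _); apply: eq_Rint => x _;
  by rewrite ReImE/= patchE indicE; case: (_ \in _); rewrite ?mul1r ?mul0r ?subr0 ?addr0.
Qed.

(** * Integrals over intervals and their primitives *)

Section line_integrals.
Context {R : realType}.
Local Notation TR := (measurableTypeR R).
Implicit Types (p q m t : R) (f g : R -> R[i]).

Lemma measurable_itvT (i : interval R) : measurable ([set` i] : set TR).
Proof. exact: measurable_itv. Qed.

Lemma rint_sub_itv (h : R -> R) (p q p' q' : R) : p <= p' -> q' <= q ->
  rint leb `[p, q] h -> rint leb `[p', q'] h.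
Proof.
move=> pp qq; apply: integrableS => //; [exact: measurable_itvT..|].
by apply: subset_itv; rewrite bnd_simp.
Qed.

Lemma cintegrable_sub_itv f (p q p' q' : R) : p <= p' -> q' <= q ->
  cintegrable leb `[p, q] f -> cintegrable leb `[p', q'] f.
Proof. by move=> pp qq [? ?]; split; exact: rint_sub_itv pp qq _. Qed.

Lemma Rint_itv_split (h : R -> R) p m q : p <= m -> m <= q -> rint leb `[p, q] h ->
  \int[leb]_(x in `[p, q]) h x =
  \int[leb]_(x in `[p, m]) h x + \int[leb]_(x in `[m, q]) h x.
Proof.
move=> pm mq hI; apply/eqP; rewrite addrC -subr_eq; apply/eqP.
rewrite (@Rintegral_itvB _ h (BLeft p) (BRight q) m)// ?bnd_simp//.
rewrite Rintegral_itv_obnd_cbnd//; apply: integrableS hI; [exact: measurable_itvT..|].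
by apply: subset_itv; rewrite bnd_simp.
Qed.

Lemma cint_itv_split f p m q : p <= m -> m <= q -> cintegrable leb `[p, q] f ->
  cint leb `[p, q] f = cint leb `[p, m] f + cint leb `[m, q] f.
Proof.
by move=> pm mq [fr fi]; rewrite !cintE (Rint_itv_split pm mq fr) (Rint_itv_split pm mq fi).
Qed.

Lemma cint_itv1 f p : cint leb `[p, p] f = 0.
Proof. by rewrite cintE set_itv1 !Rintegral_set1. Qed.

Lemma Rint_itv1 (h : R -> R) p : \int[leb]_(x in `[p, p]) h x = 0.
Proof. by rewrite set_itv1 Rintegral_set1. Qed.

Lemma Rint_continuous (h : R -> R) p q : p <= q -> rint leb `[p, q] h ->
  {within `[p, q], continuous (fun t => \int[leb]_(x in `[p, t]) h x)}.
Proof. by move=> pq hI; exact: parameterized_integral_continuous. Qed.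

Lemma cmeasurable_primitive f p q : p <= q -> cintegrable leb `[p, q] f ->
  cmeasurable (`[p, q] : set TR) (fun t => cint leb `[p, t] f).
Proof.
move=> pq [fr fi]; split.
  rewrite (_ : (fun t => _) = (fun t => \int[leb]_(x in `[p, t]) complex.Re (f x))); last first.
    by apply/funext => t; rewrite cintE.
  apply: subspace_continuous_measurable_fun; first exact: measurable_itvT.
  exact: Rint_continuous fr.
rewrite (_ : (fun t => _) = (fun t => \int[leb]_(x in `[p, t]) complex.Im (f x))); last first.
  by apply/funext => t; rewrite cintE.
apply: subspace_continuous_measurable_fun; first exact: measurable_itvT.
exact: Rint_continuous fi.
Qed.

Lemma Rint_sub_le (h : R -> R) p q p' q' : p <= p' -> p' <= q' -> q' <= q ->
  rint leb `[p, q] h -> (forall x, 0 <= h x) ->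
  \int[leb]_(x in `[p', q']) h x <= \int[leb]_(x in `[p, q]) h x.
Proof.
move=> pp pq qq hI h0; rewrite (Rint_itv_split pp (le_trans pq qq) hI).
rewrite (Rint_itv_split pq qq (rint_sub_itv pp (lexx _) hI)).
by rewrite addrCA lerDl addr_ge0// Rint_ge0.
Qed.

Lemma normc_primitive_le f p t q : p <= t -> t <= q -> cintegrable leb `[p, q] f ->
  normc (cint leb `[p, t] f) <= \int[leb]_(x in `[p, q]) normc (f x).
Proof.
move=> pt tq fI; have fI' := cintegrable_sub_itv (lexx p) tq fI.
apply: (le_trans (normc_cint (measurable_itvT _) fI')).
apply: Rint_sub_le => //; first exact: (cintegrable_normc (measurable_itvT _) fI).
by move=> x; exact: normc_ge0.
Qed.

Lemma cintegrable_primitiveM f g p q : p <= q -> cintegrable leb `[p, q] f ->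
  cintegrable leb `[p, q] g ->
  cintegrable leb `[p, q] (fun t => cint leb `[p, t] f * g t).
Proof.
move=> pq fI gI; pose M := \int[leb]_(x in `[p, q]) normc (f x).
apply: (@cintegrable_le _ _ _ _ _ (measurable_itvT `[p, q]) _ (fun t => M * normc (g t))).
- by apply: cmeasurableM; [exact: cmeasurable_primitive|exact: cintegrable_meas gI].
- move=> t /=; rewrite in_itv/= => /andP[pt tq]; rewrite normcME ler_wpM2r ?normc_ge0//.
  exact: normc_primitive_le.
- by apply: rintZ => //; exact: (cintegrable_normc (measurable_itvT _) gI).
Qed.

Lemma itv_setI_le p q t : t <= q -> `[p, q] `&` [set s | s <= t] = `[p, t]%classic.
Proof.
move=> tq; apply/seteqP; split => s /=; rewrite !in_itv/=; first by move=> [/andP[-> _] ->].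
by move=> /andP[-> st]; rewrite st (le_trans st tq).
Qed.

Lemma itv_setI_ge p q s : p <= s -> `[p, q] `&` [set t | s <= t] = `[s, q]%classic.
Proof.
move=> ps; apply/seteqP; split => t /=; rewrite !in_itv/=; first by move=> [/andP[_ ->] ->].
by move=> /andP[st ->]; rewrite st (le_trans ps st).
Qed.

(* Fubini on a triangle. *)
Lemma cint_by_parts f g p q : p <= q -> cintegrable leb `[p, q] f ->
  cintegrable leb `[p, q] g ->
  cint leb `[p, q] (fun t => cint leb `[p, t] f * g t) =
  cint leb `[p, q] (fun s => f s * cint leb `[s, q] g).
Proof.
move=> pq fI gI; have mpq := @measurable_itvT `[p, q].
pose E := [set z : TR * TR | z.1 <= z.2].
have mE : measurable E.
  have mB : measurable_fun setT (fun z : TR * TR => z.2 - z.1).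
    by apply: measurable_funB; [exact: measurable_snd|exact: measurable_fst].
  have := mB measurableT _ (@measurable_itvT `[0, +oo[).
  rewrite setTI (_ : _ @^-1` _ = E)//; apply/seteqP; split => z /=;
    by rewrite in_itv/= andbT subr_ge0.
pose h (z : TR * TR) : R[i] := (\1_E z)%:C * (f z.1 * g z.2).
have hI : cintegrable (leb \x leb)%E (`[p, q] `*` `[p, q]) h.
  have PI := cintegrable_rect_prod mpq mpq fI gI.
  apply: (@cintegrable_le _ _ _ _ _ (measurableX mpq mpq) _ (fun z => normc (f z.1 * g z.2))).
  - apply: cmeasurableM; last exact: cintegrable_meas PI.
    apply: cmeasurableR; exact: (measurable_funS measurableT (@subsetT _ _) (measurable_indic mE)).
  - move=> z _; rewrite /h normcME normcR indicE; case: (_ \in _); rewrite ?normr1 ?mul1r//.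
    by rewrite normr0 mul0r normc_ge0.
  - exact: (cintegrable_normc (measurableX mpq mpq) PI).
have swap := cfubini_swap mpq mpq hI.
have inner1 t : p <= t -> t <= q ->
    cint leb `[p, q] (fun s => h (s, t)) = cint leb `[p, t] f * g t.
  move=> pt tq.
  transitivity (cint leb `[p, q] (fun s => (\1_[set s | s <= t] s)%:C * (f s * g t))).
    by apply: eq_cint => s _; rewrite /h !indicE.
  rewrite cint_setI_ind itv_setI_le//.
  exact: (cintZr (measurable_itvT _) _ (cintegrable_sub_itv (lexx _) tq fI)).
have inner2 s : p <= s -> s <= q ->
    cint leb `[p, q] (fun t => h (s, t)) = f s * cint leb `[s, q] g.
  move=> ps sq.
  transitivity (cint leb `[p, q] (fun t => (\1_[set t | s <= t] t)%:C * (f s * g t))).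
    by apply: eq_cint => t _; rewrite /h !indicE.
  rewrite cint_setI_ind itv_setI_ge//.
  exact: (cintZ (measurable_itvT _) _ (cintegrable_sub_itv ps (lexx _) gI)).
transitivity (cint leb `[p, q] (fun t => cint leb `[p, q] (fun s => h (s, t)))).
  by apply: eq_cint => t /=; rewrite in_itv/= => /andP[pt tq]; rewrite inner1.
rewrite -swap; apply: eq_cint => s /=; rewrite in_itv/= => /andP[ps sq].
by rewrite inner2.
Qed.

End line_integrals.

(** * Zygmund's inequality *)

Section holder.
Context {d : measure_display} {T : measurableType d} {R : realType}.
Variable mu : {measure set T -> \bar R}.
Variable D : set T.
Hypothesis mD : measurable D.
Implicit Types f g h : T -> R.

Lemma rint_sqrM f g : measurable_fun D f -> measurable_fun D g ->
  rint mu D (fun x => f x ^+ 2) -> rint mu D (fun x => g x ^+ 2) ->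
  rint mu D (fun x => f x * g x).
Proof.
move=> mf mg f2 g2; apply: (@rint_le _ _ _ _ _ mD _ (fun x => f x ^+ 2 + g x ^+ 2)).
- exact: measurable_funM.
- by move=> x _; rewrite ler_norml; apply/andP; split;
    have := sqr_ge0 (f x - g x); have := sqr_ge0 (f x + g x); nra.
- exact: rintD.
Qed.

(** A nonnegative quadratic polynomial has a nonpositive discriminant; this serves both for
    integrals and for finite sums. *)
Lemma sqr_disc_le (A B C : R) : 0 <= A -> 0 <= C ->
  (forall l, 0 <= l ^+ 2 * A - 2 * l * B + C) -> B ^+ 2 <= A * C.
Proof.
move=> A0 C0 H; have [A1|A1] := eqVneq A 0.
  rewrite A1 mul0r; have [->|B0] := eqVneq B 0; first by rewrite expr0n.
  (* If [A = 0] and [B] is nonzero the polynomial is affine and not constant; it takes the value -1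
     at this point. *)
  have := H ((C + 1) / (2 * B)).
  have -> : ((C + 1) / (2 * B)) ^+ 2 * A - 2 * ((C + 1) / (2 * B)) * B + C = - 1.
    by rewrite A1; field.
  by rewrite oppr_ge0 ler10.
have {}A0 : 0 < A by rewrite lt_neqAle eq_sym A1.
have := H (B / A).
have -> : (B / A) ^+ 2 * A - 2 * (B / A) * B + C = C - B ^+ 2 / A by field.
by rewrite subr_ge0 ler_pdivrMr// mulrC.
Qed.

Lemma cauchy_schwarz f g : measurable_fun D f -> measurable_fun D g ->
  rint mu D (fun x => f x ^+ 2) -> rint mu D (fun x => g x ^+ 2) ->
  (\int[mu]_(x in D) (f x * g x)) ^+ 2 <=
  (\int[mu]_(x in D) (f x ^+ 2)) * (\int[mu]_(x in D) (g x ^+ 2)).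
Proof.
move=> mf mg f2 g2; have fg := rint_sqrM mf mg f2 g2.
apply: sqr_disc_le; [by apply: Rint_ge0 => x _; exact: sqr_ge0..|move=> l].
rewrite -RintegralZl// -RintegralZl// -RintegralB//; [|exact: rintZ..].
rewrite -RintegralD//; last by apply: rintB; [|exact: rintZ..].
apply: Rint_ge0 => x _.
have -> : l ^+ 2 * f x ^+ 2 - 2 * l * (f x * g x) + g x ^+ 2 = (l * f x - g x) ^+ 2.
  by ring.
exact: sqr_ge0.
Qed.

(** Cauchy-Schwarz for the products [h1 h2] and [h3 h4], then for each pair; fourth powers on both
    sides avoid roots. *)
Lemma holder4 h1 h2 h3 h4 : measurable_fun D h1 -> measurable_fun D h2 ->
  measurable_fun D h3 -> measurable_fun D h4 ->
  rint mu D (fun x => h1 x ^+ 4) -> rint mu D (fun x => h2 x ^+ 4) ->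
  rint mu D (fun x => h3 x ^+ 4) -> rint mu D (fun x => h4 x ^+ 4) ->
  rint mu D (fun x => h1 x * h2 x * h3 x * h4 x) /\
  (\int[mu]_(x in D) (h1 x * h2 x * h3 x * h4 x)) ^+ 4 <=
  (\int[mu]_(x in D) (h1 x ^+ 4)) * (\int[mu]_(x in D) (h2 x ^+ 4)) *
  (\int[mu]_(x in D) (h3 x ^+ 4)) * (\int[mu]_(x in D) (h4 x ^+ 4)).
Proof.
move=> m1 m2 m3 m4 i1 i2 i3 i4.
have aux f g : measurable_fun D f -> measurable_fun D g ->
    rint mu D (fun x => f x ^+ 4) -> rint mu D (fun x => g x ^+ 4) ->
    rint mu D (fun x => (f x * g x) ^+ 2) /\
    (\int[mu]_(x in D) ((f x * g x) ^+ 2)) ^+ 2 <=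
    (\int[mu]_(x in D) (f x ^+ 4)) * (\int[mu]_(x in D) (g x ^+ 4)).
  move=> mf mg f4 g4.
  have mf2 : measurable_fun D (fun x => f x ^+ 2) by exact: measurable_funX.
  have mg2 : measurable_fun D (fun x => g x ^+ 2) by exact: measurable_funX.
  have f4' : rint mu D (fun x => (f x ^+ 2) ^+ 2).
    by apply: (eq_rint mD _ f4) => x _; rewrite -exprM.
  have g4' : rint mu D (fun x => (g x ^+ 2) ^+ 2).
    by apply: (eq_rint mD _ g4) => x _; rewrite -exprM.
  split; first by apply: (eq_rint mD _ (rint_sqrM mf2 mg2 f4' g4')) => x _; rewrite exprMn.
  have := cauchy_schwarz mf2 mg2 f4' g4'.
  rewrite (@eq_Rint _ _ _ mu D (fun x => (f x ^+ 2) ^+ 2) (fun x => f x ^+ 4)); last first.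
    by move=> x _; rewrite -exprM.
  rewrite (@eq_Rint _ _ _ mu D (fun x => (g x ^+ 2) ^+ 2) (fun x => g x ^+ 4)); last first.
    by move=> x _; rewrite -exprM.
  by rewrite (@eq_Rint _ _ _ mu D (fun x => f x ^+ 2 * g x ^+ 2) (fun x => (f x * g x) ^+ 2))// =>
    x _; rewrite exprMn.
have [i12 H12] := aux _ _ m1 m2 i1 i2; have [i34 H34] := aux _ _ m3 m4 i3 i4.
have m12 : measurable_fun D (fun x => h1 x * h2 x) by exact: measurable_funM.
have m34 : measurable_fun D (fun x => h3 x * h4 x) by exact: measurable_funM.
have HI := rint_sqrM m12 m34 i12 i34.
have E x : h1 x * h2 x * (h3 x * h4 x) = h1 x * h2 x * h3 x * h4 x by rewrite mulrA.
split; first by apply: (eq_rint mD _ HI) => x _; exact: E.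
have := cauchy_schwarz m12 m34 i12 i34.
rewrite (@eq_Rint _ _ _ mu D (fun x => h1 x * h2 x * (h3 x * h4 x)) (fun x => h1 x * h2 x * h3 x *
  h4 x)); last by move=> x _; exact: E.
have p1 : 0 <= \int[mu]_(x in D) ((h1 x * h2 x) ^+ 2) by apply: Rint_ge0 => x _; exact: sqr_ge0.
have p2 : 0 <= \int[mu]_(x in D) ((h3 x * h4 x) ^+ 2) by apply: Rint_ge0 => x _; exact: sqr_ge0.
move: p1 p2 H12 H34.
move: (\int[mu]_(x in D) ((h1 x * h2 x) ^+ 2)) (\int[mu]_(x in D) ((h3 x * h4 x) ^+ 2)).
move: (\int[mu]_(x in D) (h1 x * h2 x * h3 x * h4 x)).
move=> z a b a0 b0 Ha Hb Hz.
rewrite (_ : z ^+ 4 = (z ^+ 2) ^+ 2); last by rewrite -exprM.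
rewrite -!mulrA mulrA.
apply: (@le_trans _ _ ((a * b) ^+ 2)).
  by rewrite ler_sqr ?nnegrE ?sqr_ge0 ?mulr_ge0.
by rewrite exprMn ler_pM ?sqr_ge0.
Qed.

End holder.

(** * Plane waves on a strip, the L^4 estimate and its dual *)

Section zygmund.
Context {R : realType}.
Local Notation TR := (measurableTypeR R).
Local Notation PM := (@lebesgue_measure R \x @lebesgue_measure R)%E.
Implicit Types (p q : R) (s : seq int) (c : int -> R[i]).

Definition strip p q : set (TR * TR) := `[p, q]%classic `*` torus.

Lemma measurable_strip p q : measurable (strip p q).
Proof. by apply: measurableX; [exact: measurable_itvT|exact: measurable_torus]. Qed.

Lemma PM_strip_lty p q : (PM (strip p q) < +oo)%E.
Proof.
rewrite /strip product_measure1E; [|exact: measurable_itvT|exact: measurable_torus].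
apply: lte_mul_pinfty; [by []| |exact: leb_torus_lty].
by rewrite ge0_fin_numE//; exact: leb_itv_lty.
Qed.

(** The plane wave [e^{i(mx - nt)}] at [z = (t, x)]; it solves the free equation exactly when
    [n = m^2]. *)
Definition wave (mn : int * int) (z : TR * TR) : R[i] :=
  cis (- (mn.2%:~R * z.1)) * cis (mn.1%:~R * z.2).

Lemma normc_wave mn z : normc (wave mn z) = 1.
Proof. by rewrite normcME !normc_cis mulr1. Qed.

Lemma measurable_wave mn (D : set (TR * TR)) : cmeasurable D (wave mn).
Proof.
apply: cmeasurableM; apply: cmeasurable_cis.
  apply: measurable_funN; apply: measurable_funM => //.
  exact: (measurable_funS measurableT (@subsetT _ _) measurable_fst).
apply: measurable_funM => //.
exact: (measurable_funS measurableT (@subsetT _ _) measurable_snd).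
Qed.

Lemma waveD mn mn' z : wave mn z * wave mn' z = wave (mn + mn') z.
Proof.
case: mn mn' => [m n] [m' n']; rewrite /wave/= mulrACA -!cisD.
by congr cis; rewrite !intrD; ring.
Qed.

Lemma waveJ mn z : (wave mn z)^*%C = wave (- mn) z.
Proof.
case: mn => [m n]; rewrite /wave conjcM -!cisN -!cisD.
by congr cis; rewrite !mulrNz; ring.
Qed.

Lemma cintegrable_cis_itv (w a b : R) : cintegrable leb `[a, b] (fun x => cis (w * x)).
Proof.
apply: (@cintegrable_bounded _ _ _ leb _ (measurable_itvT `[a, b]) _ 1).
- exact: leb_itv_lty.
- by apply: cmeasurable_cis; exact: measurable_funM.
- by move=> x _; rewrite normc_cis.
Qed.

Lemma cint_rect_prod (f g : R -> R[i]) p q :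
  cintegrable leb `[p, q] f -> cintegrable leb torus g ->
  cint PM (strip p q) (fun z => f z.1 * g z.2) =
  cint leb `[p, q] f * cint leb torus g.
Proof.
move=> fI gI; have mI := measurable_itvT `[p, q].
have mT := @measurable_torus R.
have [_ _ ->] := cfubini_rect mI mT (cintegrable_rect_prod mI mT fI gI).
rewrite -(cintZr mI _ fI); apply: eq_cint => t _.
by rewrite (cintZ mT (f t) gI).
Qed.

Lemma wave_ortho p mn mn' :
  cint PM (strip p (p + 2 * pi)) (fun z => wave mn z * (wave mn' z)^*%C) =
  (if mn == mn' then (2 * pi) ^+ 2 else 0)%:C.
Proof.
have E z : wave mn z * (wave mn' z)^*%C = wave (mn - mn') z by rewrite waveJ waveD.
rewrite (eq_cint _ (fun (z : TR * TR) _ => E z)) -subr_eq0.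
case: (mn - mn') => [m n]; rewrite /wave/=.
have E1 z : cis (- (n%:~R * z.1)) * cis (m%:~R * z.2) =
   (fun t : R => cis ((- n)%:~R * t)) z.1 * (fun t : R => cis (m%:~R * t)) z.2 :> R[i].
  by rewrite mulrNz mulNr.
rewrite (eq_cint _ (fun (z : TR * TR) _ => E1 z)).
rewrite (cint_rect_prod (cintegrable_cis_itv _ _ _) (cintegrable_cis_itv _ _ _)).
rewrite cint_cis_period torusE cint_cis_period oppr_eq0.
rewrite (_ : ((m, n) == 0) = (m == 0) && (n == 0))//.
by case: (m == 0); case: (n == 0); rewrite /= -rmorphM/= ?mulr0 ?mul0r ?expr2.
Qed.

Lemma normc_sum_sqr (I : Type) (L : seq I) (F : I -> R[i]) :
  normc (\sum_(i <- L) F i) ^+ 2 <= (size L)%:R * \sum_(i <- L) normc (F i) ^+ 2.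
Proof.
elim: L => [|i L ih]; first by rewrite !big_nil normc0 expr0n mulr0.
rewrite !big_cons /=.
apply: (@le_trans _ _ ((normc (F i) + normc (\sum_(j <- L) F j)) ^+ 2)).
  by rewrite ler_sqr ?nnegrE ?addr_ge0 ?normc_ge0// normcDle.
have S0 : 0 <= \sum_(j <- L) normc (F j) ^+ 2 by apply: sumr_ge0 => j _; exact: sqr_ge0.
move: ih S0 (normc_ge0 (F i)) (normc_ge0 (\sum_(j <- L) F j)).
move: (\sum_(j <- L) normc (F j) ^+ 2) (normc (F i)) (normc (\sum_(j <- L) F j)) => S a b.
rewrite -natr1; have [->|] := posnP (size L).
  rewrite mul0r add0r mul1r => b2 S0 a0 b0.
  have -> : b = 0 by apply/eqP; rewrite -sqrf_eq0 eq_le b2 sqr_ge0.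
  by rewrite addr0 lerDl.
rewrite -(ltr0n R); move: (size L)%:R => n n1 bS S0 a0 b0.
have H : 0 <= (n * a - b) ^+ 2 by exact: sqr_ge0.
rewrite -(ler_pM2l n1); nra.
Qed.

Definition wave_key (kl : int * int) : int * int :=
  (kl.1 + kl.2, kl.1 ^+ 2 + kl.2 ^+ 2).

(** Equal sums and equal sums of squares force [(k' - k) * (k' - l) = 0]. *)
Lemma wave_key_inj (kl kl' : int * int) : wave_key kl = wave_key kl' ->
  kl' \in [:: kl; (kl.2, kl.1)].
Proof.
case: kl kl' => [k l] [k' l'] [/= e1 e2]; rewrite !inE/=.
have E : l' = k + l - k' by rewrite e1 addrC addKr.
have : (k' - k) * (k' - l) = 0.
  move: e2; rewrite E => e2.
  have : 2 * ((k' - k) * (k' - l)) = k' ^+ 2 + (k + l - k') ^+ 2 - (k ^+ 2 + l ^+ 2) by ring.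
  rewrite -e2 subrr.
  by move/eqP; rewrite mulf_eq0/= => /eqP.
move/eqP; rewrite mulf_eq0 !subr_eq0 => /orP[/eqP k'k|/eqP k'l].
  by rewrite E k'k addrAC subrr add0r eqxx.
by rewrite E k'l addrK eqxx orbT.
Qed.

Definition free_wave s c z := \sum_(k <- s) c k * wave (k, k ^+ 2) z.

(* The square of sum_k c_k e^{i(kx - k^2 t)} is expanded on the waves e^{i(mx - nt)}: each of
   them comes from at most two pairs (k, l) with k + l = m and k^2 + l^2 = n. *)
Lemma zygmund_norm2 p s c : uniq s ->
  norm2 PM (strip p (p + 2 * pi)) (fun z => free_wave s c z * free_wave s c z) <=
  2 * (2 * pi) ^+ 2 * (\sum_(k <- s) normc (c k) ^+ 2) ^+ 2.
Proof.
move=> us; pose L := [seq (k, l) | k <- s, l <- s].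
have uL : uniq L by apply: allpairs_uniq => // -[? ?] [? ?] _ _.
pose S := undup (map wave_key L); have uS : uniq S by exact: undup_uniq.
pose cc (kl : int * int) := c kl.1 * c kl.2.
pose a mn := \sum_(kl <- [seq kl <- L | wave_key kl == mn]) cc kl.
have sumL (V : nmodType) (F : int * int -> V) : \sum_(kl <- L) F kl =
    \sum_(mn <- S) \sum_(kl <- [seq kl <- L | wave_key kl == mn]) F kl.
  under [RHS]eq_bigr do rewrite big_filter big_mkcond.
  rewrite exchange_big/= big_seq [RHS]big_seq; apply: eq_bigr => kl klL.
  by apply/esym; rewrite (@sum_kronecker _ V S (wave_key kl) (fun=> F kl))// mem_undup map_f.
have phiE z : free_wave s c z * free_wave s c z = trig wave S a z.
  rewrite /free_wave mulr_suml /trig.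
  transitivity (\sum_(kl <- L) cc kl * wave (wave_key kl) z).
    rewrite big_allpairs; apply: eq_bigr => k _.
    rewrite mulr_sumr; apply: eq_bigr => l _.
    by rewrite mulrACA waveD.
  rewrite sumL; apply: eq_bigr => mn _; rewrite /a mulr_suml !big_filter.
  by apply: eq_bigr => kl /eqP ->.
rewrite (eq_norm2 _ (fun z _ => phiE z)).
have mS := measurable_strip p (p + 2 * pi); have Soo := PM_strip_lty p (p + 2 * pi).
have k0 : 0 < (2 * pi) ^+ 2 :> R by rewrite exprn_gt0// pi2_gt0.
rewrite (norm2_trig mS Soo (fun mn => measurable_wave mn _) normc_wave k0 (wave_ortho p))//.
rewrite [leRHS](_ : _ = (2 * pi) ^+ 2 * (2 * (\sum_(k <- s) normc (c k) ^+ 2) ^+ 2)); last by ring.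
rewrite ler_pM2l// (_ : (\sum_(k <- s) normc (c k) ^+ 2) ^+ 2 = \sum_(kl <- L) normc (cc kl) ^+ 2);
  last first.
  rewrite expr2 mulr_suml big_allpairs; apply: eq_bigr => k _.
  by rewrite mulr_sumr; apply: eq_bigr => l _; rewrite /cc/= normcME exprMn.
rewrite sumL mulr_sumr; apply: ler_sum => mn _.
apply: (le_trans (normc_sum_sqr _ _)); rewrite ler_wpM2r ?sumr_ge0// => [kl _|]; first exact: sqr_ge0.
rewrite -[leRHS]/(2%:R) ler_nat.
case E : [seq kl <- L | wave_key kl == mn] => [//|kl0 L'].
rewrite -E; apply: (@uniq_leq_size _ _ [:: kl0; (kl0.2, kl0.1)]); first exact: filter_uniq.
move=> kl; rewrite mem_filter => /andP[/eqP kl1 _]; apply: wave_key_inj.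
have : kl0 \in [seq kl <- L | wave_key kl == mn] by rewrite E mem_head.
by rewrite mem_filter => /andP[/eqP -> _].
Qed.

(* The Fourier coefficient in the interaction picture: the Duhamel formula says that the
   profile of a solution is [i gamma] times a primitive of the profile of its cubic term. *)
Definition profile (F : TR * TR -> R[i]) (k : int) (t : R) : R[i] :=
  cis (k%:~R ^+ 2 * t) * fourier (fun x => F (t, x)) k.

(** By Fubini's theorem a time integral of a profile is a space-time pairing with a free wave. This
    is how the integrals of Duhamel's formula come within reach of Zygmund's estimate. *)
Lemma cint_profile (F : TR * TR -> R[i]) (k : int) p q :
  cintegrable PM (strip p q) F ->
  cintegrable leb `[p, q] (profile F k) /\
  cint leb `[p, q] (profile F k) =
    ((2 * pi)^-1)%:C * cint PM (strip p q) (fun z => F z * (wave (k, k ^+ 2) z)^*%C).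
Proof.
move=> FI; have mI := @measurable_itvT R `[p, q]; have mT := @measurable_torus R.
have mS := measurable_strip p q.
pose H (z : TR * TR) := cis (- (k%:~R * z.2)) * F z.
have HI : cintegrable PM (strip p q) H.
  apply: (cintegrable_boundedM (M := 1) mS _ _ FI) => [|z _]; last by rewrite normc_cis.
  apply: cmeasurable_cis; apply: measurable_funN; apply: measurable_funM => //.
  exact: (measurable_funS measurableT (@subsetT _ _) measurable_snd).
have [I1 I2 _] := cfubini_rect mI mT HI.
have fE t : fourier (fun x => F (t, x)) k =
    ((2 * pi)^-1)%:C * cint leb torus (fun x => H (t, x)).
  by rewrite /fourier cintegralE.
have mc : cmeasurable (`[p, q] : set TR) (fun t => cis (k%:~R ^+ 2 * t)).
  by apply: cmeasurable_cis; exact: measurable_funM.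
have I3 : cintegrable leb `[p, q] (fun t => cis (k%:~R ^+ 2 * t) * cint leb torus (fun x => H (t, x))).
  by apply: (cintegrable_boundedM (M := 1) mI mc _ I1) => t _; rewrite normc_cis.
have pE t : profile F k t =
    ((2 * pi)^-1)%:C * (cis (k%:~R ^+ 2 * t) * cint leb torus (fun x => H (t, x))).
  by rewrite /profile fE mulrCA.
split; first by apply: (eq_cintegrable mI (fun (t : TR) _ => esym (pE t))); exact: cintegrableZ.
rewrite (eq_cint _ (fun (t : TR) _ => pE t)) cintZ//; congr (_ * _).
have WE z : F z * (wave (k, k ^+ 2) z)^*%C = cis (k%:~R ^+ 2 * z.1) * H z.
  rewrite /wave conjcM -!cisN opprK /H /= [(k ^+ 2)%R]expr2 intrM -expr2 mulrCA; congr (_ * _).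
  exact: mulrC.
have WI : cintegrable PM (strip p q) (fun z => cis (k%:~R ^+ 2 * z.1) * H z).
  apply: (cintegrable_boundedM (M := 1) mS _ _ HI) => [|z _]; last by rewrite normc_cis.
  apply: cmeasurable_cis; apply: measurable_funM => //.
  exact: (measurable_funS measurableT (@subsetT _ _) measurable_fst).
rewrite (eq_cint _ (fun (z : TR * TR) _ => WE z)); have [J1 _ ->] := cfubini_rect mI mT WI.
apply: ae_eq_cint => //; [exact: cintegrable_meas I3|exact: cintegrable_meas J1|].
by apply: filterS I2 => t Ht pqt; rewrite /= cintZ//; exact: Ht.
Qed.

Lemma cint_strip_sub (F : TR * TR -> R[i]) p q p' q' : p <= p' -> q' <= q ->
  cintegrable PM (strip p q) F -> cintegrable PM (strip p' q') F.
Proof.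
move=> pp qq; apply: cintegrableS; [exact: measurable_strip..|].
by move=> z [/= H1 H2]; split => //; move: H1; apply: subset_itv; rewrite bnd_simp.
Qed.

Lemma rint_strip_sub (F : TR * TR -> R) p q p' q' : p <= p' -> q' <= q ->
  rint PM (strip p q) F -> rint PM (strip p' q') F.
Proof.
move=> pp qq; apply: integrableS; [exact: measurable_strip..|].
by move=> z [/= H1 H2]; split => //; move: H1; apply: subset_itv; rewrite bnd_simp.
Qed.

(* Dual to Zygmund's estimate: pair [F] with a free wave and use Holder's inequality with
   four factors in L^4. *)
Lemma strichartz_dual (F : TR * TR -> R[i]) (h1 h2 h3 : TR * TR -> R) p q s :
  q <= p + 2 * pi -> uniq s -> cmeasurable (strip p q) F ->
  measurable_fun (strip p q) h1 -> measurable_fun (strip p q) h2 ->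
  measurable_fun (strip p q) h3 ->
  rint PM (strip p q) (fun z => h1 z ^+ 4) -> rint PM (strip p q) (fun z => h2 z ^+ 4) ->
  rint PM (strip p q) (fun z => h3 z ^+ 4) ->
  (forall z, strip p q z -> normc (F z) <= h1 z * h2 z * h3 z) ->
  cintegrable PM (strip p q) F /\
  (\sum_(k <- s) normc (cint leb `[p, q] (profile F k)) ^+ 2) ^+ 2 <=
  \int[PM]_(z in strip p q) (h1 z ^+ 4) * \int[PM]_(z in strip p q) (h2 z ^+ 4) *
  \int[PM]_(z in strip p q) (h3 z ^+ 4).
Proof.
move=> qp us mF m1 m2 m3 i1 i2 i3 Fh; have mS := measurable_strip p q.
have Soo := PM_strip_lty p q.
have i4 : rint PM (strip p q) (fun z => 1 ^+ 4).
  by apply: rint_cst.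
have [Hi _] := holder4 mS m1 m2 m3 (measurable_cst (1 : R)) i1 i2 i3 i4.
have FI : cintegrable PM (strip p q) F.
  apply: (cintegrable_le mS mF _ Hi) => z Sz.
  by rewrite mulr1 Fh.
split => //.
(* The test wave has the unknown time integrals as its coefficients, so that its pairing with [F] is
   [2 pi] times the sum to be bounded. *)
pose c k := cint leb `[p, q] (profile F k).
pose A := \sum_(k <- s) normc (c k) ^+ 2; rewrite -/A.
have A0 : 0 <= A by apply: sumr_ge0 => k _; exact: sqr_ge0.
have mw : cmeasurable (strip p q) (free_wave s c).
  apply: cmeasurable_sum => k; apply: cmeasurableM; [exact: cmeasurable_cst|exact: measurable_wave].
have FWI : cintegrable PM (strip p q) (fun z => (free_wave s c z)^*%C * F z).
  apply: (cintegrable_boundedM (M := \sum_(k <- s) normc (c k)) mS _ _ FI).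
    exact: cmeasurableJ.
  move=> z _; rewrite normcJE (le_trans (normc_sum _ _))// ler_sum// => k _.
  by rewrite normcME normc_wave mulr1.
have AE : A%:C = ((2 * pi)^-1)%:C * cint PM (strip p q) (fun z => (free_wave s c z)^*%C * F z).
  rewrite (@eq_cint _ _ _ PM _ _ (fun z => \sum_(k <- s) (c k)^*%C * (F z * (wave (k, k ^+ 2)
    z)^*%C))); last first.
    move=> z _; rewrite /free_wave rmorph_sum/= mulr_suml; apply: eq_bigr => k _.
    by rewrite -[conjc _]/((_)^*%C) conjcM mulrAC mulrA.
  have WI k : cintegrable PM (strip p q) (fun z => F z * (wave (k, k ^+ 2) z)^*%C).
    have : cintegrable PM (strip p q) (fun z => (wave (k, k ^+ 2) z)^*%C * F z).
      apply: (cintegrable_boundedM (M := 1) mS _ _ FI).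
        by apply: cmeasurableJ; exact: measurable_wave.
      by move=> z _; rewrite normcJE normc_wave.
    by apply: eq_cintegrable => // z _; rewrite mulrC.
  rewrite cint_sum//; last by move=> k; exact: cintegrableZ.
  rewrite mulr_sumr /A (raddf_sum (real_complex R)); apply: eq_bigr => k _.
  rewrite cintZ// mulrCA; have [_ <-] := cint_profile k FI.
  by rewrite -/(c k) mulrC mulcJ.
have w4E z : normc (free_wave s c z) ^+ 4 = normc (free_wave s c z * free_wave s c z) ^+ 2.
  by rewrite normcME -expr2 -exprM.
have pp : p + 2 * pi <= p + 2 * pi by [].
have mS' := measurable_strip p (p + 2 * pi).
have mw' : cmeasurable (strip p (p + 2 * pi)) (free_wave s c).
  apply: cmeasurable_sum => k; apply: cmeasurableM; [exact: cmeasurable_cst|exact: measurable_wave].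
have w4' : rint PM (strip p (p + 2 * pi)) (fun z => normc (free_wave s c z) ^+ 4).
  apply: (rint_bounded mS' (M := (\sum_(k <- s) normc (c k)) ^+ 4) (PM_strip_lty _ _)).
    by apply: measurable_funX; exact: measurable_normc.
  move=> z _; rewrite ger0_norm ?exprn_ge0 ?normc_ge0// lerXn2r ?nnegrE ?normc_ge0//.
    by apply: sumr_ge0 => k _; exact: normc_ge0.
  rewrite (le_trans (normc_sum _ _))// ler_sum// => k _.
  by rewrite normcME normc_wave mulr1.
have w4 := rint_strip_sub (lexx p) qp w4'.
have W4 : \int[PM]_(z in strip p q) (normc (free_wave s c z) ^+ 4) <= 2 * (2 * pi) ^+ 2 * A ^+ 2.
  apply: le_trans (zygmund_norm2 p c us); rewrite norm2E.
  rewrite (@eq_Rint _ _ _ PM (strip p (p + 2 * pi)) (fun z => normc (free_wave s c z * free_wave s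
    c z) ^+ 2)
    (fun z => normc (free_wave s c z) ^+ 4)); last by move=> z _; rewrite w4E.
  rewrite -lee_fin -!rint_EFin//; apply: ge0_subset_integral => //.
  - by apply/measurable_EFinP; exact: rint_measurable w4'.
  - by move=> z _; rewrite lee_fin exprn_ge0// normc_ge0.
  - by move=> z [/= H1 H2]; split => //; move: H1; apply: subset_itv; rewrite bnd_simp.
have [Hi4 H4] := holder4 mS m1 m2 m3 (measurable_normc mw) i1 i2 i3 w4.
have NE : normc (cint PM (strip p q) (fun z => (free_wave s c z)^*%C * F z)) <=
    \int[PM]_(z in strip p q) (h1 z * h2 z * h3 z * normc (free_wave s c z)).
  apply: normc_cint_le => //; first by apply: cmeasurableM => //; exact: cmeasurableJ.
  by move=> z Sz; rewrite normcME normcJE mulrC ler_wpM2r ?normc_ge0// Fh.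
have AN : A = (2 * pi)^-1 * normc (cint PM (strip p q) (fun z => (free_wave s c z)^*%C * F z)).
  have := congr1 (@normc R) AE; rewrite normcME !normcR ger0_norm// => ->.
  by rewrite gtr0_norm// invr_gt0 pi2_gt0.
move: AN NE H4 W4.
have m0 (h : TR * TR -> R) : 0 <= \int[PM]_(z in strip p q) (h z ^+ 4).
  by apply: Rint_ge0 => z _; rewrite (_ : h z ^+ 4 = (h z ^+ 2) ^+ 2) ?sqr_ge0// -exprM.
move: (m0 h1) (m0 h2) (m0 h3).
move: (normc _) (\int[PM]_(z in strip p q) (h1 z * h2 z * h3 z * normc (free_wave s c z))) => n I.
move: (\int[PM]_(z in strip p q) (h1 z ^+ 4)) (\int[PM]_(z in strip p q) (h2 z ^+ 4)) => M1 M2.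
move: (\int[PM]_(z in strip p q) (h3 z ^+ 4)) (\int[PM]_(z in strip p q) (normc (free_wave s c z)
  ^+ 4)) => M3 W.
move=> p1 p2 p3 AN nI IM WA; have M0 : 0 <= M1 * M2 * M3 by rewrite !mulr_ge0.
have [A00|A00] := eqVneq A 0; first by rewrite A00 expr0n.
have A2 : 0 < A ^+ 2 by rewrite exprn_gt0// lt_neqAle eq_sym A00.
(* This absorbs the factor 2 of Zygmund's estimate, and the dual estimate holds with the constant
   1. *)
have P0 := @pi2_gt0 R; have P1 : 2 <= (2 * pi : R) ^+ 2.
  have : 2 <= pi :> R := pi_ge2 R.
  by move: (pi : R) => w w2; nra.
have nE : n = 2 * pi * A by rewrite AN mulrA divff ?mul1r// gt_eqF.
have n0 : 0 <= n by rewrite nE mulr_ge0// ltW.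
have H1 : n ^+ 4 <= M1 * M2 * M3 * (2 * (2 * pi) ^+ 2 * A ^+ 2).
  apply: le_trans (ler_wpM2l M0 WA); apply: le_trans IM.
  by rewrite lerXn2r ?nnegrE// (le_trans n0).
rewrite nE in H1; move: P1 P0 M0 H1 A2; move: (2 * pi : R) (M1 * M2 * M3) => w M.
move=> P1 P0 M0 H1 A2.
have w2 : 0 < w ^+ 2 by exact: exprn_gt0.
rewrite -(ler_pM2l A2) -(ler_pM2l w2) -(ler_pM2l w2).
apply: (@le_trans _ _ ((w * A) ^+ 4)); first by rewrite le_eqVlt; apply/orP; left; apply/eqP; ring.
apply: (le_trans H1); rewrite (_ : M * _ = 2 * (w ^+ 2 * (A ^+ 2 * M))); last by ring.
by rewrite ler_wpM2r// !mulr_ge0// ltW.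
Qed.

End zygmund.

(** * The Christ-Kiselev lemma and the retarded estimate *)

Section christ_kiselev.
Context {R : realType} {I : Type}.
Local Notation TR := (measurableTypeR R).
Implicit Types (p q m : R).

Lemma cauchy_schwarz_sum (s : seq I) (u v : I -> R) :
  (\sum_(k <- s) u k * v k) ^+ 2 <= (\sum_(k <- s) u k ^+ 2) * (\sum_(k <- s) v k ^+ 2).
Proof.
apply: sqr_disc_le; [by apply: sumr_ge0 => k _; exact: sqr_ge0..|move=> l].
rewrite (_ : _ + _ = \sum_(k <- s) (l * u k - v k) ^+ 2); last first.
  rewrite !mulr_sumr -sumrB -big_split/=; apply: eq_bigr => k _; ring.
by apply: sumr_ge0 => k _; exact: sqr_ge0.
Qed.

Lemma normc_sum_prodJ (s : seq I) (x y : I -> R[i]) :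
  normc (\sum_(k <- s) x k * (y k)^*%C) ^+ 2 <=
  (\sum_(k <- s) normc (x k) ^+ 2) * (\sum_(k <- s) normc (y k) ^+ 2).
Proof.
apply: le_trans (cauchy_schwarz_sum s (fun k => normc (x k)) (fun k => normc (y k))).
rewrite lerXn2r ?nnegrE ?normc_ge0//.
  by apply: sumr_ge0 => k _; rewrite mulr_ge0 ?normc_ge0.
apply: (le_trans (normc_sum _ _)); apply: ler_sum => k _.
by rewrite normcME normcJE.
Qed.

(** [2^(-3/2) < 3/8]: two halves of an interval cost together at most the factor 3/4, the
    contraction of the halving scheme. *)
Lemma sqrt_half_cube (x : R) : 0 <= x ->
  Num.sqrt (x / 2) ^+ 3 <= 3 / 8 * Num.sqrt x ^+ 3.
Proof.
move=> x0; have h0 := sqrtr_ge0 (x / 2); have k0 := sqrtr_ge0 x.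
have E (y : R) : 0 <= y -> (Num.sqrt y ^+ 3) ^+ 2 = y ^+ 3.
  by move=> y0; rewrite -exprM mulnC exprM sqr_sqrtr.
rewrite -ler_sqr ?nnegrE; last 2 first.
- exact: exprn_ge0.
- by rewrite mulr_ge0 ?exprn_ge0// divr_ge0.
rewrite [leRHS]exprMn !E ?divr_ge0//.
have x3 : 0 <= x ^+ 3 by rewrite exprn_ge0.
rewrite (_ : (x / 2) ^+ 3 = x ^+ 3 / 8); last by field.
by move: (x ^+ 3) x3 => y y0; nra.
Qed.

Variables (s : seq I) (f g : I -> R -> R[i]) (a b : R) (M : R -> R).
Hypothesis fI : forall k, cintegrable leb `[a, b] (f k).
Hypothesis gI : forall k, cintegrable leb `[a, b] (g k).
Hypothesis cM : {within `[a, b], continuous M}.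
Hypothesis ndM : forall p q, a <= p -> p <= q -> q <= b -> M p <= M q.

Definition increment_energy (h : I -> R -> R[i]) p q :=
  \sum_(k <- s) normc (cint leb `[p, q] (h k)) ^+ 2.

(* The exponent [3 / 2 > 1] on the increments of [M] makes the halving scheme summable. *)
Definition mass_controlled (h : I -> R -> R[i]) := forall p q, a <= p -> p <= q -> q <= b ->
  increment_energy h p q ^+ 2 <= (M q - M p) ^+ 3 /\
  forall k, (\int[leb]_(t in `[p, q]) normc (h k t)) ^+ 4 <= (M q - M p) ^+ 3.

Hypothesis fM : mass_controlled f.
Hypothesis gM : mass_controlled g.

(** The Duhamel integral of [f] paired with [g]. The constraint that [f] is taken at an earlier time
    than [g] prevents the integral from splitting into a product, and the dual estimate from
    applying directly. *)
Definition retarded_form p q :=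
  \sum_(k <- s) cint leb `[p, q] (fun t => cint leb `[p, t] (f k) * (g k t)^*%C).

Let sub h p q : a <= p -> q <= b -> cintegrable leb `[a, b] h -> cintegrable leb `[p, q] h.
Proof. by move=> ap qb; exact: cintegrable_sub_itv. Qed.

(** Cutting the triangle of ordered pairs of times at [m] leaves two triangles and a rectangle; on
    the rectangle the integral is a product. *)
Lemma retarded_form_split p m q : a <= p -> p <= m -> m <= q -> q <= b ->
  retarded_form p q = retarded_form p m + retarded_form m q +
  \sum_(k <- s) cint leb `[p, m] (f k) * (cint leb `[m, q] (g k))^*%C.
Proof.
move=> ap pm mq qb; rewrite /retarded_form -!big_split/=; apply: eq_bigr => k _.
have pq := le_trans pm mq; have am := le_trans ap pm; have mb := le_trans mq qb.
have fpq := sub ap qb (fI k); have gpq := sub ap qb (gI k).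
have fmq := sub am qb (fI k); have gmq := sub am qb (gI k).
have gJ : cintegrable leb `[p, q] (fun t => (g k t)^*%C) by apply: cintegrableJ.
have gJ' : cintegrable leb `[m, q] (fun t => (g k t)^*%C) by apply: cintegrableJ.
rewrite (cint_itv_split pm mq (cintegrable_primitiveM pq fpq gJ)) -addrA; congr (_ + _).
rewrite (@eq_cint _ _ _ leb _ _ (fun t => cint leb `[m, t] (f k) * (g k t)^*%C +
   cint leb `[p, m] (f k) * (g k t)^*%C)); last first.
  move=> t /=; rewrite in_itv/= => /andP[mt tq].
  rewrite (cint_itv_split pm mt (cintegrable_sub_itv (lexx _) (le_trans tq qb) (sub ap (lexx _) (fI
    k)))).
  by rewrite mulrDl addrC.
have mI := @measurable_itvT R `[m, q].
rewrite cintD//; [|exact: cintegrable_primitiveM|exact: cintegrableZ].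
by congr (_ + _); rewrite cintZ// cintJ.
Qed.

Let bound K := forall p q, a <= p -> p <= q -> q <= b ->
  normc (retarded_form p q) <= K * Num.sqrt (M q - M p) ^+ 3.

(** This constant grows with the number of modes; it only starts the iteration, which forgets it. *)
Lemma retarded_form_crude : bound (size s)%:R.
Proof.
move=> p q ap pq qb; have DM : 0 <= M q - M p by rewrite subr_ge0 ndM.
have [_ Cf] := fM ap pq qb; have [_ Cg] := gM ap pq qb.
apply: (le_trans (normc_sum _ _)).
rewrite (_ : _%:R * _ = \sum_(k <- s) Num.sqrt (M q - M p) ^+ 3); last first.
  by rewrite big_const_seq count_predT iter_addr addr0 mulr_natl.
apply: ler_sum => k _.
have fpq := sub ap qb (fI k); have gpq := sub ap qb (gI k).
have gJ : cintegrable leb `[p, q] (fun t => (g k t)^*%C).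
  by apply: cintegrableJ => //; exact: measurable_itvT.
have mI := @measurable_itvT R `[p, q].
pose F := \int[leb]_(t in `[p, q]) normc (f k t).
pose G := \int[leb]_(t in `[p, q]) normc (g k t).
have F0 : 0 <= F by apply: Rint_ge0 => t _; exact: normc_ge0.
have G0 : 0 <= G by apply: Rint_ge0 => t _; exact: normc_ge0.
have GI := cintegrable_normc mI gpq.
have : normc (cint leb `[p, q] (fun t => cint leb `[p, t] (f k) * (g k t)^*%C)) <= F * G.
  rewrite -RintegralZl//.
  apply: (normc_cint_le mI _ _ (rintZ mI F GI)).
    by have /cintegrable_meas := cintegrable_primitiveM pq fpq gJ.
  move=> t /=; rewrite in_itv/= => /andP[pt tq].
  by rewrite normcME normcJE ler_wpM2r ?normc_ge0// normc_primitive_le.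
move=> /le_trans; apply.
have := Cf k; have := Cg k; rewrite -/F -/G => {}Cg {}Cf.
have d0 := sqrtr_ge0 (M q - M p).
have D2 : (M q - M p) = Num.sqrt (M q - M p) ^+ 2 by rewrite sqr_sqrtr.
have aux x : 0 <= x -> x ^+ 4 <= (M q - M p) ^+ 3 -> x ^+ 2 <= Num.sqrt (M q - M p) ^+ 3.
  move=> x0 H; rewrite -ler_sqr ?nnegrE ?exprn_ge0// -!exprM.
  by apply: (le_trans H); rewrite {1}D2 -exprM.
rewrite -ler_sqr ?nnegrE ?mulr_ge0 ?exprn_ge0// exprMn.
by rewrite [leRHS]expr2 ler_pM ?sqr_ge0 ?aux.
Qed.

(** At the time halving [M], the two triangles contribute [2 * (3/8) K] and the rectangle, by
    Cauchy-Schwarz over the modes, at most [3/8 <= 1/2]. *)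
Lemma retarded_form_improve K : 0 <= K -> bound K -> bound (3 / 4 * K + 2^-1).
Proof.
move=> K0 bK p q ap pq qb; have DM : 0 <= M q - M p by rewrite subr_ge0 ndM.
have cpq : {within `[p, q], continuous M}.
  by apply: continuous_subspaceW cM; apply: subset_itv; rewrite bnd_simp.
have Mpq : M p <= M q by exact: ndM.
have [|m] := IVT pq cpq (v := (M p + M q) / 2).
  by rewrite minEle maxEle Mpq; apply/andP; split; lra.
rewrite in_itv/= => /andP[pm mq] Mm.
have mb := le_trans mq qb; have am := le_trans ap pm.
rewrite (retarded_form_split ap pm mq qb).
have H1 := bK _ _ ap pm mb; have H2 := bK _ _ am mq qb.
have [Ef _] := fM ap pm mb; have [Eg _] := gM am mq qb.
have E1 : M m - M p = (M q - M p) / 2 by rewrite Mm; lra.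
have E2 : M q - M m = (M q - M p) / 2 by rewrite Mm; lra.
rewrite E1 in H1 Ef; rewrite E2 in H2 Eg.
have HC := sqrt_half_cube DM.
set D := Num.sqrt ((M q - M p) / 2) in H1 H2 HC.
have D0 : 0 <= D by exact: sqrtr_ge0.
have D2 : (M q - M p) / 2 = D ^+ 2 by rewrite sqr_sqrtr// divr_ge0.
rewrite D2 in Ef Eg.
have e0 h p' q' : 0 <= increment_energy h p' q' by apply: sumr_ge0 => k _; exact: sqr_ge0.
have H3 : normc (\sum_(k <- s) cint leb `[p, m] (f k) * (cint leb `[m, q] (g k))^*%C) <= D ^+ 3.
  rewrite -ler_sqr ?nnegrE ?normc_ge0 ?exprn_ge0//.
  apply: (le_trans (normc_sum_prodJ _ _ _)).
  rewrite -/(increment_energy f p m) -/(increment_energy g m q) expr2.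
  have aux x : 0 <= x -> x ^+ 2 <= (D ^+ 2) ^+ 3 -> x <= D ^+ 3.
    by move=> x0; rewrite -exprM mulnC exprM ler_sqr ?nnegrE// exprn_ge0.
  by rewrite ler_pM ?aux.
have d0 : 0 <= Num.sqrt (M q - M p) ^+ 3 by rewrite exprn_ge0// sqrtr_ge0.
apply: (le_trans (normcDle _ _)); apply: (le_trans (lerD (normcDle _ _) H3)).
apply: (le_trans (lerD (lerD H1 H2) (lexx _))).
move: HC d0; move: (Num.sqrt _ ^+ 3) (D ^+ 3) => d e.
by move=> *; nra.
Qed.

(* Christ-Kiselev: a scheme halving the mass [M] turns the bound valid with the constant [K]
   into the one with [3/4 K + 1/2], whose fixed point is [2]. *)
Lemma christ_kiselev p q : a <= p -> p <= q -> q <= b ->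
  normc (retarded_form p q) <= 2 * Num.sqrt (M q - M p) ^+ 3.
Proof.
move=> ap pq qb.
have bn n : bound (2 + (3 / 4) ^+ n * (size s)%:R).
  elim: n => [|n IHn].
    move=> p' q' ap' pq' qb'; apply: (le_trans (retarded_form_crude ap' pq' qb')).
    by rewrite expr0 mul1r ler_wpM2r ?exprn_ge0 ?sqrtr_ge0// lerDr.
  have K0 : 0 <= 2 + (3 / 4) ^+ n * (size s)%:R :> R by rewrite addr_ge0// mulr_ge0// exprn_ge0//
    divr_ge0.
  move=> p' q' ap' pq' qb'; have := retarded_form_improve K0 IHn ap' pq' qb'.
  by rewrite (_ : 3 / 4 * _ + _ = 2 + (3 / 4) ^+ n.+1 * (size s)%:R)// exprS; lra.
set D := Num.sqrt (M q - M p) ^+ 3.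
have HL : (2 + (3 / 4) ^+ n * (size s)%:R) * D @[n --> \oo] --> (2 + 0 * (size s)%:R) * D.
  apply: cvgMr_tmp; apply: cvgD; first exact: cvg_cst.
  apply: cvgMr_tmp; apply: cvg_expr; rewrite ger0_norm; lra.
rewrite mul0r addr0 in HL.
apply: (ler_cvg_to (cvg_cst (normc (retarded_form p q)) : _ @ \oo --> _) HL).
by near=> n; exact: bn.
Unshelve. all: by end_near.
Qed.

End christ_kiselev.

Lemma conjcRE (R : realType) (x : R) : (x%:C : R[i])^*%C = x%:C.
Proof. by apply: eq_complexP; rewrite ?ReJ ?ImJ//= oppr0. Qed.

Lemma Rint_le_ae d (T : measurableType d) (R : realType)
    (mu : {measure set T -> \bar R}) (D : set T) (f g : T -> R) : measurable D ->
  rint mu D f -> rint mu D g -> (forall x, D x -> 0 <= f x) ->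
  (forall x, D x -> 0 <= g x) -> {ae mu, forall x, D x -> f x <= g x} ->
  \int[mu]_(x in D) f x <= \int[mu]_(x in D) g x.
Proof.
move=> mD fI gI f0 g0 fg; rewrite -lee_fin -!rint_EFin//.
apply: ae_ge0_le_integral => //.
- by apply/measurable_EFinP; exact: rint_measurable fI.
- by apply/measurable_EFinP; exact: rint_measurable gI.
Qed.

Lemma Rint_le d (T : measurableType d) (R : realType)
    (mu : {measure set T -> \bar R}) (D : set T) (f g : T -> R) : measurable D ->
  rint mu D f -> rint mu D g -> (forall x, D x -> f x <= g x) ->
  \int[mu]_(x in D) f x <= \int[mu]_(x in D) g x.
Proof.
move=> mD fI gI fg; rewrite -subr_ge0 -RintegralB//.
by apply: Rint_ge0 => x Dx; rewrite subr_ge0 fg.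
Qed.

Lemma descale (R : realType) (al be : R) (x y : R[i]) : al != 0 -> be != 0 ->
  x * y^*%C = (al * be)%:C * ((al^-1)%:C * x * ((be^-1)%:C * y)^*%C).
Proof.
move=> a0 b0; rewrite conjcM conjcRE mulrACA [RHS]mulrA.
have -> : (al * be)%:C * ((al^-1)%:C * (be^-1)%:C) = 1 :> R[i].
  by rewrite -!rmorphM/= -invfM divff// mulf_neq0.
by rewrite mul1r.
Qed.

(** * The retarded estimate for cubic expressions *)

Section retarded_strichartz.
Context {R : realType}.
Local Notation TR := (measurableTypeR R).
Local Notation PM := (@lebesgue_measure R \x @lebesgue_measure R)%E.
Implicit Types (p q : R) (s : seq int).

Lemma profile_L1 (F : TR * TR -> R[i]) (k : int) p q : cintegrable PM (strip p q) F ->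
  \int[leb]_(t in `[p, q]) normc (profile F k t) <=
  (2 * pi)^-1 * \int[PM]_(z in strip p q) normc (F z).
Proof.
move=> FI; have mI := @measurable_itvT R `[p, q]; have mT := @measurable_torus R.
have mS := measurable_strip p q; have p2 := @pi2_gt0 R.
have NI := cintegrable_normc mS FI.
have [I1 _ ->] := fubini_rect mI mT NI; have [_ I2 _] := cfubini_rect mI mT FI.
have [PI _] := cint_profile k FI.
rewrite -RintegralZl//; apply: Rint_le_ae => //.
- exact: cintegrable_normc.
- exact: rintZ.
- by move=> t _; exact: normc_ge0.
- by move=> t _; rewrite mulr_ge0 ?invr_ge0 ?(ltW p2)//; apply: Rint_ge0 => x _; exact: normc_ge0.
apply: filterS I2 => t Ht pqt; have {}Ht := Ht pqt.
rewrite /profile normcME normc_cis mul1r /fourier normcME normcR ger0_norm ?invr_ge0 ?(ltW p2)//.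
rewrite ler_wpM2l ?invr_ge0 ?(ltW p2)// cintegralE.
apply: normc_cint_le => //; last 2 first.
- by move=> x _; rewrite normcME normc_cis mul1r.
- exact: cintegrable_normc.
by apply: cmeasurableM; [apply: cmeasurable_cis; apply: measurable_funN; exact:
  measurable_funM|exact: cintegrable_meas Ht].
Qed.

Lemma Rint_strip1 p q : p <= q ->
  \int[PM]_(z in strip p q) 1 = 2 * pi * (q - p) :> R.
Proof.
move=> pq; have mS := measurable_strip p q.
rewrite Rintegral_cst//.
have E : PM (strip p q) = (leb (`[p, q]%classic : set TR) * leb (torus : set TR))%E.
  by rewrite /strip product_measure1E; [|exact: measurable_itvT|exact: measurable_torus].
rewrite mul1r; transitivity (fine (leb (`[p, q]%classic : set TR) * leb (torus : set TR))%E); first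
  by congr fine.
rewrite torusE leb_period lebesgue_measure_itv/= lte_fin; case: ltP => [_|qp].
  by rewrite -EFinD -EFinM/= mulrC.
have -> : p = q by apply/eqP; rewrite eq_le pq.
by rewrite mul0e subrr mulr0.
Qed.

(** [alpha] bounds the L^4 norm of [h]; it is positive so that [h] can be normalised by it. *)
Definition mass4 (D : set (TR * TR)) (h : TR * TR -> R) (alpha : R) :=
  [/\ measurable_fun D h, rint PM D (fun z => h z ^+ 4), 0 < alpha &
      \int[PM]_(z in D) (h z ^+ 4) <= alpha ^+ 4].

(* Plays the role of the [L^(4/3)] norm; products of three factors avoid fractional powers. *)
Definition cubic_bound (D : set (TR * TR)) (F : TR * TR -> R[i]) (alpha : R) :=
  cmeasurable D F /\ exists h1 h2 h3 a1 a2 a3,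
    [/\ mass4 D h1 a1, mass4 D h2 a2, mass4 D h3 a3, alpha = a1 * a2 * a3 &
        forall z, D z -> normc (F z) <= h1 z * h2 z * h3 z].

Lemma mass4_sub p q p' q' h alpha : p <= p' -> q' <= q ->
  mass4 (strip p q) h alpha -> mass4 (strip p' q') h alpha.
Proof.
move=> pp qq [mh hI a0 ha]; have mS := measurable_strip p q.
have mS' := measurable_strip p' q'.
have ss : strip p' q' `<=` strip p q.
  by move=> z [/= H1 H2]; split => //; move: H1; apply: subset_itv; rewrite bnd_simp.
have hI' := rint_strip_sub pp qq hI.
split => //; first exact: measurable_funS mh.
apply: le_trans ha; rewrite -lee_fin -!rint_EFin//; apply: ge0_subset_integral => //.
- by apply/measurable_EFinP; exact: rint_measurable hI.
- by move=> z _; rewrite lee_fin (_ : h z ^+ 4 = (h z ^+ 2) ^+ 2) ?sqr_ge0// -exprM.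
Qed.

Lemma cubic_bound_sub p q p' q' F alpha : p <= p' -> q' <= q ->
  cubic_bound (strip p q) F alpha -> cubic_bound (strip p' q') F alpha.
Proof.
move=> pp qq [mF [h1 [h2 [h3 [a1 [a2 [a3 [H1 H2 H3 aE Fh]]]]]]]].
have ss : strip p' q' `<=` strip p q.
  by move=> z [/= Hz ?]; split => //; move: Hz; apply: subset_itv; rewrite bnd_simp.
split; first by apply: cmeasurableS mF => //; exact: measurable_strip.
exists h1, h2, h3, a1, a2, a3; split => //; [exact: (mass4_sub pp qq)..|].
by move=> z /ss; exact: Fh.
Qed.

Lemma cubic_bound_energy p q F alpha s : q <= p + 2 * pi -> uniq s ->
  cubic_bound (strip p q) F alpha ->
  [/\ cintegrable PM (strip p q) F, 0 < alpha &
      increment_energy s (profile F) p q <= alpha ^+ 2].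
Proof.
move=> qp us [mF [h1 [h2 [h3 [a1 [a2 [a3 [[m1 i1 p1 H1] [m2 i2 p2 H2] [m3 i3 p3 H3] -> Fh]]]]]]]].
have [FI HS] := strichartz_dual qp us mF m1 m2 m3 i1 i2 i3 Fh.
have a0 : 0 < a1 * a2 * a3 by rewrite !mulr_gt0.
split => //; have e0 : 0 <= increment_energy s (profile F) p q.
  by apply: sumr_ge0 => k _; exact: sqr_ge0.
have m0 (h : TR * TR -> R) : 0 <= \int[PM]_(z in strip p q) (h z ^+ 4).
  by apply: Rint_ge0 => z _; rewrite (_ : h z ^+ 4 = (h z ^+ 2) ^+ 2) ?sqr_ge0// -exprM.
rewrite -ler_sqr ?nnegrE ?sqr_ge0//; apply: (le_trans HS).
rewrite -exprM !exprMn; apply: ler_pM => //; first exact: mulr_ge0.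
exact: ler_pM.
Qed.

Lemma pow4_ge0 (x : R) : 0 <= x ^+ 4.
Proof. by rewrite (_ : x ^+ 4 = (x ^+ 2) ^+ 2) ?sqr_ge0// -exprM. Qed.

(** Holder's inequality with 1 as the fourth factor: its integral is at most [(2 * pi) ^+ 2], which
    the normalisation [(2 * pi)^-1] absorbs. *)
Lemma strip_L1 (F : TR * TR -> R[i]) (h1 h2 h3 : TR * TR -> R) p q :
  p <= q -> q <= p + 2 * pi -> cintegrable PM (strip p q) F ->
  measurable_fun (strip p q) h1 -> measurable_fun (strip p q) h2 ->
  measurable_fun (strip p q) h3 ->
  rint PM (strip p q) (fun z => h1 z ^+ 4) -> rint PM (strip p q) (fun z => h2 z ^+ 4) ->
  rint PM (strip p q) (fun z => h3 z ^+ 4) ->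
  (forall z, strip p q z -> normc (F z) <= h1 z * h2 z * h3 z) ->
  ((2 * pi)^-1 * \int[PM]_(z in strip p q) normc (F z)) ^+ 4 <=
  \int[PM]_(z in strip p q) (h1 z ^+ 4) * \int[PM]_(z in strip p q) (h2 z ^+ 4) *
  \int[PM]_(z in strip p q) (h3 z ^+ 4).
Proof.
move=> pq qp FI m1 m2 m3 i1 i2 i3 Fh; have mS := measurable_strip p q.
have m4 : measurable_fun (strip p q) (fun=> 1 : R) by exact: measurable_cst.
have i4 : rint PM (strip p q) (fun z => (1 : R) ^+ 4).
  by apply: rint_cst => //; exact: PM_strip_lty.
have [HI H4] := holder4 mS m1 m2 m3 m4 i1 i2 i3 i4.
have NI := cintegrable_normc mS FI.
have LE : \int[PM]_(z in strip p q) normc (F z) <= \int[PM]_(z in strip p q) (h1 z * h2 z * h3 z * 1).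
  by apply: Rint_le => // z Sz; rewrite mulr1 Fh.
have P0 := @pi2_gt0 R.
have E4 : \int[PM]_(z in strip p q) ((1 : R) ^+ 4) <= (2 * pi) ^+ 2.
  rewrite (@eq_Rint _ _ _ PM (strip p q) (fun z => 1 ^+ 4) (fun=> 1)); last by move=> z _; rewrite
    expr1n.
  by rewrite Rint_strip1// expr2 ler_wpM2l ?(ltW P0)//; lra.
have m0 (h : TR * TR -> R) : 0 <= \int[PM]_(z in strip p q) (h z ^+ 4).
  by apply: Rint_ge0 => z _; exact: pow4_ge0.
have n0 : 0 <= \int[PM]_(z in strip p q) normc (F z) by apply: Rint_ge0 => z _; exact: normc_ge0.
move: LE H4 E4 (m0 h1) (m0 h2) (m0 h3) (m0 (fun=> 1)) n0 P0.
move: (\int[PM]_(z in strip p q) normc (F z)) => N.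
move: (\int[PM]_(z in strip p q) (h1 z * h2 z * h3 z * 1)) => L.
move: (\int[PM]_(z in strip p q) (h1 z ^+ 4)) (\int[PM]_(z in strip p q) (h2 z ^+ 4)) => M1 M2.
move: (\int[PM]_(z in strip p q) (h3 z ^+ 4)) (\int[PM]_(z in strip p q) ((1:R) ^+ 4)) => M3 M4.
have := pi_ge2 R; move: (pi : R) => w w2.
move=> NL L4 A4 z1 z2 z3 z4 N0 P0; have P1 : 1 <= 2 * w by lra.
have w4 : 0 < (2 * w) ^+ 4 by exact: exprn_gt0.
rewrite exprMn exprVn mulrC ler_pdivrMr//.
apply: (@le_trans _ _ (L ^+ 4)); first by rewrite lerXn2r ?nnegrE// (le_trans N0).
apply: (le_trans L4); apply: ler_wpM2l; first by rewrite !mulr_ge0.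
by apply: (le_trans A4); apply: ler_weXn2l.
Qed.

Lemma cubic_bound_L1 p q F alpha : p <= q -> q <= p + 2 * pi ->
  cubic_bound (strip p q) F alpha ->
  (2 * pi)^-1 * \int[PM]_(z in strip p q) normc (F z) <= alpha.
Proof.
move=> pq qp cF; have [FI a0 _] := cubic_bound_energy qp (erefl : uniq [::]) cF.
case: cF => mF [h1 [h2 [h3 [a1 [a2 [a3 [[m1 i1 p1 H1] [m2 i2 p2 H2] [m3 i3 p3 H3] aE Fh]]]]]]].
have HL := strip_L1 pq qp FI m1 m2 m3 i1 i2 i3 Fh.
have m0 (h : TR * TR -> R) : 0 <= \int[PM]_(z in strip p q) (h z ^+ 4).
  by apply: Rint_ge0 => z _; exact: pow4_ge0.
have n0 : 0 <= (2 * pi)^-1 * \int[PM]_(z in strip p q) normc (F z).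
  by rewrite mulr_ge0 ?invr_ge0 ?(ltW (@pi2_gt0 R))//; apply: Rint_ge0 => z _; exact: normc_ge0.
rewrite -(@ler_pXn2r _ 4) ?nnegrE ?(ltW a0)//; apply: (le_trans HL).
rewrite aE !exprMn; apply: ler_pM => //; first exact: mulr_ge0.
exact: ler_pM.
Qed.

(** [W] dominates the three normalised fourth powers, so that each factor contributes one increment
    of [M] to the dual estimate on a subinterval; three factors make the cube. *)
Lemma profile_mass_controlled (a b : R) s F (h1 h2 h3 W : TR * TR -> R) (a1 a2 a3 : R) (M : R -> R) :
  b <= a + 2 * pi -> uniq s ->
  mass4 (strip a b) h1 a1 -> mass4 (strip a b) h2 a2 -> mass4 (strip a b) h3 a3 ->
  cmeasurable (strip a b) F ->
  (forall z, strip a b z -> normc (F z) <= h1 z * h2 z * h3 z) ->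
  rint PM (strip a b) W ->
  (forall z, [/\ h1 z ^+ 4 <= a1 ^+ 4 * W z, h2 z ^+ 4 <= a2 ^+ 4 * W z & h3 z ^+ 4 <= a3 ^+ 4 * W z]) ->
  (forall p q, a <= p -> p <= q -> q <= b -> M q - M p = \int[PM]_(z in strip p q) W z) ->
  mass_controlled s a b M (fun k t => ((a1 * a2 * a3)^-1)%:C * profile F k t).
Proof.
move=> ba us H1 H2 H3 mF Fh WI HW ME p q ap pq qb.
have mS := measurable_strip p q; have mI := @measurable_itvT R `[p, q].
have ss : strip p q `<=` strip a b.
  by move=> z [/= Hz ?]; split => //; move: Hz; apply: subset_itv; rewrite bnd_simp.
have qp : q <= p + 2 * pi by apply: (le_trans qb); apply: (le_trans ba); rewrite lerD2r.
have WI' := rint_strip_sub ap qb WI.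
rewrite ME//; set A := a1 * a2 * a3.
have mF' : cmeasurable (strip p q) F by apply: cmeasurableS mF => //; exact: measurable_strip.
have Fh' z : strip p q z -> normc (F z) <= h1 z * h2 z * h3 z by move=> /ss; exact: Fh.
have [m1 i1 p1 _] := mass4_sub ap qb H1; have [m2 i2 p2 _] := mass4_sub ap qb H2.
have [m3 i3 p3 _] := mass4_sub ap qb H3.
have A0 : 0 < A by rewrite !mulr_gt0.
have [FI HS] := strichartz_dual qp us mF' m1 m2 m3 i1 i2 i3 Fh'.
have HL := strip_L1 pq qp FI m1 m2 m3 i1 i2 i3 Fh'.
have m0 (h : TR * TR -> R) : 0 <= \int[PM]_(z in strip p q) (h z ^+ 4).
  by apply: Rint_ge0 => z _; exact: pow4_ge0.
have mle h al : rint PM (strip p q) (fun z => h z ^+ 4) -> (forall z, h z ^+ 4 <= al ^+ 4 * W z) ->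
    \int[PM]_(z in strip p q) (h z ^+ 4) <= al ^+ 4 * \int[PM]_(z in strip p q) W z.
  by move=> hI hW; rewrite -RintegralZl//; apply: Rint_le => //; exact: rintZ.
have M1 := mle _ a1 i1 (fun z => let: And3 H _ _ := HW z in H).
have M2 := mle _ a2 i2 (fun z => let: And3 _ H _ := HW z in H).
have M3 := mle _ a3 i3 (fun z => let: And3 _ _ H := HW z in H).
have MM : \int[PM]_(z in strip p q) (h1 z ^+ 4) * \int[PM]_(z in strip p q) (h2 z ^+ 4) *
    \int[PM]_(z in strip p q) (h3 z ^+ 4) <= A ^+ 4 * (\int[PM]_(z in strip p q) W z) ^+ 3.
  move: (m0 h1) (m0 h2) (m0 h3) M1 M2 M3.
  move: (\int[PM]_(z in strip p q) (h1 z ^+ 4)) (\int[PM]_(z in strip p q) (h2 z ^+ 4)) => x1 x2.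
  move: (\int[PM]_(z in strip p q) (h3 z ^+ 4)) (\int[PM]_(z in strip p q) W z) => x3 D.
  move=> z1 z2 z3 M1 M2 M3.
  rewrite (_ : A ^+ 4 * D ^+ 3 = (a1 ^+ 4 * D) * (a2 ^+ 4 * D) * (a3 ^+ 4 * D)); last by rewrite
    /A; ring.
  by apply: ler_pM => //; [exact: mulr_ge0|exact: ler_pM].
have sc x y : 0 <= x -> (x ^+ 4 <= A ^+ 4 * y) -> (A^-1 * x) ^+ 4 <= y.
  by move=> x0 H; rewrite exprMn exprVn mulrC ler_pdivrMr ?exprn_gt0// mulrC.
have [PI _] : cintegrable leb `[p, q] (profile F 0) /\ True by have [] := cint_profile 0 FI.
split.
- rewrite (_ : increment_energy _ _ _ _ = A^-1 ^+ 2 * increment_energy s (profile F) p q); last first.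
    rewrite /increment_energy mulr_sumr; apply: eq_bigr => k _.
    have [PIk _] := cint_profile k FI.
    by rewrite cintZ// normcME normcR exprMn real_normK ?num_real.
  rewrite exprMn -exprM exprVn mulrC ler_pdivrMr ?exprn_gt0//.
  by rewrite [leRHS]mulrC; apply: (le_trans HS).
- move=> k; have [PIk _] := cint_profile k FI; have NI := cintegrable_normc mI PIk.
  rewrite (@eq_Rint _ _ _ leb `[p, q] _ (fun t => A^-1 * normc (profile F k t))); last first.
    by move=> t _; rewrite normcME normcR ger0_norm// invr_ge0 ltW.
  rewrite RintegralZl//; apply: sc; first by apply: Rint_ge0 => t _; exact: normc_ge0.
  apply: le_trans MM; apply: le_trans HL.
  rewrite lerXn2r ?nnegrE ?profile_L1//; first by apply: Rint_ge0 => t _; exact: normc_ge0.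
  by rewrite mulr_ge0 ?invr_ge0 ?(ltW (@pi2_gt0 R))//; apply: Rint_ge0 => z _; exact: normc_ge0.
Qed.

Lemma sqrt_cube_le15 (D : R) : 0 <= D -> D <= 6 -> Num.sqrt D ^+ 3 <= 15.
Proof.
move=> D0 D6; have d0 := sqrtr_ge0 D; have := sqr_sqrtr D0; move: (Num.sqrt D) d0 => d d0 dE.
have d25 : d <= 5 / 2 by rewrite -ler_sqr ?nnegrE//; lra.
by rewrite exprS dE; nra.
Qed.

Lemma six_le (x1 x2 x3 x4 x5 x6 : R) : 0 <= x1 -> 0 <= x2 -> 0 <= x3 ->
  0 <= x4 -> 0 <= x5 -> 0 <= x6 -> let S := (x1 + x2 + x3) + (x4 + x5 + x6) in
  [/\ x1 <= S, x2 <= S & x3 <= S] /\ [/\ x4 <= S, x5 <= S & x6 <= S].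
Proof. by move=> ? ? ? ? ? ? /=; split; split; lra. Qed.

(** A single mass has to control [F] and [G], so [W] sums the normalised fourth powers of all six
    factors. Each has integral at most 1, and [2 * 6^(3/2) <= 30]. *)
Lemma retarded_strichartz (a b : R) s F G alpha beta : a <= b -> b <= a + 2 * pi ->
  uniq s -> cubic_bound (strip a b) F alpha -> cubic_bound (strip a b) G beta ->
  normc (retarded_form s (profile F) (profile G) a b) <= 30 * (alpha * beta).
Proof.
move=> ab ba us cF cG.
have [FI al0 _] := cubic_bound_energy ba us cF; have [GI be0 _] := cubic_bound_energy ba us cG.
case: cF cG => mF [h1 [h2 [h3 [a1 [a2 [a3 [H1 H2 H3 aE Fh]]]]]]].
case=> mG [g1 [g2 [g3 [b1 [b2 [b3 [G1 G2 G3 bE Gg]]]]]]].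
pose N (h : TR * TR -> R) c z := c ^- 4 * h z ^+ 4.
pose W z := (N h1 a1 z + N h2 a2 z + N h3 a3 z) + (N g1 b1 z + N g2 b2 z + N g3 b3 z).
have mI := @measurable_itvT R `[a, b]; have mT := @measurable_torus R.
have mS := measurable_strip a b.
have NP h c : mass4 (strip a b) h c -> [/\ rint PM (strip a b) (N h c),
    \int[PM]_(z in strip a b) N h c z <= 1, forall z, 0 <= N h c z &
    forall z, h z ^+ 4 = c ^+ 4 * N h c z].
  move=> [_ hI c0 hc]; split; first exact: rintZ.
  - by rewrite RintegralZl// mulrC ler_pdivrMr ?exprn_gt0// mul1r.
  - by move=> z; rewrite mulr_ge0 ?pow4_ge0// invr_ge0 exprn_ge0// ltW.
  - by move=> z; rewrite /N mulrA divff ?mul1r// gt_eqF// exprn_gt0.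
have [hI1 hL1 hP1 hE1] := NP _ _ H1; have [hI2 hL2 hP2 hE2] := NP _ _ H2.
have [hI3 hL3 hP3 hE3] := NP _ _ H3; have [gI1 gL1 gP1 gE1] := NP _ _ G1.
have [gI2 gL2 gP2 gE2] := NP _ _ G2; have [gI3 gL3 gP3 gE3] := NP _ _ G3.
have I12 := rintD mS hI1 hI2; have I123 := rintD mS I12 hI3.
have J12 := rintD mS gI1 gI2; have J123 := rintD mS J12 gI3.
have WI : rint PM (strip a b) W by exact: rintD.
have W6 : \int[PM]_(z in strip a b) W z <= 6.
  rewrite /W !RintegralD//.
  by move: hL1 hL2 hL3 gL1 gL2 gL3; do 6! move: (Rintegral _ _ _) => ?; clear; lra.
have [w0I _ wE] := fubini_rect mI mT WI.
pose M t := \int[leb]_(tau in `[a, t]) \int[leb]_(x in torus) W (tau, x).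
have ME p q : a <= p -> p <= q -> q <= b -> M q - M p = \int[PM]_(z in strip p q) W z.
  move=> ap pq qb; rewrite /M (Rint_itv_split ap pq); last exact: rint_sub_itv w0I.
  rewrite addrAC subrr add0r.
  by have [_ _ ->] := fubini_rect (@measurable_itvT R `[p, q]) mT (rint_strip_sub ap qb WI).
have W0 z : 0 <= W z by rewrite !addr_ge0.
have ndM p q : a <= p -> p <= q -> q <= b -> M p <= M q.
  by move=> ap pq qb; rewrite -subr_ge0 ME//; apply: Rint_ge0.
have cM : {within `[a, b], continuous M} by exact: Rint_continuous.
have MF : mass_controlled s a b M (fun k t => ((a1 * a2 * a3)^-1)%:C * profile F k t).
  apply: (profile_mass_controlled ba us H1 H2 H3 mF Fh WI _ ME) => z.
  have [[L1 L2 L3] _] := six_le (hP1 z) (hP2 z) (hP3 z) (gP1 z) (gP2 z) (gP3 z).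
  by rewrite hE1 hE2 hE3; split; rewrite ler_wpM2l ?pow4_ge0.
have MG : mass_controlled s a b M (fun k t => ((b1 * b2 * b3)^-1)%:C * profile G k t).
  apply: (profile_mass_controlled ba us G1 G2 G3 mG Gg WI _ ME) => z.
  have [_ [L1 L2 L3]] := six_le (hP1 z) (hP2 z) (hP3 z) (gP1 z) (gP2 z) (gP3 z).
  by rewrite gE1 gE2 gE3; split; rewrite ler_wpM2l ?pow4_ge0.
rewrite -aE in MF; rewrite -bE in MG.
have PFI k : cintegrable leb `[a, b] (profile F k) by have [] := cint_profile k FI.
have PGI k : cintegrable leb `[a, b] (profile G k) by have [] := cint_profile k GI.
have CK := christ_kiselev (fun k => cintegrableZ mI (alpha^-1)%:C (PFI k))
  (fun k => cintegrableZ mI (beta^-1)%:C (PGI k)) cM ndM MF MG (lexx a) ab (lexx b).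
have RE : retarded_form s (profile F) (profile G) a b = (alpha * beta)%:C *
    retarded_form s (fun k t => (alpha^-1)%:C * profile F k t) (fun k t => (beta^-1)%:C * profile G
      k t) a b.
  rewrite /retarded_form mulr_sumr; apply: eq_bigr => k _.
  rewrite -(cintZ mI); last first.
    apply: cintegrable_primitiveM => //; first exact: cintegrableZ.
    by apply: cintegrableJ => //; exact: cintegrableZ.
  apply: eq_cint => t tI; have /andP[at_ tb] : a <= t <= b by move: tI; rewrite /= in_itv.
  rewrite cintZ; [|exact: measurable_itvT|exact: cintegrable_sub_itv (PFI k)].
  by apply: descale; rewrite gt_eqF.
rewrite RE normcME normcR gtr0_norm ?mulr_gt0// [leRHS]mulrC.
apply: ler_wpM2l; first by rewrite mulr_ge0 ?(ltW al0) ?(ltW be0).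
apply: (le_trans CK); rewrite (_ : 30 = 2 * 15); last by ring.
rewrite ler_wpM2l// ME//.
have D0 : 0 <= \int[PM]_(z in strip a b) W z by apply: Rint_ge0.
exact: sqrt_cube_le15.
Qed.

End retarded_strichartz.

(** * Oscillating sources *)

Lemma amgm_scaled (R : realType) (la x y : R) : 0 < la ->
  x * y <= la / 2 * x ^+ 2 + (2 * la)^-1 * y ^+ 2.
Proof.
move=> la0; have l0 : la != 0 by rewrite gt_eqF.
rewrite -subr_ge0 (_ : _ - _ = (2 * la)^-1 * (la * x - y) ^+ 2); last by field.
by rewrite mulr_ge0 ?sqr_ge0// invr_ge0 mulr_ge0// ltW.
Qed.

Lemma amgm_conclude (R : realType) (be de A B : R) : 0 < be -> 0 < de ->
  A <= de ^+ 2 -> B <= be ^+ 2 ->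
  be / de / 2 * A + (2 * (be / de))^-1 * B <= de * be.
Proof.
move=> b0 d0 HA HB.
have bn : be != 0 by rewrite gt_eqF.
have dn : de != 0 by rewrite gt_eqF.
have -> : de * be = be / de / 2 * de ^+ 2 + (2 * (be / de))^-1 * be ^+ 2.
  by field; rewrite bn dn.
by apply: lerD; apply: ler_wpM2l => //; rewrite ?invr_ge0 !mulr_ge0 ?invr_ge0// ltW.
Qed.

Lemma sum_near_far (K : eqType) (R : realType) (s s0 : seq K) (A : K -> R) :
  uniq s -> uniq s0 -> (forall k, 0 <= A k) ->
  \sum_(k <- s) A k <= \sum_(k <- s0) A k + \sum_(k <- [seq k <- s | k \notin s0]) A k.
Proof.
move=> us us0 A0; rewrite (bigID (fun k => k \in s0))/= [in leRHS]big_filter lerD2r.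
rewrite -big_filter; apply: ler_sum_subset => //; first exact: filter_uniq.
by move=> k; rewrite mem_filter => /andP[].
Qed.

Lemma Rint_itv_cst (R : realType) (r a b : R) : a <= b ->
  \int[leb]_(_ in `[a, b]) r = r * (b - a).
Proof.
move=> ab; have E : leb `[a, b] = (b - a)%:E :> \bar R.
  rewrite lebesgue_measure_itv/= lte_fin; case: ltP => [_//|ba].
  have -> : a = b by apply/eqP; rewrite eq_le ab.
  by rewrite subrr.
rewrite Rintegral_cst//; first by congr (_ * _); exact: (congr1 fine E).
Qed.

(** * Sources whose time integrals are small *)

Section small_sources.
Context {R : realType}.
Local Notation TR := (measurableTypeR R).
Local Notation PM := (@lebesgue_measure R \x @lebesgue_measure R)%E.
Implicit Types (p q T : R) (s : seq int).

Lemma normc_cint_sqr_le (f : R -> R[i]) p T : p <= T -> T <= p + 1 ->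
  CL2 leb (`[p, T] : set TR) f ->
  normc (cint leb `[p, T] f) ^+ 2 <= \int[leb]_(t in `[p, T]) (normc (f t) ^+ 2).
Proof.
move=> pT Tp Hf; have mI := @measurable_itvT R `[p, T].
have Ioo := @leb_itv_lty R p T true false.
have fI := CL2_cintegrable mI Ioo Hf; case: Hf => mf f2.
have m1 : measurable_fun (`[p, T] : set TR) (fun=> 1 : R) by exact: measurable_cst.
have i1 : rint leb (`[p, T] : set TR) (fun=> 1 ^+ 2) by apply: rint_cst.
have := cauchy_schwarz mI (measurable_normc mf) m1 f2 i1.
have -> : \int[leb]_(x in `[p, T]) (1 ^+ 2) = T - p :> R.
  rewrite (@eq_Rint _ _ _ leb `[p, T] (fun=> 1 ^+ 2) (fun=> 1)); last by move=> t _; rewrite expr1n.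
  by rewrite Rint_itv_cst// mul1r.
rewrite (@eq_Rint _ _ _ leb `[p, T] (fun t => normc (f t) * 1) (fun t => normc (f t))); last by
  move=> t _; rewrite mulr1.
move=> H; apply: (@le_trans _ _ ((\int[leb]_(t in `[p, T]) normc (f t)) ^+ 2)).
  rewrite lerXn2r ?nnegrE ?normc_ge0 ?normc_cint//.
  by apply: Rint_ge0 => t _; exact: normc_ge0.
apply: (le_trans H); rewrite -[leRHS]mulr1; apply: ler_wpM2l; last by lra.
by apply: Rint_ge0 => t _; exact: sqr_ge0.
Qed.

Variables (p T : R) (f : int -> R -> R[i]) (n0 : seq int) (eta delta : R).
Hypotheses (pT : p <= T) (Tp : T <= p + 1) (un0 : uniq n0).
Hypotheses (eta0 : 0 <= eta) (delta0 : 0 < delta).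
Hypothesis fL2 : forall k, CL2 leb (`[p, T] : set TR) (f k).
Hypothesis near : forall k t, k \in n0 -> p <= t -> t <= T ->
  normc (cint leb `[p, t] (f k)) <= eta.
Hypothesis far : forall s, uniq s -> (forall k, k \in s -> k \notin n0) ->
  \sum_(k <- s) \int[leb]_(t in `[p, T]) (normc (f k t) ^+ 2) <= delta ^+ 2.

Let mI := @measurable_itvT R `[p, T].
Let Ioo := @leb_itv_lty R p T true false.
Let fI k : cintegrable leb `[p, T] (f k).
Proof. exact: CL2_cintegrable. Qed.

Let farE s : uniq s -> \sum_(k <- [seq k <- s | k \notin n0])
   \int[leb]_(t in `[p, T]) (normc (f k t) ^+ 2) <= delta ^+ 2.
Proof.
move=> us; apply: far; first exact: filter_uniq.
by move=> k; rewrite mem_filter => /andP[].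
Qed.

Lemma small_source_energy s : uniq s ->
  increment_energy s f p T <= (size n0)%:R * eta ^+ 2 + delta ^+ 2.
Proof.
move=> us; apply: (le_trans (sum_near_far us un0 (fun k => sqr_ge0 _))).
apply: lerD; last first.
  by apply: le_trans (farE us); apply: ler_sum => k _; exact: normc_cint_sqr_le.
apply: (@le_trans _ _ (\sum_(k <- n0) eta ^+ 2)); last first.
  by rewrite big_const_seq count_predT iter_addr addr0 mulr_natl.
rewrite big_seq [leRHS]big_seq; apply: ler_sum => k kn0.
by rewrite lerXn2r ?nnegrE ?normc_ge0//; exact: near.
Qed.

(** On the modes of [n0] the primitive of [f] is uniformly small and [profile G] is bounded in L^1.
    On the others an integration by parts in time moves the integral onto [G], whose energy over
    [[t, T]] is at most [beta ^+ 2] for every [t], uniformly in the number of modes. *)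
Lemma small_source_retarded s G beta : uniq s -> cubic_bound (strip p T) G beta ->
  normc (retarded_form s f (profile G) p T) <= ((size n0)%:R * eta + delta) * beta.
Proof.
move=> us cG; have p2 := @pi_ge2 R.
have Tp2 : T <= p + 2 * pi by apply: (le_trans Tp); rewrite lerD2l; lra.
have [GI b0 _] := cubic_bound_energy Tp2 us cG.
have gI k : cintegrable leb `[p, T] (profile G k) by have [] := cint_profile k GI.
have gL1 k : \int[leb]_(t in `[p, T]) normc (profile G k t) <= beta.
  by apply: (le_trans (profile_L1 k GI)); exact: cubic_bound_L1 cG.
have gJ k : cintegrable leb `[p, T] (fun t => (profile G k t)^*%C) by exact: cintegrableJ.
apply: (le_trans (normc_sum _ _)).
apply: (le_trans (sum_near_far us un0 (fun k => normc_ge0 _))).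
rewrite mulrDl; apply: lerD.
  apply: (@le_trans _ _ (\sum_(k <- n0) eta * beta)); last first.
    by rewrite big_const_seq count_predT iter_addr addr0 -mulrA mulr_natl.
  rewrite big_seq [leRHS]big_seq; apply: ler_sum => k kn0.
  have GNI := cintegrable_normc mI (gI k).
  apply: (@le_trans _ _ (\int[leb]_(t in `[p, T]) (eta * normc (profile G k t)))); last first.
    by rewrite RintegralZl// ler_wpM2l.
  apply: normc_cint_le => //; last exact: rintZ.
    exact: cintegrable_meas (cintegrable_primitiveM pT (fI k) (gJ k)).
  move=> t tI; have /andP[pt tT] : p <= t <= T by move: tI; rewrite /= in_itv.
  by rewrite normcME normcJE ler_wpM2r ?normc_ge0//; exact: near.
set s1 := [seq k <- s | k \notin n0]; have us1 : uniq s1 by exact: filter_uniq.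
pose tl k t := cint leb `[t, T] (fun t' => (profile G k t')^*%C).
have tlE k t : p <= t -> t <= T -> tl k t = cint leb `[p, T] (fun t' => (profile G k t')^*%C) -
    cint leb `[p, t] (fun t' => (profile G k t')^*%C).
  by move=> pt tT; rewrite (cint_itv_split pt tT (gJ k)) addrAC subrr add0r.
have mtl k : cmeasurable (`[p, T] : set TR) (tl k).
  apply: (@eq_cmeasurable _ _ _ _ (fun t => cint leb `[p, T] (fun t' => (profile G k t')^*%C) -
    cint leb `[p, t] (fun t' => (profile G k t')^*%C))).
    by move=> t /=; rewrite in_itv/= => /andP[? ?]; rewrite tlE.
  by apply: cmeasurableB; [exact: cmeasurable_cst|exact: cmeasurable_primitive].
have tlb k t : p <= t -> t <= T -> normc (tl k t) <= 2 * beta.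
  move=> pt tT; rewrite tlE//; apply: (le_trans (normcBle _ _)).
  have H t' : p <= t' -> t' <= T -> normc (cint leb `[p, t'] (fun t' => (profile G k t')^*%C)) <= beta.
    move=> pt' tT'; apply: le_trans (gL1 k); apply: (le_trans (normc_primitive_le pt' tT' (gJ k))).
    by rewrite (@eq_Rint _ _ _ leb _ _ (fun t => normc (profile G k t)))// => x _; rewrite normcJE.
  by rewrite mulr_natl mulr2n lerD ?H.
have tlL2 k : CL2 leb (`[p, T] : set TR) (tl k).
  apply: (@CL2_bounded _ _ _ leb _ mI _ (2 * beta)) => //.
  by move=> t /=; rewrite in_itv/= => /andP[? ?]; exact: tlb.
have tl2 t : p <= t -> t <= T -> \sum_(k <- s1) normc (tl k t) ^+ 2 <= beta ^+ 2.
  move=> pt tT; have cG' := cubic_bound_sub pt (lexx T) cG.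
  have Tt : T <= t + 2 * pi by apply: (le_trans Tp2); rewrite lerD2r.
  have [_ _ +] := cubic_bound_energy Tt us1 cG'.
  apply: le_trans; apply: ler_sum => k _; rewrite /tl cintJ ?normcJE//.
  exact: cintegrable_sub_itv (gI k).
have [_ fi2] : True /\ forall k, rint leb (`[p, T] : set TR) (fun t => normc (f k t) ^+ 2).
  by split => // k; have [] := fL2 k.
have ti2 k : rint leb (`[p, T] : set TR) (fun t => normc (tl k t) ^+ 2) by have [] := tlL2 k.
(* This weight balances the two terms of the arithmetic-geometric inequality: each is at most
   [delta * beta / 2]. *)
pose la := beta / delta.
have la0 : 0 < la by rewrite divr_gt0.
apply: (@le_trans _ _ (\sum_(k <- s1) \int[leb]_(t in `[p, T])
    (la / 2 * normc (f k t) ^+ 2 + (2 * la)^-1 * normc (tl k t) ^+ 2))).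
  apply: ler_sum => k _; rewrite (cint_by_parts pT (fI k) (gJ k)).
  apply: (normc_cint_le mI).
  - by apply: cmeasurableM; [exact: cintegrable_meas (fI k)|exact: mtl].
  - move=> t _; rewrite normcME -/(tl k t).
    move: (normc_ge0 (f k t)) (normc_ge0 (tl k t)); move: (normc _) (normc _) => x y x0 y0.
    exact: amgm_scaled.
  - by apply: rintD => //; exact: rintZ.
rewrite -Rint_sum//; last by move=> k; apply: rintD => //; exact: rintZ.
rewrite (@eq_Rint _ _ _ leb _ _ (fun t => la / 2 * (\sum_(k <- s1) normc (f k t) ^+ 2) +
   (2 * la)^-1 * \sum_(k <- s1) normc (tl k t) ^+ 2)); last first.
  by move=> t _; rewrite big_split/= !mulr_sumr.
have Fs : rint leb (`[p, T] : set TR) (fun t => \sum_(k <- s1) normc (f k t) ^+ 2) by exact: rint_sum.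
have Ts : rint leb (`[p, T] : set TR) (fun t => \sum_(k <- s1) normc (tl k t) ^+ 2) by exact: rint_sum.
rewrite RintegralD//; [|exact: rintZ..].
rewrite !RintegralZl// Rint_sum//.
have H1 := farE us; rewrite -/s1 in H1.
have H2 : \int[leb]_(t in `[p, T]) (\sum_(k <- s1) normc (tl k t) ^+ 2) <= beta ^+ 2.
  apply: (@le_trans _ _ (\int[leb]_(t in `[p, T]) (cst (beta ^+ 2) t))).
    apply: Rint_le => //; first exact: rint_cst.
    by move=> t /=; rewrite in_itv/= => /andP[? ?]; exact: tl2.
  rewrite Rint_itv_cst//.
  by rewrite -[leRHS]mulr1 ler_wpM2l ?sqr_ge0// lerBlDl.
apply: (amgm_conclude b0 delta0 H1 H2).
Qed.

End small_sources.

(** * The Riemann-Lebesgue lemma, uniformly in the end of the interval *)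

Section riemann_lebesgue.
Context {R : realType}.
Local Notation TR := (measurableTypeR R).
Local Notation PM := (@lebesgue_measure R \x @lebesgue_measure R)%E.
Implicit Types (p q T : R) (s : seq int).

Lemma CL2_itv_extend (f : R -> R[i]) p t q : t <= q ->
  CL2 leb (`[p, t] : set TR) f ->
  CL2 leb (`[p, q] : set TR) (fun x => (\1_(`[p, t]%classic) x)%:C * f x).
Proof.
move=> tq [mf f2]; have mI := @measurable_itvT R `[p, t]; have mJ := @measurable_itvT R `[p, q].
have mP (g : TR -> R) : measurable_fun (`[p, t] : set TR) g ->
    measurable_fun (`[p, q] : set TR) (fun x => \1_(`[p, t]%classic) x * g x).
  move=> mg; rewrite (_ : (fun x => _) = g \_ `[p, t]%classic).
    apply: (measurable_funS measurableT (@subsetT _ _)).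
    exact/(measurable_restrictT _ mI).
  by apply/funext => x; rewrite patchE indicE; case: ifP => _; rewrite ?mul1r ?mul0r.
split.
  have [m1 m2] := mf; split.
    by have := mP _ m1; apply: eq_measurable_fun => x _; rewrite ReM/= mul0r subr0.
  by have := mP _ m2; apply: eq_measurable_fun => x _; rewrite ImM/= mul0r addr0.
have H : rint leb (`[p, q] : set TR) (fun x => \1_(`[p, t]%classic) x * normc (f x) ^+ 2).
  have /(integrable_mkcond _ mI) H := f2.
  apply: (@eq_integrable _ _ _ leb _ mJ _ _ _ (integrableS measurableT mJ (@subsetT _ _) H)) => x _.
  by rewrite patchE indicE; case: ifP => _; rewrite ?mul1r ?mul0r.
apply: (eq_rint mJ _ H) => x _.
by rewrite normcME normcR exprMn indicE; case: (_ \in _); rewrite ?mul0r ?normr0 ?expr0n/= ?mul0r//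
  normr1 expr1n.
Qed.

(** After extension by 0 to a full period these are Fourier coefficients, and Bessel's inequality
    makes all but finitely many small. *)
Lemma riemann_lebesgue (f : R -> R[i]) p t : t <= p + 2 * pi ->
  CL2 leb (`[p, t] : set TR) f -> forall eps : R, 0 < eps -> exists B : nat,
  forall M : int, (B < `|M|)%N -> normc (cint leb `[p, t] (fun x => cis (M%:~R * x) * f x)) < eps.
Proof.
move=> tp fL2 eps e0; have HF := CL2_itv_extend tp fL2.
have mJ := @measurable_itvT R `[p, p + 2 * pi].
have Joo : (leb (`[p, (p + 2 * pi)%R] : set TR) < +oo)%E by exact: leb_itv_lty.
have [s0 us0 H] := coef_cvg0 mJ Joo (fun k => measurable_expi k _)
   (@normc_expi R) (@pi2_gt0 R) (expi_ortho p) HF e0.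
have [B HB] := seq_bounded s0; exists B => M BM.
have /H : - M \notin s0.
  by apply/negP => /HB; rewrite abszN leqNgt BM.
rewrite /coef; congr (normc _ < _).
rewrite [LHS](@eq_cint _ _ _ leb _ _ (fun x => (\1_(`[p, t]%classic) x)%:C * (cis (M%:~R * x) * f x))).
  rewrite cint_setI_ind; congr cint; apply/seteqP; split=> x /=; first by case.
  by rewrite !in_itv/= => /andP[-> xt]; rewrite xt (le_trans xt tp).
by move=> x _; rewrite expiN -[LHS]mulrA; congr (_ * _); rewrite /expi -!cisN opprK mulrC.
Qed.

(** The times at which the integral [h] of [|f|] reaches a multiple of [eps / 2] are finite in
    number. Between two of them the oscillating integral varies by at most [eps / 2], so the
    statement at fixed ends suffices. *)
Lemma riemann_lebesgue_unif (f : R -> R[i]) p q : p <= q -> q <= p + 2 * pi ->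
  CL2 leb (`[p, q] : set TR) f -> forall eps, 0 < eps -> exists B : nat,
  forall (M : int) (t : R), (B < `|M|)%N -> p <= t -> t <= q ->
    normc (cint leb `[p, t] (fun x => cis (M%:~R * x) * f x)) <= eps.
Proof.
move=> pq qp fL2 eps e0.
have mJ := @measurable_itvT R `[p, q].
have Joo : (leb (`[p, q] : set TR) < +oo)%E by exact: leb_itv_lty.
have fI := CL2_cintegrable mJ Joo fL2; have NI := cintegrable_normc mJ fI.
have cfI (M : int) : cintegrable leb `[p, q] (fun x => cis (M%:~R * x) * f x).
  apply: (cintegrable_boundedM (M := 1) mJ _ _ fI); last by move=> x _; rewrite normc_cis.
  by apply: cmeasurable_cis; exact: measurable_funM.
pose h t := \int[leb]_(x in `[p, t]) normc (f x).
have ch : {within `[p, q], continuous h} by exact: Rint_continuous.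
have hB a b : p <= a -> a <= b -> b <= q -> h b - h a = \int[leb]_(x in `[a, b]) normc (f x).
  move=> pa ab bq; rewrite /h (Rint_itv_split pa ab); last exact: (rint_sub_itv (lexx p) bq NI).
  by rewrite addrAC subrr add0r.
have ndh a b : p <= a -> a <= b -> b <= q -> h a <= h b.
  move=> pa ab bq; rewrite -subr_ge0 hB//; apply: Rint_ge0 => x _; exact: normc_ge0.
have dB (M : int) a b : p <= a -> a <= b -> b <= q ->
   normc (cint leb `[p, b] (fun x => cis (M%:~R * x) * f x)) <=
   normc (cint leb `[p, a] (fun x => cis (M%:~R * x) * f x)) + (h b - h a).
  move=> pa ab bq; rewrite (cint_itv_split pa ab); last exact: (cintegrable_sub_itv (lexx p) bq (cfI M)).
  apply: (le_trans (normcDle _ _)); rewrite lerD2l hB//.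
  have H := cintegrable_sub_itv pa bq (cfI M).
  apply: (le_trans (normc_cint (@measurable_itvT R `[a, b]) H)).
  by rewrite (@eq_Rint _ _ _ leb `[a, b] _ (fun x => normc (f x)))// => x _; rewrite normcME
    normc_cis mul1r.
have e20 : 0 < eps / 2 by rewrite divr_gt0.
have key (n : nat) : exists B : nat, forall (M : int) (t : R), (B < `|M|)%N -> p <= t -> t <= q ->
    h t <= n%:R * (eps / 2) -> normc (cint leb `[p, t] (fun x => cis (M%:~R * x) * f x)) <= eps.
  elim: n => [|n [B IH]].
    exists 0%N => M t _ pt tq; rewrite mul0r => ht.
    have := dB M p t (lexx p) pt tq; rewrite cint_itv1 (_ : normc 0 = 0); last first.
      by apply/eqP; rewrite normc_eq0.
    have : 0 <= h p by apply: Rint_ge0 => x _; exact: normc_ge0.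
    by move: (normc _) => x; lra.
  have [hq|hq] := leP (h q) (n%:R * (eps / 2)).
    by exists B => M t BM pt tq _; apply: IH => //; apply: le_trans hq; exact: ndh.
  have h_p : h p = 0 by rewrite /h Rint_itv1.
  have n0 : 0 <= n%:R * (eps / 2) by rewrite mulr_ge0// ltW.
  have [|tn] := IVT pq ch (v := n%:R * (eps / 2)).
    have hpq : h p <= h q by exact: ndh.
    by rewrite minEle maxEle hpq h_p n0 ltW.
  rewrite in_itv/= => /andP[ptn tnq] htn.
  have fL2' : CL2 leb (`[p, tn] : set TR) f.
    case: fL2 => mf f2; split; last exact: rint_sub_itv f2.
    by apply: cmeasurableS mf => //; apply: subset_itv; rewrite bnd_simp.
  have [B' HB'] := riemann_lebesgue (le_trans tnq qp) fL2' e20.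
  exists (maxn B B') => M t; rewrite gtn_max => /andP[BM B'M] pt tq ht.
  have [ltn|tnl] := leP t tn.
    by apply: IH => //; rewrite -htn; exact: ndh.
  have := dB M tn t ptn (ltW tnl) tq; have := HB' M B'M.
  move: ht; rewrite htn -natr1 mulrDl mul1r.
  by move: (normc _) (normc _) => x y; lra.
pose n := (Num.truncn (h q / (eps / 2))).+1.
have [B HB] := key n; exists B => M t BM pt tq; apply: HB => //.
apply: (le_trans (ndh _ _ pt tq (lexx q))).
by rewrite -ler_pdivrMr// /n ltW// truncnS_gt.
Qed.

End riemann_lebesgue.

Lemma eventually_all (K : eqType) (s : seq K) (P : K -> nat -> Prop) :
  (forall l, l \in s -> exists N0, forall N, (N0 <= N)%N -> P l N) ->
  exists N0, forall N, (N0 <= N)%N -> forall l, l \in s -> P l N.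
Proof.
elim: s => [|k s IH] H; first by exists 0%N.
have [N1 H1] := H k (mem_head _ _).
have [N2 H2] : exists N0, forall N, (N0 <= N)%N -> forall l, l \in s -> P l N.
  by apply: IH => l ls; apply: H; rewrite inE ls orbT.
exists (maxn N1 N2) => N; rewrite geq_max => /andP[N1N N2N] l.
by rewrite inE => /orP[/eqP ->|ls]; [exact: H1|exact: H2].
Qed.

Lemma rint_le_ae d (T : measurableType d) (R : realType)
    (mu : {measure set T -> \bar R}) (D : set T) (f g : T -> R) : measurable D ->
  measurable_fun D f -> rint mu D g -> (forall x, D x -> 0 <= f x) ->
  {ae mu, forall x, D x -> f x <= g x} -> rint mu D f.
Proof.
move=> mD mf gI f0 fg; apply: rint_lty => //.
have mg := rint_measurable gI.
apply: (@le_lt_trans _ _ (\int[mu]_(x in D) `|(g x)%:E|)%E); last by have /integrableP[] := gI.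
apply: ae_ge0_le_integral => //.
- exact/measurable_EFinP.
- by apply: measurableT_comp => //; exact/measurable_EFinP.
apply: filterS fg => x H Dx; rewrite abse_EFin lee_fin; apply: le_trans (H Dx) _.
exact: ler_norm.
Qed.

Lemma cint0 d (T : measurableType d) (R : realType)
    (mu : {measure set T -> \bar R}) (D : set T) : cint mu D (fun=> 0 : R[i]) = 0.
Proof. by rewrite cintE/= /Rintegral integral0. Qed.

(** * Sources modulated by a plane wave of high frequency *)

Section oscillating_source.
Context {R : realType}.
Local Notation TR := (measurableTypeR R).
Local Notation PM := (@lebesgue_measure R \x @lebesgue_measure R)%E.
Implicit Types (p q T : R) (s : seq int).

Lemma fourier_bessel (f : R -> R[i]) s : uniq s -> CL2 leb torus f ->
  \sum_(k <- s) normc (fourier f k) ^+ 2 <= (2 * pi)^-1 * norm2 leb torus f.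
Proof.
move=> us Hf; have p2 := @pi2_gt0 R.
rewrite (eq_bigr (fun k => (2 * pi)^-1 ^+ 2 * normc (coef leb torus expi f k) ^+ 2)); last first.
  by move=> k _; rewrite fourierE normcME normcR exprMn ger0_norm// invr_ge0 ltW.
rewrite -mulr_sumr expr2 -mulrA ler_pM2l ?invr_gt0// mulrC ler_pdivrMr// [leRHS]mulrC.
exact: torus_bessel.
Qed.

(** Bessel's inequality on almost every time slice, integrated in time: the modes have uniformly
    summable energies. *)
Lemma slice_coef (Z : TR * TR -> R[i]) p q : CL2 PM (strip p q) Z ->
  (forall l, CL2 leb (`[p, q] : set TR) (fun t => fourier (fun x => Z (t, x)) l)) /\
  forall s, uniq s -> \sum_(l <- s) \int[leb]_(t in `[p, q])
     (normc (fourier (fun x => Z (t, x)) l) ^+ 2) <= (2 * pi)^-1 * norm2 PM (strip p q) Z.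
Proof.
move=> ZL2; have mI := @measurable_itvT R `[p, q]; have mT := @measurable_torus R.
have mS := measurable_strip p q; have p2 := @pi2_gt0 R.
have ZI := CL2_cintegrable mS (PM_strip_lty p q) ZL2.
case: (ZL2) => mZ Z2; have [I1 I2 IE] := fubini_rect mI mT Z2.
have mc l : cmeasurable (`[p, q] : set TR) (fun t => fourier (fun x => Z (t, x)) l).
  have [/cintegrable_meas mp _] := cint_profile l ZI.
  apply: (@eq_cmeasurable _ TR R _ (fun t : TR => cis (- (l%:~R ^+ 2 * t)) * profile Z l t)).
    by move=> t _; rewrite /profile mulrA [X in X * _]mulrC cisK mul1r.
  apply: cmeasurableM => //; apply: cmeasurable_cis; apply: measurable_funN.
  exact: measurable_funM.
have B : {ae leb, forall t : TR, `[p, q]%classic t -> forall s, uniq s ->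
    \sum_(l <- s) normc (fourier (fun x => Z (t, x)) l) ^+ 2 <=
    (2 * pi)^-1 * \int[leb]_(x in torus) (normc (Z (t, x)) ^+ 2)}.
  apply: filterS I2 => t Ht tI s us; rewrite -norm2E; apply: fourier_bessel => //.
  by split; [exact: cmeasurable_slice mZ tI|exact: Ht].
have L2 l : CL2 leb (`[p, q] : set TR) (fun t => fourier (fun x => Z (t, x)) l).
  split => //; apply: (rint_le_ae mI _ (rintZ mI (2 * pi)^-1 I1)).
  - by apply: measurable_funX; exact: measurable_normc.
  - by move=> t _; exact: sqr_ge0.
  by apply: filterS B => t Ht tI; have := Ht tI [:: l] erefl; rewrite big_seq1.
split => // s us; rewrite -Rint_sum//; last by move=> l; have [] := L2 l.
rewrite norm2E IE -RintegralZl//; apply: Rint_le_ae => //.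
- by apply: rint_sum => // l; have [] := L2 l.
- exact: rintZ.
- by move=> t _; apply: sumr_ge0 => l _; exact: sqr_ge0.
- move=> t _; rewrite mulr_ge0 ?invr_ge0 ?(ltW p2)//; apply: Rint_ge0 => x _; exact: sqr_ge0.
by apply: filterS B => t Ht tI; exact: Ht.
Qed.

(** In the mode [k = m + l] the source oscillates in time with the frequency [(m + l)^2 - n]; a
    resonance is a zero of this expression. *)
Lemma profile_modulation (Z : TR * TR -> R[i]) (m n k : int) t :
  cintegrable leb torus (fun x => Z (t, x)) ->
  profile (fun z => wave (m, n) z * Z z) k t =
  cis ((k ^+ 2 - n)%:~R * t) * fourier (fun x => Z (t, x)) (k - m).
Proof.
move=> ZI; have mT := @measurable_torus R.
have HI : cintegrable leb torus (fun x => cis (- ((k - m)%:~R * x)) * Z (t, x)).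
  apply: (cintegrable_boundedM (M := 1) mT _ _ ZI); last by move=> x _; rewrite normc_cis.
  by apply: cmeasurable_cis; apply: measurable_funN; exact: measurable_funM.
rewrite /profile /fourier !cintegralE.
rewrite (@eq_cint _ _ _ leb torus _ (fun x => cis (- (n%:~R * t)) * (cis (- ((k - m)%:~R * x)) * Z
  (t, x)))); last first.
  move=> x _; rewrite /wave !mulrA; congr (_ * _); rewrite -!cisD; congr cis.
  by rewrite intrB /=; ring.
have sw (A B C P : R[i]) : A * (P * (B * C)) = A * B * (P * C) by ring.
rewrite cintZ// sw; congr (_ * _).
by rewrite -cisD; congr cis; rewrite intrB expr2 intrM -expr2; ring.
Qed.

(** A mode of [Z] either vanishes or is multiplied by a frequency tending to infinity. Finitely many
    modes carry all but a small part of the energy, and the Riemann-Lebesgue lemma disposes of them.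
    The rank [N0] must not depend on [T], [s] or [G], as the bootstrap chooses these afterwards. *)
Lemma oscillating_source (Z : TR * TR -> R[i]) p q (sigma omega : nat -> int) :
  p <= q -> q <= p + 1 -> CL2 PM (strip p q) Z ->
  (forall t, p <= t -> t <= q -> cintegrable leb torus (fun x => Z (t, x))) ->
  (forall l, (forall t, p <= t -> t <= q -> fourier (fun x => Z (t, x)) l = 0) \/
     forall B : nat, exists N0, forall N, (N0 <= N)%N ->
       (B < `|(sigma N + l) ^+ 2 - omega N|)%N) ->
  forall eps : R, 0 < eps -> exists N0, forall N, (N0 <= N)%N ->
  forall T s, p <= T -> T <= q -> uniq s ->
    let X := profile (fun z => wave (sigma N, omega N) z * Z z) in
    increment_energy s X p T <= eps /\
    forall G beta, cubic_bound (strip p T) G beta ->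
      normc (retarded_form s X (profile G) p T) <= eps * beta.
Proof.
move=> pq qp ZL2 Zs res eps e0; have [cL2 cS] := slice_coef ZL2.
have p2 := @pi_ge2 R; have mI := @measurable_itvT R `[p, q].
pose a l := \int[leb]_(t in `[p, q]) (normc (fourier (fun x => Z (t, x)) l) ^+ 2).
have a0 l : 0 <= a l by apply: Rint_ge0 => t _; exact: sqr_ge0.
(* With this value [de ^+ 2 <= de] and [de + de <= eps], which serves the quadratic energy and the
   linear pairing at once. *)
pose de : R := Num.min 1 eps / 2.
have m0 : 0 < Num.min 1 eps by rewrite lt_min ltr01.
have m1 : Num.min 1 eps <= 1 by rewrite ge_min lexx.
have m2 : Num.min 1 eps <= eps by rewrite ge_min lexx orbT.
have de0 : 0 < de by rewrite divr_gt0.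
have [s0 us0 Hs0] := summable_tail a0 cS (exprn_gt0 2 de0).
pose et : R := Num.min 1 eps / (2 * (size s0).+1%:R).
have et0 : 0 < et by rewrite divr_gt0// mulr_gt0.
have ets : (size s0)%:R * et <= de.
  have -> : et = de / (size s0).+1%:R by rewrite /et /de invfM mulrA.
  rewrite mulrCA ler_piMr ?(ltW de0)//.
  by rewrite ler_pdivrMr ?ltr0n// mul1r ler_nat.
have et1 : et <= 1.
  rewrite /et ler_pdivrMr ?mulr_gt0// mul1r (le_trans m1)//.
  by rewrite -natrM ler1n mulnS.
pose f N := profile (fun z => wave (sigma N, omega N) z * Z z).
have fE N k t : p <= t -> t <= q -> f N k t =
    cis ((k ^+ 2 - omega N)%:~R * t) * fourier (fun x => Z (t, x)) (k - sigma N).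
  by move=> pt tq; apply: profile_modulation; exact: Zs.
have [N0 HN0] : exists N0, forall N, (N0 <= N)%N -> forall l, l \in s0 ->
    forall t, p <= t -> t <= q -> normc (cint leb `[p, t] (f N (sigma N + l))) <= et.
  apply: eventually_all => l _.
  have fE' N t : p <= t -> t <= q -> cint leb `[p, t] (f N (sigma N + l)) =
      cint leb `[p, t] (fun x => cis (((sigma N + l) ^+ 2 - omega N)%:~R * x) * fourier (fun y => Z
        (x, y)) l).
    move=> pt tq; apply: eq_cint => x /=; rewrite in_itv/= => /andP[px xt].
    by rewrite fE// ?(le_trans xt tq)//; congr (_ * fourier _ _); rewrite addrAC subrr add0r.
  have [z0|Hr] := res l.
    exists 0%N => N _ t pt tq; rewrite fE'//.
    rewrite (@eq_cint _ _ _ leb _ _ (fun=> 0)); last first.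
      move=> x /=; rewrite in_itv/= => /andP[px xt].
      by rewrite z0 ?mulr0// (le_trans xt tq).
    rewrite cint0 (_ : normc _ = 0) ?ltW//.
    by apply/eqP; rewrite normc_eq0.
  have qp2 : q <= p + 2 * pi by apply: (le_trans qp); rewrite lerD2l; lra.
  have [B HB] := riemann_lebesgue_unif pq qp2 (cL2 l) et0.
  have [N1 HN1] := Hr B; exists N1 => N N1N t pt tq; rewrite fE'//.
  by apply: HB => //; exact: HN1.
exists N0 => N N0N T s pT Tq us X.
have Tp : T <= p + 1 by exact: le_trans qp.
(* The exceptional modes move with the frequency of the wave, but their number does not depend on
   [N]. *)
pose n0 := [seq sigma N + l | l <- s0].
have un0 : uniq n0 by rewrite map_inj_uniq//; exact: addrI.
have mI' := @measurable_itvT R `[p, T].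
have sub : `[p, T]%classic `<=` (`[p, q]%classic : set R) by apply: subset_itv; rewrite bnd_simp.
have cL2' l : CL2 leb (`[p, T] : set TR) (fun t => fourier (fun x => Z (t, x)) l).
  case: (cL2 l) => mf f2; split; last exact: rint_sub_itv f2.
  exact: cmeasurableS mf.
have fL2 k : CL2 leb (`[p, T] : set TR) (X k).
  apply: (@eq_CL2 _ _ _ leb _ mI' (fun t => cis ((k ^+ 2 - omega N)%:~R * t) * fourier (fun x => Z
    (t, x)) (k - sigma N))).
    by move=> t /=; rewrite in_itv/= => /andP[pt tT]; rewrite -fE// (le_trans tT Tq).
  apply: (CL2_boundedM (M := 1) mI') => //; last by move=> x _; rewrite normc_cis.
  by apply: cmeasurable_cis; exact: measurable_funM.
have near k t : k \in n0 -> p <= t -> t <= T -> normc (cint leb `[p, t] (X k)) <= et.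
  by move=> /mapP[l ls0 ->] pt tT; apply: HN0 => //; exact: le_trans Tq.
have far s' : uniq s' -> (forall k, k \in s' -> k \notin n0) ->
    \sum_(k <- s') \int[leb]_(t in `[p, T]) (normc (X k t) ^+ 2) <= de ^+ 2.
  move=> us' Hs'; apply: (@le_trans _ _ (\sum_(k <- s') a (k - sigma N))).
    apply: ler_sum => k _.
    rewrite (@eq_Rint _ _ _ leb _ _ (fun t => normc (fourier (fun x => Z (t, x)) (k - sigma N)) ^+
      2)); last first.
      move=> t /=; rewrite in_itv/= => /andP[pt tT].
      by rewrite [X k t]fE// ?(le_trans tT Tq)// normcME normc_cis mul1r.
    by apply: Rint_sub_le => //; [have [] := cL2 (k - sigma N)|move=> t; exact: sqr_ge0].
  rewrite -(big_map (fun k => k - sigma N) xpredT a); apply/ltW/Hs0.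
    by rewrite map_inj_uniq//; exact: addIr.
  move=> l /mapP[k ks' ->]; apply/negP => kl; have /negP := Hs' _ ks'; apply.
  by apply/mapP; exists (k - sigma N) => //; rewrite addrC subrK.
have sz : size n0 = size s0 by rewrite size_map.
have ets2 : (size s0)%:R * et ^+ 2 <= de.
  apply: le_trans ets; rewrite ler_wpM2l// expr2 ler_piMr// ltW//.
have de2 : de ^+ 2 <= de by rewrite expr2 ler_piMr ?ltW// /de; lra.
have dee : de + de <= eps by rewrite /de; lra.
split.
  have E1 := small_source_energy pT Tp un0 (ltW et0) fL2 near far us.
  apply: (le_trans E1).
  by rewrite sz; apply: le_trans dee; exact: lerD.
move=> G beta cG; have [_ b0 _] : [/\ True, 0 < beta & True].
  have Tp2 : T <= p + 2 * pi by apply: (le_trans Tp); rewrite lerD2l; lra.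
  by have [] := cubic_bound_energy Tp2 us cG.
apply: (le_trans (small_source_retarded pT Tp un0 (ltW et0) de0 fL2 near far us cG)).
by rewrite sz; apply: ler_wpM2r; [exact: ltW|apply: le_trans dee; exact: lerD].
Qed.

End oscillating_source.

(** * Duality and bootstrap *)

Lemma conjc_sum (R : realType) (I : Type) (s : seq I) (F : I -> R[i]) :
  (\sum_(i <- s) F i)^*%C = \sum_(i <- s) (F i)^*%C.
Proof. exact: rmorph_sum. Qed.

Lemma conjcDE (R : realType) (x y : R[i]) : (x + y)^*%C = x^*%C + y^*%C.
Proof. exact: rmorphD. Qed.

Lemma dominated_by_sum (R : realType) (e g h C r : R) : 0 <= e -> 0 <= g -> 0 <= h ->
  e ^+ 2 <= g * h -> g <= C -> h <= r -> e <= C + r.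
Proof. by move=> e0 g0 h0 H gC hr; rewrite -ler_sqr ?nnegrE; nra. Qed.

(** * The L^4 mass of a function recovered by duality from its Duhamel formula *)

Section duality.
Context {R : realType}.
Local Notation TR := (measurableTypeR R).
Local Notation PM := (@lebesgue_measure R \x @lebesgue_measure R)%E.
Implicit Types (p q T : R) (s : seq int).

Lemma profile_mulJ (F G : TR * TR -> R[i]) k t : profile F k t * (profile G k t)^*%C =
  fourier (fun x => F (t, x)) k * (fourier (fun x => G (t, x)) k)^*%C.
Proof.
rewrite /profile; move: (fourier _ _) (fourier _ _) => x y.
by rewrite (conjcM (cis _)) mulrACA mulcJ normc_cis expr1n mul1r.
Qed.

Lemma normc_cint_prodJ d (T0 : measurableType d) (mu : {measure set T0 -> \bar R})
    (D : set T0) (F G : T0 -> R[i]) : measurable D -> CL2 mu D F -> CL2 mu D G ->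
  normc (cint mu D (fun x => F x * (G x)^*%C)) ^+ 2 <= norm2 mu D F * norm2 mu D G.
Proof.
move=> mD HF HG; have I := CL2_prod mD HF (CL2J mD HG).
case: (HF) (HG) => mF F2 [mG G2].
have := cauchy_schwarz mD (measurable_normc mF) (measurable_normc mG) F2 G2.
rewrite !norm2E; apply: le_trans.
rewrite lerXn2r ?nnegrE ?normc_ge0//.
  by apply: Rint_ge0 => x _; rewrite mulr_ge0 ?normc_ge0.
apply: (le_trans (normc_cint mD I)).
by rewrite (@eq_Rint _ _ _ mu D _ (fun x => normc (F x) * normc (G x)))// => x _; rewrite normcME
  normcJE.
Qed.

Lemma torus_parseval_symseq (f : R -> R[i]) : CL2 leb torus f ->
  forall eps, 0 < eps -> exists n0 : nat, forall n, (n0 <= n)%N ->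
  norm2 leb torus (fun x => f x - proj leb torus expi (2 * pi) (symseq n) f x) < eps.
Proof.
move=> Hf eps e0; have [s0 us0 H] := parseval_L2 Hf e0.
have [n0 Hn0] := seq_bounded s0; exists n0 => n n0n.
rewrite torus_norm2_proj ?symseq_uniq//; apply: H; first exact: symseq_uniq.
by move=> k /Hn0 kn; rewrite mem_symseq (leq_trans kn n0n).
Qed.

Lemma norm2_proj_le (f : R -> R[i]) s : uniq s -> CL2 leb torus f ->
  norm2 leb torus (fun x => f x - proj leb torus expi (2 * pi) s f x) <= norm2 leb torus f.
Proof.
move=> us Hf; rewrite torus_norm2_proj// gerBl mulr_ge0 ?invr_ge0 ?(ltW (@pi2_gt0 R))//.
by apply: sumr_ge0 => k _; exact: sqr_ge0.
Qed.

Lemma cint_projJ (f g : R -> R[i]) s : CL2 leb torus f -> CL2 leb torus g ->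
  cint leb torus (fun x => g x * (f x)^*%C) =
  (2 * pi)%:C * \sum_(k <- s) fourier g k * (fourier f k)^*%C +
  cint leb torus (fun x => g x * (f x - proj leb torus expi (2 * pi) s f x)^*%C).
Proof.
move=> Hf Hg; have mT := @measurable_torus R; have p2 := @pi2_gt0 R.
have Hp : CL2 leb torus (proj leb torus expi (2 * pi) s f).
  exact: (CL2_proj mT (@leb_torus_lty R) (2 * pi) (fun k => @measurable_expi R k torus) (@normc_expi R)).
have HT := cint_trigJ mT (@leb_torus_lty R) (fun k => @measurable_expi R k torus) (@normc_expi R)
   s (fun k => (2 * pi)^-1%:C * coef leb torus expi f k) Hg.
have -> : (2 * pi)%:C * \sum_(k <- s) fourier g k * (fourier f k)^*%C =
    cint leb torus (fun x => g x * (proj leb torus expi (2 * pi) s f x)^*%C).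
  rewrite [RHS]HT mulr_sumr; apply: eq_bigr => k _.
  rewrite !fourierE; move: (coef _ _ _ _ _) (coef _ _ _ _ _) => x y.
  have E : (2 * pi)%:C * (2 * pi)^-1%:C = 1 :> R[i].
    by rewrite -rmorphM/= divff// gt_eqF.
  rewrite mulrA mulrA E mul1r; exact: mulrC.
rewrite -cintD//; [|exact: CL2_prod (CL2J mT Hp)|apply: CL2_prod => //; apply: CL2J => //; exact: CL2B].
by apply: eq_cint => x _; rewrite -mulrDr -rmorphD/= addrC subrK.
Qed.

Variables (p T : R) (r : TR * TR -> R[i]) (Phi : int -> R -> R[i]) (D A rho : R).
Hypotheses (pT : p <= T) (Tp : T <= p + 1).
Hypothesis mr : cmeasurable (strip p T) r.
Hypothesis r4 : rint PM (strip p T) (fun z => normc (r z) ^+ 4).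
Hypothesis rs : forall t, p <= t -> t <= T -> CL2 leb torus (fun x => r (t, x)).
Hypothesis PhiI : forall k, cintegrable leb `[p, T] (Phi k).
Hypothesis rE : forall k t, p <= t -> t <= T ->
  profile r k t = profile r k p + cint leb `[p, t] (Phi k).
Hypothesis D0 : 0 <= D.
Hypothesis rD : forall s, uniq s -> \sum_(k <- s) normc (profile r k p) ^+ 2 <= D ^+ 2.
Hypothesis PhiA : forall s G beta, uniq s -> cubic_bound (strip p T) G beta ->
  normc (retarded_form s Phi (profile G) p T) <= A * beta.
Hypothesis rho0 : 0 < rho.
Hypothesis r_rho : \int[PM]_(z in strip p T) (normc (r z) ^+ 4) <= rho ^+ 4.

Let mI := @measurable_itvT R `[p, T].
Let mT := @measurable_torus R.
Let mS := measurable_strip p T.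

Definition cutoff (m : nat) z : R := \1_[set z | normc (r z) <= m%:R] z.
(** [|r|^2 r] is the function dual to [r] in L^4. The truncation at height [m] makes it bounded,
    hence square-integrable on every slice. *)
Definition dual_test m z : R[i] := (cutoff m z * normc (r z) ^+ 2)%:C * r z.

Lemma cutoff01 m z : 0 <= cutoff m z <= 1.
Proof. by rewrite /cutoff indicE; case: (_ \in _); rewrite ?lexx ?ler01. Qed.

Lemma measurable_cutoff m : measurable_fun (strip p T) (cutoff m).
Proof.
rewrite (_ : cutoff m = fun z => if (normc (r z) <= m%:R) then 1 else 0); last first.
  by apply/funext => z; rewrite /cutoff indicE; case: ifPn => h; [rewrite mem_set|rewrite
    memNset//= ; exact/negP].
apply: measurable_fun_if => //; try exact: measurable_cst.
by apply: measurable_fun_ler => //; exact: measurable_normc.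
Qed.

Lemma measurable_dual_test m : cmeasurable (strip p T) (dual_test m).
Proof.
apply: cmeasurableM => //; apply: cmeasurableR; apply: measurable_funM.
  exact: measurable_cutoff.
by apply: measurable_funX; exact: measurable_normc.
Qed.

Lemma dual_test_bound m : cubic_bound (strip p T) (dual_test m) (rho ^+ 3).
Proof.
have mass : mass4 (strip p T) (fun z => normc (r z)) rho.
  by split => //; exact: measurable_normc.
split; first exact: measurable_dual_test.
do 3 exists (fun z => normc (r z)); exists rho, rho, rho; split => //; first by ring.
move=> z _; rewrite normcME normcR ger0_norm; last first.
  by rewrite mulr_ge0 ?sqr_ge0//; have /andP[] := cutoff01 m z.
rewrite -expr2 ler_wpM2r ?normc_ge0// ler_piMl ?sqr_ge0//.
by have /andP[] := cutoff01 m z.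
Qed.

Lemma dual_test_le m z : normc (dual_test m z) <= m%:R ^+ 3.
Proof.
rewrite normcME normcR /cutoff indicE; have [h|h] := leP (normc (r z)) m%:R.
  rewrite mem_set// mul1r ger0_norm ?sqr_ge0// -exprSr lerXn2r ?nnegrE ?normc_ge0//.
by rewrite memNset/= ?mul0r ?normr0 ?mul0r ?exprn_ge0//; apply/negP; rewrite -ltNge.
Qed.

Lemma dual_test_slice m t : p <= t -> t <= T -> CL2 leb torus (fun x => dual_test m (t, x)).
Proof.
move=> pt tT; apply: (@CL2_bounded _ _ _ leb _ mT _ (m%:R ^+ 3)).
- exact: leb_torus_lty.
- have tI : `[p, T]%classic t by rewrite /= in_itv/= pt.
  exact: cmeasurable_slice (measurable_dual_test m) tI.
- by move=> x _; exact: dual_test_le.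
Qed.

Lemma dual_test_mulJ m z : dual_test m z * (r z)^*%C = (cutoff m z * normc (r z) ^+ 4)%:C.
Proof. by rewrite /dual_test -mulrA mulcJ -rmorphM/= -mulrA -exprD. Qed.

(** Duhamel's formula splits the pairing into the data at time [p] against the energy of the test
    function, and the conjugate of a retarded form. They contribute [D] and [A] respectively. *)
Lemma finite_pairing_le m s : uniq s ->
  normc (\sum_(k <- s) cint leb `[p, T]
     (fun t => profile (dual_test m) k t * (profile r k t)^*%C)) <= (D + A) * rho ^+ 3.
Proof.
move=> us; have p2 := @pi_ge2 R.
have Tp2 : T <= p + 2 * pi by apply: (le_trans Tp); rewrite lerD2l; lra.
have cG := dual_test_bound m; have [GI b0 GE] := cubic_bound_energy Tp2 us cG.
have gI k : cintegrable leb `[p, T] (profile (dual_test m) k) by have [] := cint_profile k GI.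
have gJ k : cintegrable leb `[p, T] (fun t => (profile (dual_test m) k t)^*%C).
  exact: cintegrableJ.
have HP k := cintegrable_primitiveM pT (PhiI k) (gJ k).
have -> : \sum_(k <- s) cint leb `[p, T] (fun t => profile (dual_test m) k t * (profile r k t)^*%C) =
    \sum_(k <- s) cint leb `[p, T] (profile (dual_test m) k) * (profile r k p)^*%C +
    (retarded_form s Phi (profile (dual_test m)) p T)^*%C.
  rewrite /retarded_form conjc_sum -big_split; apply: eq_bigr => k _; rewrite -[RHS]/(_ + _).
  rewrite -cintZr// -cintJ//; rewrite -cintD//; [|exact: cintegrableZr|exact: cintegrableJ].
  apply: eq_cint => t tI; have /andP[pt tT] : p <= t <= T by move: tI; rewrite /= in_itv.
  rewrite (rE k pt tT); move: (profile (dual_test m) k t) (profile r k p) (cint leb `[p, t] (Phi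
    k)) => x y z.
  by rewrite conjcDE mulrDr (conjcM z) conjcK [z^*%C * x]mulrC.
apply: (le_trans (normcDle _ _)); rewrite normcJE mulrDl; apply: lerD; last exact: PhiA.
rewrite -ler_sqr ?nnegrE ?normc_ge0 ?mulr_ge0 ?exprn_ge0 ?(ltW rho0)//.
apply: (le_trans (normc_sum_prodJ _ _ _)); rewrite exprMn mulrC.
apply: ler_pM => //; try (by apply: sumr_ge0 => k _; exact: sqr_ge0).
exact: rD.
Qed.

Lemma pairing_integral m : (\int[PM]_(z in strip p T) (cutoff m z * normc (r z) ^+ 4))%:C =
  cint leb `[p, T] (fun t => cint leb torus (fun x => dual_test m (t, x) * (r (t, x))^*%C)).
Proof.
have I : cintegrable PM (strip p T) (fun z => (cutoff m z * normc (r z) ^+ 4)%:C).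
  apply: cintegrableR; apply: (rint_le mS _ _ r4).
    by apply: measurable_funM; [exact: measurable_cutoff|apply: measurable_funX; exact:
      measurable_normc].
  move=> z _; have /andP[c0 c1] := cutoff01 m z.
  by rewrite ger0_norm ?mulr_ge0 ?exprn_ge0 ?normc_ge0// ler_piMl// exprn_ge0// normc_ge0.
rewrite -cintR; have [_ _ ->] := cfubini_rect mI mT I.
by apply: eq_cint => t _; apply: eq_cint => x _; rewrite dual_test_mulJ.
Qed.

Lemma pairing_slices_integrable m :
  cintegrable leb `[p, T] (fun t => cint leb torus (fun x => dual_test m (t, x) * (r (t, x))^*%C)).
Proof.
have I : cintegrable PM (strip p T) (fun z => dual_test m z * (r z)^*%C).
  apply: (cintegrable_le mS _ _ r4) => [|z _].
    by apply: cmeasurableM; [exact: measurable_dual_test|exact: cmeasurableJ].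
  have /andP[c0 c1] := cutoff01 m z.
  rewrite dual_test_mulJ normcR ger0_norm ?mulr_ge0 ?exprn_ge0 ?normc_ge0//.
  by rewrite ler_piMl// exprn_ge0// normc_ge0.
by have [] := cfubini_rect mI mT I.
Qed.

(** Parseval's identity on each slice reduces the pairing to finitely many modes, up to an error
    [E n] tending to 0 at every time. Its dominating function exists because the test function is
    bounded. *)
Lemma cutoff_mass_le m :
  \int[PM]_(z in strip p T) (cutoff m z * normc (r z) ^+ 4) <= 2 * pi * ((D + A) * rho ^+ 3).
Proof.
have p2 := @pi2_gt0 R; have p22 := @pi_ge2 R.
have Tp2 : T <= p + 2 * pi by apply: (le_trans Tp); rewrite lerD2l; lra.
have [GI _ _] := cubic_bound_energy Tp2 (erefl : uniq [::]) (dual_test_bound m).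
have gI k : cintegrable leb `[p, T] (profile (dual_test m) k) by have [] := cint_profile k GI.
pose S n t := \sum_(k <- symseq n) profile (dual_test m) k t * (profile r k t)^*%C.
pose E n t := cint leb torus (fun x => dual_test m (t, x) *
  (r (t, x) - proj leb torus expi (2 * pi) (symseq n) (fun x => r (t, x)) x)^*%C).
pose P t := cint leb torus (fun x => dual_test m (t, x) * (r (t, x))^*%C).
have PI : cintegrable leb `[p, T] P := pairing_slices_integrable m.
have PE n t : p <= t -> t <= T -> P t = (2 * pi)%:C * S n t + E n t.
  move=> pt tT; rewrite /P (cint_projJ (symseq n) (rs pt tT) (dual_test_slice m pt tT)).
  congr (_ * _ + _); apply: eq_bigr => k _.
  by rewrite profile_mulJ.
have rI k : cmeasurable (`[p, T] : set TR) (profile r k).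
  apply: (@eq_cmeasurable _ TR R _ (fun t : TR => profile r k p + cint leb `[p, t] (Phi k))).
    by move=> t tI; have /andP[pt tT] : p <= t <= T by [move: tI; rewrite /= in_itv]; rewrite [RHS]rE.
  by apply: cmeasurableD; [exact: cmeasurable_cst|exact: cmeasurable_primitive].
have rB k t : p <= t -> t <= T -> normc (profile r k t) <= normc (profile r k p) +
    \int[leb]_(t in `[p, T]) normc (Phi k t).
  move=> pt tT; rewrite rE//; apply: (le_trans (normcDle _ _)).
  by rewrite lerD2l; exact: normc_primitive_le.
have grI k : cintegrable leb `[p, T] (fun t => profile (dual_test m) k t * (profile r k t)^*%C).
  apply: (@eq_cintegrable _ _ _ leb _ mI (fun t => (profile r k t)^*%C * profile (dual_test m) k t)).
    by move=> t _; rewrite mulrC.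
  apply: (cintegrable_boundedM (M := normc (profile r k p) +
    \int[leb]_(t in `[p, T]) normc (Phi k t)) mI _ _ (gI k)); first exact: cmeasurableJ.
  by move=> t tI; have /andP[pt tT] : p <= t <= T by [move: tI; rewrite /= in_itv]; rewrite
    normcJE; exact: rB.
have SI n : cintegrable leb `[p, T] (S n) by exact: cintegrable_sum.
have mE n : cmeasurable (`[p, T] : set TR) (E n).
  apply: (@eq_cmeasurable _ TR R _ (fun t : TR => P t - (2 * pi)%:C * S n t)).
    by move=> t /=; rewrite in_itv/= => /andP[pt tT]; rewrite (PE n)// addrAC subrr add0r.
  apply: cmeasurableB; first exact: cintegrable_meas PI.
  by apply: cmeasurableM; [exact: cmeasurable_cst|exact: cintegrable_meas (SI n)].
have NE n t : p <= t -> t <= T -> normc (E n t) ^+ 2 <=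
    norm2 leb torus (fun x => dual_test m (t, x)) *
    norm2 leb torus (fun x => r (t, x) - proj leb torus expi (2 * pi) (symseq n) (fun x => r (t, x)) x).
  move=> pt tT; apply: normc_cint_prodJ => //; first exact: dual_test_slice.
  apply: CL2B => //; first exact: rs.
  exact: (CL2_proj mT (@leb_torus_lty R) (2 * pi) (fun k => @measurable_expi R k torus) (@normc_expi R)).
have r2 : rint PM (strip p T) (fun z => normc (r z) ^+ 2).
  apply: (@rint_le _ _ _ _ _ mS _ (fun z => 1 + normc (r z) ^+ 4)).
  - by apply: measurable_funX; exact: measurable_normc.
  - move=> z _; rewrite ger0_norm ?sqr_ge0// (_ : _ ^+ 4 = (normc (r z) ^+ 2) ^+ 2); last by
    rewrite -exprM.
    by move: (_ ^+ 2) => y; nra.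
  - by apply: rintD => //; apply: rint_cst => //; exact: PM_strip_lty.
have [r2I _ _] := fubini_rect mI mT r2.
have rho1 : 0 <= rho by exact: ltW.
pose C := m%:R ^+ 6 * (2 * pi) : R.
have GB t : p <= t -> t <= T -> norm2 leb torus (fun x => dual_test m (t, x)) <= C.
  move=> pt tT; rewrite norm2E.
  have [_ G2] := dual_test_slice m pt tT.
  apply: (@le_trans _ _ (\int[leb]_(x in torus) (cst (m%:R ^+ 6) x))).
    apply: Rint_le => //; first by apply: rint_cst => //; exact: leb_torus_lty.
    have E6 : m%:R ^+ 6 = (m%:R ^+ 3) ^+ 2 :> R by rewrite -exprM.
    move=> x _; rewrite /cst E6.
    by rewrite lerXn2r ?nnegrE ?normc_ge0 ?exprn_ge0//; exact: dual_test_le.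
  by rewrite torusE Rint_itv_cst ?add0r ?subr0// ltW.
have Elim : \int[leb]_(t in `[p, T]) normc (E n t) @[n --> \oo] --> (0 : R).
  have -> : 0 = \int[leb]_(t in `[p, T]) (0 : R) by rewrite Rint_itv_cst// mul0r.
  apply: (@Rint_dct _ TR R leb _ mI _ _ (fun t => C + \int[leb]_(x in torus) (normc (r (t, x)) ^+ 2))).
  - by move=> n; exact: measurable_normc.
  - exact: measurable_cst.
  - move=> t /=; rewrite in_itv/= => /andP[pt tT].
    apply/cvgrPdist_lt => eps e0.
    have C1 : 0 < C + 1 by rewrite ltr_wpDl// mulr_ge0 ?exprn_ge0// ltW.
    have [n0 Hn0] := torus_parseval_symseq (rs pt tT) (divr_gt0 (exprn_gt0 2 e0) C1).
    exists n0 => // n /= n0n; rewrite sub0r normrN ger0_norm ?normc_ge0//.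
    rewrite -ltr_sqr ?nnegrE ?normc_ge0 ?(ltW e0)//.
    apply: (le_lt_trans (NE n t pt tT)).
    apply: (@le_lt_trans _ _ ((C + 1) * norm2 leb torus (fun x => r (t, x) - proj leb torus expi (2
      * pi) (symseq n) (fun x => r (t, x)) x))).
      by apply: ler_wpM2r; [exact: norm2_ge0|rewrite ler_wpDr// GB].
    by rewrite mulrC -ltr_pdivlMr// Hn0.
  - by apply: rintD => //; apply: rint_cst => //; exact: leb_itv_lty.
  - move=> n t /=; rewrite in_itv/= => /andP[pt tT]; rewrite ger0_norm ?normc_ge0//.
    rewrite -norm2E; apply: (dominated_by_sum _ _ _ (NE n t pt tT)).
    + exact: normc_ge0.
    + exact: norm2_ge0.
    + exact: norm2_ge0.
    + exact: GB.
    + by apply: norm2_proj_le; [exact: symseq_uniq|exact: rs].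
apply/ler_addgt0Pl => eps e0.
move/cvgrPdist_lt : Elim => /(_ _ e0)[n _ /(_ n (leqnn _))].
rewrite sub0r normrN => HE.
have EI : cintegrable leb `[p, T] (E n).
  apply: (@eq_cintegrable _ _ _ leb _ mI (fun t => P t - (2 * pi)%:C * S n t)).
    by move=> t /=; rewrite in_itv/= => /andP[pt tT]; rewrite (PE n)// addrAC subrr add0r.
  by apply: cintegrableB => //; exact: cintegrableZ.
have V0 : 0 <= \int[PM]_(z in strip p T) (cutoff m z * normc (r z) ^+ 4).
  apply: Rint_ge0 => z _; have /andP[c0 _] := cutoff01 m z.
  by rewrite mulr_ge0 ?exprn_ge0 ?normc_ge0.
rewrite -[leLHS]ger0_norm// -normcR pairing_integral.
have -> : cint leb `[p, T] (fun t => cint leb torus (fun x => dual_test m (t, x) * (r (t, x))^*%C)) =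
    (2 * pi)%:C * cint leb `[p, T] (S n) + cint leb `[p, T] (E n).
  rewrite -cintZ// -cintD//; last exact: cintegrableZ.
  by apply: eq_cint => t /=; rewrite in_itv/= => /andP[pt tT]; exact: PE.
rewrite addrC; apply: (le_trans (normcDle _ _)); apply: lerD.
  by apply: (le_trans (normc_cint mI EI)); apply: le_trans (ltW HE); exact: ler_norm.
rewrite normcME normcR ger0_norm ?(ltW p2)//; apply: ler_wpM2l; first exact: ltW.
by rewrite cint_sum//; apply: finite_pairing_le; exact: symseq_uniq.
Qed.

(** When [rho ^+ 4] is the mass itself, this reads [rho <= 2 * pi * (D + A)]. *)
Lemma duality_bound : \int[PM]_(z in strip p T) (normc (r z) ^+ 4) <= 2 * pi * ((D + A) * rho ^+ 3).
Proof.
have HL : \int[PM]_(z in strip p T) (cutoff m z * normc (r z) ^+ 4) @[m --> \oo] -->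
    \int[PM]_(z in strip p T) (normc (r z) ^+ 4).
  apply: (@Rint_dct _ _ R PM _ mS _ _ (fun z => normc (r z) ^+ 4)) => //.
  - move=> m; apply: measurable_funM; first exact: measurable_cutoff.
    by apply: measurable_funX; exact: measurable_normc.
  - by apply: measurable_funX; exact: measurable_normc.
  - move=> z _; apply/cvgrPdist_lt => e e0.
    exists (Num.truncn (normc (r z))).+1 => // m /= hm.
    rewrite /cutoff indicE mem_set ?mul1r ?subrr ?normr0//=.
    apply: (@le_trans _ _ (Num.truncn (normc (r z))).+1%:R); first by rewrite ltW// truncnS_gt.
    by rewrite ler_nat.
  move=> m z _; have /andP[c0 c1] := cutoff01 m z.
  by rewrite ger0_norm ?mulr_ge0 ?exprn_ge0 ?normc_ge0// ler_piMl// exprn_ge0// normc_ge0.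
apply: (ler_cvg_to HL (cvg_cst (2 * pi * ((D + A) * rho ^+ 3)) : _ @ \oo --> _)).
by near=> m; exact: cutoff_mass_le.
Unshelve. all: by end_near.
Qed.

End duality.

Lemma pow4D_le (R : realType) (x y : R) : (x + y) ^+ 4 <= 8 * (x ^+ 4 + y ^+ 4).
Proof.
have E (z : R) : z ^+ 4 = (z ^+ 2) ^+ 2 by rewrite -exprM.
have H (a b : R) : (a + b) ^+ 2 <= 2 * (a ^+ 2 + b ^+ 2).
  by have := sqr_ge0 (a - b); nra.
have H1 := H x y; have H2 := H (x ^+ 2) (y ^+ 2).
have s0 : 0 <= (x + y) ^+ 2 by exact: sqr_ge0.
rewrite !E; apply: (@le_trans _ _ ((2 * (x ^+ 2 + y ^+ 2)) ^+ 2)).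
  by rewrite lerXn2r ?nnegrE// (le_trans s0).
by rewrite exprMn; move: H2; lra.
Qed.

(** The origin of the bound [4 * eta + 2 * rho] on the L^4 norm of [2 * w + |r|]: [8 * 16 <= 4^4]
    and [8 <= 2^4]. *)
Lemma mass_sum_le (R : realType) (a b : R) : 0 <= a -> 0 <= b ->
  8 * (16 * a ^+ 4 + b ^+ 4) <= (4 * a + 2 * b) ^+ 4.
Proof.
move=> a0 b0.
have p1 : 0 <= a ^+ 4 := exprn_ge0 4 a0.
have p2 : 0 <= a ^+ 3 * b := mulr_ge0 (exprn_ge0 3 a0) b0.
have p3 : 0 <= a ^+ 2 * b ^+ 2 := mulr_ge0 (exprn_ge0 2 a0) (exprn_ge0 2 b0).
have p4 : 0 <= a * b ^+ 3 := mulr_ge0 a0 (exprn_ge0 3 b0).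
have p5 : 0 <= b ^+ 4 := exprn_ge0 4 b0.
by lra.
Qed.

Lemma sqr_normc3_le (R : realType) (x y z : R[i]) :
  normc (x + y + z) ^+ 2 <= 3 * (normc x ^+ 2 + normc y ^+ 2 + normc z ^+ 2).
Proof.
have := normcDle (x + y) z; have := normcDle x y.
move: (normc_ge0 x) (normc_ge0 y) (normc_ge0 z) (normc_ge0 (x + y + z)).
move: (normc (x + y + z)) (normc (x + y)) (normc x) (normc y) (normc z) => u v a b c.
move=> a0 b0 c0 u0 H1 H2; apply: (@le_trans _ _ ((a + b + c) ^+ 2)).
  by rewrite lerXn2r ?nnegrE ?addr_ge0//; lra.
by have := sqr_ge0 (a - b); have := sqr_ge0 (b - c); have := sqr_ge0 (a - c); nra.
Qed.

(** The square is at most [32 * eta ^+ 2 + 8 * rho0 ^+ 2]. With the constant 30 of the retarded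
    estimate this gives 960 and 240, so that the nonlinear term is at most [rho / 2] and goes to the
    left side; hence the factor 2 in [rho1]. *)
Lemma bootstrap_arith (R : realType) (C g eta rho rho0 rho1 d : R) :
  0 < C -> 0 <= g -> 0 < rho -> rho <= rho0 -> rho1 = 2 * (C * d) ->
  960 * C * g * eta ^+ 2 <= 1 / 4 -> 240 * C * g * rho0 ^+ 2 <= 1 / 4 ->
  rho ^+ 4 <= C * ((d + g * (30 * (rho * (4 * eta + 2 * rho) ^+ 2))) * rho ^+ 3) ->
  rho <= rho1.
Proof.
move=> C0 g0 r0 rr -> H1 H2 H; have r3 : 0 < rho ^+ 3 by exact: exprn_gt0.
have {}H : rho <= C * (d + g * (30 * (rho * (4 * eta + 2 * rho) ^+ 2))).
  by rewrite -(ler_pM2r r3) -exprS -mulrA.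
have Cg : 0 <= 30 * (C * g) by rewrite !mulr_ge0// ltW.
have rr2 : rho ^+ 2 <= rho0 ^+ 2 by rewrite lerXn2r ?nnegrE ?(ltW r0)// (le_trans (ltW r0)).
have s2 : (4 * eta + 2 * rho) ^+ 2 <= 32 * eta ^+ 2 + 8 * rho0 ^+ 2.
  by have := sqr_ge0 (4 * eta - 2 * rho); nra.
have : 30 * (C * g) * (4 * eta + 2 * rho) ^+ 2 <= 1 / 2.
  apply: (le_trans (ler_wpM2l Cg s2)); lra.
move: H (ltW r0); rewrite (_ : C * _ = C * d + 30 * (C * g) * (4 * eta + 2 * rho) ^+ 2 * rho); last
  by ring.
by move: (30 * (C * g) * _) (C * d) => y x; nra.
Qed.

(** * The bootstrap on a short interval *)

Section bootstrap.
Context {R : realType}.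
Local Notation TR := (measurableTypeR R).
Local Notation PM := (@lebesgue_measure R \x @lebesgue_measure R)%E.
Implicit Types (p q T : R) (s : seq int).

Variables (gamma eta rho0 p q d : R) (r F X : TR * TR -> R[i]) (w : TR * TR -> R).
Hypotheses (pq : p <= q) (qp : q <= p + 1) (eta0 : 0 < eta) (rho0_gt0 : 0 < rho0).
Hypothesis mr : cmeasurable (strip p q) r.
Hypothesis r4 : rint PM (strip p q) (fun z => normc (r z) ^+ 4).
Hypothesis rs : forall t, p <= t -> t <= q -> CL2 leb torus (fun x => r (t, x)).
Hypothesis mw : measurable_fun (strip p q) w.
Hypothesis w4 : rint PM (strip p q) (fun z => w z ^+ 4).
Hypothesis w_eta : \int[PM]_(z in strip p q) (w z ^+ 4) <= eta ^+ 4.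
Hypothesis mF : cmeasurable (strip p q) F.
Hypothesis F_le : forall z, strip p q z ->
  normc (F z) <= normc (r z) * (2 * w z + normc (r z)) * (2 * w z + normc (r z)).
Hypothesis XI : cintegrable PM (strip p q) X.
Hypothesis rE : forall k t, p <= t -> t <= q -> profile r k t = profile r k p +
  'i%C * gamma%:C * (cint leb `[p, t] (profile F k) + cint leb `[p, t] (profile X k)).
Hypothesis d0 : 0 < d.
Hypothesis rd : forall s, uniq s -> \sum_(k <- s) normc (profile r k p) ^+ 2 <= d ^+ 2.
Hypothesis Xd : forall T s, p <= T -> T <= q -> uniq s ->
  increment_energy s (profile X) p T <= d ^+ 2 /\
  forall G beta, cubic_bound (strip p T) G beta ->
    normc (retarded_form s (profile X) (profile G) p T) <= d * beta.
Hypothesis eta_small : 960 * (2 * pi) * `|gamma| * eta ^+ 2 <= 1 / 4.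
Hypothesis rho0_small : 240 * (2 * pi) * `|gamma| * rho0 ^+ 2 <= 1 / 4.

Let mS := measurable_strip p q.
Let mT := @measurable_torus R.
Let m T := \int[PM]_(z in strip p T) (normc (r z) ^+ 4).

Let rho1 : R := 2 * (2 * pi * (d + `|gamma| * d)).

Hypothesis rho1_lt : rho1 < rho0.

Lemma strip_subset T : T <= q -> (strip p T : set (TR * TR)) `<=` strip p q.
Proof.
by move=> Tq z [/= Hz ?]; split => //; move: Hz; apply: subset_itv; rewrite bnd_simp.
Qed.

Lemma nonlinear_bound T rho : T <= q -> 0 < rho -> m T <= rho ^+ 4 ->
  cubic_bound (strip p T) F (rho * (4 * eta + 2 * rho) * (4 * eta + 2 * rho)).
Proof.
move=> Tq rho_gt0 mT_rho; have mS' := measurable_strip p T.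
have ss := strip_subset Tq.
have mr' : cmeasurable (strip p T) r by exact: cmeasurableS mr.
have mw' : measurable_fun (strip p T) w by exact: measurable_funS mw.
have r4' := rint_strip_sub (lexx p) Tq r4; have w4' := rint_strip_sub (lexx p) Tq w4.
have [_ _ _ w_eta'] : mass4 (strip p T) w eta by apply: (mass4_sub (lexx p) Tq).
have mass1 : mass4 (strip p T) (fun z => normc (r z)) rho by split => //; exact: measurable_normc.
have mh : measurable_fun (strip p T) (fun z => 2 * w z + normc (r z)).
  by apply: measurable_funD; [exact: measurable_funM|exact: measurable_normc].
have I1 : rint PM (strip p T) (fun z => 8 * (16 * w z ^+ 4 + normc (r z) ^+ 4)).
  by apply: rintZ => //; apply: rintD => //; exact: rintZ.
have le1 z : (2 * w z + normc (r z)) ^+ 4 <= 8 * (16 * w z ^+ 4 + normc (r z) ^+ 4).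
  by apply: (le_trans (pow4D_le _ _)); rewrite exprMn (_ : 2 ^+ 4 = 16)//; ring.
have I2 : rint PM (strip p T) (fun z => (2 * w z + normc (r z)) ^+ 4).
  apply: (rint_le mS' _ _ I1) => [|z _]; first exact: measurable_funX.
  by rewrite ger0_norm ?pow4_ge0.
have e0 : 0 < 4 * eta + 2 * rho by rewrite addr_gt0 ?mulr_gt0.
have mass2 : mass4 (strip p T) (fun z => 2 * w z + normc (r z)) (4 * eta + 2 * rho).
  split => //; apply: (le_trans (Rint_le mS' I2 I1 (fun z _ => le1 z))).
  rewrite RintegralZl//; last by apply: rintD => //; exact: rintZ.
  rewrite RintegralD//; last exact: rintZ.
  rewrite RintegralZl//.
  apply: (@le_trans _ _ (8 * (16 * eta ^+ 4 + rho ^+ 4))).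
    by rewrite ler_wpM2l// lerD// ler_wpM2l.
  by apply: mass_sum_le; exact: ltW.
split; first exact: cmeasurableS mF.
do 3 eexists; exists rho, (4 * eta + 2 * rho), (4 * eta + 2 * rho).
by split; [exact: mass1|exact: mass2|exact: mass2|by []|move=> z /ss; exact: F_le].
Qed.

Let gc : R[i] := 'i%C * gamma%:C.
Let normc_gc : normc gc = `|gamma|.
Proof. by rewrite normcME normc_i normcR mul1r. Qed.

Let Phi k t := gc * (profile F k t + profile X k t).

Lemma mass_le T rho : p <= T -> T <= q -> 0 < rho -> m T <= rho ^+ 4 ->
  m T <= 2 * pi * ((d + (`|gamma| * d + `|gamma| *
     (30 * (rho * (4 * eta + 2 * rho) ^+ 2)))) * rho ^+ 3).
Proof.
move=> pT Tq rho_gt0 mT_rho; have cF := nonlinear_bound Tq rho_gt0 mT_rho.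
have Tp : T <= p + 1 by exact: le_trans qp.
have p2 := @pi_ge2 R.
have Tp2 : T <= p + 2 * pi by apply: (le_trans Tp); rewrite lerD2l; lra.
have mI := @measurable_itvT R `[p, T]; have mS' := measurable_strip p T.
have ss := strip_subset Tq.
have [FI _ _] := cubic_bound_energy Tp2 (erefl : uniq [::]) cF.
have XI' := cint_strip_sub (lexx p) Tq XI.
have pF k : cintegrable leb `[p, T] (profile F k) by have [] := cint_profile k FI.
have pX k : cintegrable leb `[p, T] (profile X k) by have [] := cint_profile k XI'.
have PI k : cintegrable leb `[p, T] (Phi k).
  by apply: cintegrableZ => //; exact: cintegrableD.
apply: (@duality_bound R p T r Phi) => //.
- exact: cmeasurableS mr.
- exact: rint_strip_sub r4.
- by move=> t pt tT; apply: rs => //; exact: le_trans Tq.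
- move=> k t pt tT; rewrite rE//; last exact: le_trans Tq.
  have pF' := cintegrable_sub_itv (lexx p) tT (pF k).
  have pX' := cintegrable_sub_itv (lexx p) tT (pX k).
  have mI' := @measurable_itvT R `[p, t].
  by rewrite /Phi cintZ ?cintD//; exact: cintegrableD.
- exact: ltW.
move=> s G beta us cG; have [GI b0 _] := cubic_bound_energy Tp2 us cG.
have pG k : cintegrable leb `[p, T] (profile G k) by have [] := cint_profile k GI.
have pGJ k : cintegrable leb `[p, T] (fun t => (profile G k t)^*%C) by exact: cintegrableJ.
have -> : retarded_form s Phi (profile G) p T = gc * (retarded_form s (profile F) (profile G) p T +
    retarded_form s (profile X) (profile G) p T).
  rewrite /retarded_form -big_split mulr_sumr; apply: eq_bigr => k _.
  rewrite -[X in _ = _ * X]/(_ + _).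
  have H1 := cintegrable_primitiveM pT (pF k) (pGJ k).
  have H2 := cintegrable_primitiveM pT (pX k) (pGJ k).
  rewrite -cintD// -cintZ//; last exact: cintegrableD.
  apply: eq_cint => t tI; have /andP[pt tT] : p <= t <= T by move: tI; rewrite /= in_itv.
  have pF' := cintegrable_sub_itv (lexx p) tT (pF k).
  have pX' := cintegrable_sub_itv (lexx p) tT (pX k).
  have mI' := @measurable_itvT R `[p, t].
  by rewrite /Phi cintZ ?cintD//; [rewrite -mulrA mulrDl|exact: cintegrableD].
rewrite normcME normc_gc -mulrDr -mulrA; apply: ler_wpM2l => //.
apply: (le_trans (normcDle _ _)); rewrite mulrDl [leRHS]addrC; apply: lerD; last first.
  by have [_] := Xd pT Tq us; exact.
by apply: (le_trans (retarded_strichartz pT Tp2 us cF cG)); rewrite expr2 !mulrA.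
Qed.

Lemma mass_continuous : {within `[p, q], continuous m}.
Proof.
have mI := @measurable_itvT R `[p, q].
have [w0I _ _] := fubini_rect mI mT r4.
have H : {within `[p, q], continuous (fun t => \int[leb]_(tau in `[p, t])
   \int[leb]_(x in torus) (normc (r (tau, x)) ^+ 4))} by exact: Rint_continuous.
apply: (subspace_eq_continuous _ H) => t; rewrite inE/= in_itv/= => /andP[pt tq].
by have [_ _] := fubini_rect (@measurable_itvT R `[p, t]) mT (rint_strip_sub (lexx p) tq r4).
Qed.

(** A continuity argument: otherwise the mass, which starts from 0, takes at some time the value
    [rho ^+ 4] with [rho1 < rho <= rho0], and the a priori estimate at that time gives
    [rho <= rho1]. *)
Lemma mass_rho1 : m q <= rho1 ^+ 4.
Proof.
have p2 := @pi2_gt0 R; have g0 : 0 <= `|gamma| by exact: normr_ge0.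
have r10 : 0 < rho1.
  by rewrite /rho1; do 2! (apply: mulr_gt0 => //); rewrite ltr_wpDr// mulr_ge0// (ltW d0).
have m0 : 0 <= m q by apply: Rint_ge0 => z _; exact: pow4_ge0.
rewrite leNgt; apply/negP => mq.
pose mu := Num.sqrt (Num.sqrt (m q)).
have mu0 : 0 <= mu by exact: sqrtr_ge0.
have mu4 : mu ^+ 4 = m q by rewrite /mu (_ : 4 = 2 * 2)%N// exprM !sqr_sqrtr// sqrtr_ge0.
have mu1 : rho1 < mu by rewrite -(@ltr_pXn2r _ 4) ?nnegrE ?(ltW r10)// mu4.
pose rho := Num.min mu rho0.
have rho_gt : rho1 < rho by rewrite lt_min mu1.
have rho_gt0 : 0 < rho by exact: lt_trans rho_gt.
have rho4 : rho ^+ 4 <= m q.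
  by rewrite -mu4 lerXn2r ?nnegrE ?(ltW rho_gt0)// ge_min lexx.
have mp : m p = 0.
  have [_ _] := fubini_rect (@measurable_itvT R `[p, p]) mT (rint_strip_sub (lexx p) pq r4).
  by rewrite Rint_itv1.
have [|T] := IVT pq mass_continuous (v := rho ^+ 4).
  by rewrite mp minEle maxEle m0 pow4_ge0.
rewrite in_itv/= => /andP[pT Tq] mTE.
have := mass_le pT Tq rho_gt0; rewrite mTE lexx => /(_ erefl).
rewrite addrA => /(bootstrap_arith p2 g0 rho_gt0 _ (erefl rho1) eta_small rho0_small).
rewrite ge_min lexx orbT => /(_ erefl).
by rewrite leNgt rho_gt.
Qed.

(** The energy at time [q] is the datum of the next interval; this is what allows the intervals to
    be chained. *)
Lemma bootstrap_energy s : uniq s -> \sum_(k <- s) normc (profile r k q) ^+ 2 <=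
  3 * (d ^+ 2 + `|gamma| ^+ 2 * (rho1 * (4 * eta + 2 * rho1) * (4 * eta + 2 * rho1)) ^+ 2 +
       `|gamma| ^+ 2 * d ^+ 2).
Proof.
move=> us; have p2 := @pi2_gt0 R; have p22 := @pi_ge2 R.
have r10 : 0 < rho1.
  by rewrite /rho1; do 2! (apply: mulr_gt0 => //); rewrite ltr_wpDr// mulr_ge0// (ltW d0).
have qp2 : q <= p + 2 * pi by apply: (le_trans qp); rewrite lerD2l; lra.
have [_ _ EF] := cubic_bound_energy qp2 us (nonlinear_bound (lexx q) r10 mass_rho1).
have [EX _] := Xd pq (lexx q) us.
apply: (@le_trans _ _ (\sum_(k <- s) 3 * (normc (profile r k p) ^+ 2 +
   `|gamma| ^+ 2 * normc (cint leb `[p, q] (profile F k)) ^+ 2 +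
   `|gamma| ^+ 2 * normc (cint leb `[p, q] (profile X k)) ^+ 2))).
  apply: ler_sum => k _; rewrite rE// mulrDr addrA -/gc.
  apply: (le_trans (sqr_normc3_le _ _ _)).
  by rewrite !(normcME gc) normc_gc !exprMn.
rewrite -mulr_sumr ler_pM2l// !big_split/= -!mulr_sumr.
by apply: lerD; [apply: lerD; [exact: rd|apply: ler_wpM2l => //; exact: sqr_ge0]|apply: ler_wpM2l
  => //; exact: sqr_ge0].
Qed.

End bootstrap.

(** * Duhamel's formula and multiplication by functions of time *)

Section time_modulation.
Context {R : realType}.
Local Notation TR := (measurableTypeR R).
Local Notation PM := (@lebesgue_measure R \x @lebesgue_measure R)%E.

Lemma is_derive_continuous_itv (phi g : R -> R) a b :
  (forall x : R, x \in `[a, b] -> is_derive x 1 phi (g x)) ->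
  {within `[a, b], continuous phi}.
Proof.
move=> H; apply: continuous_in_subspaceT => x xab.
have [dx _] := H x (set_mem xab).
by apply: differentiable_continuous; exact/derivable1_diffP.
Qed.

Lemma cis_FTC (phi g : R -> R) a b : a <= b -> continuous g ->
  (forall x : R, x \in `[a, b] -> is_derive x 1 phi (g x)) ->
  cint leb `[a, b] (fun s => 'i%C * (g s)%:C * cis (phi s)) = cis (phi b) - cis (phi a).
Proof.
move=> ab cg H; have cphi := is_derive_continuous_itv H.
have cg' : {within `[a, b], continuous g} by exact: continuous_subspaceT.
have ccos : {within `[a, b], continuous (cos \o phi)}.
  by apply: within_continuous_comp => // x _; exact: continuous_cos.
have csin : {within `[a, b], continuous (sin \o phi)}.
  by apply: within_continuous_comp => // x _; exact: continuous_sin.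
have ds (x : R) : x \in `[a, b] -> is_derive x 1 (fun y => sin (phi y)) (g x * cos (phi x)).
  by move=> /H dx; apply: is_derive_eq (is_derive1_comp (is_derive_sin _) dx) _; rewrite mulrC.
have dc (x : R) : x \in `[a, b] -> is_derive x 1 (fun y => cos (phi y)) (- (g x * sin (phi x))).
  by move=> /H dx; apply: is_derive_eq (is_derive1_comp (is_derive_cos _) dx) _; rewrite mulNr mulrC.
have -> : cis (phi b) - cis (phi a) = (cos (phi b) - cos (phi a)) +i* (sin (phi b) - sin (phi a)).
  by apply: eq_complexP; rewrite !ReImE.
rewrite cintE; congr (_ +i* _).
  rewrite -(Rint_FTC ab _ dc); last first.
    by move=> x; apply: cvgN; apply: cvgM; [exact: cg'|exact: csin].
  by apply: eq_Rint => x _; rewrite !ReM !ImM/=; ring.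
rewrite -(Rint_FTC ab _ ds); last first.
  by move=> x; apply: cvgM; [exact: cg'|exact: ccos].
by apply: eq_Rint => x _; rewrite !ReImE/=; ring.
Qed.

Lemma primitive_exists (g : R -> R) : continuous g -> exists phi : R -> R,
  phi 0 = 0 /\ forall x : R, 0 <= x -> is_derive x 1 phi (g x).
Proof.
(* Integrating from -1 makes 0 an interior point, where a two-sided derivative exists. *)
move=> cg; pose F x := \int[leb]_(t in `[-1, x]) g t.
exists (fun x => F x - F 0); split; first by rewrite subrr.
move=> x x0.
have I : leb.-integrable `[-1, x + 1] (EFin \o g).
  by apply: rint_continuous; exact: continuous_subspaceT.
have xx : x < x + 1 by rewrite ltrDl.
have x1 : -1 < x by rewrite (lt_le_trans _ x0)// ltrN10.
have [d1 d2] := continuous_FTC1_closed xx I x1 (cg x).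
have dF : is_derive x 1 F (g x) by apply: DeriveDef; [exact: d1|rewrite -derive1E; exact: d2].
by apply: is_derive_eq; rewrite subr0.
Qed.

(** The product rule for [e^{iwt}] and a primitive, in integrated form; it yields the Duhamel
    formula of the rotated solution. *)
Lemma rotation_product (w : R) (P0 : R[i]) (g : R -> R[i]) t : 0 <= t ->
  cintegrable leb `[0, t] g ->
  cis (w * t) * (P0 + cint leb `[0, t] g) = P0 +
  cint leb `[0, t] (fun s => 'i%C * w%:C * (cis (w * s) * (P0 + cint leb `[0, s] g))) +
  cint leb `[0, t] (fun s => cis (w * s) * g s).
Proof.
move=> t0 gI; have mI := @measurable_itvT R `[0, t].
have mcis : cmeasurable (`[0, t] : set TR) (fun s => cis (w * s)).
  by apply: cmeasurable_cis; exact: measurable_funM.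
have cwI : cintegrable leb `[0, t] (fun s => cis (w * s)) by exact: cintegrable_cis_itv.
have dI : cintegrable leb `[0, t] (fun s => 'i%C * w%:C * cis (w * s)) by exact: cintegrableZ.
have dw (x : R) : is_derive x 1 (fun y => w * y) w.
  by apply: is_derive_eq; rewrite /GRing.scale/= mulr1.
have FTC a : 0 <= a -> a <= t ->
    cint leb `[a, t] (fun s => 'i%C * w%:C * cis (w * s)) = cis (w * t) - cis (w * a).
  move=> a0 at_; apply: (cis_FTC at_ (g := fun=> w)); first by move=> x; exact: cst_continuous.
have cgI : cintegrable leb `[0, t] (fun s => cis (w * s) * g s).
  by apply: (cintegrable_boundedM (M := 1) mI mcis _ gI) => x _; rewrite normc_cis.
have PI := cintegrable_primitiveM t0 gI dI.
rewrite (@eq_cint _ _ _ leb `[0, t] (fun s => 'i%C * w%:C * (cis (w * s) * (P0 + cint leb `[0, s] g)))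
  (fun s => P0 * ('i%C * w%:C * cis (w * s)) + cint leb `[0, s] g * ('i%C * w%:C * cis (w * s))));
    last first.
  by move=> s _; rewrite -mulrDl mulrA mulrC.
rewrite cintD//; last exact: cintegrableZ.
rewrite cintZ// FTC// mulr0 cis0 (cint_by_parts t0 gI dI).
rewrite (@eq_cint _ _ _ leb `[0, t] (fun s => g s * cint leb `[s, t] (fun s => 'i%C * w%:C * cis (w
  * s)))
  (fun s => cis (w * t) * g s - cis (w * s) * g s)); last first.
  move=> s sI; have /andP[s0 st] : 0 <= s <= t by move: sI; rewrite /= in_itv.
  by rewrite FTC// mulrC mulrBl.
rewrite cintB//; last exact: cintegrableZ.
rewrite cintZ//; move: (cint _ _ _) (cint _ _ _) => x y; ring.
Qed.

Lemma cint_profileD (F G : TR * TR -> R[i]) k p q : cintegrable PM (strip p q) F ->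
  cintegrable PM (strip p q) G ->
  cint leb `[p, q] (profile (fun z => F z + G z) k) =
  cint leb `[p, q] (profile F k) + cint leb `[p, q] (profile G k).
Proof.
move=> FI GI; have mS := measurable_strip p q.
have WI H : cintegrable PM (strip p q) H ->
    cintegrable PM (strip p q) (fun z => H z * (wave (k, k ^+ 2) z)^*%C).
  move=> HI; have : cintegrable PM (strip p q) (fun z => (wave (k, k ^+ 2) z)^*%C * H z).
    apply: (cintegrable_boundedM (M := 1) mS _ _ HI).
      by apply: cmeasurableJ; exact: measurable_wave.
    by move=> z _; rewrite normcJE normc_wave.
  by apply: eq_cintegrable => // z _; rewrite mulrC.
have [_ ->] := cint_profile k (cintegrableD mS FI GI).
have [_ ->] := cint_profile k FI; have [_ ->] := cint_profile k GI.
rewrite -mulrDr -cintD//; [|exact: WI..].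
by congr (_ * _); apply: eq_cint => z _; rewrite mulrDl.
Qed.

Lemma cint_profileN (F : TR * TR -> R[i]) k p q : cintegrable PM (strip p q) F ->
  cint leb `[p, q] (profile (fun z => - F z) k) = - cint leb `[p, q] (profile F k).
Proof.
move=> FI; have mS := measurable_strip p q; have NI := cintegrableN mS FI.
apply/eqP; rewrite -addr_eq0; apply/eqP; rewrite -cint_profileD//.
rewrite (@eq_cint _ _ _ leb `[p, q] _ (fun=> 0)) ?cint0// => t _.
rewrite /profile /fourier cintegralE (@eq_cint _ _ _ leb torus _ (fun=> 0)) ?cint0 ?mulr0// => x _.
by rewrite addNr mulr0.
Qed.

Lemma cint_profile_modulated (phi : R -> R[i]) (G : TR * TR -> R[i]) (M : R) k p q :
  cmeasurable (`[p, q] : set TR) phi -> (forall t, p <= t -> t <= q -> normc (phi t) <= M) ->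
  cintegrable PM (strip p q) G ->
  cintegrable PM (strip p q) (fun z => phi z.1 * G z) /\
  cint leb `[p, q] (profile (fun z => phi z.1 * G z) k) =
  cint leb `[p, q] (fun t => phi t * profile G k t).
Proof.
move=> mphi phiM GI; have mS := measurable_strip p q.
have mI := @measurable_itvT R `[p, q]; have mT := @measurable_torus R.
have mphi1 : cmeasurable (strip p q) (fun z : TR * TR => phi z.1).
  have H : forall f : TR -> R, measurable_fun (`[p, q] : set TR) f ->
      measurable_fun (strip p q) (fun z : TR * TR => f z.1).
    move=> f mf; apply: (@measurable_comp _ _ _ _ _ _ (`[p, q] : set TR)) => //.
      by move=> _ [z [/= H _] <-].
    exact: (measurable_funS measurableT (@subsetT _ _) measurable_fst).
  by case: mphi => m1 m2; split; [exact: (H (fun t => complex.Re (phi t)))|exact: (H (fun t =>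
    complex.Im (phi t)))].
have phiM' z : strip p q z -> normc (phi z.1) <= M.
  by move=> [/=]; rewrite in_itv/= => /andP[? ?] _; exact: phiM.
have PI := cintegrable_boundedM mS mphi1 phiM' GI.
split => //; have [I1 _] := cint_profile k PI; have [I2 _] := cint_profile k GI.
apply: ae_eq_cint => //; first exact: cintegrable_meas I1.
  by apply: cmeasurableM => //; exact: cintegrable_meas I2.
have [_ I3 _] := cfubini_rect mI mT GI.
apply: filterS I3 => t Ht tI; have {}Ht := Ht tI.
have HI : cintegrable leb torus (fun x => cis (- (k%:~R * x)) * G (t, x)).
  apply: (cintegrable_boundedM (M := 1) mT _ _ Ht); last by move=> x _; rewrite normc_cis.
  by apply: cmeasurable_cis; apply: measurable_funN; exact: measurable_funM.
rewrite /profile /fourier !cintegralE.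
rewrite (@eq_cint _ _ _ leb torus _ (fun x => phi t * (cis (- (k%:~R * x)) * G (t, x)))); last first.
  by move=> x _; rewrite mulrCA.
by rewrite cintZ//; move: (cint _ _ _) => y; ring.
Qed.

Lemma profile_wave (n k : int) (t : R) :
  profile (wave (n, n ^+ 2)) k t = (k == n)%:R.
Proof.
have mT := @measurable_torus R.
have E : profile (wave (n, n ^+ 2)) k t = profile (fun z => wave (n, n ^+ 2) z * 1) k t.
  rewrite /profile /fourier !cintegralE; congr (_ * (_ * _)).
  by apply: eq_cint => x _; rewrite mulr1.
rewrite E profile_modulation; last first.
  apply: (@cintegrable_bounded _ _ _ leb _ mT _ 1); [exact: leb_torus_lty|exact: cmeasurable_cst|].
  by move=> x _; rewrite -(@cis0 R) normc_cis.
have f1 : fourier (fun=> 1 : R[i]) (k - n) = (k == n)%:R.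
  rewrite /fourier cintegralE.
  rewrite (@eq_cint _ _ _ leb torus _ (fun x => cis ((n - k)%:~R * x))); last first.
    by move=> x _; rewrite mulr1 -mulNr -intrN opprB.
  rewrite torusE cint_cis_period subr_eq0 eq_sym; case: eqP => _; last by rewrite mulr0.
  by rewrite -rmorphM/= mulVf// gt_eqF ?pi2_gt0.
rewrite f1; case: eqP => [->|_]; last by rewrite mulr0.
by rewrite subrr mul0r cis0 mulr1.
Qed.

End time_modulation.

(** * The approximate solution *)

Section cubic_algebra.
Context {R : realType}.
Implicit Types (a b u w : R[i]).

Definition cub u : R[i] := (normc u ^+ 2)%:C * u.

Lemma normc_cub u : normc (cub u) = normc u ^+ 3.
Proof. by rewrite /cub normcME normcR ger0_norm ?sqr_ge0// -exprSr. Qed.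

(** Grouped for a wave [b] of constant modulus: the second and third terms merely rotate [a] and
    [b], and the parenthesis collects the genuine interactions. *)
Lemma cub_expand a b : cub (a + b) = cub a + 2 * (normc b ^+ 2)%:C * a +
  (normc b ^+ 2)%:C * b + (2 * (normc a ^+ 2)%:C * b + a ^+ 2 * b^*%C + a^*%C * b ^+ 2).
Proof. by rewrite /cub -!mulcJ conjcDE; move: (a^*%C) (b^*%C) => a' b'; ring. Qed.

(** The local Lipschitz bound is put as a product of three factors, the shape which [cubic_bound]
    asks for. *)
Lemma cub_diff u w (W : R) : normc w <= W -> normc (cub u - cub w) <=
  normc (u - w) * (2 * W + normc (u - w)) * (2 * W + normc (u - w)).
Proof.
move=> wW; have w0 := normc_ge0 w; have u0 := normc_ge0 u; have d0 := normc_ge0 (u - w).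
have uW : normc u <= W + normc (u - w).
  by rewrite -{1}(subrK w u); apply: (le_trans (normcDle _ _)); rewrite addrC lerD2r.
have E : cub u - cub w = (normc u ^+ 2)%:C * (u - w) + ((normc u - normc w) * (normc u + normc
  w))%:C * w.
  rewrite (_ : (normc u - normc w) * (normc u + normc w) = normc u ^+ 2 - normc w ^+ 2); last by ring.
  by rewrite /cub rmorphB/=; ring.
have dn := normc_dist u w.
rewrite E; apply: (le_trans (normcDle _ _)); rewrite !normcME !normcR (ger0_norm (sqr_ge0 _)).
rewrite normrM (ger0_norm (addr_ge0 u0 w0)).
move: dn; move: (normr_ge0 (normc u - normc w)); move: `|_ - _|.
move: uW wW w0 u0 d0; move: (normc u) (normc w) (normc (u - w)); clear.
move=> x y z xW yW y0 x0 z0 d dge dz.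
have W0 : 0 <= W by exact: le_trans yW.
have h1 : x ^+ 2 * z <= (W + z) ^+ 2 * z by rewrite ler_wpM2r// lerXn2r ?nnegrE// (le_trans x0).
have h2 : d * (x + y) * y <= z * (2 * W + z) * W.
  apply: ler_pM => //; first by rewrite mulr_ge0// addr_ge0.
  by apply: ler_pM => //; [rewrite addr_ge0|lra].
apply: (le_trans (lerD h1 h2)); rewrite -subr_ge0.
rewrite (_ : _ - _ = z * W * (W + z)); last by ring.
by rewrite !mulr_ge0// addr_ge0.
Qed.

End cubic_algebra.

(** * Duhamel's formula for positive times *)

Section forward_solution.
Context {R : realType}.
Local Notation TR := (measurableTypeR R).
Local Notation PM := (@lebesgue_measure R \x @lebesgue_measure R)%E.

Lemma fourierB (f g : R -> R[i]) k : cintegrable leb torus f -> cintegrable leb torus g ->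
  fourier (fun x => f x - g x) k = fourier f k - fourier g k.
Proof.
move=> fI gI; have mT := @measurable_torus R; rewrite /fourier !cintegralE -mulrBr.
have cI (h : TR -> R[i]) : cintegrable leb torus h -> cintegrable leb torus (fun x : TR => cis (-
  (k%:~R * x)) * h x).
  move=> hI; apply: (cintegrable_boundedM (M := 1) mT _ _ hI); last by move=> x _; rewrite normc_cis.
  by apply: cmeasurable_cis; apply: measurable_funN; exact: measurable_funM.
by rewrite -cintB//; [congr (_ * _); apply: eq_cint => x _; rewrite mulrBr|exact: cI..].
Qed.

Lemma fourierZ (z : R[i]) (f : R -> R[i]) k : cintegrable leb torus f ->
  fourier (fun x => z * f x) k = z * fourier f k.
Proof.
move=> fI; have mT := @measurable_torus R; rewrite /fourier !cintegralE mulrCA.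
congr (_ * _); rewrite -cintZ//; first by apply: eq_cint => x _; rewrite mulrCA.
apply: (cintegrable_boundedM (M := 1) mT _ _ fI); last by move=> x _; rewrite normc_cis.
by apply: cmeasurable_cis; apply: measurable_funN; exact: measurable_funM.
Qed.

Lemma eq_fourier (f g : R -> R[i]) k : (forall x, torus x -> f x = g x) -> fourier f k = fourier g k.
Proof.
move=> fg; rewrite /fourier !cintegralE; congr (_ * _).
by apply: eq_cint => x Tx; rewrite fg.
Qed.

Lemma measurable_strip_time (f : TR -> R) p q : measurable_fun (`[p, q] : set TR) f ->
  measurable_fun (strip p q) (fun z : TR * TR => f z.1).
Proof.
move=> mf; apply: (@measurable_comp _ _ _ _ _ _ (`[p, q] : set TR)) => //.
  by move=> _ [z [/= H _] <-].
exact: (measurable_funS measurableT (@subsetT _ _) measurable_fst).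
Qed.

Variables (gamma tau : R).

Definition forward_solution (f : R -> R[i]) (U : TR * TR -> R[i]) :=
  [/\ cmeasurable (strip 0 tau) U, rint PM (strip 0 tau) (fun z => normc (U z) ^+ 4),
      forall t, 0 <= t -> t <= tau -> CL2 leb torus (fun x => U (t, x)) &
      forall k t, 0 <= t -> t <= tau -> profile U k t = fourier f k +
        'i%C * gamma%:C * cint leb `[0, t] (profile (fun z => cub (U z)) k)].

Lemma cint_strip_pow4 (F : TR * TR -> R[i]) (n : nat) p q (C : R) : (n <= 4)%N ->
  cmeasurable (strip p q) F -> forall U : TR * TR -> R[i],
  cmeasurable (strip p q) U -> rint PM (strip p q) (fun z => normc (U z) ^+ 4) ->
  (forall z, strip p q z -> normc (F z) <= C * normc (U z) ^+ n) -> cintegrable PM (strip p q) F.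
Proof.
move=> n4 mF U mU U4 FU; have mS := measurable_strip p q.
apply: (cintegrable_le mS mF (g := fun z => `|C| * (1 + normc (U z) ^+ 4))).
  move=> z Sz; apply: (le_trans (FU z Sz)).
  apply: (@le_trans _ _ (`|C| * normc (U z) ^+ n)).
    by rewrite ler_wpM2r ?exprn_ge0 ?normc_ge0// ler_norm.
  rewrite ler_wpM2l//; have u0 := normc_ge0 (U z).
  have [u1|u1] := leP (normc (U z)) 1.
    by apply: (@le_trans _ _ 1); [rewrite exprn_ile1|rewrite lerDl exprn_ge0].
  by rewrite ler_wpDl// ler_weXn2l// ltW.
apply: rintZ => //; apply: rintD => //.
by apply: rint_cst => //; exact: PM_strip_lty.
Qed.

Lemma cub_integrable (U : TR * TR -> R[i]) p q : cmeasurable (strip p q) U ->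
  rint PM (strip p q) (fun z => normc (U z) ^+ 4) -> cintegrable PM (strip p q) (fun z => cub (U z)).
Proof.
move=> mU U4; apply: (@cint_strip_pow4 _ 3 _ _ 1 _ _ U) => //.
  by apply: cmeasurableM => //; apply: cmeasurableR; apply: measurable_funX; exact: measurable_normc.
by move=> z _; rewrite normc_cub mul1r.
Qed.

End forward_solution.

(** * The ansatz and the equation of the remainder *)

Section ansatz.
Context {R : realType}.
Local Notation TR := (measurableTypeR R).
Local Notation PM := (@lebesgue_measure R \x @lebesgue_measure R)%E.

Variables (gamma tau c : R) (u0 : R -> R[i]) (V U : TR * TR -> R[i]) (m psi : R -> R) (n : int).
Hypotheses (tau0 : 0 <= tau) (c0 : 0 <= c).
Hypothesis u0L2 : CL2 leb torus u0.
Hypothesis VS : forward_solution gamma tau u0 V.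
Hypothesis US : forward_solution gamma tau (fun x => u0 x + c%:C * expi n x) U.
Hypothesis cm : continuous m.
Hypothesis psi0 : psi 0 = 0.
Hypothesis dpsi : forall t : R, 0 <= t -> is_derive t 1 psi (gamma * (2 * m t + c ^+ 2)).

(* [slow + fast] approximates the solution from [u0 + c e^{inx}]: [theta] is the phase
   which the wave of amplitude [c] imparts to [V], and [psi] the one that the mass [m] of [V]
   and [c] itself impart to the wave. *)
Definition theta := 2 * gamma * c ^+ 2.
Definition slow (z : TR * TR) : R[i] := cis (theta * z.1) * V z.
Definition fast (z : TR * TR) : R[i] := c%:C * cis (psi z.1) * wave (n, n ^+ 2) z.
Definition remainder z := U z - slow z - fast z.
Definition cubic_defect z := cub (U z) - cub (slow z + fast z).
(** The part of [cub (slow z + fast z)] that no rotation absorbs. Subtracting [m] takes away the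
    mean of [|V|^2], which would keep the first term in resonance with the wave. *)
Definition resonance_defect z := 2 * (normc (V z) ^+ 2 - m z.1)%:C * fast z +
  slow z ^+ 2 * (fast z)^*%C + (slow z)^*%C * fast z ^+ 2.
Definition envelope z := normc (V z) + c.

Lemma normc_slow z : normc (slow z) = normc (V z).
Proof. by rewrite normcME normc_cis mul1r. Qed.

Lemma normc_fast z : normc (fast z) = c.
Proof. by rewrite /fast normcME normc_wave (normcME c%:C) normc_cis !mulr1 normcR ger0_norm. Qed.

(** The parenthesis on the right is the source generating [slow] and [fast], the derivatives of
    their phases included. The two defects thus form the whole source of the remainder. *)
Lemma defect_sum z : cubic_defect z + resonance_defect z =
  cub (U z) - (cis (theta * z.1) * cub (V z) + ((2 * c ^+ 2)%:C * cis (theta * z.1) * V z +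
    ((2 * m z.1 + c ^+ 2) * c)%:C * cis (psi z.1) * wave (n, n ^+ 2) z)).
Proof.
have E1 : cis (theta * z.1) * cub (V z) = cub (slow z).
  by rewrite /cub normc_slow /slow mulrCA.
have E2 : ((2 * m z.1 + c ^+ 2) * c)%:C * cis (psi z.1) * wave (n, n ^+ 2) z =
    (2 * m z.1 + c ^+ 2)%:C * fast z by rewrite /fast rmorphM/= !mulrA.
have E3 : (2 * c ^+ 2)%:C * cis (theta * z.1) * V z = (2 * c ^+ 2)%:C * slow z by rewrite /slow mulrA.
rewrite E1 E2 E3 /cubic_defect /resonance_defect cub_expand normc_fast normc_slow.
move: (slow z) (fast z) => a b; move: (a^*%C) (b^*%C) (cub a) (cub (U z)) => a' b' x y.
move: (c ^+ 2) (normc (V z) ^+ 2) (m z.1) => c2 v2 mz.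
have E (p q : R) : (2 * p + q)%:C = 2 * p%:C + q%:C :> R[i].
  by rewrite rmorphD rmorphM rmorph_nat.
have E' (p : R) : (2 * p)%:C = 2 * p%:C :> R[i] by rewrite rmorphM rmorph_nat.
have E'' (p q : R) : (p - q)%:C = p%:C - q%:C :> R[i] by rewrite rmorphB.
by rewrite E E' E''; ring.
Qed.

Lemma continuous_psi : {within `[0, tau], continuous psi}.
Proof.
apply: (is_derive_continuous_itv (g := fun t => gamma * (2 * m t + c ^+ 2))) => t.
by rewrite in_itv/= => /andP[t0 _]; exact: dpsi.
Qed.

Lemma m_bounded : exists M : R, forall t, 0 <= t -> t <= tau -> `|m t| <= M.
Proof.
have cnm : {within `[0, tau], continuous (fun t => `|m t|)}.
  by apply: continuous_subspaceT => t; apply: cvg_norm; exact: cm.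
have [t _ H] := EVT_max tau0 cnm; exists `|m t| => t' t0 tt.
by apply: H; rewrite in_itv/= t0.
Qed.

Let mS t := measurable_strip 0 t : measurable (strip 0 t : set (TR * TR)).
Let mcis_th D : cmeasurable (D : set TR) (fun t => cis (theta * t)).
Proof. by apply: cmeasurable_cis; exact: measurable_funM. Qed.
Let mpsi : measurable_fun (`[0, tau] : set TR) psi.
Proof.
apply: subspace_continuous_measurable_fun; [exact: measurable_itvT|exact: continuous_psi].
Qed.
Let mm : measurable_fun (`[0, tau] : set TR) m.
Proof.
apply: subspace_continuous_measurable_fun; first exact: measurable_itvT.
exact: continuous_subspaceT.
Qed.
Let sub_itv t : t <= tau -> (`[0, t]%classic : set R) `<=` `[0, tau].
Proof. by move=> tt; apply: subset_itv; rewrite bnd_simp. Qed.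
Lemma measurable_slow : cmeasurable (strip 0 tau) slow.
Proof.
have [mV _ _ _] := VS; apply: cmeasurableM => //.
apply: cmeasurable_cis; apply: measurable_funM => //.
exact: (measurable_funS measurableT (@subsetT _ _) measurable_fst).
Qed.

Lemma measurable_fast : cmeasurable (strip 0 tau) fast.
Proof.
apply: cmeasurableM; last exact: measurable_wave.
apply: cmeasurableM; first exact: cmeasurable_cst.
by apply: cmeasurable_cis; exact: measurable_strip_time.
Qed.

Lemma measurable_remainder : cmeasurable (strip 0 tau) remainder.
Proof.
have [mU _ _ _] := US; apply: cmeasurableB; last exact: measurable_fast.
by apply: cmeasurableB => //; exact: measurable_slow.
Qed.

Lemma measurable_cub (F : TR * TR -> R[i]) : cmeasurable (strip 0 tau) F -> cmeasurable (strip 0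
  tau) (fun z => cub (F z)).
Proof.
move=> mF; apply: cmeasurableM => //; apply: cmeasurableR.
by apply: measurable_funX; exact: measurable_normc.
Qed.

Lemma measurable_cubic_defect : cmeasurable (strip 0 tau) cubic_defect.
Proof.
have [mU _ _ _] := US; apply: cmeasurableB; apply: measurable_cub => //.
by apply: cmeasurableD; [exact: measurable_slow|exact: measurable_fast].
Qed.

Lemma measurable_envelope : measurable_fun (strip 0 tau) envelope.
Proof.
have [mV _ _ _] := VS; apply: measurable_funD; first exact: measurable_normc.
exact: measurable_cst.
Qed.

Lemma envelope_pow4_le z : envelope z ^+ 4 <= 8 * (normc (V z) ^+ 4 + c ^+ 4).
Proof. exact: pow4D_le. Qed.

Lemma envelope_pow4 : rint PM (strip 0 tau) (fun z => envelope z ^+ 4).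
Proof.
have [mV V4 _ _] := VS; apply: (rint_le (mS tau) (g := fun z => 8 * (normc (V z) ^+ 4 + c ^+ 4))).
- by apply: measurable_funX; exact: measurable_envelope.
- by move=> z _; rewrite ger0_norm ?pow4_ge0// envelope_pow4_le.
apply: rintZ => //; apply: rintD => //; apply: rint_cst => //; exact: PM_strip_lty.
Qed.

Lemma remainder_pow4 : rint PM (strip 0 tau) (fun z => normc (remainder z) ^+ 4).
Proof.
have [mU U4 _ _] := US.
apply: (rint_le (mS tau) (g := fun z => 8 * (normc (U z) ^+ 4 + envelope z ^+ 4))).
- by apply: measurable_funX; apply: measurable_normc; exact: measurable_remainder.
- move=> z _; rewrite ger0_norm ?pow4_ge0//; apply: le_trans (pow4D_le _ _).
  rewrite lerXn2r ?nnegrE ?addr_ge0 ?normc_ge0//.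
  rewrite /remainder -addrA -opprD; apply: (le_trans (normcBle _ _)); rewrite lerD2l.
  by apply: (le_trans (normcDle _ _)); rewrite normc_slow normc_fast.
apply: rintZ => //; apply: rintD => //; exact: envelope_pow4.
Qed.

Lemma slice_fast t : CL2 leb torus (fun x => fast (t, x)).
Proof.
have mT := @measurable_torus R.
apply: (@CL2_bounded _ _ _ leb _ mT _ c); [exact: leb_torus_lty| |by move=> x _; rewrite normc_fast].
have -> : (fun x => fast (t, x)) = fun x => c%:C * cis (psi t) * cis (- ((n ^+ 2)%:~R * t)) * expi n x.
  by apply/funext => x; rewrite /fast /wave mulrA.
by apply: cmeasurableM; [exact: cmeasurable_cst|exact: measurable_expi].
Qed.

Lemma slice_remainder t : 0 <= t -> t <= tau -> CL2 leb torus (fun x => remainder (t, x)).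
Proof.
move=> t0 tt; have [_ _ sV _] := VS; have [_ _ sU _] := US.
apply: CL2B => //; last exact: slice_fast.
by apply: CL2B => //; [exact: sU|exact: (CL2Z (@measurable_torus R) (cis (theta * t)) (sV t t0 tt))].
Qed.

Lemma cubic_defect_le z : normc (cubic_defect z) <=
  normc (remainder z) * (2 * envelope z + normc (remainder z)) * (2 * envelope z + normc (remainder z)).
Proof.
have -> : remainder z = U z - (slow z + fast z) by rewrite /remainder opprD addrA.
apply: cub_diff; apply: (le_trans (normcDle _ _)).
by rewrite normc_slow normc_fast.
Qed.

Lemma fourier_expi (l k : int) : fourier (@expi R l) k = (k == l)%:R.
Proof.
rewrite -(profile_wave l k (0 : R)) /profile mulr0 cis0 mul1r; apply: eq_fourier => x _.
by rewrite /wave /= mulr0 oppr0 cis0 mul1r.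
Qed.

Lemma profile_fast k t : profile fast k t = c%:C * cis (psi t) * (k == n)%:R.
Proof.
have mT := @measurable_torus R.
rewrite -(profile_wave n k t) /profile (fourierZ (c%:C * cis (psi t)) (f := fun x => wave (n, n ^+
  2) (t, x))); last first.
  apply: (CL2_cintegrable mT); first exact: leb_torus_lty.
  by apply: (CL2_bounded (M := 1) mT) => [||x _]; [exact: leb_torus_lty|
    exact: (cmeasurableM (cmeasurable_cst torus (cis (- ((n ^+ 2)%:~R * t)))) (measurable_expi n
      torus))|rewrite normc_wave].
by rewrite mulrCA.
Qed.

Lemma profile_remainder k t : 0 <= t -> t <= tau ->
  profile remainder k t = profile U k t - cis (theta * t) * profile V k t -
    c%:C * cis (psi t) * (k == n)%:R.
Proof.
move=> t0 tt; have mT := @measurable_torus R; have Too := @leb_torus_lty R.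
have [_ _ sV _] := VS; have [_ _ sU _] := US.
have VI := CL2_cintegrable mT Too (sV t t0 tt); have UI := CL2_cintegrable mT Too (sU t t0 tt).
have fI := CL2_cintegrable mT Too (slice_fast t).
have sI : cintegrable leb torus (fun x => slow (t, x)).
  exact: (cintegrableZ mT (cis (theta * t)) VI).
rewrite -profile_fast /profile.
rewrite (fourierB (f := fun x => U (t, x) - slow (t, x)) (g := fun x => fast (t, x)))//; last first.
  exact: cintegrableB.
rewrite (fourierB (f := fun x => U (t, x)) (g := fun x => slow (t, x)))//.
rewrite (fourierZ (cis (theta * t)) (f := fun x => V (t, x)))//.
by rewrite !mulrBr; congr (_ - _ - _); rewrite mulrCA.
Qed.

(** [rotation_product] differentiates the rotation of [V], and the fundamental theorem of calculus
    the phase [psi]. At time 0 the wave in the datum of [U] cancels [fast], so that the remainder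
    starts from 0. *)
Lemma remainder_duhamel k t : 0 <= t -> t <= tau ->
  [/\ cintegrable PM (strip 0 t) cubic_defect, cintegrable PM (strip 0 t) resonance_defect &
   profile remainder k t = 'i%C * gamma%:C *
    (cint leb `[0, t] (profile cubic_defect k) + cint leb `[0, t] (profile resonance_defect k))].
Proof.
move=> t0 tt; have mT := @measurable_torus R; have Too := @leb_torus_lty R.
have mI := @measurable_itvT R `[0, t]; have mSt := mS t.
have [mV V4 sV VE] := VS; have [mU U4 sU UE] := US.
have ss : (strip 0 t : set (TR * TR)) `<=` strip 0 tau by exact: strip_subset.
have mS' (F : TR * TR -> R[i]) : cmeasurable (strip 0 tau) F -> cmeasurable (strip 0 t) F.
  by move=> mF; apply: cmeasurableS mF => //; exact: mS.
have V4' := rint_strip_sub (lexx 0) tt V4; have U4' := rint_strip_sub (lexx 0) tt U4.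
have CUI := cub_integrable (mS' _ mU) U4'; have CVI := cub_integrable (mS' _ mV) V4'.
have VI : cintegrable PM (strip 0 t) V.
  apply: (@cint_strip_pow4 _ V 1 _ _ 1 _ (mS' _ mV) V (mS' _ mV) V4') => // z _.
  by rewrite mul1r expr1.
have WI : cintegrable PM (strip 0 t) (wave (n, n ^+ 2)).
  apply: (cintegrable_bounded (M := 1) mSt); first exact: PM_strip_lty.
    exact: measurable_wave.
  by move=> z _; rewrite normc_wave.
have mw : cmeasurable (strip 0 tau) (fun z => slow z + fast z).
  by apply: cmeasurableD; [exact: measurable_slow|exact: measurable_fast].
have w4 : rint PM (strip 0 t) (fun z => normc (slow z + fast z) ^+ 4).
  apply: (rint_le mSt (g := fun z => envelope z ^+ 4)).
  - by apply: measurable_funX; apply: measurable_normc; exact: mS'.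
  - move=> z _; rewrite ger0_norm ?pow4_ge0// lerXn2r ?nnegrE ?addr_ge0 ?normc_ge0//.
    by apply: (le_trans (normcDle _ _)); rewrite normc_slow normc_fast.
  - exact: rint_strip_sub envelope_pow4.
have CDI : cintegrable PM (strip 0 t) cubic_defect.
  by apply: cintegrableB => //; apply: cub_integrable w4; exact: mS'.
pose f1 s := cis (theta * s) : R[i].
pose f2 s := (2 * c ^+ 2)%:C * cis (theta * s) : R[i].
pose f3 s := ((2 * m s + c ^+ 2) * c)%:C * cis (psi s) : R[i].
have [Mb HM] := m_bounded.
have mf3 : cmeasurable (`[0, t] : set TR) f3.
  apply: cmeasurableM; last first.
    by apply: cmeasurable_cis; apply: measurable_funS mpsi => //; exact: sub_itv.
  apply: cmeasurableR; apply: measurable_funM => //; apply: measurable_funD => //.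
  by apply: measurable_funM => //; apply: measurable_funS mm => //; exact: sub_itv.
have f1_le s : 0 <= s -> s <= t -> normc (f1 s) <= 1 by rewrite normc_cis.
have f2_le s : 0 <= s -> s <= t -> normc (f2 s) <= `|2 * c ^+ 2|.
  by rewrite normcME normc_cis mulr1 normcR.
have f3_le s : 0 <= s -> s <= t -> normc (f3 s) <= (2 * Mb + c ^+ 2) * c.
  move=> s0 st; rewrite normcME normc_cis mulr1 normcR normrM (ger0_norm c0) ler_wpM2r//.
  apply: (le_trans (ler_normD _ _)); rewrite (ger0_norm (sqr_ge0 c)) lerD2r normrM ger0_norm//.
  by rewrite ler_wpM2l// HM// (le_trans st).
have mf1 : cmeasurable (`[0, t] : set TR) f1 by exact: mcis_th.
have mf2 : cmeasurable (`[0, t] : set TR) f2 by apply: cmeasurableM; [exact: cmeasurable_cst|exact: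
  mcis_th].
have [D1I D1E] := cint_profile_modulated k mf1 f1_le CVI.
have [D2I D2E] := cint_profile_modulated k mf2 f2_le VI.
have [D3I D3E] := cint_profile_modulated k mf3 f3_le WI.
have RDE : resonance_defect = fun z => (cub (U z) - (f1 z.1 * cub (V z) +
    (f2 z.1 * V z + f3 z.1 * wave (n, n ^+ 2) z))) - cubic_defect z.
  by apply/funext => z; rewrite -defect_sum addrAC subrr add0r.
have D23 := cintegrableD mSt D2I D3I; have D123 := cintegrableD mSt D1I D23.
have DI := cintegrableB mSt CUI D123.
have RDI : cintegrable PM (strip 0 t) resonance_defect by rewrite RDE; exact: cintegrableB.
split; [exact: CDI|exact: RDI|rewrite -(cint_profileD k CDI RDI)].
have -> : profile (fun z => cubic_defect z + resonance_defect z) k =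
    profile (fun z => cub (U z) + - (f1 z.1 * cub (V z) + (f2 z.1 * V z + f3 z.1 * wave (n, n ^+ 2)
      z))) k.
  by congr profile; apply/funext => z; exact: defect_sum.
rewrite (cint_profileD k CUI (cintegrableN mSt D123)).
rewrite (cint_profileN k D123) (cint_profileD k D1I D23) (cint_profileD k D2I D3I) D1E D2E D3E.
have [CVP _] := cint_profile k CVI.
have gI : cintegrable leb `[0, t] (fun s => 'i%C * gamma%:C * profile (fun z => cub (V z)) k s).
  exact: cintegrableZ.
have := rotation_product theta (fourier u0 k) t0 gI.
have VE' s : 0 <= s -> s <= t -> fourier u0 k + cint leb `[0, s] (fun s =>
    'i%C * gamma%:C * profile (fun z => cub (V z)) k s) = profile V k s.
  move=> s0 st; rewrite (VE k s s0 (le_trans st tt)) cintZ; first by [].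
    exact: measurable_itvT.
  exact: cintegrable_sub_itv CVP.
rewrite (VE' t t0 (lexx t)) => ROT.
rewrite (profile_remainder k t0 tt) ROT (UE k t t0 tt).
have -> : fourier (fun x => u0 x + c%:C * expi n x) k = fourier u0 k + c%:C * (k == n)%:R.
  have u0I := CL2_cintegrable mT Too u0L2.
  have eI := CL2_cintegrable mT Too (@CL2_expi R n).
  have -> : (fun x => u0 x + c%:C * expi n x) = (fun x => u0 x - (- c%:C) * expi n x).
    by apply/funext => x; rewrite mulNr opprK.
  rewrite (fourierB k u0I (cintegrableZ mT (- c%:C) eI)).
  by rewrite (fourierZ (- c%:C) k eI) fourier_expi mulNr opprK.
have FTC : cint leb `[0, t] (fun s => f3 s * profile (wave (n, n ^+ 2)) k s) * ('i%C * gamma%:C) =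
    c%:C * (k == n)%:R * (cis (psi t) - 1).
  have cg : continuous (fun s => gamma * (2 * m s + c ^+ 2)).
    move=> s; apply: cvgM; first exact: cvg_cst.
    apply: cvgD; last exact: cvg_cst.
    by apply: cvgM; [exact: cvg_cst|exact: cm].
  have FT : cint leb `[0, t] (fun s => 'i%C * (gamma * (2 * m s + c ^+ 2))%:C * cis (psi s)) =
      cis (psi t) - 1.
    have -> : 1 = cis (psi 0) :> R[i] by rewrite psi0 cis0.
    by apply: (cis_FTC t0 cg) => s; rewrite in_itv/= => /andP[s0 _]; exact: dpsi.
  have cpsi : {within `[0, t], continuous psi}.
    by apply: continuous_subspaceW continuous_psi; exact: sub_itv.
  have fI : cintegrable leb `[0, t] (fun s => 'i%C * (gamma * (2 * m s + c ^+ 2))%:C * cis (psi s)).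
    apply: (cintegrable_bounded (M := `|gamma| * (2 * Mb + c ^+ 2)) mI); first exact: leb_itv_lty.
      apply: cmeasurableM; last by apply: cmeasurable_cis; apply: measurable_funS mpsi => //;
        exact: sub_itv.
      apply: cmeasurableM; first exact: cmeasurable_cst.
      apply: cmeasurableR; apply: measurable_funM => //; apply: measurable_funD => //.
      by apply: measurable_funM => //; apply: measurable_funS mm => //; exact: sub_itv.
    move=> s; rewrite /= in_itv/= => /andP[s0 st].
    rewrite 2!normcME normc_cis normc_i mulr1 mul1r normcR normrM ler_wpM2l//.
    apply: (le_trans (ler_normD _ _)); rewrite (ger0_norm (sqr_ge0 c)) lerD2r normrM ger0_norm//.
    by rewrite ler_wpM2l// HM// (le_trans st).
  rewrite -FT -(cintZ mI _ fI); have f3I : cintegrable leb `[0, t] (fun s => f3 s * profile (wave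
    (n, n ^+ 2)) k s).
    have [PWI _] := cint_profile k WI; apply: (cintegrable_boundedM mI mf3 _ PWI) => s.
    by rewrite /= in_itv/= => /andP[s0 st]; exact: f3_le.
  rewrite -(cintZr mI _ f3I); apply: eq_cint => s _.
  rewrite profile_wave /f3 (rmorphM (real_complex R) (2 * m s + c ^+ 2)).
  rewrite (rmorphM (real_complex R) gamma) /=; move: ((2 * m s + c ^+ 2)%:C) (cis (psi s)) ((k == n)%:R).
  by move=> d e h; ring.
have MI1 : cintegrable leb `[0, t] (fun s => f1 s * profile (fun z => cub (V z)) k s).
  apply: (cintegrable_boundedM mI mf1 _ CVP) => s.
  by rewrite /= in_itv/= => /andP[s0 st]; exact: f1_le.
have MI2 : cintegrable leb `[0, t] (fun s => f2 s * profile V k s).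
  have [PVI _] := cint_profile k VI; apply: (cintegrable_boundedM mI mf2 _ PVI) => s.
  by rewrite /= in_itv/= => /andP[s0 st]; exact: f2_le.
have R1 : cint leb `[0, t] (fun s => cis (theta * s) * ('i%C * gamma%:C * profile (fun z => cub (V
  z)) k s)) =
    'i%C * gamma%:C * cint leb `[0, t] (fun s => f1 s * profile (fun z => cub (V z)) k s).
  by rewrite -(cintZ mI _ MI1); apply: eq_cint => s _; rewrite mulrCA.
have R2 : cint leb `[0, t] (fun s => 'i%C * theta%:C * (cis (theta * s) * (fourier u0 k + cint leb
  `[0, s] (fun s =>
    'i%C * gamma%:C * profile (fun z => cub (V z)) k s)))) =
    'i%C * gamma%:C * cint leb `[0, t] (fun s => f2 s * profile V k s).
  rewrite -(cintZ mI _ MI2); apply: eq_cint => s; rewrite /= in_itv/= => /andP[s0 st].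
  have -> : theta%:C = gamma%:C * (2 * c ^+ 2)%:C :> R[i].
    by rewrite -rmorphM; congr (_%:C); rewrite /theta; ring.
  rewrite (VE' s s0 st) /f2; move: (cis _) (profile V k s) (2 * c ^+ 2)%:C => d e h; ring.
rewrite R1 R2; move: FTC.
move: (cint leb `[0, t] (fun s => f1 s * _)) (cint leb `[0, t] (fun s => f2 s * _)).
move: (cint leb `[0, t] (fun s => f3 s * _)) (cint leb `[0, t] (profile _ k)).
move: (fourier u0 k) (cis (psi t)) (k == n)%:R => A B d x3 y x1 x2 FTC.
have -> : 'i%C * gamma%:C * (y - (x1 + (x2 + x3))) =
   'i%C * gamma%:C * (y - (x1 + x2)) - x3 * ('i%C * gamma%:C) by ring.
by rewrite FTC; ring.
Qed.

End ansatz.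

Section three_sources.
Context {R : realType}.
Local Notation TR := (measurableTypeR R).
Variables (p T : R) (f f1 f2 f3 g : int -> R -> R[i]) (s : seq int).
Hypothesis pT : p <= T.
Hypothesis fE : forall k t, p <= t -> t <= T -> f k t = f1 k t + f2 k t + f3 k t.
Hypotheses (I1 : forall k, cintegrable leb `[p, T] (f1 k))
  (I2 : forall k, cintegrable leb `[p, T] (f2 k)) (I3 : forall k, cintegrable leb `[p, T] (f3 k)).
Hypothesis gI : forall k, cintegrable leb `[p, T] (g k).

Lemma cint_three k t : p <= t -> t <= T -> cint leb `[p, t] (f k) =
  cint leb `[p, t] (f1 k) + cint leb `[p, t] (f2 k) + cint leb `[p, t] (f3 k).
Proof.
move=> pt tT; have mI := @measurable_itvT R `[p, t].
have J1 := cintegrable_sub_itv (lexx p) tT (I1 k).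
have J2 := cintegrable_sub_itv (lexx p) tT (I2 k).
have J3 := cintegrable_sub_itv (lexx p) tT (I3 k).
rewrite -(cintD mI J1 J2) -(cintD mI (cintegrableD mI J1 J2) J3).
by apply: eq_cint => x /=; rewrite in_itv/= => /andP[px xt]; rewrite fE// (le_trans xt).
Qed.

Lemma energy_three (e : R) : increment_energy s f1 p T <= e ->
  increment_energy s f2 p T <= e -> increment_energy s f3 p T <= e ->
  increment_energy s f p T <= 9 * e.
Proof.
move=> H1 H2 H3; apply: (@le_trans _ _ (3 * (increment_energy s f1 p T +
  increment_energy s f2 p T + increment_energy s f3 p T))); last by lra.
rewrite /increment_energy -!big_split mulr_sumr; apply: ler_sum => k _.
by rewrite (cint_three k pT (lexx T)); exact: sqr_normc3_le.
Qed.

Lemma retarded_three (e : R) : normc (retarded_form s f1 g p T) <= e ->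
  normc (retarded_form s f2 g p T) <= e -> normc (retarded_form s f3 g p T) <= e ->
  normc (retarded_form s f g p T) <= 3 * e.
Proof.
move=> H1 H2 H3; have mI := @measurable_itvT R `[p, T].
have gJ k : cintegrable leb `[p, T] (fun t => (g k t)^*%C) by exact: cintegrableJ.
have -> : retarded_form s f g p T =
    retarded_form s f1 g p T + retarded_form s f2 g p T + retarded_form s f3 g p T.
  rewrite /retarded_form -!big_split; apply: eq_bigr => k _; rewrite -[RHS]/(_ + _ + _).
  have K1 := cintegrable_primitiveM pT (I1 k) (gJ k).
  have K2 := cintegrable_primitiveM pT (I2 k) (gJ k).
  have K3 := cintegrable_primitiveM pT (I3 k) (gJ k).
  rewrite -(cintD mI K1 K2) -(cintD mI (cintegrableD mI K1 K2) K3).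
  apply: eq_cint => t tI; have /andP[pt tT] : p <= t <= T by move: tI; rewrite /= in_itv.
  by rewrite cint_three// !mulrDl.
apply: (le_trans (normcDle _ _)); apply: (le_trans (lerD (normcDle _ _) H3)).
by apply: (le_trans (lerD (lerD H1 H2) (lexx _))); lra.
Qed.

End three_sources.

(** The frequency is [l * (2 N + l)]: only the mode [l = 0] is resonant, and the mean of the
    corresponding source vanishes. *)
Lemma resonance1 (N B : nat) (l : int) : l != 0 -> (B + `|l| + 1 <= N)%N ->
  (B < `|((N%:Z + l) ^+ 2 - N%:Z ^+ 2)%R|)%N.
Proof.
move=> l0 NB; have -> : (N%:Z + l) ^+ 2 - N%:Z ^+ 2 = l * (N%:Z + N%:Z + l) by ring.
rewrite abszM; apply: (@leq_trans (1 * `|N%:Z + N%:Z + l|)); first by lia.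
by apply: leq_mul => //; lia.
Qed.

(** The frequency is a square plus [N^2], so no mode is resonant. *)
Lemma resonance2 (N B : nat) (l : int) : (B + 1 <= N)%N ->
  (B < `|((- N%:Z + l) ^+ 2 - - N%:Z ^+ 2)%R|)%N.
Proof.
move=> NB; have : 0 <= (- N%:Z + l) ^+ 2 by exact: sqr_ge0.
by move: ((- N%:Z + l) ^+ 2) => y y0; nia.
Qed.

(** The frequency is [2 (N + l)^2 - l^2], which grows with [N] for each fixed mode. *)
Lemma resonance3 (N B : nat) (l : int) : (B + `|l| + `|l| ^ 2 + 1 <= N)%N ->
  (B < `|((N%:Z + N%:Z + l) ^+ 2 - (N%:Z ^+ 2 + N%:Z ^+ 2))%R|)%N.
Proof.
move=> NB; have -> : (N%:Z + N%:Z + l) ^+ 2 - (N%:Z ^+ 2 + N%:Z ^+ 2) =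
  2 * (N%:Z + l) ^+ 2 - l ^+ 2 by ring.
have H1 : (N%:Z + l) <= (N%:Z + l) ^+ 2 by nia.
have H2 : l ^+ 2 = (`|l| ^ 2)%N%:Z by lia.
by move: H1; rewrite H2; move: ((N%:Z + l) ^+ 2) => y; lia.
Qed.

(** * The three oscillating sources *)

Section resonances.
Context {R : realType}.
Local Notation TR := (measurableTypeR R).
Local Notation PM := (@lebesgue_measure R \x @lebesgue_measure R)%E.

Lemma Rint_torus_cst (r : R) : \int[leb]_(_ in torus) r = 2 * pi * r.
Proof.
rewrite torusE Rint_itv_cst; first by rewrite add0r subr0 mulrC.
by rewrite lerDl ltW// pi2_gt0.
Qed.

Lemma CL2_strip_sub (F : TR * TR -> R[i]) p q p' q' : p <= p' -> q' <= q ->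
  CL2 PM (strip p q) F -> CL2 PM (strip p' q') F.
Proof.
move=> pp qq [mF F2]; split; last exact: rint_strip_sub F2.
apply: cmeasurableS mF; first exact: measurable_strip.
by move=> z [/= H1 H2]; split => //; move: H1; apply: subset_itv; rewrite bnd_simp.
Qed.

Variables (gamma tau c : R) (u0 : R -> R[i]) (V : TR * TR -> R[i]) (m psi : R -> R).
Hypotheses (tau0 : 0 <= tau) (c0 : 0 <= c).
Hypothesis VS : forward_solution gamma tau u0 V.
Hypothesis cm : continuous m.
Hypothesis mE : forall t, 0 <= t -> t <= tau ->
  m t = (2 * pi)^-1 * norm2 leb torus (fun x => V (t, x)).
Hypothesis dpsi : forall t : R, 0 <= t -> is_derive t 1 psi (gamma * (2 * m t + c ^+ 2)).

(** These are the amplitudes carried by the waves of frequencies [n], [2 n] and [- n]. They do not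
    depend on [n], which enters through the waves alone. *)
Definition mass_source (z : TR * TR) : R[i] :=
  (2 * c)%:C * cis (psi z.1) * (normc (V z) ^+ 2 - m z.1)%:C.
Definition sum_source (z : TR * TR) : R[i] :=
  (c ^+ 2)%:C * cis (2 * psi z.1 - theta gamma c * z.1) * (V z)^*%C.
Definition diff_source (z : TR * TR) : R[i] :=
  c%:C * cis (2 * (theta gamma c * z.1) - psi z.1) * V z ^+ 2.

Lemma resonance_defectE n z : resonance_defect gamma c V m psi n z =
  wave (n, n ^+ 2) z * mass_source z + wave (- n, - n ^+ 2) z * diff_source z +
  wave (n + n, n ^+ 2 + n ^+ 2) z * sum_source z.
Proof.
have w2 : wave (n + n, n ^+ 2 + n ^+ 2) z = wave (n, n ^+ 2) z ^+ 2 :> R[i].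
  by rewrite [RHS]expr2 waveD.
have wJ : wave (- n, - n ^+ 2) z = (wave (n, n ^+ 2) z)^*%C :> R[i] by rewrite waveJ.
have p2 x : cis (2 * x) = cis x ^+ 2 :> R[i] by rewrite expr2 -cisD; congr cis; ring.
rewrite w2 wJ /mass_source /sum_source /diff_source /resonance_defect /fast /slow.
have E2 : (2 * c)%:C = 2 * c%:C :> R[i] by rewrite rmorphM rmorph_nat.
have E3 : (c ^+ 2)%:C = c%:C ^+ 2 :> R[i] by rewrite rmorphXn.
rewrite !cisD !cisN !p2 !conjcM !conjcRE E2 E3.
move: (wave (n, n ^+ 2) z) (cis (psi z.1)) (cis (theta gamma c * z.1)) (V z) => w P Q v.
move: (w^*%C) (P^*%C) (Q^*%C) (v^*%C) ((normc v ^+ 2 - m z.1)%:C) => w' P' Q' v' h.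
ring.
Qed.

Let mS := measurable_strip 0 tau.
Let mV : cmeasurable (strip 0 tau) V. Proof. by have [] := VS. Qed.
Let V4 : rint PM (strip 0 tau) (fun z => normc (V z) ^+ 4). Proof. by have [] := VS. Qed.
Let mpsi : measurable_fun (strip 0 tau) (fun z : TR * TR => psi z.1).
Proof.
apply: measurable_strip_time; apply: subspace_continuous_measurable_fun.
  exact: measurable_itvT.
exact: (continuous_psi dpsi).
Qed.
Let mm : measurable_fun (strip 0 tau) (fun z : TR * TR => m z.1).
Proof.
apply: measurable_strip_time; apply: subspace_continuous_measurable_fun.
  exact: measurable_itvT.
exact: continuous_subspaceT.
Qed.

Let mth : measurable_fun (strip 0 tau) (fun z : TR * TR => theta gamma c * z.1).
Proof.
apply: measurable_funM; first exact: measurable_cst.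
exact: (measurable_funS measurableT (@subsetT _ _) measurable_fst).
Qed.

Lemma CL2_mass_source : CL2 PM (strip 0 tau) mass_source.
Proof.
have [M HM] := m_bounded tau0 cm.
apply: (CL2_le mS (g := fun z => 8 * c ^+ 2 * (normc (V z) ^+ 4 + M ^+ 2))).
- apply: cmeasurableM.
    by apply: cmeasurableM; [exact: cmeasurable_cst|exact: cmeasurable_cis].
  apply: cmeasurableR; apply: measurable_funB => //.
  by apply: measurable_funX; exact: measurable_normc.
- move=> [t x] [/= + _]; rewrite in_itv/= => /andP[t0 tt].
  rewrite /mass_source !normcME normc_cis mulr1 !normcR exprMn !real_normK ?num_real//.
  have HM2 : m t ^+ 2 <= M ^+ 2.
    rewrite -[leLHS](@real_normK R (m t)) ?num_real// lerXn2r ?nnegrE ?HM//.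
    by apply: le_trans (HM t t0 tt).
  have -> : normc (V (t, x)) ^+ 4 = (normc (V (t, x)) ^+ 2) ^+ 2 by rewrite -exprM.
  move: (normc (V (t, x)) ^+ 2) HM2 => v HM2 /=.
  have c2 := sqr_ge0 c; have : (v - m t) ^+ 2 <= 2 * (v ^+ 2 + M ^+ 2).
    by have := sqr_ge0 (v + m t); nra.
  by move=> H; have := ler_wpM2l c2 H; nra.
- by apply: rintZ => //; apply: rintD => //; apply: rint_cst => //; exact: PM_strip_lty.
Qed.

Lemma CL2_sum_source : CL2 PM (strip 0 tau) sum_source.
Proof.
apply: (CL2_le mS (g := fun z => (c ^+ 2) ^+ 2 * (1 + normc (V z) ^+ 4))).
- apply: cmeasurableM; last exact: cmeasurableJ.
  apply: cmeasurableM; first exact: cmeasurable_cst.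
  by apply: cmeasurable_cis; apply: measurable_funB => //; exact: measurable_funM.
- move=> z _; rewrite /sum_source !normcME normc_cis mulr1 normcR normcJE exprMn.
  rewrite ger0_norm ?sqr_ge0//; apply: ler_wpM2l; first exact: sqr_ge0.
  have -> : normc (V z) ^+ 4 = (normc (V z) ^+ 2) ^+ 2 by rewrite -exprM.
  by move: (normc (V z) ^+ 2) => v; nra.
- by apply: rintZ => //; apply: rintD => //; apply: rint_cst => //; exact: PM_strip_lty.
Qed.

Lemma CL2_diff_source : CL2 PM (strip 0 tau) diff_source.
Proof.
apply: (CL2_le mS (g := fun z => c ^+ 2 * normc (V z) ^+ 4)).
- apply: cmeasurableM; last exact: cmeasurableM.
  apply: cmeasurableM; first exact: cmeasurable_cst.
  by apply: cmeasurable_cis; apply: measurable_funB => //; exact: measurable_funM.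
- move=> z _; rewrite /diff_source (normcME (c%:C * _)) (normcME c%:C) normc_cis mulr1 normcR.
  have -> : normc (V z ^+ 2) = normc (V z) ^+ 2 by rewrite [V z ^+ 2]expr2 normcME -expr2.
  by rewrite ger0_norm// exprMn -exprM.
- exact: rintZ.
Qed.

Let sV t : 0 <= t -> t <= tau -> CL2 leb torus (fun x => V (t, x)).
Proof. by have [_ _ + _] := VS; exact. Qed.
Let mT := @measurable_torus R.
Let Too := @leb_torus_lty R.

Lemma slice_mass_source t : 0 <= t -> t <= tau -> cintegrable leb torus (fun x => mass_source (t, x)).
Proof.
move=> t0 tt; have [_ V2] := sV t0 tt.
have I : rint leb torus (fun x => normc (V (t, x)) ^+ 2 - m t).
  by apply: rintB => //; exact: rint_cst.
exact: (cintegrableZ mT ((2 * c)%:C * cis (psi t)) (cintegrableR I)).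
Qed.

Lemma slice_sum_source t : 0 <= t -> t <= tau -> cintegrable leb torus (fun x => sum_source (t, x)).
Proof.
move=> t0 tt; have VI := CL2_cintegrable mT Too (sV t0 tt).
exact: (cintegrableZ mT ((c ^+ 2)%:C * cis (2 * psi t - theta gamma c * t)) (cintegrableJ mT VI)).
Qed.

Lemma slice_diff_source t : 0 <= t -> t <= tau -> cintegrable leb torus (fun x => diff_source (t, x)).
Proof.
move=> t0 tt.
exact: (cintegrableZ mT (c%:C * cis (2 * (theta gamma c * t) - psi t)) (CL2_prod mT (sV t0 tt) (sV
  t0 tt))).
Qed.

(** This is the effect of choosing [m] as the mean of [|V|^2] in the phase [psi]: the one resonant
    mode is empty. *)
Lemma fourier_mass_source t : 0 <= t -> t <= tau -> fourier (fun x => mass_source (t, x)) 0 = 0.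
Proof.
move=> t0 tt; have [_ V2] := sV t0 tt; have p2 := @pi2_gt0 R.
have I : rint leb torus (fun x => normc (V (t, x)) ^+ 2 - m t).
  by apply: rintB => //; exact: rint_cst.
rewrite /mass_source (fourierZ ((2 * c)%:C * cis (psi t)) 0 (cintegrableR I)).
rewrite /fourier cintegralE (@eq_cint _ _ _ leb torus _ (fun x => (normc (V (t, x)) ^+ 2 - m
  t)%:C)); last first.
  by move=> x _; rewrite mul0r oppr0 cis0 mul1r.
rewrite cintR RintegralB//; last exact: rint_cst.
rewrite -norm2E Rint_torus_cst.
by rewrite (mE t0 tt) mulVKf ?gt_eqF// subrr !mulr0.
Qed.

Let waveI Z p q (mn : int * int) : CL2 PM (strip p q) Z ->
  cintegrable PM (strip p q) (fun z => wave mn z * Z z).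
Proof.
move=> Z2; have mS' := measurable_strip p q.
apply: (cintegrable_boundedM (M := 1) mS'); first exact: measurable_wave.
  by move=> z _; rewrite normc_wave.
by apply: CL2_cintegrable => //; exact: PM_strip_lty.
Qed.

Lemma profile_resonance_defect n k t : 0 <= t -> t <= tau ->
  profile (resonance_defect gamma c V m psi n) k t =
  profile (fun z => wave (n, n ^+ 2) z * mass_source z) k t +
  profile (fun z => wave (- n, - n ^+ 2) z * diff_source z) k t +
  profile (fun z => wave (n + n, n ^+ 2 + n ^+ 2) z * sum_source z) k t.
Proof.
move=> t0 tt; pose wz (mn : int * int) (Z : TR * TR -> R[i]) x := wave mn (t, x) * Z (t, x).
have wI mn Z : cintegrable leb torus (fun x => Z (t, x)) -> cintegrable leb torus (wz mn Z).
  move=> ZI; apply: (cintegrable_boundedM (M := 1) mT _ _ ZI); last by move=> x _; rewrite normc_wave.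
  exact: (cmeasurableM (cmeasurable_cst torus (cis (- (mn.2%:~R * t)))) (measurable_expi mn.1 torus)).
have W1 := wI (n, n ^+ 2) _ (slice_mass_source t0 tt).
have W2 := wI (- n, - n ^+ 2) _ (slice_diff_source t0 tt).
have W3 := wI (n + n, n ^+ 2 + n ^+ 2) _ (slice_sum_source t0 tt).
rewrite /profile -!(mulrDr (cis (k%:~R ^+ 2 * t))); congr (_ * _).
rewrite (eq_fourier (g := fun x => wz (n, n ^+ 2) mass_source x - - 1 * (wz (- n, - n ^+ 2)
  diff_source x -
  - 1 * wz (n + n, n ^+ 2 + n ^+ 2) sum_source x))); last first.
  by move=> x _; rewrite resonance_defectE /wz; ring.
have J3 := cintegrableZ mT (- 1) W3; have J23 := cintegrableB mT W2 J3.
rewrite (fourierB k W1 (cintegrableZ mT (- 1) J23)) (fourierZ (- 1) k J23) (fourierB k W2 J3).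
by rewrite (fourierZ (- 1) k W3) !mulN1r !opprK addrA.
Qed.

Lemma resonance_source p q : 0 <= p -> p <= q -> q <= tau -> q <= p + 1 ->
  forall d, 0 < d -> exists N0 : nat, forall N : nat, (N0 <= N)%N ->
  forall T s, p <= T -> T <= q -> uniq s ->
    increment_energy s (profile (resonance_defect gamma c V m psi N)) p T <= d ^+ 2 /\
    forall G beta, cubic_bound (strip p T) G beta ->
      normc (retarded_form s (profile (resonance_defect gamma c V m psi N)) (profile G) p T) <= d * beta.
Proof.
move=> p0 pq qt qp d d0.
(* Three sources of size [e] add up to an energy of at most [9 * e] and a pairing of at most
   [3 * e]. *)
pose e : R := Num.min (d ^+ 2 / 9) (d / 3).
have e0 : 0 < e by rewrite lt_min !divr_gt0// exprn_gt0.
have e1 : e <= d ^+ 2 / 9 by rewrite ge_min lexx.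
have e2 : e <= d / 3 by rewrite ge_min lexx orbT.
have e9 : 9 * e <= d ^+ 2 by lra.
have e3 : 3 * e <= d by lra.
have p21 : 1 <= 2 * pi :> R by have := @pi_ge2 R; lra.
have S1 := CL2_strip_sub p0 qt CL2_mass_source; have S2 := CL2_strip_sub p0 qt CL2_diff_source.
have S3 := CL2_strip_sub p0 qt CL2_sum_source.
have in_tau t : p <= t -> t <= q -> 0 <= t /\ t <= tau.
  by move=> pt tq; split; [exact: le_trans pt|exact: le_trans qt].
have L1 t : p <= t -> t <= q -> cintegrable leb torus (fun x => mass_source (t, x)).
  by move=> /in_tau H /H[]; exact: slice_mass_source.
have L2 t : p <= t -> t <= q -> cintegrable leb torus (fun x => diff_source (t, x)).
  by move=> /in_tau H /H[]; exact: slice_diff_source.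
have L3 t : p <= t -> t <= q -> cintegrable leb torus (fun x => sum_source (t, x)).
  by move=> /in_tau H /H[]; exact: slice_sum_source.
have R1 l : (forall t, p <= t -> t <= q -> fourier (fun x => mass_source (t, x)) l = 0) \/
    forall B : nat, exists N0, forall N : nat, (N0 <= N)%N -> (B < `|((N%:Z + l) ^+ 2 - N%:Z ^+ 2)%R|)%N.
  have [->|l0] := eqVneq l 0.
    by left=> t /in_tau H /H[t0 tt]; exact: fourier_mass_source.
  by right=> B; exists (B + `|l| + 1)%N => N NB; exact: resonance1.
have R2 l : (forall t, p <= t -> t <= q -> fourier (fun x => diff_source (t, x)) l = 0) \/
    forall B : nat, exists N0, forall N : nat, (N0 <= N)%N -> (B < `|((- N%:Z + l) ^+ 2 - - N%:Z ^+
      2)%R|)%N.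
  by right=> B; exists (B + 1)%N => N NB; exact: resonance2.
have R3 l : (forall t, p <= t -> t <= q -> fourier (fun x => sum_source (t, x)) l = 0) \/
    forall B : nat, exists N0, forall N : nat, (N0 <= N)%N ->
      (B < `|((N%:Z + N%:Z + l) ^+ 2 - (N%:Z ^+ 2 + N%:Z ^+ 2))%R|)%N.
  by right=> B; exists (B + `|l| + `|l| ^ 2 + 1)%N => N NB; exact: resonance3.
have [N1 H1] := oscillating_source (sigma := fun N => N%:Z) (omega := fun N => N%:Z ^+ 2)
  pq qp S1 L1 R1 e0.
have [N2 H2] := oscillating_source (sigma := fun N => - N%:Z) (omega := fun N => - N%:Z ^+ 2)
  pq qp S2 L2 R2 e0.
have [N3 H3] := oscillating_source (sigma := fun N => N%:Z + N%:Z)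
  (omega := fun N => N%:Z ^+ 2 + N%:Z ^+ 2) pq qp S3 L3 R3 e0.
exists (maxn N1 (maxn N2 N3)) => N; rewrite !geq_max => /andP[N1N /andP[N2N N3N]] T s pT Tq us.
have [E1 F1] := H1 N N1N T s pT Tq us; have [E2 F2] := H2 N N2N T s pT Tq us.
have [E3 F3] := H3 N N3N T s pT Tq us.
have RE k t : p <= t -> t <= T -> profile (resonance_defect gamma c V m psi N) k t =
    profile (fun z => wave (N%:Z, N%:Z ^+ 2) z * mass_source z) k t +
    profile (fun z => wave (- N%:Z, - N%:Z ^+ 2) z * diff_source z) k t +
    profile (fun z => wave (N%:Z + N%:Z, N%:Z ^+ 2 + N%:Z ^+ 2) z * sum_source z) k t.
  by move=> pt tT; have [a b] := in_tau t pt (le_trans tT Tq); exact: profile_resonance_defect.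
have PI Z mn k : CL2 PM (strip p q) Z -> cintegrable leb `[p, T] (profile (fun z => wave mn z * Z z) k).
  move=> Z2; have [I _] := cint_profile k (waveI mn (CL2_strip_sub (lexx p) Tq Z2)).
  exact: I.
have I1 k := PI _ (N%:Z, N%:Z ^+ 2) k S1; have I2 k := PI _ (- N%:Z, - N%:Z ^+ 2) k S2.
have I3 k := PI _ (N%:Z + N%:Z, N%:Z ^+ 2 + N%:Z ^+ 2) k S3.
split.
  exact: le_trans (energy_three pT RE I1 I2 I3 E1 E2 E3) e9.
move=> G beta cG.
have Tp2 : T <= p + 2 * pi by apply: (le_trans Tq); apply: (le_trans qp); rewrite lerD2l.
have [GI b0 _] := cubic_bound_energy Tp2 us cG.
have gI k : cintegrable leb `[p, T] (profile G k) by have [] := cint_profile k GI.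
apply: (le_trans (retarded_three pT RE I1 I2 I3 gI (F1 G beta cG) (F2 G beta cG) (F3 G beta cG))).
by rewrite mulrA ler_wpM2r ?(ltW b0).
Qed.

End resonances.

(** * Convergence of the Fourier coefficients *)

Lemma small_square (R : realType) (A : R) : 0 <= A -> exists2 x : R, 0 < x & A * x ^+ 2 <= 1 / 4.
Proof.
move=> A0; have A1 : 0 < A + 1 by lra.
exists (1 / (4 * (A + 1))); first by rewrite divr_gt0// mulr_gt0.
set x := 1 / _; have x0 : 0 <= x by rewrite divr_ge0// mulr_ge0// ltW.
have x1 : x * (4 * (A + 1)) = 1 by rewrite /x divfK// gt_eqF// mulr_gt0.
nra.
Qed.

(** [K * d] is the [rho1] of the bootstrap. As [d <= 1], the whole energy bound is at most
    [B * d ^+ 2] with [B] independent of [d], hence at most [eps] for [d] small. *)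
Lemma bootstrap_target (R : realType) (g eta rho0 eps : R) : 0 <= g -> 0 < eta -> 0 < rho0 -> 0 < eps ->
  exists2 d : R, 0 < d & 2 * (2 * pi * (d + g * d)) < rho0 /\
    3 * (d ^+ 2 + g ^+ 2 * (2 * (2 * pi * (d + g * d)) *
      (4 * eta + 2 * (2 * (2 * pi * (d + g * d)))) * (4 * eta + 2 * (2 * (2 * pi * (d + g * d))))) ^+ 2 +
      g ^+ 2 * d ^+ 2) <= eps.
Proof.
move=> g0 e0 r0 ep0; pose K : R := 2 * (2 * pi * (1 + g)).
have K0 : 0 < K by rewrite /K; do 2! (apply: mulr_gt0 => //; try exact: pi2_gt0); lra.
pose B : R := 3 * (1 + g ^+ 2 * (K * (4 * eta + 2 * K) * (4 * eta + 2 * K)) ^+ 2 + g ^+ 2).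
have B0 : 0 < B.
  by rewrite /B mulr_gt0// ltr_wpDr ?sqr_ge0// ltr_wpDr// mulr_ge0 ?sqr_ge0.
pose d : R := Num.min 1 (Num.min (rho0 / (2 * K)) (eps / B)).
have d0 : 0 < d by rewrite !lt_min ltr01 !divr_gt0// mulr_gt0.
have d1 : d <= 1 by rewrite ge_min lexx.
have d2 : d <= rho0 / (2 * K) by rewrite !ge_min lexx !orbT.
have d3 : d <= eps / B by rewrite !ge_min lexx !orbT.
have KE : 2 * (2 * pi * (d + g * d)) = K * d by rewrite /K; ring.
exists d => //; rewrite KE; split.
  move: d2; rewrite ler_pdivlMr; last exact: (mulr_gt0 _ K0).
  move=> d2.
  by have := mulr_gt0 K0 d0; lra.
have dd : d ^+ 2 <= d by rewrite expr2 ler_piMr// ltW.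
have Kd : K * d <= K by rewrite ler_piMr// ltW.
have Kd0 : 0 <= K * d by rewrite mulr_ge0// ltW.
have h : 0 <= 4 * eta + 2 * (K * d) by rewrite addr_ge0// mulr_ge0// ltW.
have h2 : 4 * eta + 2 * (K * d) <= 4 * eta + 2 * K by lra.
have h3 : K * d * (4 * eta + 2 * (K * d)) * (4 * eta + 2 * (K * d)) <=
   d * (K * (4 * eta + 2 * K) * (4 * eta + 2 * K)).
  rewrite [X in _ <= X](_ : _ = K * d * (4 * eta + 2 * K) * (4 * eta + 2 * K)); last by ring.
  by apply: ler_pM => //; [rewrite mulr_ge0|apply: ler_pM].
have h4 : (K * d * (4 * eta + 2 * (K * d)) * (4 * eta + 2 * (K * d))) ^+ 2 <=
   d ^+ 2 * (K * (4 * eta + 2 * K) * (4 * eta + 2 * K)) ^+ 2.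
  have P0 := mulr_ge0 (mulr_ge0 Kd0 h) h.
  by rewrite -exprMn lerXn2r ?nnegrE// (le_trans P0).
have h5 : B * d <= eps by move: d3; rewrite ler_pdivlMr// mulrC.
apply: (le_trans _ h5); apply: (@le_trans _ _ (B * d ^+ 2)); last by rewrite ler_wpM2l// ltW.
have gg : 0 <= g ^+ 2 := sqr_ge0 g; have := ler_wpM2l gg h4.
move: (g ^+ 2 * (_ ^+ 2)) => y hy; rewrite /B.
move: hy; move: (_ ^+ 2) (g ^+ 2) (d ^+ 2) => x u v hy.
lra.
Qed.

(** * Propagation of the smallness of the remainder *)

Section convergence.
Context {R : realType}.
Local Notation TR := (measurableTypeR R).
Local Notation PM := (@lebesgue_measure R \x @lebesgue_measure R)%E.

Variables (gamma tau c : R) (u0 : R -> R[i]) (V : TR * TR -> R[i]) (U : nat -> TR * TR -> R[i]).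
Variables (m psi : R -> R).
Hypotheses (tau0 : 0 <= tau) (c0 : 0 <= c) (u0L2 : CL2 leb torus u0).
Hypothesis VS : forward_solution gamma tau u0 V.
Hypothesis US : forall N : nat, forward_solution gamma tau (fun x => u0 x + c%:C * expi N x) (U N).
Hypothesis cm : continuous m.
Hypothesis mE : forall t, 0 <= t -> t <= tau ->
  m t = (2 * pi)^-1 * norm2 leb torus (fun x => V (t, x)).
Hypothesis psi0 : psi 0 = 0.
Hypothesis dpsi : forall t : R, 0 <= t -> is_derive t 1 psi (gamma * (2 * m t + c ^+ 2)).

Let rem N := remainder gamma c V (U N) psi N.

(* The sum over finite families stands for the squared L^2 norm at time [T]. *)
Definition vanishing T := forall eps : R, 0 < eps -> exists N0 : nat, forall N : nat, (N0 <= N)%N ->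
  forall s : seq int, uniq s -> \sum_(k <- s) normc (profile (rem N) k T) ^+ 2 <= eps.

Lemma vanishing0 : vanishing 0.
Proof.
move=> eps e0; exists 0%N => N _ s us; rewrite big1 ?(ltW e0)// => k _.
have [_ _ ->] := remainder_duhamel tau0 c0 u0L2 VS (US N) cm psi0 dpsi k (lexx 0) tau0.
by rewrite !cint_itv1 addr0 mulr0; apply/eqP; rewrite sqrf_eq0 normc_eq0.
Qed.

Variables (eta rho0 : R).
Hypotheses (eta0 : 0 < eta) (rho0_gt0 : 0 < rho0).
Hypothesis eta_small : 960 * (2 * pi) * `|gamma| * eta ^+ 2 <= 1 / 4.
Hypothesis rho0_small : 240 * (2 * pi) * `|gamma| * rho0 ^+ 2 <= 1 / 4.

(** The target [eps] fixes [d], and only then is [N] taken large enough for the remainder at [p] and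
    the sources to be below [d]; [eta] and [rho0] do not change with the interval. *)
Lemma vanishing_step p q : 0 <= p -> p <= q -> q <= tau -> q <= p + 1 ->
  \int[PM]_(z in strip p q) (envelope c V z ^+ 4) <= eta ^+ 4 -> vanishing p -> vanishing q.
Proof.
move=> p0 pq qt qp wE vp eps e0.
have [d d0 [d1 d2]] := bootstrap_target (normr_ge0 gamma) eta0 rho0_gt0 e0.
have [N1 H1] := vp _ (exprn_gt0 2 d0).
have [N2 H2] := resonance_source tau0 c0 VS cm mE dpsi p0 pq qt qp d0.
exists (maxn N1 N2) => N; rewrite geq_max => /andP[N1N N2N] s us.
apply: le_trans d2.
have ss : (strip p q : set (TR * TR)) `<=` strip 0 tau.
  by move=> z [/= h1 h2]; split => //; move: h1; apply: subset_itv; rewrite bnd_simp.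
have mS0 := measurable_strip 0 tau.
have q0 : 0 <= q by exact: le_trans pq.
have pt : p <= tau by exact: le_trans qt.
apply: (@bootstrap_energy R gamma eta rho0 p q d (rem N) (cubic_defect gamma c V (U N) psi N)
   (resonance_defect gamma c V m psi N) (envelope c V)) => //.
- exact: cmeasurableS mS0 ss (measurable_remainder VS (US N) dpsi).
- exact: rint_strip_sub p0 qt (remainder_pow4 c0 VS (US N) dpsi).
- move=> t pt' tq; have t0 := le_trans p0 pt'; have tt := le_trans tq qt.
  exact: (@slice_remainder R gamma tau c u0 V (U N) psi N c0 VS (US N) t t0 tt).
- exact: measurable_funS mS0 ss (measurable_envelope c VS).
- exact: rint_strip_sub p0 qt (envelope_pow4 c VS).
- exact: cmeasurableS mS0 ss (measurable_cubic_defect VS (US N) dpsi).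
- by move=> z _; exact: cubic_defect_le.
- have [_ XI _] := remainder_duhamel tau0 c0 u0L2 VS (US N) cm psi0 dpsi 0 q0 qt.
  exact: cint_strip_sub p0 (lexx q) XI.
- move=> k t pt' tq.
  have t0 : 0 <= t by exact: le_trans pt'.
  have tt : t <= tau by exact: le_trans qt.
  have [FI XI ->] := remainder_duhamel tau0 c0 u0L2 VS (US N) cm psi0 dpsi k t0 tt.
  have [_ _ ->] := remainder_duhamel tau0 c0 u0L2 VS (US N) cm psi0 dpsi k p0 pt.
  have [PF _] := cint_profile k FI; have [PX _] := cint_profile k XI.
  rewrite (cint_itv_split p0 pt' PF) (cint_itv_split p0 pt' PX).
  by rewrite -mulrDr addrACA.
- exact: H1.
- by move=> T s' pT Tq us'; exact: H2.
Qed.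

(** [H] adds elapsed time to accumulated L^4 mass, so that an increment at most [ka] makes an
    interval both short and light. The induction runs over the levels [n * ka] of [H], reached by
    continuity. *)
Lemma vanishing_end : vanishing tau.
Proof.
have mI := @measurable_itvT R `[0, tau]; have mT := @measurable_torus R.
have w4 := envelope_pow4 c VS; have [wI _ _] := fubini_rect mI mT w4.
pose w t := \int[leb]_(x in torus) (envelope c V (t, x) ^+ 4).
have w0 t : 0 <= w t by apply: Rint_ge0 => x _; exact: pow4_ge0.
pose H t := \int[leb]_(s in `[0, t]) w s + t.
have cH : {within `[0, tau], continuous H}.
  move=> t; apply: cvgD; first by apply: Rint_continuous.
  by apply: continuous_subspaceT => s; exact: cvg_id.
have HB p q : 0 <= p -> p <= q -> q <= tau ->
    H q - H p = \int[PM]_(z in strip p q) (envelope c V z ^+ 4) + (q - p).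
  move=> p0 pq qt; have [_ _ ->] := fubini_rect (@measurable_itvT R `[p, q]) mT (rint_strip_sub p0
    qt w4).
  rewrite /H (Rint_itv_split p0 pq); last exact: rint_sub_itv wI.
  by rewrite -/(w _); ring.
have I0 p q : 0 <= \int[PM]_(z in strip p q) (envelope c V z ^+ 4).
  by apply: Rint_ge0 => z _; exact: pow4_ge0.
have ndH p q : 0 <= p -> p <= q -> q <= tau -> H p <= H q.
  by move=> p0 pq qt; rewrite -subr_ge0 HB// addr_ge0// subr_ge0.
pose ka : R := Num.min 1 (eta ^+ 4).
have ka0 : 0 < ka by rewrite lt_min ltr01 exprn_gt0.
have key (n : nat) : forall t, 0 <= t -> t <= tau -> H t <= n%:R * ka -> vanishing t.
  elim: n => [|n IH] t t0 tt Ht.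
    have : t <= 0.
      have := HB 0 t (lexx 0) t0 tt; rewrite subr0 /(H 0) Rint_itv1 add0r subr0.
      by move: Ht; rewrite mul0r; have := I0 0 t; lra.
    by move=> t00; have -> : t = 0; [apply/eqP; rewrite eq_le t0 t00|exact: vanishing0].
  have [Hn|Hn] := leP (H t) (n%:R * ka); first exact: IH.
  have H00 : H 0 = 0 by rewrite /H Rint_itv1 addr0.
  have n0 : 0 <= n%:R * ka by rewrite mulr_ge0// ltW.
  have cH' : {within `[0, t], continuous H}.
    by apply: continuous_subspaceW cH; apply: subset_itv; rewrite bnd_simp.
  have [|p] := IVT t0 cH' (v := n%:R * ka).
    have h0t : H 0 <= H t by exact: ndH.
    by rewrite minEle maxEle h0t H00 n0 ltW.
  rewrite in_itv/= => /andP[p0 pt] Hp.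
  have vp : vanishing p by apply: IH => //; [exact: le_trans tt|rewrite Hp].
  have := HB p t p0 pt tt; rewrite Hp => HE.
  have HK : \int[PM]_(z in strip p t) (envelope c V z ^+ 4) + (t - p) <= ka.
    by rewrite -HE lerBlDl; move: Ht; rewrite -natr1 mulrDl mul1r.
  have k1 : ka <= 1 by rewrite ge_min lexx.
  have k2 : ka <= eta ^+ 4 by rewrite ge_min lexx orbT.
  apply: (vanishing_step p0 pt tt _ _ vp).
    by move: HK; have := I0 p t; move: (Rintegral _ _ _) => x; lra.
  by apply: le_trans k2; move: HK; move: (Rintegral _ _ _) => x; lra.
pose n := (Num.truncn (H tau / ka)).+1.
apply: (key n) => //; rewrite -ler_pdivrMr// /n ltW// truncnS_gt.
Unshelve. all: by [].
Qed.

End convergence.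

Lemma fourier_limit (R : realType) (gamma tau c : R) (u0 : R -> R[i])
    (V : measurableTypeR R * measurableTypeR R -> R[i]) U (m : R -> R) :
  0 <= tau -> 0 <= c -> CL2 leb torus u0 -> forward_solution gamma tau u0 V ->
  (forall N : nat, forward_solution gamma tau (fun x => u0 x + c%:C * expi N x) (U N)) ->
  continuous m -> (forall t, 0 <= t -> t <= tau ->
    m t = (2 * pi)^-1 * norm2 leb torus (fun x => V (t, x))) ->
  forall (k : int) (eps : R), 0 < eps -> exists N0 : nat, forall N : nat, (N0 <= N)%N ->
    normc (fourier (fun x => U N (tau, x)) k -
      cis (2 * gamma * c ^+ 2 * tau) * fourier (fun x => V (tau, x)) k) < eps.
Proof.
move=> tau0 c0 u0L2 VS US cm mE k eps e0.
have cg : continuous (fun t => gamma * (2 * m t + c ^+ 2)).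
  move=> t; apply: cvgM; first exact: cvg_cst.
  apply: cvgD; last exact: cvg_cst.
  by apply: cvgM; [exact: cvg_cst|exact: cm].
have [psi [psi0 dpsi]] := primitive_exists cg.
have p2 := @pi2_gt0 R.
have [eta eta0 eta_small] := @small_square R (960 * (2 * pi) * `|gamma|)
  (mulr_ge0 (mulr_ge0 (ler0n _ _) (ltW p2)) (normr_ge0 _)).
have [rho rho0 rho_small] := @small_square R (240 * (2 * pi) * `|gamma|)
  (mulr_ge0 (mulr_ge0 (ler0n _ _) (ltW p2)) (normr_ge0 _)).
have vt := vanishing_end tau0 c0 u0L2 VS US cm mE psi0 dpsi eta0 rho0 eta_small rho_small.
have e2 : 0 < eps / 2 by rewrite divr_gt0.
have [N0 HN0] := vt _ (exprn_gt0 2 e2).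
(* For [N] larger than [|k|] the wave has no component in the mode [k], and the remainder there is
   just the difference to be bounded. *)
exists (maxn N0 `|k|.+1) => N; rewrite geq_max => /andP[N0N kN].
have := HN0 N N0N [:: k] erefl; rewrite big_seq1.
rewrite (@profile_remainder R gamma tau c u0 V (U N) psi N c0 VS (US N) k tau tau0 (lexx tau)).
have -> : (k == N%:Z) = false by apply/eqP => kE; move: kN; rewrite kE absz_nat ltnn.
rewrite mulr0 subr0 /profile /theta; move: (fourier _ k) (fourier _ k) => y x.
have -> : cis (k%:~R ^+ 2 * tau) * x - cis (2 * gamma * c ^+ 2 * tau) * (cis (k%:~R ^+ 2 * tau) * y) =
    cis (k%:~R ^+ 2 * tau) * (x - cis (2 * gamma * c ^+ 2 * tau) * y) :> R[i] by ring.
rewrite normcME normc_cis mul1r.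
rewrite ler_sqr ?nnegrE ?normc_ge0 ?(ltW e2)//.
by move=> /le_lt_trans; apply; rewrite ltr_pdivrMr// ltr_pMr// ltr1n.
Qed.


(** * Time reversal *)

Section measure_preserving.
Context {d : measure_display} {T : measurableType d} {R : realType}.
Variable mu : {measure set T -> \bar R}.
Variable phi : T -> T.
Hypothesis mphi : measurable_fun setT phi.
Hypothesis phi_mu : forall A, measurable A -> mu (phi @^-1` A) = mu A.
Variable D : set T.
Hypothesis mD : measurable D.

Let mD' : measurable (phi @^-1` D).
Proof. by rewrite -[X in measurable X]setTI; exact: mphi. Qed.

Lemma preserving_measurable d' (T' : measurableType d') (f : T -> T') : measurable_fun D f ->
  measurable_fun (phi @^-1` D) (fun x => f (phi x)).
Proof.
move=> mf; apply: (@measurable_comp _ _ _ _ _ _ D) => //.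
  by move=> _ [x /= Dx <-].
exact: measurable_funS mphi.
Qed.

Lemma preserving_ge0_integral (f : T -> \bar R) : measurable_fun D f ->
  (forall x, D x -> (0 <= f x)%E) ->
  (\int[mu]_(x in D) f x = \int[mu]_(x in phi @^-1` D) f (phi x))%E.
Proof.
move=> mf f0; rewrite -[RHS](ge0_integral_pushforward mphi mu mD mf); last first.
  by move=> x /set_mem; exact: f0.
by apply: eq_measure_integral => //= A mA _; rewrite /pushforward; exact/esym/phi_mu.
Qed.

Lemma preserving_Rint (f : T -> R) : measurable_fun D f ->
  \int[mu]_(x in D) f x = \int[mu]_(x in phi @^-1` D) f (phi x).
Proof.
move=> mf; rewrite /Rintegral; congr fine; rewrite integralE [RHS]integralE.
have mEf : measurable_fun D (fun x => (f x)%:E) by exact/measurable_EFinP.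
rewrite (preserving_ge0_integral (measurable_funepos mEf) (fun x _ => funepos_ge0 _ x)).
rewrite (preserving_ge0_integral (measurable_funeneg mEf) (fun x _ => funeneg_ge0 _ x)).
by congr (_ - _)%E; apply: eq_integral => x _; rewrite ?funeposE ?funenegE.
Qed.

Lemma preserving_rint (f : T -> R) : rint mu D f -> rint mu (phi @^-1` D) (fun x => f (phi x)).
Proof.
move=> fI; have mf := rint_measurable fI; apply/integrableP; split.
  by apply/measurable_EFinP; exact: preserving_measurable.
rewrite -(@preserving_ge0_integral (fun x => `|(f x)%:E|%E)) //.
  by have /integrableP[] := fI.
by apply: measurableT_comp => //; exact/measurable_EFinP.
Qed.

Lemma preserving_cmeasurable (f : T -> R[i]) : cmeasurable D f ->
  cmeasurable (phi @^-1` D) (fun x => f (phi x)).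
Proof. by case=> m1 m2; split; [exact: preserving_measurable m1|exact: preserving_measurable m2]. Qed.

Lemma preserving_cint (f : T -> R[i]) : cmeasurable D f ->
  cint mu D f = cint mu (phi @^-1` D) (fun x => f (phi x)).
Proof.
by case=> m1 m2; rewrite !cintE; congr (_ +i* _); [exact: (preserving_Rint m1)|exact:
  (preserving_Rint m2)].
Qed.

End measure_preserving.

(** * Reflection of the time variable *)

Section reflection.
Context {R : realType}.
Local Notation TR := (measurableTypeR R).
Local Notation PM := (@lebesgue_measure R \x @lebesgue_measure R)%E.
Variable t0 : R.

Definition reflect (t : TR) : TR := t0 - t.
Definition reflect_time (z : TR * TR) : TR * TR := (t0 - z.1, z.2).

Lemma measurable_reflect : measurable_fun setT reflect.
Proof. by apply: measurable_funB; [exact: measurable_cst|exact: measurable_id]. Qed.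

Lemma measurable_reflect_time : measurable_fun setT reflect_time.
Proof.
apply/measurable_fun_pairP; split; last exact: measurable_snd.
by apply: measurable_funB; [exact: measurable_cst|exact: measurable_fst].
Qed.

Lemma reflect_itv a b : reflect @^-1` `[a, b] = `[t0 - b, t0 - a]%classic.
Proof.
by apply/seteqP; split => t; rewrite /reflect/= !in_itv/= => /andP[? ?]; apply/andP; split; lra.
Qed.

Lemma reflect_leb (A : set TR) : measurable A -> leb (reflect @^-1` A) = leb A.
Proof.
move=> mA; have mr := measurable_reflect.
apply/esym; apply: (lebesgue_measure_unique (mu := pushforward leb reflect)) => //= _ [[a b]] _ <-.
rewrite /pushforward/= (_ : reflect @^-1` _ = `[t0 - b, t0 - a[%classic); last first.
  by apply/seteqP; split => t; rewrite /reflect/= !in_itv/= => /andP[? ?]; apply/andP; split; lra.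
rewrite !lebesgue_measure_itv/= !lte_fin ltrD2l ltrN2; case: ifP => // _.
by rewrite -!EFinD; congr EFin; ring.
Qed.

Lemma reflect_time_PM (A : set (TR * TR)) : measurable A -> PM (reflect_time @^-1` A) = PM A.
Proof.
move=> mA; have mr := measurable_reflect_time.
apply/esym; apply: (product_measure_unique (m' := pushforward PM reflect_time)) => //= B C mB mC.
rewrite /pushforward/= (_ : reflect_time @^-1` _ = (reflect @^-1` B) `*` C)//.
rewrite product_measure1E//; first by congr (_ * _)%E; exact: reflect_leb.
by rewrite -[X in measurable X]setTI; exact: measurable_reflect.
Qed.

Lemma reflect_strip a b : reflect_time @^-1` (strip a b) = strip (t0 - b) (t0 - a).
Proof.
apply/seteqP; split => -[t x] [/= + ?]; rewrite !in_itv/= => /andP[? ?]; split => //=;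
  by rewrite in_itv/=; apply/andP; split; lra.
Qed.

Lemma cint_reflect (f : R -> R[i]) a b : cmeasurable (`[a, b] : set TR) f ->
  cint leb `[t0 - b, t0 - a] (fun s => f (t0 - s)) = cint leb `[a, b] f.
Proof.
move=> mf; have mI := @measurable_itvT R `[a, b].
rewrite [RHS](@preserving_cint _ TR R leb reflect measurable_reflect reflect_leb _ mI f mf).
by rewrite reflect_itv.
Qed.

Lemma cintegrable_reflect (f : R -> R[i]) a b : cintegrable leb `[a, b] f ->
  cintegrable leb `[t0 - b, t0 - a] (fun s => f (t0 - s)).
Proof.
move=> [f1 f2]; have mI := @measurable_itvT R `[a, b].
have := preserving_rint measurable_reflect reflect_leb mI f1.
have := preserving_rint measurable_reflect reflect_leb mI f2.
by rewrite reflect_itv.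
Qed.

End reflection.

(** When the positive or the negative part has an infinite integral, [fine] gives 0 on both
    sides. *)
Lemma Rint_opp d (T : measurableType d) (R : realType) (mu : {measure set T -> \bar R})
    (D : set T) (f : T -> R) : \int[mu]_(x in D) - f x = - \int[mu]_(x in D) f x.
Proof.
rewrite /Rintegral integralE [in RHS]integralE.
have -> : (fun x => (- f x)%:E) = (\- (fun x => (f x)%:E))%E by apply/funext.
rewrite funeposN funenegN.
have : (0 <= \int[mu]_(x in D) (EFin \o f)^\- x)%E by apply: integral_ge0.
have : (0 <= \int[mu]_(x in D) (EFin \o f)^\+ x)%E by apply: integral_ge0.
move: (\int[mu]_(x in D) _)%E (\int[mu]_(x in D) _)%E => [x| |] [y| |]//= _ _.
- by rewrite opprB.
- by rewrite oppr0.
- by rewrite oppr0.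
- by rewrite oppr0.
Qed.

Lemma cint_conj d (T : measurableType d) (R : realType) (mu : {measure set T -> \bar R})
    (D : set T) (f : T -> R[i]) : cint mu D (fun x => (f x)^*%C) = (cint mu D f)^*%C.
Proof.
rewrite !cintE; apply: eq_complexP.
  by rewrite [RHS]ReJ /=; congr fine; apply: eq_integral => x _; rewrite ReJ.
rewrite [RHS]ImJ [LHS]/= -Rint_opp.
by congr fine; apply: eq_integral => x _; rewrite ImJ.
Qed.

Lemma fourier_conj (R : realType) (f : R -> R[i]) (k : int) :
  fourier (fun x => (f x)^*%C) k = (fourier f (- k))^*%C.
Proof.
rewrite /fourier !cintegralE conjcM conjcRE -cint_conj; congr (_ * _).
apply: (@eq_cint _ (measurableTypeR R) R leb) => x _.
by rewrite conjcM -cisN mulrNz mulNr opprK.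
Qed.

(** * Solutions of the equation restricted to strips *)

Section from_nls.
Context {R : realType}.
Local Notation TR := (measurableTypeR R).
Local Notation PM := (@lebesgue_measure R \x @lebesgue_measure R)%E.

Lemma L2_CL2 (f : R -> R[i]) : L2 f -> CL2 leb torus f.
Proof.
case=> mf f2; have mf' : cmeasurable (torus : set TR) (f : TR -> R[i]) by exact: mf.
split => //; apply: rint_lty.
- by apply: measurable_funX; exact: measurable_normc.
- by move=> x _; exact: sqr_ge0.
- exact: f2.
Qed.

Lemma CL2_L2 (f : R -> R[i]) : CL2 leb torus f -> L2 f.
Proof.
move=> [mf f2]; split; first exact: mf.
by rewrite (rint_EFin (@measurable_torus R) f2) ltry.
Qed.

Lemma L2normE (f : R -> R[i]) : L2norm f = Num.sqrt (norm2 leb torus f).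
Proof. by rewrite /L2norm norm2E. Qed.

(** Duhamel's formula is stated between two times and refers to no initial datum: this form is
    stable under reflection of time. *)
Definition strip_solution gamma p q (U : TR * TR -> R[i]) :=
  [/\ cmeasurable (strip p q) U, rint PM (strip p q) (fun z => normc (U z) ^+ 4),
      forall t, p <= t -> t <= q -> CL2 leb torus (fun x => U (t, x)) &
      forall k s t, p <= s -> s <= t -> t <= q -> profile U k t = profile U k s +
        'i%C * gamma%:C * cint leb `[s, t] (profile (fun z => cub (U z)) k)].

Lemma strip_forward gamma tau f U : 0 <= tau -> strip_solution gamma 0 tau U ->
  (forall k, fourier (fun x => U (0, x)) k = fourier f k) -> forward_solution gamma tau f U.
Proof.
move=> tau0 [mU U4 sU UE] Uf; split => // k t t0 tt.
rewrite (UE k 0 t (lexx 0) t0 tt); congr (_ + _).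
by rewrite /profile mulr0 cis0 mul1r Uf.
Qed.

Definition uncurry_solution (u : R -> R -> R[i]) (z : TR * TR) : R[i] := u z.1 z.2.

Lemma nls_L4 gamma f u p q : nls_solution gamma f u ->
  cmeasurable (strip p q) (uncurry_solution u) /\
  rint PM (strip p q) (fun z => normc (uncurry_solution u z) ^+ 4).
Proof.
(* [L4_on] concerns an open interval; adding 1 makes it contain the closed one. *)
case=> _ _ u4 _; pose M := Num.max `|p| `|q|; pose T := M + 1.
have T0 : 0 < T by rewrite /T ltr_wpDl// le_max normr_ge0.
have [mu ui] := u4 T T0.
have mD : measurable (`]-T, T[%classic `*` torus : set (TR * TR)).
  by apply: measurableX; [exact: measurable_itvT|exact: measurable_torus].
have ss : strip p q `<=` `]-T, T[%classic `*` torus.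
  move=> [t x] [/= + ?]; rewrite !in_itv/= => /andP[pt tq]; split => //=.
  have h1 : `|p| <= M by rewrite le_max lexx.
  have h2 : `|q| <= M by rewrite le_max lexx orbT.
  have h3 := ler_norm q; have h4 := lerNnormlW (lexx `|p|).
  by rewrite /T {mu ui T0 mD}; clearbody M; apply/andP; split; lra.
have mu' : cmeasurable (`]-T, T[%classic `*` torus : set (TR * TR)) (uncurry_solution u) by exact: mu.
have mS := measurable_strip p q.
split; first exact: cmeasurableS ss mu'.
apply: (integrableS mD mS ss); apply: rint_lty => //.
  by apply: measurable_funX; exact: measurable_normc.
by move=> z _; exact: pow4_ge0.
Qed.

Lemma nls_profile gamma f u k t : nls_solution gamma f u ->
  profile (uncurry_solution u) k t = fourier f k + 'i%C * gamma%:C *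
    (if 0 <= t then cint leb `[0, t] (profile (fun z => cub (uncurry_solution u z)) k)
     else - cint leb `[t, 0] (profile (fun z => cub (uncurry_solution u z)) k)).
Proof.
move=> uS; have [_ _ _ uD] := uS.
have IC p q : cintegrable leb `[p, q] (profile (fun z => cub (uncurry_solution u z)) k).
  have [mU U4] := nls_L4 p q uS.
  by have [] := cint_profile k (cub_integrable mU U4).
have E p q : cintegral `[p, q] (fun s => cis (- (k%:~R ^+ 2 * (t - s))) * fourier (cubic (u s)) k) =
    cis (- (k%:~R ^+ 2 * t)) * cint leb `[p, q] (profile (fun z => cub (uncurry_solution u z)) k).
  rewrite cintegralE -(cintZ (@measurable_itvT R `[p, q]) _ (IC p q)).
  apply: eq_cint => s _; rewrite /profile mulrA -cisD; congr (cis _ * _); ring.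
rewrite /profile [fourier _ k](uD t k) /cintegral0 mulrDr mulrA cisK mul1r.
have K (A I : R[i]) : cis (k%:~R ^+ 2 * t) * (A * (cis (- (k%:~R ^+ 2 * t)) * I)) = A * I.
  by rewrite mulrCA [cis _ * (_ * _)]mulrA cisK mul1r.
by congr (_ + _); case: ifP => _; rewrite E; [exact: K|rewrite !mulrN K].
Qed.

Lemma nls_strip_pos gamma f u tau : nls_solution gamma f u ->
  strip_solution gamma 0 tau (uncurry_solution u).
Proof.
move=> uS; have [uL2 _ _ _] := uS; have [mU U4] := nls_L4 0 tau uS.
split => //; first by move=> t _ _; exact: (L2_CL2 (uL2 t)).
move=> k s t s0 st tt.
have [IC _] := cint_profile k (cub_integrable mU U4).
rewrite !(nls_profile k _ uS) s0 (le_trans s0 st).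
rewrite (cint_itv_split s0 st (cintegrable_sub_itv (lexx 0) tt IC)).
by rewrite mulrDr addrA.
Qed.

Lemma nls_strip_neg gamma f u tau : nls_solution gamma f u ->
  strip_solution gamma (- tau) 0 (uncurry_solution u).
Proof.
move=> uS; have [uL2 _ _ _] := uS; have [mU U4] := nls_L4 (- tau) 0 uS.
split => //; first by move=> t _ _; exact: (L2_CL2 (uL2 t)).
move=> k s t s0 st tt.
have [IC _] := cint_profile k (cub_integrable mU U4).
have P x : x <= 0 -> profile (uncurry_solution u) k x = fourier f k - 'i%C * gamma%:C *
    cint leb `[x, 0] (profile (fun z => cub (uncurry_solution u z)) k).
  move=> x0; rewrite (nls_profile k x uS); case: ifPn => x0'.
    have -> : x = 0 by apply/eqP; rewrite eq_le x0.
    by rewrite cint_itv1 mulr0 addr0 subr0.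
  by rewrite mulrN.
rewrite (P t tt) (P s (le_trans st tt)).
rewrite (cint_itv_split st tt (cintegrable_sub_itv s0 (lexx 0) IC)).
by move: (cint _ _ _) (cint _ _ _) (fourier f k) => x y z; ring.
Qed.

Lemma fourier_init gamma (f : R -> R[i]) u k : nls_solution gamma f u -> fourier (u 0) k = fourier f k.
Proof.
move=> uS; have := nls_profile k 0 uS.
by rewrite lexx cint_itv1 mulr0 addr0 /profile mulr0 cis0 mul1r.
Qed.

Lemma cub_conj (z : R[i]) : cub z^*%C = (cub z)^*%C.
Proof. by rewrite /cub normcJE conjcM conjcRE. Qed.

Lemma profile_reflect (F : TR * TR -> R[i]) t0 k t :
  profile (fun z => (F (reflect_time t0 z))^*%C) k t =
  cis (k%:~R ^+ 2 * t0) * (profile F (- k) (t0 - t))^*%C.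
Proof.
rewrite /profile [fourier _ k](fourier_conj (fun x => F (t0 - t, x)) k).
move: (fourier _ _) => x; rewrite conjcM -cisN mulrA -cisD; congr (cis _ * _).
by rewrite mulrNz sqrrN; ring.
Qed.

(** The equation is invariant under [t -> t0 - t] combined with complex conjugation. Conjugation
    sends the mode [k] to [- k], which does not change [k^2]. *)
Lemma strip_reflect gamma p q t0 U : strip_solution gamma p q U ->
  strip_solution gamma (t0 - q) (t0 - p) (fun z => (U (reflect_time t0 z))^*%C).
Proof.
move=> [mU U4 sU UE]; have mS := measurable_strip p q.
have mr := measurable_reflect_time t0; have PMr := reflect_time_PM t0.
have mU' : cmeasurable (strip (t0 - q) (t0 - p)) (fun z => U (reflect_time t0 z)).
  by rewrite -reflect_strip; exact: preserving_cmeasurable.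
split.
- exact: cmeasurableJ.
- have := preserving_rint mr PMr mS U4; rewrite reflect_strip.
  by apply: eq_rint => [|z _]; [exact: measurable_strip|rewrite normcJE].
- move=> t tp tq; have := sU (t0 - t); rewrite lerBrDl lerBlDl => H.
  by apply: CL2J => //; apply: H; lra.
move=> k s t ps st tq; rewrite !profile_reflect.
have [IC _] := cint_profile (- k) (cub_integrable mU U4).
have a1 : p <= t0 - t by lra.
have a2 : t0 - t <= t0 - s by lra.
have a3 : t0 - s <= q by lra.
rewrite (UE (- k) _ _ a1 a2 a3).
have cubE : profile (fun z => cub (U (reflect_time t0 z))^*%C) k =
    profile (fun z => (cub (U (reflect_time t0 z)))^*%C) k.
  by congr profile; apply/funext => z; exact: cub_conj.
have -> : cint leb `[s, t] (profile (fun z => cub (U (reflect_time t0 z))^*%C) k) =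
    cis (k%:~R ^+ 2 * t0) * (cint leb `[t0 - t, t0 - s] (profile (fun z => cub (U z)) (- k)))^*%C.
  have IC' := cintegrable_sub_itv a1 a3 IC.
  rewrite -(cint_reflect t0 (cintegrable_meas IC')) -cint_conj -cintZ; last 2 first.
  - exact: measurable_itvT.
  - by apply: cintegrableJ; [exact: measurable_itvT|have := cintegrable_reflect t0 IC'; rewrite !subKr].
  rewrite !subKr; apply: eq_cint => x _.
  by rewrite cubE -(profile_reflect (fun z => cub (U z))).
rewrite conjcDE (conjcM ('i%C * gamma%:C)) (conjcM 'i%C) conjcRE.
have -> : ('i%C : R[i])^*%C = - 'i%C by apply: eq_complexP; rewrite ?ReJ ?ImJ !ReImE /= ?oppr0.
move: (_^*%C) (_^*%C) (cis _) => x y z; ring.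
Qed.

End from_nls.

(** A weighted Young inequality on the cross term; the bound involves [g] and [f - g] only, so that
    it is uniform as [f] tends to [g]. *)
Lemma norm2_dist d (T : measurableType d) (R : realType) (mu : {measure set T -> \bar R})
    (D : set T) (mD : measurable D) (f g : T -> R[i]) (r : R) : 0 < r ->
  CL2 mu D f -> CL2 mu D g ->
  `|norm2 mu D f - norm2 mu D g| <= r * norm2 mu D g + (1 + r^-1) * norm2 mu D (fun x => f x - g x).
Proof.
move=> r0 f2 g2; have h2 := CL2B mD f2 g2; have [_ If] := f2; have [_ Ig] := g2; have [_ Ih] := h2.
rewrite !norm2E -!RintegralZl// -RintegralB// -RintegralD//; [|exact: rintZ..].
have Id := rintB mD If Ig.
apply: le_trans (le_normr_Rintegral mD Id) _; apply: Rint_le => //.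
- exact: integrable_norm Id.
- by apply: rintD => //; exact: rintZ.
move=> x _.
have := normc_ge0 (f x - g x); have := normc_ge0 (g x); have := normc_ge0 (f x).
have := normc_dist (f x) (g x).
move: (normc (f x - g x)) (normc (f x)) (normc (g x)) => h a b /[!ler_norml]/andP[h1 h2'] a0 b0 h0.
have rK : r * r^-1 = 1 by rewrite divff// gt_eqF.
have i0 : 0 < r^-1 by rewrite invr_gt0.
move: rK i0; move: (r^-1) => s rs s0.
have sq : 0 <= s * (r * b - h) ^+ 2 by rewrite mulr_ge0 ?sqr_ge0// ltW.
have e : s * (r * b - h) ^+ 2 = r * b ^+ 2 - 2 * b * h + s * h ^+ 2.
  have -> : s * (r * b - h) ^+ 2 = (r * s) * (r * b ^+ 2 - 2 * b * h) + s * h ^+ 2 by ring.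
  by rewrite rs mul1r.
by apply/andP; split; nra.
Qed.

(** * Continuity of the mass, and solutions that vanish at some time *)

Section mass.
Context {R : realType}.
Local Notation TR := (measurableTypeR R).
Local Notation PM := (@lebesgue_measure R \x @lebesgue_measure R)%E.

Lemma continuous_mass gamma f (u : R -> R -> R[i]) : nls_solution gamma f u ->
  continuous (fun t => (2 * pi)^-1 * norm2 leb torus (u t)).
Proof.
move=> [uL2 uc _ _] t; have mT := @measurable_torus R.
apply: (@cvgM R) => //; first exact: cvg_cst.
apply/cvgrPdist_lt => eps eps0.
pose n := norm2 leb torus (u t).
have n0 : 0 <= n := norm2_ge0 _ _ _.
pose r := eps / (2 * (n + 1)); have r0 : 0 < r by rewrite divr_gt0// mulr_gt0// ltr_wpDl.
pose C := 1 + r^-1; have C0 : 0 < C by rewrite ltr_wpDr// invr_ge0 ltW.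
have d0 : 0 < Num.sqrt (eps / (2 * C)) by rewrite sqrtr_gt0 divr_gt0// mulr_gt0.
have := uc t => /cvgrPdist_lt/(_ _ d0); apply: filterS => s.
rewrite sub0r normrN L2normE ger0_norm ?sqrtr_ge0// ltr_sqrt; last by rewrite divr_gt0// mulr_gt0.
move=> H; rewrite distrC; apply: le_lt_trans (norm2_dist mT r0 (L2_CL2 (uL2 s)) (L2_CL2 (uL2 t))) _.
have H1 : r * n < eps / 2.
  have -> : r * n = eps / 2 * (n / (n + 1)) by rewrite /r; field; apply/eqP; lra.
  by rewrite gtr_pMr ?divr_gt0// ltr_pdivrMr; lra.
have H2 : C * norm2 leb torus (fun x => u s x - u t x) < eps / 2.
  rewrite mulrC -ltr_pdivlMr//; apply: lt_le_trans H _; rewrite le_eqVlt; apply/orP; left.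
  by rewrite invfM mulrA.
rewrite -/n -/C; lra.
Qed.

Lemma fourier0 k : fourier (fun _ : R => 0 : R[i]) k = 0.
Proof.
have e : (fun x : R => cis (- (k%:~R * x)) * 0 : R[i]) = fun=> 0 by apply/funext => x; rewrite mulr0.
by rewrite /fourier cintegralE e cint0 mulr0.
Qed.

Lemma zero_forward gamma tau : forward_solution gamma tau (fun=> 0) (fun=> 0 : R[i]).
Proof.
have F0 := fourier0.
have mS := @measurable_strip R 0 tau.
split.
- exact: cmeasurable_cst.
- by rewrite normc0 expr0n; exact: integrable0.
- by move=> t _ _; exact: CL20.
move=> k t _ _; have P0 : profile (fun z : TR * TR => cub (0 : R[i])) k = fun=> 0.
  by apply/funext => s; rewrite /profile /cub mulr0 F0 mulr0.
by rewrite P0 cint0 mulr0 addr0 /profile F0 mulr0.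
Qed.

Lemma strip_mass_cvg gamma tau f V U c : 0 <= tau -> 0 <= c -> CL2 leb torus f ->
  strip_solution gamma 0 tau V -> (forall k, fourier (fun x => V (0, x)) k = fourier f k) ->
  (forall N : nat, strip_solution gamma 0 tau (U N)) ->
  (forall N k, fourier (fun x => U N (0, x)) k = fourier (fun x => f x + c%:C * expi N x) k) ->
  (exists2 m : R -> R, continuous m & forall t, 0 <= t -> t <= tau ->
     m t = (2 * pi)^-1 * norm2 leb torus (fun x => V (t, x))) ->
  forall k eps, 0 < eps -> exists N0, forall N, (N0 <= N)%N ->
    normc (fourier (fun x => U N (tau, x)) k -
      cis (2 * gamma * c ^+ 2 * tau) * fourier (fun x => V (tau, x)) k) < eps.
Proof.
move=> tau0 c0 f2 VS Vf US Uf [m cm mE].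
apply: (fourier_limit tau0 c0 f2 (strip_forward tau0 VS Vf) _ cm mE) => N.
exact: strip_forward tau0 (US N) (Uf N).
Qed.

(* The zero solution is the limit of solutions with zero initial data, so that reversing
   time shows that a solution vanishing at time [tau] vanished initially. *)
Lemma strip_zero gamma tau (U : TR * TR -> R[i]) : 0 <= tau -> strip_solution gamma 0 tau U ->
  (forall k, fourier (fun x => U (tau, x)) k = 0) -> forall k, fourier (fun x => U (0, x)) k = 0.
Proof.
move=> tau0 US Utau k.
have F0 := fourier0.
pose W z := (U (reflect_time tau z))^*%C.
have WS : strip_solution gamma 0 tau W.
  by have := strip_reflect tau US; rewrite subrr subr0.
have Wf (N : nat) l : fourier (fun x => W (0, x)) l = fourier (fun x : R => 0 + 0%:C * expi N x) l.
  have -> : (fun x : R => 0 + 0%:C * expi N x) = (fun=> 0 : R[i]).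
    by apply/funext => x; rewrite mul0r addr0.
  rewrite F0 [LHS](fourier_conj (fun x => U (tau - 0, x)) l) subr0 Utau.
  by apply: eq_complexP; rewrite ?ReJ ?ImJ/= ?oppr0.
have C0 : CL2 leb torus (fun _ : R => 0 : R[i]) by exact: CL20.
have m0 (t : R) : 0 <= t -> t <= tau -> 0 = (2 * pi)^-1 * norm2 leb torus (fun _ : R => 0 : R[i]).
  move=> _ _; rewrite norm2E; under eq_Rint do rewrite normc0 expr0n/=.
  by rewrite /Rintegral integral0 mulr0.
have cm0 : continuous (fun _ : R => 0 : R) by move=> x; exact: cvg_cst.
(* The limit theorem with [c = 0], the zero solution as limit, and the constant sequence [W]. *)
have K := fourier_limit tau0 (lexx 0) C0 (zero_forward gamma tau)
  (fun N => strip_forward tau0 WS (Wf N)) cm0 m0 (- k).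
have : normc (fourier (fun x => W (tau, x)) (- k)) = 0.
  apply/eqP/negPn/negP => n0.
  have p0 : 0 < normc (fourier (fun x => W (tau, x)) (- k)) by rewrite lt_def n0 normc_ge0.
  have [N0 /(_ _ (leqnn _))] := K _ p0.
  by rewrite F0 mulr0 subr0 ltxx.
rewrite [X in normc X](fourier_conj (fun x => U (tau - tau, x)) (- k)) subrr opprK normcJE.
by move/eqP; rewrite normc_eq0 => /eqP.
Qed.

End mass.

(** * The flow on perturbed data *)

Section flow.
Context {R : realType}.
Local Notation TR := (measurableTypeR R).

Lemma L2_add_wave (u0 : R -> R[i]) c n : L2 u0 -> L2 (fun x => u0 x + c%:C * expi n x).
Proof.
move=> u2; have mT := @measurable_torus R; apply: CL2_L2; apply: CL2D => //; first exact: L2_CL2.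
by apply: CL2Z => //; exact: CL2_expi.
Qed.

Lemma nls_limit_pos gamma t (u0 : R -> R[i]) v (u : nat -> R -> R -> R[i]) c :
  0 <= t -> 0 <= c -> L2 u0 -> nls_solution gamma u0 v ->
  (forall N : nat, nls_solution gamma (fun x => u0 x + c%:C * expi N x) (u N)) ->
  forall k eps, 0 < eps -> exists N0, forall N, (N0 <= N)%N ->
    normc (fourier (u N t) k - cis (2 * gamma * c ^+ 2 * t) * fourier (v t) k) < eps.
Proof.
move=> t0 c0 u2 vS uS.
apply: (strip_mass_cvg t0 c0 (L2_CL2 u2) (nls_strip_pos t vS) _ (fun N => nls_strip_pos t (uS N))).
- by move=> k; exact: fourier_init vS.
- by move=> N k; exact: fourier_init (uS N).
- by exists (fun t => (2 * pi)^-1 * norm2 leb torus (v t)); first exact: continuous_mass vS.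
Qed.

(** The conjugate of [u] at time [- t] is a solution for positive times; conjugation turns
    [e^{-iNx}] into [e^{iNx}], hence the opposite frequency in the data. *)
Lemma nls_limit_neg gamma t (u0 : R -> R[i]) v (u : nat -> R -> R -> R[i]) c :
  0 <= t -> 0 <= c -> L2 u0 -> nls_solution gamma u0 v ->
  (forall N : nat, nls_solution gamma (fun x => u0 x + c%:C * expi (- N%:Z) x) (u N)) ->
  forall k eps, 0 < eps -> exists N0, forall N, (N0 <= N)%N ->
    normc (fourier (u N (- t)) k - (cis (2 * gamma * c ^+ 2 * t))^*%C * fourier (v (- t)) k) < eps.
Proof.
move=> t0 c0 u2 vS uS k eps eps0; have mT := @measurable_torus R.
have S f w : nls_solution gamma f w -> strip_solution gamma 0 t
    (fun z => (uncurry_solution w (reflect_time 0 z))^*%C).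
  by move=> wS; have := strip_reflect 0 (nls_strip_neg t wS); rewrite subr0 sub0r opprK.
have I f w l : nls_solution gamma f w ->
    fourier (fun x => (w (0 - 0) x)^*%C) l = fourier (fun x => (f x)^*%C) l.
  by move=> wS; rewrite subr0 (fourier_conj f) (fourier_conj (w 0)) (fourier_init _ wS).
have E N l : fourier (fun x => (u N (0 - 0) x)^*%C) l =
    fourier (fun x => (u0 x)^*%C + c%:C * expi N x) l.
  rewrite (I _ _ l (uS N)); apply: eq_fourier => x _.
  by rewrite conjcDE (conjcM c%:C) conjcRE -expiN opprK.
have [|N0 H] := strip_mass_cvg t0 c0 (CL2J mT (L2_CL2 u2)) (S _ _ vS) (fun l => I _ _ l vS)
  (fun N => S _ _ (uS N)) E _ (- k) eps0.
  pose m s := (2 * pi)^-1 * norm2 leb torus (v s).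
  have cm : continuous m := continuous_mass vS.
  exists (m \o -%R).
    by move=> s; apply: continuous_comp; [exact: opp_continuous|exact: cm].
  move=> s _ _; rewrite /m /=; congr (_ * _); rewrite !norm2E; apply: eq_Rint => x _.
  by rewrite normcJE /uncurry_solution /= sub0r.
exists N0 => N /H; congr (_ < _).
rewrite (_ : fourier _ (- k) = (fourier (u N (- t)) k)^*%C); last first.
  by rewrite [LHS](fourier_conj (u N (0 - t)) (- k)) opprK sub0r.
rewrite (_ : fourier _ (- k) = (fourier (v (- t)) k)^*%C); last first.
  by rewrite [LHS](fourier_conj (v (0 - t)) (- k)) opprK sub0r.
rewrite -normcJE; congr normc; move: (cis _) (fourier _ _) (fourier _ _) => x y z.
by apply: eq_complexP; rewrite !ReImE; ring.
Qed.

Lemma flow_limit gamma t Phi (u0 : R -> R[i]) : gamma != 0 -> t != 0 ->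
  flow_map gamma t Phi -> L2 u0 -> exists c : R, exists2 s : int, `|s|%N = 1%N &
  0 <= c /\ forall k eps, 0 < eps -> exists N0, forall N : nat, (N0 <= N)%N ->
    normc (fourier (Phi (fun x => u0 x + c%:C * expi (s * N) x)) k + fourier (Phi u0) k) < eps.
Proof.
move=> g0 t0 PhiS u2; have [v vS ->] := PhiS u0 u2.
pose c := Num.sqrt (pi / (2 * `|gamma| * `|t|)).
have q0 : 0 < 2 * `|gamma| * `|t| :> R by rewrite !mulr_gt0 ?normr_gt0.
have c2 : c ^+ 2 = pi / (2 * `|gamma| * `|t|) by rewrite sqr_sqrtr// divr_ge0 ?pi_ge0// ltW.
have cE : 2 * `|gamma| * c ^+ 2 * `|t| = pi.
  by rewrite c2; field; rewrite !normr_eq0 g0 t0.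
have cisE : cis (2 * gamma * c ^+ 2 * `|t|) = -1 :> R[i].
  have cispi : cis pi = -1 :> R[i] by rewrite /cis cospi sinpi; apply: eq_complexP; rewrite /= ?oppr0.
  have [gp|gn] := ltP 0 gamma; first by move: cE; rewrite gtr0_norm// => ->.
  have -> : 2 * gamma * c ^+ 2 * `|t| = - (2 * `|gamma| * c ^+ 2 * `|t|) by rewrite (ler0_norm gn); ring.
  by rewrite cE cisN cispi; apply: eq_complexP; rewrite !ReImE /= ?oppr0.
have cc : 0 <= c := sqrtr_ge0 _.
pose Sol s (N : nat) := cid2 (PhiS _ (L2_add_wave c (s * N%:Z) u2)).
(* The sign [s] of the frequency is that of the time, in accordance with the reversal used for
   negative times. *)
exists c; have [tp|tn] := ltP 0 t; [exists 1 => //|exists (-1) => //]; split=> // k eps eps0.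
  pose w N := sval (Sol 1 N).
  have wS (N : nat) : nls_solution gamma (fun x => u0 x + c%:C * expi N x) (w N).
    by rewrite /w; case: (Sol 1 N) => /= u + _; rewrite mul1r.
  have [N0 H] := nls_limit_pos (ltW tp) cc u2 vS wS k eps0.
  exists N0 => N /H; rewrite -(gtr0_norm tp) cisE mulN1r opprK (gtr0_norm tp).
  by rewrite /w; case: (Sol 1 N) => /= u _ ->.
pose w N := sval (Sol (-1) N).
have wS (N : nat) : nls_solution gamma (fun x => u0 x + c%:C * expi (- N%:Z) x) (w N).
  by rewrite /w; case: (Sol (-1) N) => /= u + _; rewrite mulN1r.
have tn' : 0 <= - t by rewrite oppr_ge0.
have [N0 H] := nls_limit_neg tn' cc u2 vS wS k eps0.
have J : ((-1 : R[i])^*)%C = -1 by apply: eq_complexP; rewrite !ReImE /= ?oppr0.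
exists N0 => N /H; rewrite -(ler0_norm tn) cisE J mulN1r opprK (ler0_norm tn) opprK.
by rewrite /w; case: (Sol (-1) N) => /= u _ ->.
Qed.

Lemma flow_neq0 gamma t Phi (u0 : R -> R[i]) : flow_map gamma t Phi -> L2 u0 ->
  ~ ae_eq lebesgue_measure torus u0 (cst 0) -> exists k, fourier (Phi u0) k != 0.
Proof.
move=> PhiS u2 nz; have [v vS ->] := PhiS u0 u2.
apply: contrapT => H; have {}H k : fourier (v t) k = 0.
  by apply: contrapT => /eqP ?; apply: H; exists k.
have mT := @measurable_torus R.
suff Z k : fourier u0 k = 0.
  apply: nz; have [mu u2'] := L2_CL2 u2.
  have n0 : norm2 leb torus u0 = 0 by apply: fourier_eq0 => //; exact: L2_CL2.
  have mn : measurable_fun torus (fun x => (normc (u0 x) ^+ 2)%:E).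
    by apply/measurable_EFinP; apply: measurable_funX; exact: measurable_normc.
  have : (\int[leb]_(x in torus) `|(normc (u0 x) ^+ 2)%:E| = 0)%E.
    under eq_integral do rewrite abse_EFin ger0_norm ?sqr_ge0//.
    by rewrite (rint_EFin mT u2') -norm2E n0.
  move/(ae_eq_integral_abs leb mT mn); apply: filterS => x K Tx; apply/eqP.
  by have /eqP := K Tx; rewrite eqe sqrf_eq0 normc_eq0.
rewrite -(fourier_init k vS); have [tp|tn] := leP 0 t.
  exact: (strip_zero tp (nls_strip_pos t vS) H).
have tn' : 0 <= - t by rewrite oppr_ge0 ltW.
have S : strip_solution gamma 0 (- t) (fun z => (uncurry_solution v (reflect_time 0 z))^*%C).
  by have := strip_reflect 0 (nls_strip_neg (- t) vS); rewrite subr0 sub0r opprK.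
have Z : forall l, fourier (fun x => (v (0 - - t) x)^*%C) l = 0.
  by move=> l; rewrite sub0r opprK (fourier_conj (v t)) H; apply: eq_complexP; rewrite ?ReImE /= ?oppr0.
have := strip_zero tn' S Z (- k); rewrite [X in X = _](fourier_conj (v (0 - 0)) (- k)) opprK subr0.
by move=> /(congr1 (@normc R)); rewrite normcJE normc0 => /eqP; rewrite normc_eq0 => /eqP.
Qed.

End flow.

(** * Convergence in B and in Sobolev spaces *)

Section test_functions.
Context {R : realType}.
Local Notation TR := (measurableTypeR R).

Lemma is_derive_trig (w a b x : R) : is_derive x 1 (fun y => a * cos (w * y) + b * sin (w * y))
  (b * w * cos (w * x) + - (a * w) * sin (w * x)).
Proof.
have dw : is_derive x 1 (fun y : R => w * y) w.
  have := is_deriveZ w (is_derive_id x 1); rewrite /GRing.scale /= mulr1.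
  exact.
have dc := is_derive1_comp (is_derive_cos (w * x)) dw.
have ds := is_derive1_comp (is_derive_sin (w * x)) dw.
have := is_deriveD (is_deriveZ a dc) (is_deriveZ b ds); rewrite /GRing.scale /=.
by move=> H; apply: is_derive_eq; ring.
Qed.

(** The span of the cosine and the sine of one frequency is stable under differentiation, so that
    exponentials are test functions and Fourier coefficients are defined on distributions. *)
Lemma derive1n_trig (w a b : R) n : exists a' b', derive1n n (fun y => a * cos (w * y) + b * sin (w
  * y)) =
  fun y => a' * cos (w * y) + b' * sin (w * y).
Proof.
elim: n => [|n [a' [b' IH]]]; first by exists a, b.
exists (b' * w), (- (a' * w)); rewrite derive1nS IH; apply/funext => x.
rewrite derive1E; have [_ ->] := is_derive_trig w a' b' x.
by [].
Qed.

Lemma derivable_trig (w a b x : R) : derivable (fun y => a * cos (w * y) + b * sin (w * y)) x 1.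
Proof. by have [] := is_derive_trig w a b x. Qed.

Lemma expi_periodic k (x : R) : expi k (x + 2 * pi) = expi k x.
Proof. by rewrite /expi mulrDr cisDpi2. Qed.

Lemma expi_smooth k (n : nat) (x : R) :
  derivable (derive1n n (fun y => complex.Re (expi k y))) x 1 /\
  derivable (derive1n n (fun y => complex.Im (expi k y))) x 1.
Proof.
have RE : (fun y : R => complex.Re (expi k y)) = fun y => 1 * cos (k%:~R * y) + 0 * sin (k%:~R * y).
  by apply/funext => y; rewrite mul1r mul0r addr0.
have IE : (fun y : R => complex.Im (expi k y)) = fun y => 0 * cos (k%:~R * y) + 1 * sin (k%:~R * y).
  by apply/funext => y; rewrite mul1r mul0r add0r.
rewrite RE IE; have [a [b ->]] := derive1n_trig k%:~R 1 0 n.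
by have [a' [b' ->]] := derive1n_trig k%:~R 0 1 n; split; exact: derivable_trig.
Qed.

Definition expi_test k : testfun R := TestFun (expi_periodic k) (expi_smooth k).

Lemma testfun_CL2 (phi : testfun R) : CL2 leb torus phi.
Proof.
have cR : continuous (fun y : R => complex.Re (phi y)).
  by move=> y; have [+ _] := testfun_smooth phi 0 y => /derivable1_diffP/differentiable_continuous.
have cI : continuous (fun y : R => complex.Im (phi y)).
  by move=> y; have [_] := testfun_smooth phi 0 y => /derivable1_diffP/differentiable_continuous.
have mphi : cmeasurable (torus : set TR) phi.
  by split; apply: measurable_torusP; exact: continuous_measurable_fun.
split; first exact: mphi.
have I : rint leb torus (fun y : TR => complex.Re (phi y) * complex.Re (phi y) + complex.Im (phi y)
  * complex.Im (phi y)).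
  apply: rint_continuous; apply: continuous_subspaceT => y.
  by apply: cvgD; apply: cvgM; first [exact: cR|exact: cI].
by apply: (eq_rint (@measurable_torus R) _ I) => y _; rewrite normc_sqr !expr2.
Qed.

(** The Riemann-Lebesgue lemma applied to the test function; only frequencies of large modulus
    matter, whatever the sign [s]. *)
Lemma L2_pairing_cvg (f : R -> R[i]) (c : R) (phi : testfun R) (s : int) : L2 f -> `|s|%N = 1%N ->
  forall eps, 0 < eps -> exists N0, forall N : nat, (N0 <= N)%N ->
    normc (cintegral torus (fun x => (f x + c%:C * expi (s * N) x) * phi x) -
           cintegral torus (fun x => f x * phi x)) < eps.
Proof.
move=> f2 s1 eps eps0; have mT := @measurable_torus R; have phi2 := testfun_CL2 phi.
have c1 : 0 < `|c| + 1 by rewrite ltr_wpDl.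
have phi2' : CL2 leb (`[0, (0 + 2 * pi)%R]%classic : set TR) phi by rewrite -torusE.
have [B H] := riemann_lebesgue (lexx (0 + 2 * pi)) phi2' (divr_gt0 eps0 c1).
exists B.+1 => N BN; have f2' := L2_CL2 f2.
have fI := CL2_prod mT f2' phi2.
have eI : cintegrable leb torus (fun x => expi (s * N) x * phi x) by apply: CL2_prod => //; exact:
  CL2_expi.
rewrite !cintegralE -cintB //; last first.
  by apply: CL2_prod => //; apply: CL2D => //; apply: CL2Z => //; exact: CL2_expi.
rewrite (@eq_cint _ TR R leb torus _ (fun x => c%:C * (expi (s * N) x * phi x))); last first.
  by move=> x _; rewrite mulrDl addrC addKr mulrA.
rewrite cintZ // normcME normcR.
have := H (s * N) _; rewrite -torusE abszM s1 mul1n => /(_ BN) H1.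
apply: le_lt_trans (_ : _ <= (`|c| + 1) * normc (cint leb torus (fun x => expi (s * N) x * phi x))) _.
  by rewrite ler_wpM2r ?normc_ge0// lerDl.
by rewrite mulrC -ltr_pdivlMr.
Qed.

Lemma L2norm_wave_le (u0 : R -> R[i]) (c : R) : L2 u0 -> exists M, forall n : int,
  L2norm (fun x => u0 x + c%:C * expi n x) <= M.
Proof.
move=> u2; have mT := @measurable_torus R.
exists (Num.sqrt (2 * norm2 leb torus u0 + 2 * norm2 leb torus (fun _ : R => c%:C))) => n.
have e2 : CL2 leb torus (fun x => c%:C * expi n x) by apply: CL2Z => //; exact: CL2_expi.
rewrite L2normE ler_sqrt; last by rewrite addr_ge0// mulr_ge0// norm2_ge0.
apply: le_trans (norm2D_le mT (L2_CL2 u2) e2) _; rewrite lerD2l ler_pM2l//.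
by rewrite !norm2E le_eqVlt; apply/orP; left; apply/eqP; apply: eq_Rint => x _; rewrite normcME
  normc_expi mulr1.
Qed.

End test_functions.

(** * Convergence in a space embedded in the distributions *)

Section embedding.
Context {R : realType}.

Lemma nbhs_normc (a : R[i]) (r : R) : 0 < r -> nbhs (a : R[i]^o) [set z | normc (z - a) < r].
Proof.
move=> r0; apply/nbhs_ballP; exists r%:C; first by rewrite /= ltcR.
by move=> z; rewrite -ball_normE /= -normcNE opprB ltcR.
Qed.

Lemma weakstar_nbhs (l : weakstar R) (phi : testfun R) (r : R) : 0 < r ->
  nbhs l [set l' : weakstar R | normc ((l' : Defs.distribution R) phi - (l : Defs.distribution R)
    phi) < r].
Proof.
move=> r0.
have := @initial_continuous _ _ (fun l : Defs.distribution R =>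
    (l : testfun R -> R[i]) : {ptws testfun R -> R[i]^o}) l.
have := @proj_continuous (testfun R) (fun=> R[i]^o) phi (l : Defs.distribution R).
move=> H1 H2; have H := @continuous_comp _ _ _ _ _ _ H2 H1.
exact: (H _ (nbhs_normc ((l : Defs.distribution R) phi) r0)).
Qed.

Lemma eq_distribution (l l' : Defs.distribution R) : l =1 l' -> l = l'.
Proof.
case: l l' => [l ll lc] [l' ll' lc'] /= /funext E; move: ll lc ll' lc'; rewrite E => *.
by congr Distribution; exact: Prop_irrelevance.
Qed.

Section separated.
Variables (B : topologicalType) (j : B -> weakstar R).
Hypothesis jE : continuously_embedded j.

Lemma embedded_nbhs (b : B) (phi : testfun R) (r : R) : 0 < r ->
  nbhs b [set b' | normc ((j b' : Defs.distribution R) phi - (j b : Defs.distribution R) phi) < r].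
Proof. by move=> r0; have [_ cj] := jE; exact: (cj b _ (weakstar_nbhs (j b) phi r0)). Qed.

(** Relative compactness promotes convergence of distributions to convergence in [B]: a cluster
    point of the sequence has the same pairings as [b0], and [j] is injective. *)
Lemma precompact_cvg (b : nat -> B) (b0 : B) : precompact (range b) ->
  (forall (phi : testfun R) eps, 0 < eps -> exists N0, forall N, (N0 <= N)%N ->
     normc ((j (b N) : Defs.distribution R) phi - (j b0 : Defs.distribution R) phi) < eps) ->
  b n @[n --> \oo] --> b0.
Proof.
rewrite precompactE => K bw V nV; apply: contrapT => nbV.
(* The filter of tails along the indices at which the sequence lies outside [V]; it is proper
   because there are infinitely many of them. *)
pose F : set_system B := [set S | exists N0, forall N, (N0 <= N)%N -> ~ V (b N) -> S (b N)].
have FF : ProperFilter F.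
  apply: Build_ProperFilter.
    move=> [N0 H]; apply: nbV; exists N0 => // N /= HN; apply: contrapT => nV'; exact: H N HN nV'.
  split.
  - by exists 0%N.
  - move=> S T [N1 H1] [N2 H2]; exists (maxn N1 N2) => N; rewrite geq_max => /andP[h1 h2] nv.
    by split; [exact: H1|exact: H2].
  - by move=> S T ST [N1 H1]; exists N1 => N h1 nv; apply: ST; exact: H1.
have FK : F (closure (range b)).
  by exists 0%N => N _ _; apply: subset_closure; exists N.
have [b1 [_ cl]] := K F FF FK.
have b10 : b1 = b0.
  have [ij _] := jE; apply: ij; apply: eq_distribution => phi; apply/eqP; rewrite -subr_eq0 -normc_eq0.
  apply/negPn/negP => n0.
  pose r := normc ((j b1 : Defs.distribution R) phi - (j b0 : Defs.distribution R) phi) / 2.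
  have r0 : 0 < r by rewrite divr_gt0// lt_def n0 normc_ge0.
  have [N0 H] := bw phi r r0.
  have FS : F [set b' | normc ((j b' : Defs.distribution R) phi - (j b0 : Defs.distribution R) phi) < r].
    by exists N0 => N h _; exact: H.
  have [b2 [/= h1 h2]] := cl _ _ FS (embedded_nbhs b1 phi r0).
  move: h1 h2 r0; rewrite /r; move: (_ phi) (_ phi) (_ phi) => x y z h1 h2 r0.
  have := normcBle (z - y) (z - x); have -> : z - y - (z - x) = x - y by ring.
  lra.
have FV : F (~` V) by exists 0%N => N _.
by move: nV; rewrite -b10 => nV; have [b2 []] := cl _ _ FV nV.
Qed.

End separated.

End embedding.

(** * Sobolev norms and the discontinuity of the flow *)

Section sobolev.
Context {R : realType}.
Local Notation TR := (measurableTypeR R).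

Lemma Hsnorm_ge (s : R) (f : R -> R[i]) (k : int) :
  (((1 + (k%:~R : R) ^+ 2) `^ (s / 2) * normc (fourier f k))%:E <= Hsnorm s f)%E.
Proof.
pose a k := (1 + (k%:~R : R) ^+ 2) `^ (s / 2) * normc (fourier f k).
have a0 l : 0 <= a l by rewrite mulr_ge0 ?powR_ge0 ?normc_ge0.
have -> : (a k)%:E = (((a k) ^+ 2)%:E `^ 2^-1)%E.
  by rewrite poweR_EFin powR12_sqrt ?sqr_ge0// sqrtr_sqr ger0_norm.
have H0 : (0 <= \esum_(l in [set: int]) ((a l) ^+ 2)%:E)%E.
  by apply: esum_ge0 => l _; rewrite lee_fin sqr_ge0.
apply: gt0_ler_poweR => //.
- by rewrite in_itv/= lee_fin sqr_ge0 leey.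
- by rewrite in_itv/= H0 leey.
apply: esum_ge; exists [set k]; first by split => //; exact: finite_set1.
by rewrite fsbig_set1.
Qed.

Lemma Hsnorm_expi (s c : R) (f : R -> R[i]) (n : int) : 0 <= c ->
  (forall k, fourier f k = c%:C * (k == n)%:R) ->
  Hsnorm s f = (c * (1 + (n%:~R : R) ^+ 2) `^ (s / 2))%:E.
Proof.
move=> c0 fE; pose w := (1 + (n%:~R : R) ^+ 2) `^ (s / 2).
have w0 : 0 <= w by exact: powR_ge0.
rewrite /Hsnorm (eq_esum (b := fun k => if k \in [set n] then ((c * w) ^+ 2)%:E else 0%E)); last first.
  move=> k _; rewrite fE; case: ifPn => [/set_mem/= ->|].
    by rewrite eqxx mulr1 normcR ger0_norm// mulrC.
  by rewrite notin_setE/= => /eqP/negPf ->; rewrite mulr0 normc0 mulr0 expr0n.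
rewrite -esum_mkcond esum_set1 ?lee_fin ?sqr_ge0//.
by rewrite poweR_EFin powR12_sqrt ?sqr_ge0// sqrtr_sqr ger0_norm// mulr_ge0.
Qed.

Lemma weight_cvg0 (s c : R) : s < 0 -> 0 <= c -> forall eps, 0 < eps -> exists N0,
  forall n : int, (N0 <= `|n|)%N -> c * (1 + (n%:~R : R) ^+ 2) `^ (s / 2) < eps.
Proof.
move=> s0 c0 eps eps0; pose a := - (s / 2); have a0 : 0 < a by rewrite /a; lra.
(* [c + 1] rather than [c] keeps [K] positive when [c = 0]. *)
pose K := (c + 1) / eps; have K0 : 0 < K by rewrite divr_gt0// ltr_wpDl.
pose N0 := (Num.truncn (K `^ a^-1)).+1; exists N0 => n Hn.
have Kn : K `^ a^-1 < 1 + (n%:~R : R) ^+ 2.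
  have h1 : K `^ a^-1 < N0%:R by exact: truncnS_gt.
  have h2 : (N0%:R : R) <= `|n|%:R by rewrite ler_nat.
  have h3 : (1 : R) <= `|n|%:R by rewrite ler1n (leq_trans _ Hn).
  have -> : (n%:~R : R) ^+ 2 = `|n|%:R ^+ 2.
    by rewrite natr_absz intr_norm real_normK// num_real.
  nra.
have p0 : 0 < 1 + (n%:~R : R) ^+ 2 by rewrite ltr_wpDr// sqr_ge0.
have KL : K < (1 + (n%:~R : R) ^+ 2) `^ a.
  have := gt0_ltr_powR a0 _ _ Kn; rewrite -powRrM mulVf ?gt_eqF// powRr1 ?ltW//.
  by apply; rewrite nnegrE ?powR_ge0 ?ltW.
have -> : s / 2 = - a by rewrite opprK.
rewrite powRN ltr_pdivrMr ?powR_gt0//.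
by move: KL; rewrite /K ltr_pdivrMr// mulrC; lra.
Qed.

Lemma fourier_add_wave (u0 : R -> R[i]) (c : R) n k :
  fourier ((fun x => u0 x + c%:C * expi n x) \- u0) k = c%:C * (k == n)%:R.
Proof.
rewrite -fourier_expi -fourierZ; last first.
  by apply: CL2_cintegrable; [exact: measurable_torus|rewrite torusE; exact: leb_itv_lty|exact:
    CL2_expi].
by apply: eq_fourier => x _ /=; rewrite addrC addKr.
Qed.

(** A point closer to [- y] than [|y|] is farther from [y] than [|y|], since the two centres are
    [2 |y|] apart. This makes the contradiction quantitative at one fixed large N. *)
Lemma normc_opposite (y z : R[i]) : normc (z + y) < normc y -> normc y < normc (z - y).
Proof.
have := normcBle (z + y) (z - y); have -> : z + y - (z - y) = 2%:C * y.
  by rewrite (_ : 2%:C = 2%:R) ?rmorph_nat//; ring.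
rewrite normcME normcR ger0_norm//; lra.
Qed.

(** The neighbourhood of [e (Phi u0)] is defined by a single Fourier coefficient, one which does not
    vanish on [Phi u0]. *)
Lemma flow_B_discontinuous gamma t Phi (B : topologicalType) (j : B -> weakstar R)
    (e : (R -> R[i]) -> B) (u0 : R -> R[i]) : gamma != 0 -> t != 0 -> flow_map gamma t Phi ->
  continuously_embedded j -> L2_compactly_embedded j e -> L2 u0 ->
  ~ ae_eq lebesgue_measure torus u0 (cst 0) -> ~ B_continuous_at e Phi u0.
Proof.
move=> g0 t0 PhiS jE [je _ ec] u2 nz Bc.
have PhiL2 f : L2 f -> L2 (Phi f) by move=> /PhiS[u [uL2 _ _ _] ->]; exact: uL2.
have [k Fk] := flow_neq0 PhiS u2 nz.
have [c [s s1 [_ flow]]] := flow_limit g0 t0 PhiS u2.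
pose f (N : nat) x := u0 x + c%:C * expi (s * N) x.
have f2 N : L2 (f N) by exact: L2_add_wave.
have ef : e (f n) @[n --> \oo] --> e u0.
  apply: (precompact_cvg jE).
    have [M HM] := L2norm_wave_le c u2.
    have := ec (range f) M; rewrite image_comp; apply.
    - by move=> _ [N _ <-]; exact: f2.
    - by move=> _ [N _ <-]; exact: HM.
  move=> phi eps eps0; have [N0 H] := L2_pairing_cvg c phi u2 s1 eps0.
  by exists N0 => N /H; rewrite !je.
(* The pairing of distributions is bilinear, whence the test function of frequency [- k] for the
   mode [k]. *)
have pair g : L2 g -> (j (e g) : Defs.distribution R) (expi_test (- k)) = (2 * pi)%:C * fourier g k.
  move=> g2; rewrite je// /fourier mulrA -rmorphM/= divff ?gt_eqF ?pi2_gt0// mul1r !cintegralE.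
  apply: (@eq_cint _ TR R leb) => x _; rewrite mulrC; congr (_ * _).
  by rewrite /= /expi mulrNz mulNr.
have F0 : 0 < normc (fourier (Phi u0) k) by rewrite lt_def normc_ge0 normc_eq0 Fk.
have r0 : 0 < 2 * pi * normc (fourier (Phi u0) k) by rewrite mulr_gt0// pi2_gt0.
have [U nU UV] := Bc _ (embedded_nbhs jE (e (Phi u0)) (expi_test (- k)) r0).
have [N1 _ H1] := ef _ nU.
have [N2 H2] := flow k _ F0.
pose N := maxn N1 N2.
have /(UV _ (f2 N)) /= : U (e (f N)) by apply: H1; exact: leq_maxl.
rewrite !pair//; [|exact: PhiL2..].
rewrite -mulrBr normcME normcR gtr0_norm ?pi2_gt0// ltr_pM2l ?pi2_gt0//.
by apply/negP; rewrite -leNgt ltW// normc_opposite// H2// leq_maxr.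
Qed.

(** Argued on the norm itself: the perturbation is a single wave, whose H^s norm is explicit and
    tends to 0, and one mode bounds the norm of the difference of the images from below. *)
Lemma flow_Hs_discontinuous gamma t Phi (s : R) (u0 : R -> R[i]) : gamma != 0 -> t != 0 ->
  flow_map gamma t Phi -> s < 0 -> L2 u0 ->
  ~ ae_eq lebesgue_measure torus u0 (cst 0) -> ~ Hs_continuous_at s Phi u0.
Proof.
move=> g0 t0 PhiS s0 u2 nz Hc; have mT := @measurable_torus R.
have Too : (leb (torus : set TR) < +oo)%E by rewrite torusE; exact: leb_itv_lty.
have PhiL2 f : L2 f -> cintegrable leb torus (Phi f).
  by move=> /PhiS[u [uL2 _ _ _] ->]; apply: CL2_cintegrable => //; exact: (L2_CL2 (uL2 t)).
have [k Fk] := flow_neq0 PhiS u2 nz.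
have [c [e e1 [c0 flow]]] := flow_limit g0 t0 PhiS u2.
have F0 : 0 < normc (fourier (Phi u0) k) by rewrite lt_def normc_ge0 normc_eq0 Fk.
have w0 : 0 < (1 + (k%:~R : R) ^+ 2) `^ (s / 2) by rewrite powR_gt0// ltr_wpDr// sqr_ge0.
have [d d0 Hd] := Hc _ (mulr_gt0 w0 F0).
have [N1 H1] := weight_cvg0 s0 c0 d0.
have [N2 H2] := flow k _ F0.
pose N := maxn N1 N2.
have f2 := L2_add_wave c (e * N) u2.
have := Hd _ f2; rewrite (Hsnorm_expi s c0 (fourier_add_wave u0 c (e * N))) lte_fin.
move=> /(_ (H1 _ _)); rewrite abszM e1 mul1n => /(_ (leq_maxl _ _)).
apply/negP; rewrite -leNgt; apply: le_trans (Hsnorm_ge s _ k).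
rewrite lee_fin ler_wpM2l ?(ltW w0)// fourierB; [|exact: PhiL2..].
by rewrite ltW// normc_opposite// H2// leq_maxr.
Qed.

End sobolev.

Theorem mainTheorem3 (R : realType) (gamma : R) (gamma_neq0 : gamma != 0)
    (t : R) (t_neq0 : t != 0)
    (Phi : (R -> R[i]) -> R -> R[i]) (Phi_flow : flow_map gamma t Phi) :
  (forall (B : topologicalType) (j : B -> weakstar R)
      (e : (R -> R[i]) -> B),
    continuously_embedded j -> L2_compactly_embedded j e ->
    forall u0 : R -> R[i], L2 u0 ->
      ~ ae_eq lebesgue_measure torus u0 (cst 0) ->
      ~ B_continuous_at e Phi u0) /\
  (forall s : R, s < 0 ->
    forall u0 : R -> R[i], L2 u0 ->
      ~ ae_eq lebesgue_measure torus u0 (cst 0) ->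
      ~ Hs_continuous_at s Phi u0).
Proof.
split=> [B j e jE eE|s s0] u0 u2 nz.
- exact: flow_B_discontinuous gamma_neq0 t_neq0 Phi_flow jE eE u2 nz.
- exact: flow_Hs_discontinuous gamma_neq0 t_neq0 Phi_flow s0 u2 nz.
Qed.
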